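(* Let $\lambda=\frac12(1+\sqrt{13})$ and let $\Lambda=\dot\bigcup_{i=1}^4\Lambda_i\subset\mathbb{R}^2$ be the set of control points of any element of the Frank--Robinson tiling hull (defined in the context), where $\Lambda_i$ denotes the set of control points of type $i$. Then the diffraction measure of the corresponding Dirac comb $\delta_\Lambda=\sum_{x\in\Lambda}\delta_x$ is of the form $$\widehat\gamma=\operatorname{dens}(\Lambda)^2\,\delta_0+\widehat\gamma_{\mathsf{sc}},$$ where the singular continuous part $\widehat\gamma_{\mathsf{sc}}$ can be expressed in terms of a generalised Riesz product. More generally, if one assigns general complex weights $u_1,\dots,u_4$, not all zero, to the four types of control points, the corresponding diffraction measure (that of the weighted Dirac comb $\sum_{i=1}^4u_i\,\delta_{\Lambda_i}$) is still singular, where the only point measure is the central peak at $0$ with intensity $$I_0=\operatorname{dens}(\Lambda)^2\,\big|\nu_1u_1+\nu_2u_2+\nu_3u_3+\nu_4u_4\big|^2,$$ where $\operatorname{dens}(\Lambda)=(3+\lambda)/13$ and $(\nu_1,\nu_2,\nu_3,\nu_4)=\frac19\,(4-\lambda,\;4\lambda-7,\;4\lambda-7,\;19-7\lambda)$ are the relative prototile frequencies.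
   Context: Here $\lambda=\frac12(1+\sqrt{13})\approx2.303$, so $\lambda^2=\lambda+3$. The four prototiles are axis-parallel rectangles (width $\times$ height): type 1 is $\lambda\times\lambda$, type 2 is $\lambda\times1$, type 3 is $1\times\lambda$, type 4 is $1\times1$. The control point of each tile is its lower-left corner, labelled (coloured) by the tile type. The Frank--Robinson inflation scales by $Q=\lambda\,\mathbb{1}_2$ (with $\mathbb{1}_2$ the $2\times2$ identity matrix) and dissects each scaled prototile $Q(\mathfrak t_j)$ (lower-left corner at $0$) into translates of prototiles. With $T_{ij}$ the set of lower-left corners of the tiles of type $i$ in $Q(\mathfrak t_j)$, one has: - $T_{11}=\{(2,2)\}$; $T_{21}=\{(2,0),(2,1),(0,\lambda+2)\}$; $T_{31}=\{(0,2),(1,2),(\lambda+2,0)\}$; $T_{41}=\{(0,0),(1,0),(0,1),(1,1),(\lambda+2,\lambda),(\lambda,\lambda+2),(\lambda+1,\lambda+2),(\lambda+2,\lambda+1),(\lambda+2,\lambda+2)\}$; - $T_{12}=\{(0,0)\}$, $T_{32}=\{(\lambda,0),(\lambda+1,0),(\lambda+2,0)\}$; - $T_{13}=\{(0,0)\}$, $T_{23}=\{(0,\lambda),(0,\lambda+1),(0,\lambda+2)\}$; - $T_{14}=\{(0,0)\}$; all other $T_{ij}$ are empty. The hull is the closure, in the local rubber topology, of the translation orbit (under $\mathbb{R}^2$) of a tiling of the plane that is fixed under the square of this inflation. In the local rubber topology, two tilings are close if, on a large ball around $0$, they agree after small individual displacements of the tiles. The hull is a compact tiling space of infinite local complexity.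 For a (weighted) Dirac comb $\omega$, the autocorrelation is $\gamma=\lim_{r\to\infty}\frac{1}{\operatorname{vol}(B_r(0))}\,\omega_r*\widetilde{\omega_r}$ (vague limit), where $\omega_r$ is the restriction of $\omega$ to the ball $B_r(0)$ and $\widetilde\mu(g)=\overline{\mu(\widetilde g)}$ with $\widetilde g(x)=\overline{g(-x)}$. The diffraction measure is the Fourier transform $\widehat\gamma$, with the convention $\widehat f(k)=\int e^{-2\pi i\langle k|x\rangle}f(x)\,\mathrm{d}x$. Singular means singular with respect to Lebesgue measure. $\operatorname{dens}(\Lambda)$ is the mean number of points of $\Lambda$ per unit area. A Riesz product $\prod_{m\ge0}f_m(k)$ with continuous functions $f_m$ stands for the measure defined as the vague limit, as $n\to\infty$, of the absolutely continuous measures with densities $\prod_{m=0}^{n}f_m(k)$. The term ''generalised Riesz product'' is used informally, and no specific formula is part of the statement. *)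

(* Defs.v *)
From HB Require Import structures.
From mathcomp Require Export all_boot all_order all_algebra finmap.
From mathcomp Require Export complex.
From mathcomp Require Export all_classical all_reals all_analysis.
From mathcomp Require Import ring lra.

Set Implicit Arguments.
Unset Strict Implicit.
Unset Printing Implicit Defensive.

Import Order.TTheory GRing.Theory Num.Theory numFieldNormedType.Exports.

Local Open Scope classical_set_scope.
Local Open Scope ring_scope.

Notation plane R := (R * R)%type.

(* measurableTypeR R is R with the Borel sigma-algebra, under the display that
   lebesgue_measure uses. *)
Notation borel_plane R := (measurableTypeR R * measurableTypeR R)%type.
Notation plane_measure R := {measure set (borel_plane R) -> \bar R}.

Definition lambda (R : realType) : R := (1 + Num.sqrt 13) / 2.

(* The prototile types 1, 2, 3, 4 are the elements 0, 1, 2, 3 of 'I_4. *)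

Definition width (R : realType) (i : 'I_4) : R :=
  nth 0 [:: lambda R; lambda R; 1; 1] i.

Definition height (R : realType) (i : 'I_4) : R :=
  nth 0 [:: lambda R; 1; lambda R; 1] i.

Definition tile (R : realType) (i : 'I_4) (x : plane R) : set (plane R) :=
  [set` `[x.1, x.1 + width R i]] `*` [set` `[x.2, x.2 + height R i]].

(* (i, x) stands for the tile of type i with lower-left corner x. *)
Definition tileset (R : realType) : Type := set ('I_4 * plane R).

Definition is_tiling (R : realType) (T : tileset R) : Prop :=
  (forall p : plane R, exists i x, T (i, x) /\ tile i x p) /\
  (forall i x j y, T (i, x) -> T (j, y) -> (i, x) <> (j, y) ->
     interior (tile i x) `&` interior (tile j y) = set0).

(* Row i, column j: the corners of the tiles of type i in the inflated
   prototile of type j. *)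
Definition displacements (R : realType) (i j : 'I_4) : seq (plane R) :=
  let l := lambda R in
  nth [::] (nth [::]
    [:: [:: [:: (2, 2)]; [:: (0, 0)]; [:: (0, 0)]; [:: (0, 0)] ];
        [:: [:: (2, 0); (2, 1); (0, l + 2)];
            [::];
            [:: (0, l); (0, l + 1); (0, l + 2)];
            [::] ];
        [:: [:: (0, 2); (1, 2); (l + 2, 0)];
            [:: (l, 0); (l + 1, 0); (l + 2, 0)];
            [::];
            [::] ];
        [:: [:: (0, 0); (1, 0); (0, 1); (1, 1); (l + 2, l); (l, l + 2);
                (l + 1, l + 2); (l + 2, l + 1); (l + 2, l + 2)];
            [::]; [::]; [::] ] ] i) j.

Definition inflate (R : realType) (T : tileset R) : tileset R :=
  [set p | exists j y t, [/\ T (j, y), t \in displacements R p.1 j &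
     p.2 = (lambda R * y.1 + t.1, lambda R * y.2 + t.2)]].

Definition translate (R : realType) (t : plane R) (T : tileset R) : tileset R :=
  [set p | T (p.1, p.2 - t)].

Definition rubber_sub (R : realType) (e : R) (T T' : tileset R) : Prop :=
  forall (i : 'I_4) (x : plane R), ball (0 : plane R) e^-1 x -> T (i, x) ->
    exists2 y, T' (i, y) & ball x e y.

Definition rubber_close (R : realType) (e : R) : set (tileset R * tileset R) :=
  [set TT | rubber_sub e TT.1 TT.2 /\ rubber_sub e TT.2 TT.1].

Definition rubber_entourage (R : realType) : set_system (tileset R * tileset R) :=
  filter_from [set e : R | 0 < e] (@rubber_close R).

Lemma rubber_sub_le (R : realType) (e e' : R) (T T' : tileset R) :
  0 < e -> e <= e' -> rubber_sub e T T' -> rubber_sub e' T T'.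
Proof.
move=> e0 ee' H i x x0 Tx.
have [|y T'y xy] := H i x _ Tx.
  by apply: le_ball x0; rewrite lef_pV2 ?posrE// (lt_le_trans e0).
by exists y => //; apply: le_ball xy.
Qed.

Lemma rubber_sub_split (R : realType) (e : R) (T1 T2 T3 : tileset R) :
  let d := Num.min (e / 2) (2^-1) in
  0 < e -> rubber_sub d T1 T2 -> rubber_sub d T2 T3 -> rubber_sub e T1 T3.
Proof.
move=> d e0 H12 H23 i x x0 T1x.
have d0 : 0 < d by rewrite lt_min divr_gt0//= invr_gt0.
have de : d <= e / 2 by rewrite ge_min lexx.
have d2 : d <= 2^-1 by rewrite ge_min lexx orbT.
have dV : 2 * e^-1 <= d^-1.
  by rewrite -[2]invrK -invfM [_ * e]mulrC lef_pV2 ?posrE// divr_gt0.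
have dV2 : 2 <= d^-1 by rewrite -[2]invrK lef_pV2 ?posrE// invr_gt0.
have eV0 : 0 < e^-1 by rewrite invr_gt0.
have [|y T2y xy] := H12 i x _ T1x; first by apply: le_ball x0; lra.
have [|z T3z yz] := H23 i y _ T2y.
  by apply: (@le_ball _ _ _ (e^-1 + d)); [lra|exact: ball_triangle x0 xy].
exists z => //; apply: (@le_ball _ _ _ (d + d)); first by lra.
exact: ball_triangle xy yz.
Qed.

Lemma rubber_entourage_filter (R : realType) : Filter (@rubber_entourage R).
Proof.
apply: filter_from_filter; first by exists 1 => /=.
move=> e1 e2 /= e10 e20; exists (Num.min e1 e2); first by rewrite /= lt_min e10.
have m0 : 0 < Num.min e1 e2 by rewrite lt_min e10.
by move=> [T T'] [/= H H']; split; split => /=;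
  (apply: rubber_sub_le m0 _ _; [by rewrite ge_min lexx ?orbT|]).
Qed.

Lemma rubber_entourage_diagonal (R : realType) (A : set (tileset R * tileset R)) :
  rubber_entourage A -> diagonal `<=` A.
Proof.
move=> [e /= e0 eA] [T T'] /= TT'; apply: eA.
rewrite /diagonal /= in TT'; rewrite -TT'.
by split => i x _ Tx; exists x => //; exact: ballxx.
Qed.

Lemma rubber_entourage_inv (R : realType) (A : set (tileset R * tileset R)) :
  rubber_entourage A -> rubber_entourage (A^-1)%relation.
Proof.
by move=> [e /= e0 eA]; exists e => // -[T T'] [/= H H']; apply: (eA (T', T)).
Qed.

Lemma rubber_entourage_split (R : realType) (A : set (tileset R * tileset R)) :
  rubber_entourage A ->
  exists2 B, rubber_entourage B & (B \; B `<=` A)%relation.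
Proof.
move=> [e /= e0 eA]; exists (rubber_close (Num.min (e / 2) (2^-1))).
  by exists (Num.min (e / 2) (2^-1)) => //=; rewrite lt_min divr_gt0//= invr_gt0.
move=> [T1 T3] [T2 /= [/= H12 H21] [/= H23 H32]]; apply: eA; split => /=.
  exact: rubber_sub_split e0 H12 H23.
exact: rubber_sub_split e0 H32 H21.
Qed.

HB.instance Definition _ (R : realType) := Choice.on (tileset R).
HB.instance Definition _ (R : realType) :=
  isUniform.Build (tileset R) (@rubber_entourage_filter R)
    (@rubber_entourage_diagonal R) (@rubber_entourage_inv R)
    (@rubber_entourage_split R).

(* The closure is taken among all sets of tiles; a limit of translates of a
   tiling is again a tiling. *)
Definition hull (R : realType) (T0 : tileset R) : set (tileset R) :=
  closure (range (fun t : plane R => translate t T0)).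

Definition control_points (R : realType) (T : tileset R) (i : 'I_4) :
  set (plane R) := [set x | T (i, x)].

Definition all_control_points (R : realType) (T : tileset R) : set (plane R) :=
  \bigcup_i control_points T i.

Definition inner (R : realType) (k x : plane R) : R := k.1 * x.1 + k.2 * x.2.

(* The Euclidean ball; the norm of R * R in the library is the maximum norm. *)
Definition disc (R : realType) (r : R) : set (plane R) :=
  [set x | Num.sqrt (inner x x) < r].

Definition leb2 (R : realType) : plane_measure R :=
  (@lebesgue_measure R \x @lebesgue_measure R)%E.

Definition area (R : realType) (A : set (plane R)) : R := fine (leb2 R A).

Definition npoints (R : realType) (A : set (plane R)) (r : R) : R :=
  (#|` fset_set (A `&` disc r)|)%fset%:R.

Definition has_density (R : realType) (A : set (plane R)) (d : R) : Prop :=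
  npoints A r / area (disc r) @[r --> +oo] --> d.

Definition has_rel_frequency (R : realType) (A B : set (plane R)) (nu : R) : Prop :=
  npoints A r / npoints B r @[r --> +oo] --> nu.

Definition Cc (R : realType) (g : plane R -> R[i]) : Prop :=
  continuous (g : plane R -> (R[i] : numFieldType)) /\
  exists2 K : set (plane R), compact K & forall x, ~ K x -> g x = 0.

Definition functional (R : realType) : Type := (plane R -> R[i]) -> R[i].

Definition tilde_fun (R : realType) (g : plane R -> R[i]) : plane R -> R[i] :=
  fun x => (g (- x))^*.

Definition tilde (R : realType) (mu : functional R) : functional R :=
  fun g => (mu (tilde_fun g))^*.

Definition conv (R : realType) (mu nu : functional R) : functional R :=
  fun g => mu (fun x => nu (fun y => g (x + y))).

(* The measure \sum_x (w x) \delta_x; the sum is over the x with a nonzero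
   term, of which there are finitely many in all uses below. *)
Definition dirac_comb (R : realType) (w : plane R -> R[i]) : functional R :=
  fun g => \sum_(x \in [set: plane R]) (w x * g x).

Definition restricted_comb (R : realType) (w : plane R -> R[i]) (r : R) :
  functional R := dirac_comb (fun x => w x * \1_(disc r) x).

(* Vague convergence, whence only the values of gamma on Cc matter. *)
Definition is_autocorrelation (R : realType) (w : plane R -> R[i])
    (gamma : functional R) : Prop :=
  forall g, Cc g ->
    ((area (disc r))^-1)%:C%C *
      conv (restricted_comb w r) (tilde (restricted_comb w r)) g
    @[r --> +oo] --> (gamma g : (R[i] : numFieldType)).

Definition cintegral (R : realType) (mu : plane_measure R)
    (f : plane R -> R[i]) : R[i] :=
  (Rintegral mu setT (fun x => complex.Re (f x)) +i*
   Rintegral mu setT (fun x => complex.Im (f x)))%C.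

Definition expi (R : realType) (t : R) : R[i] := (cos t +i* sin t)%C.

Definition fourier (R : realType) (f : plane R -> R[i]) (k : plane R) : R[i] :=
  cintegral (leb2 R) (fun x => expi (- (2 * pi * inner k x)) * f x).

Definition conv_fun (R : realType) (g h : plane R -> R[i]) (x : plane R) : R[i] :=
  cintegral (leb2 R) (fun y => g y * h (x - y)).

Definition locally_finite (R : realType)
    (mu : plane_measure R) : Prop :=
  forall K : set (plane R), compact K -> (mu K < +oo)%E.

(* The Fourier transform of an unbounded positive definite measure (Argabright
   and Gil de Lamadrid; Berg and Forst): the unique positive Radon measure mu
   such that gamma (g * g~) = \int |g^|^2 dmu for all g in Cc, where
   g^ (k) = fourier g (- k) is the inverse transform of g. *)
Definition is_fourier_transform (R : realType) (gamma : functional R)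
    (mu : plane_measure R) : Prop :=
  locally_finite mu /\
  forall g, Cc g ->
    let c := gamma (conv_fun g (tilde_fun g)) in
    (\int[mu]_k (ComplexField.Normc.normc (fourier g (- k)) ^+ 2)%:E
       = (complex.Re c)%:E)%E /\ complex.Im c = 0.

Definition is_diffraction (R : realType) (w : plane R -> R[i])
    (mu : plane_measure R) : Prop :=
  exists gamma, is_autocorrelation w gamma /\ is_fourier_transform gamma mu.

Definition singular (R : realType) (mu : plane_measure R) : Prop :=
  exists N : set (borel_plane R),
    [/\ measurable N, leb2 R N = 0%E & mu (~` N) = 0%E].

Definition singular_continuous (R : realType)
    (mu : plane_measure R) : Prop :=
  singular mu /\ forall x, mu [set x] = 0%E.

Definition is_riesz_product (R : realType) (f : nat -> plane R -> R)
    (mu : plane_measure R) : Prop :=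
  [/\ forall m, continuous (f m),
      forall m k, 0 <= f m k,
      locally_finite mu &
      forall g, Cc g ->
        cintegral (leb2 R) (fun k => g k * (\prod_(m < n.+1) f m k)%:C%C)
        @[n --> \oo] --> (cintegral mu g : (R[i] : numFieldType))].

Definition fr_density (R : realType) : R := (3 + lambda R) / 13.

Definition fr_frequency (R : realType) (i : 'I_4) : R :=
  let l := lambda R in
  nth 0 [:: 4 - l; 4 * l - 7; 4 * l - 7; 19 - 7 * l] i / 9.

(* Main.v *)
(* By the inflation hierarchy and Fourier inversion, the diffraction is the vague limit of the densities
lambda^(-2N) |sum_x u_x e(-<k,x>)|^2 of one level-N supertile. An atom at k != 0 is excluded as the recursion at
the points lambda^n k contracts unless lambda^n k tends to 0 modulo integers. Averages of the characters
e(lambda^(D t) k) have different limits under these densities and Lebesgue measure, hence singularity. *)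
Require Import Defs.
From HB Require Import structures.
From mathcomp Require Import measurable_realfun.
From mathcomp Require Import ring lra zify.

Set Implicit Arguments.
Unset Strict Implicit.
Unset Printing Implicit Defensive.

Import Order.TTheory GRing.Theory Num.Theory numFieldNormedType.Exports.

Local Open Scope classical_set_scope.
Local Open Scope ring_scope.

(** The conjugate [1 - lambda] is about -1.3, so [lambda] is not a Pisot number; this is why
    [lambda^n k] approaches the integers only for [k = 0]. Elements of the hull are accessible only
    by rubber approximation, hence they enter through a uniform separation of corners and through
    pair counts with continuous test functions. Vague convergence alone does not show singularity.
    The link is the Hellinger affinity with Lebesgue measure: the square roots of the densities
    become arbitrarily small in L1 on every box, and a set on which the level-[n] sums are small
    keeps small mass at all later levels, because a sum of level [n + m] factors through level [n].
    Smallness in L1 follows from the variance of averaged characters, which is governed by a finite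
    graph of pairs of neighbouring tiles; its non-diagonal part grows by a factor of at most 5 per
    inflation, less than [lambda^2]. The limit measure is built from limit masses of dyadic cells.
    The Riesz product has no prescribed formula; its factors are quotients of consecutive positive
    continuous approximants of the measure, so that the partial products telescope. *)

Lemma eqW d (T : porderType d) (x y : T) : x = y -> (x <= y)%O. Proof. by move=> ->. Qed.

Lemma le_via d (T : porderType d) (y x z : T) : (x <= y -> y <= z -> x <= z)%O. Proof. exact: le_trans. Qed.
Arguments le_via {d T} y {x z}.

Lemma cvgM_cst (R : realType) (T : Type) (F : set_system T) (f : T -> R) (a b : R) : Filter F ->
 f x @[x --> F] --> b -> a * f x @[x --> F] --> a * b.
Proof. by move=> FF h; apply: cvgM => //; exact: cvg_cst. Qed.

Lemma cvg0_ev (R : realType) (u : nat -> R) e : u n @[n --> \oo] --> (0 : R) -> 0 < e ->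
 exists N, forall n, (N <= n)%N -> u n <= e.
Proof. by move=> /cvgrPdist_le h /h[N _ H]; exists N => n /H; rewrite /= sub0r normrN; apply: le_trans; exact: ler_norm. Qed.

Lemma sum_cst (V : nmodType) (I : Type) (s : seq I) (c : V) : \sum_(i <- s) c = c *+ size s.
Proof. by rewrite big_const_seq count_predT iter_addr_0. Qed.

Notation pairE := surjective_pairing.
Notation mcomp := measurableT_comp.
Notation mfunM := measurable_funM.
Notation normcM := ComplexField.Normc.normcM.
Notation normc := ComplexField.Normc.normc.
Notation cRe := complex.Re.
Notation cIm := complex.Im.

(** * Complex modulus, real and imaginary parts *)

Section ComplexNorm.
Variable R : realType.
Implicit Types z w : R[i].

Lemma sqr_normcE z : normc z ^+ 2 = cRe z ^+ 2 + cIm z ^+ 2.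
Proof. by case: z => a b; rewrite /normc /= sqr_sqrtr// addr_ge0 ?sqr_ge0. Qed.

Lemma normc_ge0 z : 0 <= normc z.
Proof. by case: z => a b; rewrite /normc sqrtr_ge0. Qed.

Lemma normc_norm z : `|z| = (normc z)%:C%C.
Proof. by rewrite normc_def; case: z. Qed.

Lemma normr_Re_le z : `|cRe z| <= normc z.
Proof.
rewrite -(@ler_pXn2r _ 2) ?nnegrE ?normc_ge0// sqr_normcE.
by rewrite real_normK ?num_real// lerDl sqr_ge0.
Qed.

Lemma normr_Im_le z : `|cIm z| <= normc z.
Proof.
rewrite -(@ler_pXn2r _ 2) ?nnegrE ?normc_ge0// sqr_normcE.
by rewrite real_normK ?num_real// lerDr sqr_ge0.
Qed.

Lemma normc_le_ReIm z : normc z <= `|cRe z| + `|cIm z|.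
Proof.
rewrite -(@ler_pXn2r _ 2) ?nnegrE ?normc_ge0 ?addr_ge0// sqr_normcE.
rewrite sqrrD !real_normK ?num_real// -addrA lerD2l lerDr.
by rewrite pmulrn_lge0// mulr_ge0.
Qed.

Lemma normc_conj z : normc z^*%C = normc z.
Proof. by case: z => a b; rewrite /normc /= sqrrN. Qed.

Lemma normc_real (x : R) : normc x%:C%C = `|x|.
Proof. by rewrite /normc /= expr0n addr0 sqrtr_sqr. Qed.

Lemma normcD z w : normc (z + w) <= normc z + normc w.
Proof. exact: le_normcD. Qed.

Lemma normc_sum (I : Type) (s : seq I) (P : pred I) (F : I -> R[i]) :
 normc (\sum_(i <- s | P i) F i) <= \sum_(i <- s | P i) normc (F i).
Proof.
elim/big_ind2 : _ => [|x1 x2 y1 y2 h1 h2|//].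
 by rewrite ComplexField.Normc.normc0.
by rewrite (le_trans (normcD _ _))// lerD.
Qed.

Lemma ReD z w : cRe (z + w) = cRe z + cRe w.
Proof. by case: z; case: w. Qed.
Lemma ImD z w : cIm (z + w) = cIm z + cIm w.
Proof. by case: z; case: w. Qed.
Lemma ReB z w : cRe (z - w) = cRe z - cRe w.
Proof. by case: z; case: w. Qed.
Lemma ImB z w : cIm (z - w) = cIm z - cIm w.
Proof. by case: z; case: w. Qed.
Lemma cReM z w : cRe (z * w) = cRe z * cRe w - cIm z * cIm w.
Proof. by case: z; case: w. Qed.
Lemma cImM z w : cIm (z * w) = cRe z * cIm w + cIm z * cRe w.
Proof. by case: z; case: w. Qed.
Lemma ReJ z : cRe z^*%C = cRe z. Proof. by case: z. Qed.
Lemma ImJ z : cIm z^*%C = - cIm z. Proof. by case: z. Qed.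
Lemma Re_sum (I : Type) (s : seq I) (P : pred I) (F : I -> R[i]) :
 cRe (\sum_(i <- s | P i) F i) = \sum_(i <- s | P i) cRe (F i).
Proof. by apply: (big_morph _ ReD). Qed.
Lemma Im_sum (I : Type) (s : seq I) (P : pred I) (F : I -> R[i]) :
 cIm (\sum_(i <- s | P i) F i) = \sum_(i <- s | P i) cIm (F i).
Proof. by apply: (big_morph _ ImD). Qed.

Lemma complex_eqP z w : cRe z = cRe w -> cIm z = cIm w -> z = w.
Proof. by case: z; case: w => a b c d /= -> ->. Qed.

Lemma mulcJ z : z * z^*%C = (normc z ^+ 2)%:C%C.
Proof.
by apply: complex_eqP; rewrite ?cReM ?cImM ReJ ImJ /= ?sqr_normcE; lra.
Qed.

Lemma cvg_complex (T : Type) (F : set_system T) (f : T -> R[i]) z : Filter F ->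
 cRe (f x) @[x --> F] --> cRe z -> cIm (f x) @[x --> F] --> cIm z ->
 f x @[x --> F] --> (z : (R[i] : numFieldType)).
Proof.
move=> FF hr hi; apply/(@cvgrPdist_lt (R[i] : numFieldType) (R[i] : numFieldType)) => e e0.
have [e1 e1E] : exists e1 : R, e = e1%:C%C.
 exists (cRe e); apply: complex_eqP => //=. by move: e0; rewrite ltcE /= => /andP[/eqP].
rewrite e1E in e0 *; have e10 : 0 < e1 by move: e0; rewrite ltcR.
have e2 : 0 < e1 / 2 by rewrite divr_gt0.
move/cvgrPdist_lt : hr => /(_ _ e2) hr; move/cvgrPdist_lt : hi => /(_ _ e2) hi.
apply: filterS2 hr hi => x /= hr hi.
rewrite normc_norm ltcR (le_lt_trans (normc_le_ReIm _))//.
by rewrite ReB ImB (splitr e1) ltrD.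
Qed.

Lemma continuous_Re (T : topologicalType) (f : T -> R[i]) :
 continuous (f : T -> (R[i] : numFieldType)) -> continuous (fun x => cRe (f x)).
Proof.
move=> cf x; apply/cvgrPdist_lt => e e0.
have /(@cvgrPdist_lt (R[i] : numFieldType) (R[i] : numFieldType)) := cf x.
move=> /(_ e%:C%C); rewrite ltcR => /(_ e0); apply: filterS => y /=.
by rewrite normc_norm ltcR -ReB; apply: le_lt_trans; exact: normr_Re_le.
Qed.

Lemma continuous_Im (T : topologicalType) (f : T -> R[i]) :
 continuous (f : T -> (R[i] : numFieldType)) -> continuous (fun x => cIm (f x)).
Proof.
move=> cf x; apply/cvgrPdist_lt => e e0.
have /(@cvgrPdist_lt (R[i] : numFieldType) (R[i] : numFieldType)) := cf x.
move=> /(_ e%:C%C); rewrite ltcR => /(_ e0); apply: filterS => y /=.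
by rewrite normc_norm ltcR -ImB; apply: le_lt_trans; exact: normr_Im_le.
Qed.

Lemma continuous_complex (T : topologicalType) (f : T -> R[i]) :
 continuous (fun x => cRe (f x)) -> continuous (fun x => cIm (f x)) ->
 continuous (f : T -> (R[i] : numFieldType)).
Proof. by move=> cr ci x; apply: cvg_complex; [exact: cr|exact: ci]. Qed.

End ComplexNorm.

(** * The complex exponential on the unit circle *)

Section Expi.
Variable R : realType.
Implicit Types s t : R.

Lemma expiD s t : expi (s + t) = expi s * expi t.
Proof. by apply: complex_eqP; rewrite ?cReM ?cImM /= ?cosD ?sinD; ring. Qed.

Lemma expi0 : expi (0 : R) = 1.
Proof. by apply: complex_eqP; rewrite /= ?cos0 ?sin0. Qed.

Lemma expiN t : expi (- t) = (expi t)^*%C.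
Proof. by apply: complex_eqP; rewrite ?ReJ ?ImJ /= ?cosN ?sinN. Qed.

Lemma normc_expi t : normc (expi t) = 1.
Proof.
have : normc (expi t) ^+ 2 = 1 by rewrite sqr_normcE /= cos2Dsin2.
by move/eqP; rewrite sqrf_eq1 => /orP[/eqP//|/eqP h]; have := normc_ge0 (expi t); rewrite h; lra.
Qed.

Lemma sin_lip s t : `|sin s - sin t| <= `|s - t|.
Proof.
wlog st : s t / s <= t.
 move=> H; case: (leP s t) => [|/ltW] h; first exact: H. by rewrite distrC [leRHS]distrC; exact: H.
have [->|sltt] := eqVneq s t; first by rewrite !subrr.
have {sltt}st : s < t by rewrite lt_neqAle sltt.
have [|c _ h] := @MVT R (@sin R) (@cos R) s t st.
 by apply: continuous_subspaceT => x; exact: continuous_sin.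
rewrite distrC h normrM (distrC t s) ler_piMl//.
by rewrite ler_norml cos_geN1 cos_le1.
Qed.

Lemma cos_lip s t : `|cos s - cos t| <= `|s - t|.
Proof.
rewrite -!sinDpihalf (le_trans (sin_lip _ _))//.
by rewrite (_ : s + _ - _ = s - t)//; ring.
Qed.

Lemma expi_lip s t : normc (expi s - expi t) <= 2 * `|s - t|.
Proof.
rewrite (le_trans (normc_le_ReIm _))// ReB ImB /= mulr_natl mulr2n.
by rewrite lerD// ?cos_lip ?sin_lip.
Qed.

End Expi.

(** * Dyadic cells and Borel sets of the plane *)

Section Plane.
Variable R : realType.
Notation P := (plane R).

Lemma plane_ballP (x y : P) e :
 ball x e y <-> `|x.1 - y.1| < e /\ `|x.2 - y.2| < e.
Proof. by split => -[? ?]; split. Qed.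

Lemma continuous_plane_le (f : P -> R) (K : R) :
 (forall x y, `|f x - f y| <= K * (`|x.1 - y.1| + `|x.2 - y.2|)) -> continuous f.
Proof.
move=> hf x; apply/cvgrPdist_lt => e e0.
pose d := e / (2 * (`|K| + 1)).
have K1 : 0 < `|K| + 1 by rewrite ltr_wpDl.
have d0 : 0 < d by rewrite divr_gt0// mulr_gt0.
have : nbhs x (ball x d) by exact: nbhsx_ballx.
apply: filterS => y /plane_ballP[h1 h2].
rewrite (le_lt_trans (hf _ _))//.
have : K * (`|x.1 - y.1| + `|x.2 - y.2|) <= (`|K| + 1) * (`|x.1 - y.1| + `|x.2 - y.2|)
 by rewrite ler_wpM2r ?addr_ge0// (le_trans (ler_norm K))// lerDl.
move=> /le_lt_trans; apply.
have -> : e = (`|K| + 1) * (d + d) by rewrite /d; field; rewrite gt_eqF.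
by rewrite ltr_pM2l// ltrD.
Qed.

(** Half-open squares partition the plane at each level, so a point has a single index [cell_of].
    The same cells later carry the masses of the limit measure and the approximants of the Riesz
    product. *)
Definition cell (n : nat) (p : int * int) : set P :=
 [set` `[p.1%:~R / 2 ^+ n, (p.1 + 1)%:~R / 2 ^+ n[] `*`
 [set` `[p.2%:~R / 2 ^+ n, (p.2 + 1)%:~R / 2 ^+ n[].

Lemma measurable_cell n p : measurable (cell n p : set (borel_plane R)).
Proof. by apply: measurableX; exact: measurable_itv. Qed.

Definition cell_of (n : nat) (x : P) : int * int :=
 (Num.floor (x.1 * 2 ^+ n), Num.floor (x.2 * 2 ^+ n)).

Lemma cell_ofP n x p : cell n p x <-> p = cell_of n x.
Proof.
have e2 : 0 < (2 ^+ n : R) by rewrite exprn_gt0.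
rewrite /cell /= !in_itv /= !ler_pdivrMr// !ltr_pdivlMr//.
split=> [[/andP[a b] /andP[c d]]|->].
 rewrite /cell_of; case: p a b c d => a b /= *. by congr pair; apply/esym/floor_def; apply/andP.
by rewrite /cell_of/=; split; apply/andP; split; rewrite ?floor_le ?floorD1_gt.
Qed.

Lemma cell_diam n p x y : cell n p x -> cell n p y ->
 `|x.1 - y.1| < 2 ^- n /\ `|x.2 - y.2| < 2 ^- n.
Proof.
have e2 : 0 < (2 ^+ n : R) by rewrite exprn_gt0.
rewrite /cell /= !in_itv /= !intrD !mulrDl mul1r.
by move=> [/andP[? ?] /andP[? ?]] [/andP[? ?] /andP[? ?]]; split; rewrite ltr_norml; lra.
Qed.

Lemma exp2N_lt (e : R) : 0 < e -> exists n, 2 ^- n < e.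
Proof.
move=> e0; have /archi_boundP : 0 <= e^-1 by rewrite invr_ge0 ltW.
set n := Num.bound _ => h; exists n.
rewrite -[e]invrK ltf_pV2 ?posrE ?exprn_gt0 ?invr_gt0//.
by rewrite (lt_le_trans h)// -natrX ler_nat ltnW// ltn_expl.
Qed.

(** The sigma-algebra is a product one, so openness must be turned into a countable union of
    rectangles: the dyadic cells contained in [U]. *)
Lemma open_plane_measurable (U : set P) : open U ->
 measurable (U : set (borel_plane R)).
Proof.
move=> oU.
have -> : U = \bigcup_(q : nat * (int * int))
  (if `[< cell q.1 q.2 `<=` U >] then cell q.1 q.2 else set0).
 apply/seteqP; split => [x Ux|x [q _]]; last by case: asboolP => // h /h.
 have /nbhs_ballP[e /= e0 eU] : nbhs x U by exact: open_nbhs_nbhs. have [n ne] := exp2N_lt e0.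
 exists (n, cell_of n x) => //=. have hx : cell n (cell_of n x) x by apply/cell_ofP.
 case: asboolP => // -[] y hy; apply: eU; apply/plane_ballP. have [? ?] := cell_diam hx hy. by split; apply: lt_trans ne.
apply: countable_bigcupT_measurable => [|q]; first exact: countableP.
by case: asboolP => _ //; exact: measurable_cell.
Qed.

Lemma cont_mfun (f : P -> R) : continuous f ->
 measurable_fun setT (f : borel_plane R -> measurableTypeR R).
Proof.
move=> cf; apply: (measurability _ (RGenOInfty.measurableE R)).
move=> _ [_ [a ->] <-]; rewrite setTI; apply: open_plane_measurable.
by apply: open_comp; [move=> x _; exact: cf|exact: interval_open].
Qed.

End Plane.

Section ImageMeasure.
Context d1 d2 (T1 : measurableType d1) (T2 : measurableType d2) (R : realType).

Definition image_measure (m : {measure set T1 -> \bar R}) (f : T1 -> T2)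
  (mf : measurable_fun setT f) : {measure set T2 -> \bar R} :=
 measure_function_pushforward__canonical__measure_function_Measure m mf.

End ImageMeasure.

(** * Lebesgue measure under dilations and translations *)

Section AffineMeasure.
Variable R : realType.
Notation P := (plane R).
Notation BP := (borel_plane R).
Notation leb := (@lebesgue_measure R).

Lemma measurable_affine (s a : R) :
 measurable_fun setT (fun x : measurableTypeR R => s * x + a : measurableTypeR R).
Proof. by apply: measurable_funD => //; exact: mfunM. Qed.

(** The rescaled image measure agrees with Lebesgue measure on half-open intervals, which determine
    it. *)
Lemma leb_affine (s a : R) (A : set (measurableTypeR R)) : 0 < s -> measurable A ->
 leb ((fun x => s * x + a) @^-1` A) = ((s^-1 : R)%:E * leb A)%E.
Proof.
move=> s0 mA; have mphi := measurable_affine s a.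
suff -> : leb A = mscale (NngNum (ltW s0)) (image_measure leb mphi) A.
 by rewrite /mscale /= muleA -EFinM mulVf ?gt_eqF// mul1e.
apply: lebesgue_measure_unique => // X [[b c] _ <-].
rewrite /mscale /= /pushforward.
rewrite [X in (_ = _ * lebesgue_measure X)%E](_ : _ = `](b - a) / s, (c - a) / s]%classic).
2: by apply/seteqP; split => x /=; rewrite !in_itv /= ltr_pdivrMr// ler_pdivlMr//;
   move=> /andP[? ?]; apply/andP; split; lra.
rewrite !lebesgue_measure_itv /= !lte_fin ltr_pM2r ?invr_gt0// ltrD2r.
case: ifP => _; last by rewrite mule0.
by rewrite -!EFinD -EFinM; congr EFin; field; rewrite gt_eqF.
Qed.

Definition affine2 (s : R) (a x : P) : P := (s * x.1 + a.1, s * x.2 + a.2).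

Lemma measurable_affine2 (s : R) (a : P) :
 measurable_fun setT (affine2 s a : BP -> BP).
Proof.
apply/measurable_fun_pairP; split => /=.
 exact: (mcomp (measurable_affine s a.1) measurable_fst).
exact: (mcomp (measurable_affine s a.2) measurable_snd).
Qed.

Lemma leb2_affine (s : R) (a : P) (A : set BP) : 0 < s -> measurable A ->
 leb2 R (affine2 s a @^-1` A) = ((s ^- 2 : R)%:E * leb2 R A)%E.
Proof.
move=> s0 mA; have mphi := measurable_affine2 s a.
have s20 : 0 <= s ^+ 2 by rewrite exprn_ge0 ?ltW.
suff -> : leb2 R A = mscale (NngNum s20) (image_measure (leb2 R) mphi) A.
 by rewrite /mscale /= muleA -EFinM mulVf ?mul1e// expf_neq0 ?gt_eqF.
apply: product_measure_unique => // X Y mX mY.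
change ((s ^+ 2)%:E * (leb \x leb) (((fun x : R => (s * x + a.1)%R) @^-1` X) `*`
 ((fun x : R => (s * x + a.2)%R) @^-1` Y)) = leb X * leb Y)%E.
rewrite product_measure1E//; last 2 first.
- by rewrite -[_ @^-1` _]setTI; apply: measurable_affine.
- by rewrite -[_ @^-1` _]setTI; apply: measurable_affine.
rewrite [X in (_ * (X * _))%E]leb_affine// [X in (_ * (_ * X))%E]leb_affine//.
set u := leb X; set v := leb Y.
have -> : ((s^-1 : R)%:E * u * ((s^-1 : R)%:E * v) = (s ^- 2 : R)%:E * (u * v))%E by rewrite muleACA -EFinM -invfM -expr2.
by rewrite muleA -EFinM mulfV ?mul1e// expf_neq0// gt_eqF.
Qed.

Lemma ge0_integral_affine2 (s : R) (a : P) (f : BP -> \bar R) : 0 < s ->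
 measurable_fun setT f -> (forall x, 0 <= f x)%E ->
 (\int[leb2 R]_x f (affine2 s a x) = (s ^- 2 : R)%:E * \int[leb2 R]_x f x)%E.
Proof.
move=> s0 mf f0; have mphi := measurable_affine2 s a.
have s20 : 0 <= s ^- 2 by rewrite invr_ge0 exprn_ge0 ?ltW.
rewrite -[in LHS](preimage_setT (affine2 s a : BP -> BP)).
rewrite -(ge0_integral_pushforward mphi)//.
rewrite (eq_measure_integral (mscale (NngNum s20) (leb2 R))).
 by rewrite ge0_integral_mscale.
by move=> A mA _; exact: leb2_affine.
Qed.

Lemma integrable_affine2 (s : R) (a : P) (f : BP -> \bar R) : 0 < s ->
 (leb2 R).-integrable setT f ->
 (leb2 R).-integrable setT (fun x => f (affine2 s a x)).
Proof.
move=> s0 /integrableP[mf fi]; apply/integrableP; split.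
 exact: mcomp mf (measurable_affine2 s a).
rewrite (ge0_integral_affine2 a (f := fun x => `|f x|%E))//.
 by rewrite lte_mul_pinfty// lee_fin invr_ge0 exprn_ge0 ?ltW.
exact: mcomp.
Qed.

Lemma integral_affine2 (s : R) (a : P) (f : BP -> \bar R) : 0 < s ->
 (leb2 R).-integrable setT f ->
 (\int[leb2 R]_x f (affine2 s a x) = (s ^- 2 : R)%:E * \int[leb2 R]_x f x)%E.
Proof.
move=> s0 fi; have mf := measurable_int _ fi.
rewrite [LHS]integralE [in RHS]integralE.
under [X in (X - _)%E]eq_integral do rewrite (funepos_comp f)/=.
under [X in (_ - X)%E]eq_integral do rewrite (funeneg_comp f)/=.
rewrite (ge0_integral_affine2 a s0 (measurable_funepos mf)) ?(ge0_integral_affine2 a s0 (measurable_funeneg mf))//.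
have := integrable_neg_fin_num measurableT fi.
have := integrable_pos_fin_num measurableT fi.
move: (\int[leb2 R]_x f^\+ x)%E (\int[leb2 R]_x f^\- x)%E => [u| |] [v| |]// _ _.
by move=> *; congr EFin; rewrite mulrBr.
Qed.

Lemma Rintegral_affine2 (s : R) (a : P) (f : P -> R) : 0 < s ->
 (leb2 R).-integrable setT (EFin \o f) ->
 Rintegral (leb2 R) setT (fun x => f (affine2 s a x)) =
 s ^- 2 * Rintegral (leb2 R) setT f.
Proof.
move=> s0 fi; rewrite /Rintegral (integral_affine2 a s0 fi) fineM//.
exact: integrable_fin_num.
Qed.

Definition box (a b c d : R) : set P := [set` `[a, b]] `*` [set` `[c, d]].

Lemma measurable_box a b c d : measurable (box a b c d : set BP).
Proof. by apply: measurableX; exact: measurable_itv. Qed.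

Lemma leb2_itv (A B : interval R) :
 leb2 R ([set` A] `*` [set` B]) = (leb [set` A] * leb [set` B])%E.
Proof. by rewrite /leb2 /= product_measure1E. Qed.

Lemma leb2_box a b c d : a <= b -> c <= d ->
 leb2 R (box a b c d) = ((b - a) * (d - c))%:E.
Proof.
move=> ab cd; rewrite leb2_itv !lebesgue_measure_itv /= !lte_fin.
have H u v : u <= v -> (if u < v then (v%:E - u%:E)%E else 0%E) = (v - u)%:E by rewrite le_eqVlt => /predU1P[->|->//]; rewrite ltxx subrr.
by rewrite !H.
Qed.

End AffineMeasure.

(** * Integrals of real-valued functions *)

Section RealIntegral.
Context d (T : measurableType d) (R : realType).
Variable mu : {measure set T -> \bar R}.
Implicit Types f g : T -> R.

Definition rint f := mu.-integrable setT (EFin \o f).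
Definition Int f := Rintegral mu setT f.

Lemma rint_meas f : rint f -> measurable_fun setT f.
Proof. by move=> /measurable_int/measurable_EFinP. Qed.

Lemma rint_le f g : measurable_fun setT f -> (forall x, `|f x| <= g x) ->
 rint g -> rint f.
Proof.
move=> mf fg ig; apply: (le_integrable measurableT _ _ ig).
 exact/measurable_EFinP.
move=> x _ /=; rewrite lee_fin (le_trans (fg x))//; exact: ler_norm.
Qed.

Lemma rintD f g : rint f -> rint g -> rint (fun x => f x + g x).
Proof. by move=> hf hg; exact: (integrableD measurableT hf hg). Qed.

Lemma rintZ c f : rint f -> rint (fun x => c * f x).
Proof. by move=> hf; exact: (integrableZl measurableT c hf). Qed.

Lemma rintB f g : rint f -> rint g -> rint (fun x => f x - g x).
Proof. by move=> hf hg; exact: (integrableB measurableT hf hg). Qed.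

Lemma rint0 : rint (fun=> 0).
Proof. exact: integrable0. Qed.

Lemma rint_sum (I : Type) (s : seq I) (F : I -> T -> R) :
 (forall i, rint (F i)) -> rint (fun x => \sum_(i <- s) F i x).
Proof.
move=> h; elim: s => [|i s ih].
 by under eq_fun do rewrite big_nil; exact: rint0.
by under eq_fun do rewrite big_cons; exact: rintD.
Qed.

Lemma rint_norm f : rint f -> rint (fun x => `|f x|).
Proof. by move=> /integrable_abse. Qed.

Lemma IntD f g : rint f -> rint g ->
 Int (fun x => f x + g x) = Int f + Int g.
Proof. by move=> hf hg; exact: (RintegralD measurableT hf hg). Qed.

Lemma IntB f g : rint f -> rint g ->
 Int (fun x => f x - g x) = Int f - Int g.
Proof. by move=> hf hg; exact: (RintegralB measurableT hf hg). Qed.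

Lemma IntZ c f : rint f -> Int (fun x => c * f x) = c * Int f.
Proof. by move=> hf; exact: (RintegralZl c measurableT hf). Qed.

Lemma Int0 : Int (fun=> 0) = 0.
Proof. by rewrite /Int /Rintegral integral0. Qed.

Lemma Int_sum (I : Type) (s : seq I) (F : I -> T -> R) :
 (forall i, rint (F i)) ->
 Int (fun x => \sum_(i <- s) F i x) = \sum_(i <- s) Int (F i).
Proof.
move=> h; elim: s => [|i s ih].
 by under eq_fun do rewrite big_nil; rewrite Int0 big_nil.
under eq_fun do rewrite big_cons; rewrite IntD ?ih ?big_cons//.
exact: rint_sum.
Qed.

Lemma le_Int f g : rint f -> rint g -> (forall x, f x <= g x) -> Int f <= Int g.
Proof. by move=> hf hg fg; exact: le_Rintegral. Qed.

Lemma Int_ge0 f : (forall x, 0 <= f x) -> 0 <= Int f.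
Proof. by move=> f0; exact: Rintegral_ge0. Qed.

Lemma Int_norm f : rint f -> `|Int f| <= Int (fun x => `|f x|).
Proof. by move=> hf; exact: le_normr_Rintegral. Qed.

Lemma eq_Int f g : f =1 g -> Int f = Int g.
Proof. by move=> /funext ->. Qed.

Lemma Int_EFin f : rint f -> (Int f)%:E = (\int[mu]_x (f x)%:E)%E.
Proof.
by move=> hf; rewrite /Int /Rintegral fineK//; exact: integrable_fin_num.
Qed.

Lemma ge0_rint f : measurable_fun setT f -> (forall x, 0 <= f x) ->
 (\int[mu]_x (f x)%:E < +oo)%E -> rint f.
Proof.
move=> mf f0 h; apply/integrableP; split; first exact/measurable_EFinP.
by under eq_integral do rewrite /= ger0_norm//.
Qed.

Lemma Int_dominated (F : nat -> T -> R) f g :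
 (forall n, measurable_fun setT (F n)) -> rint g ->
 (forall n x, `|F n x| <= g x) -> (forall x, F n x @[n --> \oo] --> f x) ->
 rint f /\ Int (F n) @[n --> \oo] --> Int f.
Proof.
move=> mF ig Fg Ff.
have mf : measurable_fun setT f by apply: (measurable_fun_cvg mF) => x _; exact: Ff.
have [||||h1 _ h2] := @dominated_convergence _ _ _ mu setT measurableT
 (fun n => EFin \o F n) (EFin \o f) (EFin \o g) _ _ _ ig.
- by move=> n; exact/measurable_EFinP.
- exact/measurable_EFinP.
- by apply: aeW => x _ /=; apply: cvg_EFin; [exact: nearW|exact: Ff].
- by apply: aeW => x n _ /=; rewrite lee_fin.
split=> //; rewrite /Int /Rintegral.
apply: fine_cvg; rewrite fineK//; exact: integrable_fin_num.
Qed.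

End RealIntegral.

(** * Continuous functions of compact support *)

Section TestFunctions.
Variable R : realType.
Notation P := (plane R).
Notation BP := (borel_plane R).
Implicit Types f g : P -> R.

Definition supp_in (L : R) f := forall x, ~ (`|x.1| <= L /\ `|x.2| <= L) -> f x = 0.
(** Real-valued counterpart of [Cc]; a bound on the coordinates replaces the compact set, so
    supports combine by arithmetic. *)
Definition kc f := continuous f /\ exists2 L : R, 0 <= L & supp_in L f.

Lemma compact_box a b c d : compact (box a b c d : set P).
Proof. by apply: compact_setX; exact: segment_compact. Qed.

Lemma sub_box (L : R) (x : P) : (`|x.1| <= L /\ `|x.2| <= L) <-> box (- L) L (- L) L x.
Proof. by rewrite /box /= !in_itv /= -!ler_norml; split => -[-> ->]. Qed.

Lemma compact_sub_box (K : set P) : compact K -> exists2 L : R, 0 <= L & K `<=` box (- L) L (- L) L.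
Proof.
move=> cK.
have h1 : compact (fst @` K) by apply: continuous_compact => //; apply: continuous_subspaceT => x; exact: cvg_fst.
have h2 : compact (snd @` K) by apply: continuous_compact => //; apply: continuous_subspaceT => x; exact: cvg_snd.
have [M1 [_ H1]] := compact_bounded h1; have [M2 [_ H2]] := compact_bounded h2.
exists (`|M1| + `|M2| + 1); first by rewrite !addr_ge0.
move=> x Kx; apply/sub_box; split.
 apply: (H1 (`|M1| + `|M2| + 1)); last by exists x. by have := ler_norm M1; have := normr_ge0 M2; lra.
apply: (H2 (`|M1| + `|M2| + 1)); last by exists x.
by have := ler_norm M2; have := normr_ge0 M1; lra.
Qed.

Lemma kc_bounded f : kc f -> exists2 M : R, 0 <= M & forall x, `|f x| <= M.
Proof.
move=> [cf [L L0 sf]].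
have h : compact (f @` (box (- L) L (- L) L)) by apply: continuous_compact; [exact: continuous_subspaceT|exact: compact_box].
have [M [_ H]] := compact_bounded h.
exists (`|M| + 1); first by rewrite addr_ge0.
move=> x; have [bx|nb] := pselect (`|x.1| <= L /\ `|x.2| <= L).
 apply: (H (`|M| + 1)); first by have := ler_norm M; lra. by exists x => //; exact/sub_box.
by rewrite sf// normr0 addr_ge0.
Qed.

(** Heine-Cantor on a box one unit larger than the support. The modulus is cut at 1, so that a point
    [x] outside the larger box forces [y] outside the support. *)
Lemma kc_unif f : kc f -> forall e : R, 0 < e -> exists2 d : R, 0 < d &
 forall x y, `|x.1 - y.1| < d -> `|x.2 - y.2| < d -> `|f x - f y| < e.
Proof.
move=> [cf [L L0 sf]] e e0.
have /compact_near_coveringP H := @compact_box (- (L + 1)) (L + 1) (- (L + 1)) (L + 1).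
have := H _ (0 : R)^'+ (fun d x => forall y, `|x.1 - y.1| < d -> `|x.2 - y.2| < d -> `|f x - f y| < e) _.
case.
 move=> x _; have e2 : 0 < e / 2 by rewrite divr_gt0. have /cvgrPdist_lt/(_ _ e2)/nbhs_ballP[d /= d0 hd] := cf x.
 exists (ball x (d / 2), [set t | 0 < t < d / 2]) => /=.
  split; first by apply: nbhsx_ballx; rewrite divr_gt0. near=> t; apply/andP; split; near: t; first exact: nbhs_right_gt.
  by apply: nbhs_right_lt; rewrite divr_gt0.
 move=> [x' t] /= [/plane_ballP[h1 h2] /andP[t0 td]] y y1 y2.
 have hx' : `|f x - f x'| < e / 2 by apply: hd; apply/plane_ballP; split; lra. have hy : `|f x - f y| < e / 2.
  apply: hd; apply/plane_ballP; split.
   by rewrite (le_lt_trans (ler_distD x'.1 _ _))//; lra.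
  by rewrite (le_lt_trans (ler_distD x'.2 _ _))//; lra.
 rewrite (le_lt_trans (ler_distD (f x) _ _))// distrC; lra.
move=> d0 /= d0p hd.
pose d := Num.min (d0 / 2) 1.
have dp : 0 < d by rewrite lt_min divr_gt0//=.
have dd0 : d < d0 by rewrite (@le_lt_trans _ _ (d0 / 2))// ?ge_min ?lexx//; lra.
exists d => // x y h1 h2.
have [bx|nb] := pselect (`|x.1| <= L + 1 /\ `|x.2| <= L + 1).
 apply: (hd d) => //=; [by rewrite sub0r normrN gtr0_norm|exact/sub_box].
have d1 : d <= 1 by rewrite ge_min lexx orbT.
rewrite !sf ?subrr ?normr0//.
 move=> [y1 y2]; apply: nb; split.
  by have := ler_distD y.1 x.1 0; rewrite !subr0; lra.
 by have := ler_distD y.2 x.2 0; rewrite !subr0; lra.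
by move=> [x1 x2]; apply: nb; split; lra.
Unshelve. all: by end_near. Qed.

Lemma kcM f g : kc f -> continuous g -> kc (fun x => f x * g x).
Proof.
move=> [cf [L L0 sf]] cg; split; first by move=> x; apply: cvgM; [exact: cf|exact: cg].
by exists L => // x h; rewrite sf// mul0r.
Qed.

Lemma kcD f g : kc f -> kc g -> kc (fun x => f x + g x).
Proof.
move=> [cf [L L0 sf]] [cg [M M0 sg]]; split; first by move=> x; apply: cvgD; [exact: cf|exact: cg].
exists (L + M); first exact: addr_ge0.
by move=> x h; rewrite sf ?sg ?addr0// => -[h1 h2]; apply: h; split; lra.
Qed.

Lemma kcZ c f : kc f -> kc (fun x => c * f x).
Proof.
move=> [cf [L L0 sf]]; split; first by move=> x; apply: cvgM_cst; exact: cf.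
by exists L => // x h; rewrite sf// mulr0.
Qed.

Lemma kcB f g : kc f -> kc g -> kc (fun x => f x - g x).
Proof.
move=> hf hg; have := kcD hf (kcZ (-1) hg).
by congr kc; apply: funext => x; rewrite mulN1r.
Qed.

Lemma continuous_shift f (a : P) : continuous f -> continuous (fun x : P => f (x + a)).
Proof.
move=> cf x; apply: continuous_comp; last exact: cf.
by apply: cvgD; [exact: cvg_id|exact: cvg_cst].
Qed.

Lemma kc_shift f (a : P) : kc f -> kc (fun x : P => f (x + a)).
Proof.
move=> [cf [L L0 sf]]; split; first exact: continuous_shift.
exists (L + `|a.1| + `|a.2|); first by rewrite !addr_ge0.
move=> x h; rewrite sf//= => -[h1 h2]; apply: h.
have := ler_normB (x.1 + a.1) a.1; have := ler_normB (x.2 + a.2) a.2.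
by rewrite !addrK; have := normr_ge0 a.1; have := normr_ge0 a.2; split; lra.
Qed.

Lemma Cc_kc (g : P -> R[i]) : Cc g -> kc (fun x => cRe (g x)) /\ kc (fun x => cIm (g x)).
Proof.
move=> [cg [K cK gK]]; have [L L0 KL] := compact_sub_box cK.
have h x : ~ (`|x.1| <= L /\ `|x.2| <= L) -> g x = 0 by move=> nb; apply: gK => /KL/sub_box.
split; split; try by [exact: continuous_Re|exact: continuous_Im].
 by exists L => // x /h ->.
by exists L => // x /h ->.
Qed.

Lemma kc_Cc (g : P -> R[i]) : kc (fun x => cRe (g x)) -> kc (fun x => cIm (g x)) -> Cc g.
Proof.
move=> [c1 [L L0 s1]] [c2 [M M0 s2]]; split; first exact: continuous_complex.
exists (box (- (L + M)) (L + M) (- (L + M)) (L + M)); first exact: compact_box.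
move=> x nb; apply: complex_eqP => /=.
 by rewrite s1// => -[? ?]; apply/nb/sub_box; split; lra.
by rewrite s2// => -[? ?]; apply/nb/sub_box; split; lra.
Qed.

Lemma kc_meas f : kc f -> measurable_fun setT (f : BP -> measurableTypeR R).
Proof. by move=> [cf _]; exact: cont_mfun. Qed.

Section LocallyFinite.
Variables (mu : plane_measure R) (lmu : locally_finite mu).

Lemma rint_bdd f (L M : R) : measurable_fun setT (f : BP -> measurableTypeR R) ->
 (forall x, `|f x| <= M) -> supp_in L f -> rint mu f.
Proof.
move=> mf fM sf.
have mB := measurable_box (- L) L (- L) L.
have h : mu.-integrable (box (- L) L (- L) L) (EFin \o f).
 apply: measurable_bounded_integrable => //; first by apply: lmu; exact: compact_box.
  exact: measurable_funTS.
 exists M; split; first exact: num_real. by move=> N MN x _ /=; rewrite (le_trans (fM x))// ltW.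
rewrite /rint; have -> : EFin \o f = (EFin \o f) \_ (box (- L) L (- L) L).
 apply/funext => x; rewrite patchE; case: ifPn => // /negP nb /=. by rewrite sf// => /sub_box hb; apply: nb; rewrite inE.
by rewrite -integrable_mkcond.
Qed.

Lemma kc_rint f : kc f -> rint mu f.
Proof.
move=> kf; have [M _ fM] := kc_bounded kf; have [cf [L L0 sf]] := kf.
exact: (rint_bdd (kc_meas kf) fM sf).
Qed.

Lemma indic_box_rint a b c d : rint mu (\1_(box a b c d) : P -> R).
Proof.
pose L := `|a| + `|b| + `|c| + `|d|.
apply: (@rint_bdd _ L 1).
- by apply: measurable_indic; exact: measurable_box.
- by move=> x; rewrite indicE; case: (_ \in _); rewrite ?normr1 ?normr0.
move=> x nb; rewrite indicE memNset// => -[/=]; rewrite !in_itv/= => /andP[? ?] /andP[? ?]; apply: nb.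
have := normr_ge0 a; have := normr_ge0 b; have := normr_ge0 c; have := normr_ge0 d.
have := ler_norm b; have := ler_norm d.
have := ler_norm (- a); have := ler_norm (- c); rewrite !normrN => *.
by rewrite /L; split; rewrite ler_norml; apply/andP; split; lra.
Qed.

End LocallyFinite.

Lemma leb2_locally_finite : locally_finite (leb2 R).
Proof.
move=> K cK; have [L L0 KL] := compact_sub_box cK.
have LL : - L <= L by lra.
have mK : measurable (K : set BP).
 rewrite -(setCK K); apply: measurableC; apply: open_plane_measurable.
 by rewrite openC; apply: compact_closed => //; exact: (@norm_hausdorff R).
rewrite (@le_lt_trans _ _ (leb2 R (box (- L) L (- L) L)))//; last by rewrite leb2_box// ltry.
by apply: le_measure; rewrite ?inE//; exact: measurable_box.
Qed.

Lemma Int_box a b c d : a <= b -> c <= d ->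
 Int (leb2 R) (\1_(box a b c d)) = (b - a) * (d - c).
Proof.
move=> ab cd; rewrite /Int /Rintegral integral_indic//; last exact: measurable_box.
by rewrite setIT leb2_box.
Qed.

Lemma Int_shift f (a : P) : rint (leb2 R) f ->
 rint (leb2 R) (fun x : P => f (x + a)) /\
 Int (leb2 R) (fun x : P => f (x + a)) = Int (leb2 R) f.
Proof.
move=> fi; have e : (fun x : P => f (x + a)) = (fun x => f (affine2 1 a x)).
 by apply/funext => x; congr f; rewrite /affine2 !mul1r.
rewrite e; split; first exact: (integrable_affine2 a ltr01 fi).
by rewrite /Int (Rintegral_affine2 a ltr01 fi) expr1n invr1 mul1r.
Qed.

End TestFunctions.

Lemma cvg0_le (R : realType) (T : Type) (F : set_system T) (f g : T -> R) : Filter F ->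
 (\forall x \near F, `|f x| <= g x) -> g x @[x --> F] --> 0 ->
 f x @[x --> F] --> 0.
Proof.
move=> FF h /cvgr0Pnorm_lt hg; apply/cvgr0Pnorm_lt => e e0; have := hg e e0.
apply: filterS2 h => x h; apply: le_lt_trans.
by rewrite (le_trans h)// ler_norm.
Qed.

(** * The exponential weight and its transform, the Poisson kernel *)

Section Kernel.
Variable R : realType.
Notation leb := (@lebesgue_measure R).
Implicit Types (e a x t : R).

Definition wexp e t : R := expR (- (e * `|t|)).
(** For [e > 0] this is the Fourier transform of [wexp e], a kernel of unit mass whose width is
    proportional to [e]. The weight is exponential rather than Gaussian because its transform and
    the mass of that transform have elementary primitives. *)
Definition poisson e x : R := 2 * e / (e ^+ 2 + (2 * pi * x) ^+ 2).

Lemma is_derive_lin a x : is_derive x 1 (fun t : R => a * t) a.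
Proof.
have := @is_deriveZ R R R id a x 1 1 (is_derive_id x 1).
by rewrite /GRing.scale /= mulr1.
Qed.

Lemma continuous_lin a : continuous (fun t : R => a * t).
Proof. by move=> x; apply: cvgM_cst; exact: cvg_id. Qed.

Lemma continuous_exp_lin a : continuous (fun t : R => expR (a * t)).
Proof. by move=> x; apply: continuous_comp; [exact: continuous_lin|exact: continuous_expR]. Qed.

Lemma continuous_cos_lin a : continuous (fun t : R => cos (a * t)).
Proof. by move=> x; apply: continuous_comp; [exact: continuous_lin|exact: continuous_cos]. Qed.

Lemma continuous_sin_lin a : continuous (fun t : R => sin (a * t)).
Proof. by move=> x; apply: continuous_comp; [exact: continuous_lin|exact: continuous_sin]. Qed.

Lemma exp_lin_cvg0 e : 0 < e -> expR (- e * x) @[x --> +oo] --> (0 : R).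
Proof.
move=> e0; under eq_fun do rewrite mulNr.
have h : e * x @[x --> +oo] --> +oo.
 apply/cvgryPge => A; near=> x. by rewrite mulrC -ler_pdivrMr//; near: x; apply: nbhs_pinfty_ge; exact: num_real.
exact: (@cvg_comp _ _ _ (fun x => e * x) (fun y : R => expR (- y)) _ _ _ h (@cvgr_expR R)).
Unshelve. all: by end_near. Qed.

(** A primitive of [expR (- e * x) * (1 + cos (a * x))]. The added 1 makes the integrand
    nonnegative, as the fundamental theorem on a half-line demands; it is subtracted again in
    [Int_wexp_cos]. *)
Let prim e a x := - (expR (- e * x) / e) +
 expR (- e * x) * ((- e * cos (a * x) + a * sin (a * x)) / (e ^+ 2 + a ^+ 2)).

Let is_derive_prim e a x : 0 < e ->
 is_derive x 1 (prim e a) (expR (- e * x) * (1 + cos (a * x))).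
Proof.
move=> e0.
have dE : is_derive x 1 (fun t => expR (- e * t)) (expR (- e * x) * - e).
 exact: (is_derive1_comp (is_derive_expR (- e * x)) (is_derive_lin (- e) x)).
have dC : is_derive x 1 (fun t => cos (a * t)) (- sin (a * x) * a).
 exact: (is_derive1_comp (is_derive_cos (a * x)) (is_derive_lin a x)).
have dS : is_derive x 1 (fun t => sin (a * t)) (cos (a * x) * a).
 exact: (is_derive1_comp (is_derive_sin (a * x)) (is_derive_lin a x)).
have d1 := is_deriveM dE (is_derive_cst e^-1 x 1).
have d2 := is_deriveN d1.
have d3 := is_deriveD (is_deriveM (is_derive_cst (- e) x 1) dC) (is_deriveM (is_derive_cst a x 1) dS).
have d4 := is_deriveM dE (is_deriveM d3 (is_derive_cst (e ^+ 2 + a ^+ 2)^-1 x 1)).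
have d5 := is_deriveD d2 d4.
apply: (is_derive_eq d5).
have ea : e ^+ 2 + a ^+ 2 != 0 by rewrite gt_eqF// ltr_wpDr ?sqr_ge0// exprn_gt0.
rewrite ?(addrfctE, mulrfctE, opprfctE) /cst /GRing.scale /=; field.
by rewrite ea gt_eqF.
Qed.

Lemma exp_cos_half e a : 0 < e ->
 (\int[leb]_(x in `[0%R, +oo[) (expR (- e * x) * (1 + cos (a * x)))%:E =
  (e^-1 + e / (e ^+ 2 + a ^+ 2))%:E)%E.
Proof.
move=> e0; have d := is_derive_prim a _ e0.
have cp : continuous (prim e a).
 move=> x; apply/differentiable_continuous/derivable1_diffP. by have [] := d x.
rewrite (@ge0_continuous_FTC2y R _ (prim e a) 0 0).
- by rewrite /prim !mulr0 expR0 cos0 sin0 -EFinB; congr EFin; lra.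
- by move=> x _; rewrite mulr_ge0 ?expR_ge0// -lerBlDl sub0r cos_geN1.
- apply: continuous_subspaceT => x; apply: cvgM; first exact: continuous_exp_lin.
 by apply: cvgD; [exact: cvg_cst|exact: continuous_cos_lin].
- pose M := e^-1 + (e + `|a|) / (e ^+ 2 + a ^+ 2).
 have ea : 0 < e ^+ 2 + a ^+ 2 by rewrite ltr_wpDr ?sqr_ge0// exprn_gt0.
apply: (@cvg0_le _ _ _ _ (fun x => expR (- e * x) * M)).
  near=> x; rewrite /= /prim. rewrite (le_trans (ler_normD _ _))// normrN !normrM (gtr0_norm (expR_gt0 _)) /M mulrDr.
  rewrite normfV (gtr0_norm e0) lerD2l ler_wpM2l ?expR_ge0//. rewrite normfV (gtr0_norm ea) ler_pM2r ?invr_gt0//.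
  rewrite (le_trans (ler_normD _ _))// !normrM normrN (gtr0_norm e0).
  by rewrite lerD// ler_piMr ?(ltW e0)// ler_norml ?cos_geN1 ?cos_le1 ?sin_geN1 ?sin_le1.
 rewrite -(mul0r M); apply: cvgM; [exact: exp_lin_cvg0|exact: cvg_cst].
- by move=> x _; have [] := d x.
- by apply: cvg_at_right_filter; exact: cp.
- by move=> x _; rewrite derive1E; have [_ ->] := d x.
Unshelve. all: by end_near. Qed.

Lemma wexp_gt0 e t : 0 < wexp e t. Proof. exact: expR_gt0. Qed.

Lemma continuous_wexp e : continuous (wexp e).
Proof.
move=> x; apply: continuous_comp; last exact: continuous_expR.
by apply: cvgN; apply: cvgM_cst; exact: norm_continuous.
Qed.

Lemma ge0_itv0y : [set x : R | 0 <= x] = `[0, +oo[%classic.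
Proof. by apply/seteqP; split => x /=; rewrite in_itv /= ?andbT. Qed.

Lemma exp_cos_full e a : 0 < e ->
 (\int[leb]_x (wexp e x * (1 + cos (a * x)))%:E =
  (2 * (e^-1 + e / (e ^+ 2 + a ^+ 2)))%:E)%E.
Proof.
move=> e0; rewrite ge0_symfun_integralT.
- rewrite ge0_itv0y EFinM; congr (_ * _)%E.
 rewrite -(exp_cos_half a e0); apply: eq_integral => x; rewrite inE /= in_itv/= andbT => x0. by rewrite /wexp ger0_norm// mulNr.
- by move=> x; rewrite mulr_ge0 ?(ltW (wexp_gt0 _ _))//; have := cos_geN1 (a * x); lra.
- move=> x; apply: cvgM; first exact: continuous_wexp.
 by apply: cvgD; [exact: cvg_cst|exact: continuous_cos_lin].
- by move=> x /=; rewrite /wexp normrN mulrN cosN.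
Qed.

Lemma meas_wexp e : measurable_fun setT (wexp e : measurableTypeR R -> measurableTypeR R).
Proof. by apply: continuous_measurable_fun; exact: continuous_wexp. Qed.

Lemma meas_cos_lin a : measurable_fun setT ((fun x => cos (a * x)) : measurableTypeR R -> measurableTypeR R).
Proof. by apply: continuous_measurable_fun; exact: continuous_cos_lin. Qed.

Lemma rint_wexp e : 0 < e -> rint leb (wexp e).
Proof.
move=> e0; apply: (@rint_le _ _ _ leb _ (fun x => wexp e x * (1 + cos (0 * x)))).
- exact: meas_wexp.
- by move=> x; rewrite mul0r cos0 gtr0_norm ?wexp_gt0// ler_peMr ?ltW ?wexp_gt0//; lra.
apply: ge0_rint.
- apply: mfunM; first exact: meas_wexp.
 by apply: measurable_funD; [exact: measurable_cst|exact: meas_cos_lin].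
- by move=> x; rewrite mulr_ge0 ?(ltW (wexp_gt0 _ _))//; have := cos_geN1 (0 * x); lra.
by rewrite exp_cos_full// ltry.
Qed.

Lemma rint_wexpM e (g : R -> R) : 0 < e -> continuous g -> (forall x, `|g x| <= 1) ->
 rint leb (fun x => wexp e x * g x).
Proof.
move=> e0 cg g1; apply: (rint_le _ _ (rint_wexp e0)).
 by apply: mfunM; [exact: meas_wexp|exact: continuous_measurable_fun].
by move=> x; rewrite normrM (gtr0_norm (wexp_gt0 _ _)) ler_piMr// ltW// wexp_gt0.
Qed.

Lemma Int_wexp e : 0 < e -> Int leb (wexp e) = 2 / e.
Proof.
move=> e0; have h := exp_cos_full 0 e0.
have i2 : rint leb (fun x => wexp e x * (1 + cos (0 * x))).
 have -> : (fun x => wexp e x * (1 + cos (0 * x))) = (fun x => 2 * wexp e x) by apply/funext => x; rewrite mul0r cos0; ring.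
 exact/rintZ/rint_wexp.
have : Int leb (fun x => wexp e x * (1 + cos (0 * x))) = 2 * (e^-1 + e / (e ^+ 2 + 0 ^+ 2)) by apply: EFin_inj; rewrite Int_EFin.
have -> : Int leb (fun x => wexp e x * (1 + cos (0 * x))) = 2 * Int leb (wexp e)
 by rewrite -IntZ ?rint_wexp//; apply: eq_Int => x; rewrite mul0r cos0; ring.
have -> : 2 * (e^-1 + e / (e ^+ 2 + 0 ^+ 2)) = 2 * (2 / e) by field; rewrite gt_eqF.
by move/mulfI; apply.
Qed.

Lemma Int_wexp_cos e x : 0 < e ->
 Int leb (fun t => wexp e t * cos (2 * pi * x * t)) = poisson e x.
Proof.
move=> e0; set a := 2 * pi * x.
have cb (y : R) : `|cos y| <= 1 by rewrite ler_norml cos_geN1 cos_le1.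
have i1 : rint leb (fun t => wexp e t * cos (a * t)) by apply: rint_wexpM => //; exact: continuous_cos_lin.
have i2 : rint leb (fun t => wexp e t * (1 + cos (a * t))) by under eq_fun do rewrite mulrDr mulr1; apply: rintD => //; exact: rint_wexp.
have : Int leb (fun t => wexp e t * (1 + cos (a * t))) = 2 * (e^-1 + e / (e ^+ 2 + a ^+ 2))
 by apply: EFin_inj; rewrite Int_EFin// exp_cos_full.
have -> : Int leb (fun t => wexp e t * (1 + cos (a * t))) =
  2 / e + Int leb (fun t => wexp e t * cos (a * t)).
 rewrite -Int_wexp// -IntD ?rint_wexp//. by apply: eq_Int => t; rewrite mulrDr mulr1.
by rewrite mulrDr => /addrI ->; rewrite /poisson mulrA.
Qed.

Lemma Int_opp (f : R -> R) : measurable_fun setT (f : measurableTypeR R -> measurableTypeR R) ->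
 rint leb f -> rint leb (fun x => f (- x)) -> Int leb (fun x => f (- x)) = Int leb f.
Proof.
move=> mf i1 i2.
have mN : measurable_fun setT (-%R : measurableTypeR R -> measurableTypeR R) by apply: continuous_measurable_fun; exact: opp_continuous.
rewrite /Int /Rintegral; congr fine.
transitivity (\int[image_measure leb mN]_x (f x)%:E)%E.
 rewrite -[X in integral _ X]setTI. rewrite (@integral_pushforward _ _ _ _ _ _ mN leb setT (EFin \o f))//.
 - by rewrite preimage_setT setIid.
 - exact/measurable_EFinP.
by apply: eq_measure_integral => A mA _; exact: lebesgue_measureN.
Qed.

Lemma Int_wexp_sin e a : 0 < e -> Int leb (fun t => wexp e t * sin (a * t)) = 0.
Proof.
move=> e0; have sb (y : R) : `|sin y| <= 1 by rewrite ler_norml sin_geN1 sin_le1.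
have i1 : rint leb (fun t => wexp e t * sin (a * t)) by apply: rint_wexpM => //; exact: continuous_sin_lin.
have e1 : (fun t => wexp e (- t) * sin (a * - t)) = (fun t => -1 * (wexp e t * sin (a * t)))
 by apply/funext => t; rewrite /wexp normrN mulrN sinN; ring.
have := Int_opp (rint_meas i1) i1.
rewrite e1 IntZ// => /(_ (rintZ _ i1)); lra.
Qed.

Lemma poisson_gt0 e x : 0 < e -> 0 < poisson e x.
Proof.
by move=> e0; rewrite divr_gt0 ?mulr_gt0// ltr_wpDr ?sqr_ge0// exprn_gt0.
Qed.

Lemma poissonN e x : poisson e (- x) = poisson e x.
Proof. by rewrite /poisson mulrN sqrrN. Qed.

Lemma poisson_scale e x : 0 < e -> e * poisson e (e * x) = poisson 1 x.
Proof.
move=> e0; rewrite /poisson; field.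
have h (y : R) : 0 <= y ^+ 2 by exact: sqr_ge0.
apply/andP; split.
 by rewrite gt_eqF//; have := h (2 * pi * x); nra.
rewrite gt_eqF//.
have := h (2 * pi * (e * x)); have : 0 < e ^+ 2 by rewrite exprn_gt0.
nra.
Qed.

Lemma continuous_poisson e : 0 < e -> continuous (poisson e).
Proof.
move=> e0 x; apply: cvgM; first exact: cvg_cst.
apply: cvgV.
 by rewrite gt_eqF// ltr_wpDr ?sqr_ge0// exprn_gt0.
by apply: cvgD; [exact: cvg_cst|]; rewrite expr2; apply: cvgM; apply: continuous_lin.
Qed.

Lemma poisson_half : (\int[leb]_(x in `[0%R, +oo[) (poisson 1 x)%:E = (2^-1 : R)%:E)%E.
Proof.
pose F x : R := pi^-1 * atan (2 * pi * x).
have d x : is_derive x 1 F (poisson 1 x).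
 have d1 := is_derive1_comp (is_derive1_atan (2 * pi * x)) (is_derive_lin (2 * pi) x).
 have := is_deriveM (is_derive_cst (pi^-1 : R) x 1) d1. move/is_derive_eq; apply; rewrite /GRing.scale /= /poisson expr1n.
 move: (pi_gt0 R); move: pi => p p0. have h : 0 < 1 + (2 * p * x) ^+ 2 by rewrite ltr_wpDr ?sqr_ge0. by field; rewrite !gt_eqF.
have cp : continuous F by move=> x; apply/differentiable_continuous/derivable1_diffP; have [] := d x.
rewrite (@ge0_continuous_FTC2y R _ F 0 2^-1).
- by rewrite /F mulr0 atan0 mulr0 sube0.
- by move=> x _; rewrite ltW ?poisson_gt0.
- by apply: continuous_subspaceT => x; exact: continuous_poisson.
- have -> : 2^-1 = pi^-1 * (pi / 2) :> R.
  by move: (pi_gt0 R); move: pi => p p0; field; rewrite gt_eqF.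
 apply: cvgM; first exact: cvg_cst. apply: (@cvg_comp _ _ _ (fun x => 2 * pi * x) atan +oo +oo); last exact: cvgy_atan.
 have p0 : 0 < 2 * pi :> R by rewrite mulr_gt0 ?pi_gt0. apply/cvgryPge => A; near=> x.
 by rewrite mulrC -ler_pdivrMr//; near: x; exact: nbhs_pinfty_ge.
- by move=> x _; have [] := d x.
- by apply: cvg_at_right_filter; exact: cp.
- by move=> x _; rewrite derive1E; have [_ ->] := d x.
Unshelve. all: by end_near. Qed.

Lemma poisson1_integral : rint leb (poisson 1) /\ Int leb (poisson 1) = 1.
Proof.
have h : (\int[leb]_x (poisson 1 x)%:E = 1%E)%E.
 rewrite ge0_symfun_integralT; last 3 first.
 - by move=> x; rewrite ltW ?poisson_gt0.
 - exact: continuous_poisson.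
 - by move=> x /=; rewrite poissonN. by rewrite ge0_itv0y poisson_half -EFinM mulfV.
have i1 : rint leb (poisson 1).
 apply: ge0_rint; [by apply: continuous_measurable_fun; exact: continuous_poisson| |by rewrite h ltry].
 by move=> x; rewrite ltW ?poisson_gt0.
by split => //; apply: EFin_inj; rewrite Int_EFin.
Qed.

End Kernel.

(** * Exchange of integrals under product majorants *)

Section Fubini.
Context d1 d2 (T1 : measurableType d1) (T2 : measurableType d2) (R : realType).
Variables (m1 : {sigma_finite_measure set T1 -> \bar R}).
Variables (m2 : {sigma_finite_measure set T2 -> \bar R}).

Lemma rint_prod (F : T1 * T2 -> R) u v : measurable_fun setT F ->
 (forall x y, `|F (x, y)| <= u x * v y) -> rint m1 u -> rint m2 v ->
 (m1 \x m2)%E.-integrable setT (EFin \o F).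
Proof.
move=> mF Fuv iu iv; apply/integrable12ltyP; first exact/measurable_EFinP.
have mv := rint_meas iv; have mu := rint_meas iu.
apply: (@le_lt_trans _ _ (\int[m1]_x (`|u x| * Int m2 (fun y => `|v y|))%:E)%E).
 apply: ge0_le_integral => //.
 - by move=> x _; apply: integral_ge0.
 - apply: (@measurable_fun_fubini_tonelli_F _ _ _ _ _ m2 (fun z => `|(EFin \o F) z|%E)) => //.
  by apply: mcomp => //; apply/measurable_EFinP.
 - apply/measurable_EFinP; apply: mfunM; last exact: measurable_cst.
  exact: mcomp.
 move=> x _; rewrite EFinM Int_EFin ?rint_norm// -ge0_integralZl//; last first.
  by apply/measurable_EFinP; exact: mcomp.
 apply: ge0_le_integral => //.
 - apply: mcomp => //; apply/measurable_EFinP.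
  by apply: mcomp mF _; exact: measurable_pair1.
 - by apply: measurable_funeM; apply/measurable_EFinP; exact: mcomp.
 by move=> y _; rewrite -EFinM lee_fin (le_trans (Fuv x y))// -normrM ler_norm.
have i : rint m1 (fun x => `|u x| * Int m2 (fun y => `|v y|)) by under eq_fun do rewrite mulrC; apply: rintZ; exact: rint_norm.
by rewrite -Int_EFin// ltry.
Qed.

(** The majorant [u x * v y] gives integrability on the product, after which Fubini applies; all
    later exchanges only have to exhibit [u] and [v]. *)
Lemma Int_swap (F : T1 * T2 -> R) u v : measurable_fun setT F ->
 (forall x y, `|F (x, y)| <= u x * v y) -> rint m1 u -> rint m2 v ->
 rint m1 (fun x => Int m2 (fun y => F (x, y))) /\
 Int m1 (fun x => Int m2 (fun y => F (x, y))) =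
 Int m2 (fun y => Int m1 (fun x => F (x, y))).
Proof.
move=> mF Fuv iu iv; have iF := rint_prod mF Fuv iu iv.
have i2 x : rint m2 (fun y => F (x, y)).
 apply: (rint_le _ (Fuv x)); last exact: rintZ. by apply: mcomp mF _; exact: measurable_pair1.
have i1 y : rint m1 (fun x => F (x, y)).
 apply: (@rint_le _ _ _ m1 _ (fun x => v y * u x)); last exact: rintZ.
  by apply: mcomp mF _; exact: measurable_pair2.
 by move=> x; rewrite mulrC.
have ri : rint m1 (fun x => Int m2 (fun y => F (x, y))).
 have := integrable_fubini_F iF; rewrite /rint; congr (_.-integrable _ _). by apply/funext => x /=; rewrite Int_EFin.
split => //; have := Fubini iF.
under eq_integral do rewrite -Int_EFin//.
under [in X in _ = X -> _]eq_integral do rewrite -Int_EFin//.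
by rewrite /Int /Rintegral => ->.
Qed.

Lemma Int_prod u v : rint m1 u -> rint m2 v ->
 rint (m1 \x m2)%E (fun x => u x.1 * v x.2) /\
 Int (m1 \x m2)%E (fun x => u x.1 * v x.2) = Int m1 u * Int m2 v.
Proof.
move=> iu iv; have mu := rint_meas iu; have mv := rint_meas iv.
have mF : measurable_fun setT (fun x : T1 * T2 => u x.1 * v x.2).
 apply: mfunM.
  by apply: mcomp mu _; exact: measurable_fst.
 by apply: mcomp mv _; exact: measurable_snd.
have iF : rint (m1 \x m2)%E (fun x => u x.1 * v x.2).
 apply: (@rint_prod _ (fun x => `|u x|) (fun x => `|v x|)) => //; [|exact: rint_norm..]. by move=> x y /=; rewrite normrM.
split => //.
have := integral12_prod_meas1 iF; rewrite /fubini_F.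
under eq_integral => x _ do rewrite -(@Int_EFin _ _ _ m2 (fun y => u x * v y)) ?rintZ// IntZ// mulrC.
rewrite -(@Int_EFin _ _ _ m1 (fun x => Int m2 v * u x)) ?rintZ// IntZ//.
by rewrite -Int_EFin// => -[]; rewrite mulrC.
Qed.

End Fubini.

Section SwapR.
Context d1 d2 (T1 : measurableType d1) (T2 : measurableType d2) (R : realType).
Variables (m1 : {sigma_finite_measure set T1 -> \bar R}).
Variables (m2 : {sigma_finite_measure set T2 -> \bar R}).

Lemma rint_swap (F : T1 * T2 -> R) u v : measurable_fun setT F ->
 (forall x y, `|F (x, y)| <= u x * v y) -> rint m1 u -> rint m2 v ->
 rint m2 (fun y => Int m1 (fun x => F (x, y))).
Proof.
move=> mF Fuv iu iv.
have mF' : measurable_fun setT (fun z : T2 * T1 => F (z.2, z.1)) by apply: mcomp mF _; exact: measurable_swap.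
have [] // := @Int_swap _ _ _ _ _ m2 m1 _ v u mF' _ iv iu.
by move=> y x /=; rewrite mulrC.
Qed.

End SwapR.

Lemma normr_mulD_le (R : realType) (w a b c d p q : R) : 0 < w ->
 `|a| <= q -> `|b| <= p -> `|c| <= q -> `|d| <= p ->
 `|w * (a * b + c * d)| <= w * (q + q) * p.
Proof.
move=> w0 aq bp cq dp; rewrite normrM gtr0_norm// -mulrA ler_pM2l//.
by rewrite (le_trans (ler_normD _ _))// !normrM mulrDl lerD// ler_pM.
Qed.

(** An ultrafilter decides for every threshold whether the values lie above it; the supremum of the
    thresholds accepted is the limit. *)
Lemma ulim_cvg (R : realType) (T : Type) (U : set_system T) (u : T -> R) (M : R) : UltraFilter U ->
 (forall n, `|u n| <= M) -> cvg (u @ U).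
Proof.
move=> UU uM; pose X := [set c | U [set n | c <= u n]].
have X0 : X !=set0.
 exists (- M); rewrite /X /=; apply: filterS (@filterT _ U _) => n _ /=. by have := uM n; rewrite ler_norml => /andP[].
have Xb : ubound X M.
 move=> c Xc; have [n /= cn] := filter_ex Xc; apply: le_trans cn _. by have := uM n; rewrite ler_norml => /andP[].
suff h : u @ U --> sup X by apply: cvgP h.
apply/cvgrPdist_lt => e e0.
have [c Xc cs] : exists2 c, X c & sup X - e / 2 < c by apply: sup_adherent; [rewrite divr_gt0|split => //; exists M].
have n2 : U [set n | u n < sup X + e / 2].
 have [H|H] := in_ultra_setVsetC [set n | sup X + e / 2 <= u n] UU.
  have : sup X + e / 2 <= sup X by apply: ub_le_sup => //; exists M. by rewrite gerDl leNgt divr_gt0.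
 by apply: filterS H => n /= /negP; rewrite -ltNge.
near=> n.
have h1 : c <= u n by near: n; exact: Xc.
have h2 : u n < sup X + e / 2 by near: n; exact: n2.
by rewrite distrC ltr_norml; apply/andP; split; lra.
Unshelve. all: by end_near.
Qed.

Section FrankRobinson.
Variable R : realType.
Notation P := (plane R).
Notation PM := (plane_measure R).
Notation P0 := (0 : P).
Notation mR := (measurableTypeR R).
Notation BP := (borel_plane R).
Notation leb := (@lebesgue_measure R).
Notation tl := ('I_4 * P)%type.
Notation zz := (int * int)%type.
Notation lam := (lambda R).
Notation Int2 := (Int (leb2 R)).
Notation rint2 := (rint (leb2 R)).
Notation ind A := (\1_A : P -> R).
Notation sq r := (box (- r) r (- r) r : set P).
Notation leb2_lf := (@leb2_locally_finite R).
Notation w := (@width R).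
Notation h := (@height R).
Notation mfun f := (measurable_fun setT (f : BP -> mR)).

(** * Fourier transform and the Plancherel identity *)

Section Fourier.
Notation L2 := (leb \x leb)%E.
Implicit Types (k x y : P) (f g : P -> R[i]).

Lemma leb2_sf : sigma_finite setT (leb2 R).
Proof.
have /sigma_finiteP[F [TF ndF Foo]] := sigma_finiteT leb.
exists (fun n => F n `*` F n).
 rewrite -setXTT TF predeqE => -[x y]; split.
  move=> [/= [n _ Fnx] [k _ Gky]]; exists (maxn n k) => //; split.
  - by move: x Fnx; exact/subsetPset/ndF/leq_maxl.
  - by move: y Gky; exact/subsetPset/ndF/leq_maxr.
 by move=> [n _ []/= ? ?]; split; exists n.
move=> k; have [? ?] := Foo k.
split; first exact: measurableX.
have -> : leb2 R (F k `*` F k) = (leb (F k) * leb (F k))%E by exact: product_measure1E.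
by rewrite lte_mul_pinfty// ge0_fin_numE.
Qed.
(* The library's instance for product measures only applies to finite factors. *)
Definition leb2s : set BP -> \bar R := leb2 R.
HB.instance Definition _ := Measure.on leb2s.
HB.instance Definition _ := Measure_isSigmaFinite.Build _ BP R leb2s leb2_sf.

Lemma leb2_swap (F : BP * BP -> R) u v : measurable_fun setT (F : BP * BP -> mR) ->
 (forall x y, `|F (x, y)| <= u x * v y) -> rint2 u -> rint2 v ->
 [/\ rint2 (fun x => Int2 (fun y => F (x, y))),
   rint2 (fun y => Int2 (fun x => F (x, y))) &
   Int2 (fun x => Int2 (fun y => F (x, y))) =
   Int2 (fun y => Int2 (fun x => F (x, y)))].
Proof.
pose mu2 : {sigma_finite_measure set BP -> \bar R} := leb2s.
move=> mF Fb iu iv.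
have [r1 E1] := @Int_swap _ _ _ _ _ mu2 mu2 F _ _ mF Fb iu iv.
by have r2 := @rint_swap _ _ _ _ _ mu2 mu2 F _ _ mF Fb iu iv.
Qed.

Lemma supp_in_le (L L' : R) (h : P -> R) : L <= L' -> supp_in L h -> supp_in L' h.
Proof.
move=> LL sh x nb; apply: sh => -[a b]; apply: nb.
by split; [exact: le_trans a LL|exact: le_trans b LL].
Qed.

(** The character of the inverse transform: [is_fourier_transform] evaluates [fourier g] at [- k],
    which cancels the sign of the exponent. *)
Definition ek k x : R[i] := expi (2 * pi * inner k x).

Lemma innerB k x y : inner k (x - y) = inner k x - inner k y.
Proof. by rewrite /inner /=; ring. Qed.
Lemma innerD k x y : inner k (x + y) = inner k x + inner k y.
Proof. by rewrite /inner /=; ring. Qed.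
Lemma innerN k x : inner k (- x) = - inner k x.
Proof. by rewrite /inner /=; ring. Qed.
Lemma innerNl k x : inner (- k) x = - inner k x.
Proof. by rewrite /inner /=; ring. Qed.
Lemma innerBl k k' x : inner (k - k') x = inner k x - inner k' x.
Proof. by rewrite /inner /=; ring. Qed.

Lemma ekD k x y : ek k (x + y) = ek k x * ek k y.
Proof. by rewrite /ek innerD mulrDr expiD. Qed.

Lemma ekN k x : ek k (- x) = (ek k x)^*%C.
Proof. by rewrite /ek innerN mulrN expiN. Qed.

Lemma normc_ek k x : normc (ek k x) = 1.
Proof. exact: normc_expi. Qed.

Lemma normr_inner_le k x : `|inner k x| <= `|k.1| * `|x.1| + `|k.2| * `|x.2|.
Proof. by rewrite /inner (le_trans (ler_normD _ _))// !normrM. Qed.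

Lemma ek_lip k k' x :
 normc (ek k x - ek k' x) <= 4 * pi * (`|k.1 - k'.1| * `|x.1| + `|k.2 - k'.2| * `|x.2|).
Proof.
rewrite (le_trans (expi_lip _ _))// -mulrBr -innerBl.
rewrite normrM (ger0_norm (mulr_ge0 _ (pi_ge0 R)))// mulrA (_ : 2 * (2 * pi) = 4 * pi :> R); last by ring.
by rewrite ler_wpM2l ?mulr_ge0 ?pi_ge0// normr_inner_le.
Qed.

Definition crint (mu : PM) f := rint mu (fun x => cRe (f x)) /\ rint mu (fun x => cIm (f x)).

Lemma cintegralE (mu : PM) f : cintegral mu f =
 (Int mu (fun x => cRe (f x)) +i* Int mu (fun x => cIm (f x)))%C.
Proof. by []. Qed.

Lemma cintegralD (mu : PM) f g : crint mu f -> crint mu g ->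
 crint mu (fun x => f x + g x) /\
 cintegral mu (fun x => f x + g x) = cintegral mu f + cintegral mu g.
Proof.
move=> [f1 f2] [g1 g2].
have e1 : (fun x => cRe (f x + g x)) = (fun x => cRe (f x) + cRe (g x)) by apply/funext => x; rewrite ReD.
have e2 : (fun x => cIm (f x + g x)) = (fun x => cIm (f x) + cIm (g x)) by apply/funext => x; rewrite ImD.
split; first by split; rewrite ?e1 ?e2; exact: rintD.
by apply: complex_eqP; rewrite ?ReD ?ImD !cintegralE /= ?e1 ?e2 IntD.
Qed.

Lemma cintegralZ (mu : PM) (c : R[i]) f : crint mu f ->
 crint mu (fun x => c * f x) /\ cintegral mu (fun x => c * f x) = c * cintegral mu f.
Proof.
move=> [f1 f2].
have e1 : (fun x => cRe (c * f x)) = (fun x => cRe c * cRe (f x) - cIm c * cIm (f x)) by apply/funext => x; rewrite cReM.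
have e2 : (fun x => cIm (c * f x)) = (fun x => cRe c * cIm (f x) + cIm c * cRe (f x)) by apply/funext => x; rewrite cImM.
split; first by split; rewrite ?e1 ?e2; [apply: rintB|apply: rintD]; exact: rintZ.
apply: complex_eqP; rewrite ?cReM ?cImM !cintegralE /= ?e1 ?e2.
 by rewrite IntB; [rewrite !IntZ|exact: rintZ..].
by rewrite IntD; [rewrite !IntZ|exact: rintZ..].
Qed.

Lemma cintegral0 (mu : PM) : crint mu (fun=> 0) /\ cintegral mu (fun=> 0) = 0.
Proof.
split; first by split; exact: rint0.
by rewrite cintegralE /= !Int0.
Qed.

Lemma cintegral_sum (mu : PM) (I : Type) (s : seq I) (F : I -> P -> R[i]) :
 (forall i, crint mu (F i)) ->
 crint mu (fun x => \sum_(i <- s) F i x) /\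
 cintegral mu (fun x => \sum_(i <- s) F i x) = \sum_(i <- s) cintegral mu (F i).
Proof.
move=> h; elim: s => [|i s [ih1 ih2]].
 have e : (fun x => \sum_(i <- [::]) F i x) = fun=> 0 by apply/funext => x; rewrite big_nil. by rewrite e big_nil; exact: cintegral0.
have e : (fun x => \sum_(i <- i :: s) F i x) = (fun x => F i x + \sum_(i <- s) F i x) by apply/funext => x; rewrite big_cons.
have [h1 h2] := cintegralD (h i) ih1.
by rewrite e big_cons h2 ih2.
Qed.

Lemma cintegral_shift f (a : P) : crint (leb2 R) f ->
 crint (leb2 R) (fun x : P => f (x + a)) /\
 cintegral (leb2 R) (fun x : P => f (x + a)) = cintegral (leb2 R) f.
Proof.
move=> [f1 f2]; have [h1 h2] := Int_shift a f1; have [h3 h4] := Int_shift a f2.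
by split => //; rewrite !cintegralE h2 h4.
Qed.

Lemma normc_cintegral_le (mu : PM) f : crint mu f ->
 normc (cintegral mu f) <= Int mu (fun x => `|cRe (f x)|) + Int mu (fun x => `|cIm (f x)|).
Proof.
move=> [f1 f2]; rewrite (le_trans (normc_le_ReIm _))// cintegralE /=.
by rewrite lerD// Int_norm.
Qed.

Lemma fourierN f k : fourier f (- k) = cintegral (leb2 R) (fun x => ek k x * f x).
Proof.
by congr cintegral; apply/funext => x; rewrite /ek innerNl mulrN opprK.
Qed.

Lemma continuous_inner k : continuous (inner k).
Proof.
apply: (@continuous_plane_le _ _ (`|k.1| + `|k.2|)) => x y.
rewrite -innerB (le_trans (normr_inner_le _ _))//= mulrDl !mulrDr.
have a := normr_ge0 k.1; have b := normr_ge0 k.2.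
have c := normr_ge0 (x.1 - y.1); have d := normr_ge0 (x.2 - y.2).
nra.
Qed.

Lemma continuous_cos_inner k : continuous (fun x => cos (2 * pi * inner k x)).
Proof.
move=> x; apply: continuous_comp; last exact: continuous_cos.
by apply: cvgM_cst; exact: continuous_inner.
Qed.

Lemma continuous_sin_inner k : continuous (fun x => sin (2 * pi * inner k x)).
Proof.
move=> x; apply: continuous_comp; last exact: continuous_sin.
by apply: cvgM_cst; exact: continuous_inner.
Qed.

Lemma Cc_ekM f k : Cc f -> Cc (fun x => ek k x * f x).
Proof.
move=> /Cc_kc[k1 k2]; have cc := @continuous_cos_inner k; have cs := @continuous_sin_inner k.
apply: kc_Cc.
 have := kcB (kcM k1 cc) (kcM k2 cs); congr kc. by apply/funext => x; rewrite cReM /= mulrC [X in _ - X]mulrC.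
have := kcD (kcM k2 cc) (kcM k1 cs); congr kc.
by apply/funext => x; rewrite cImM /= mulrC [X in _ + X]mulrC.
Qed.

Lemma Cc_crint (mu : PM) f : locally_finite mu -> Cc f -> crint mu f.
Proof. by move=> lm /Cc_kc[k1 k2]; split; exact: kc_rint. Qed.

Lemma Cc_shift f (a : P) : Cc f -> Cc (fun x : P => f (x + a)).
Proof.
move=> /Cc_kc[k1 k2]; apply: kc_Cc; first exact: (kc_shift a k1).
exact: (kc_shift a k2).
Qed.

Lemma CcZ (c : R[i]) f : Cc f -> Cc (fun x => c * f x).
Proof.
move=> /Cc_kc[k1 k2]; apply: kc_Cc.
 have := kcB (kcZ (cRe c) k1) (kcZ (cIm c) k2); congr kc. by apply/funext => x; rewrite cReM.
have := kcD (kcZ (cRe c) k2) (kcZ (cIm c) k1); congr kc.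
by apply/funext => x; rewrite cImM.
Qed.

Lemma CcD f g : Cc f -> Cc g -> Cc (fun x => f x + g x).
Proof.
move=> /Cc_kc[k1 k2] /Cc_kc[k3 k4]; apply: kc_Cc.
 by have := kcD k1 k3; congr kc; apply/funext => x; rewrite ReD.
by have := kcD k2 k4; congr kc; apply/funext => x; rewrite ImD.
Qed.

Lemma Cc_sum (I : Type) (s : seq I) (F : I -> P -> R[i]) : (forall i, Cc (F i)) -> (exists f, Cc f) ->
 Cc (fun x => \sum_(i <- s) F i x).
Proof.
move=> h [f0 hf0]; elim: s => [|i s ih].
 have := CcZ 0 hf0; congr Cc; apply/funext => x; by rewrite big_nil mul0r.
by have := CcD (h i) ih; congr Cc; apply/funext => x; rewrite big_cons.
Qed.

Lemma fourier_shift f (a : P) k : Cc f ->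
 fourier (fun x : P => f (x + a)) (- k) = ek k (- a) * fourier f (- k).
Proof.
move=> cf; rewrite !fourierN.
have h := Cc_crint leb2_lf (Cc_ekM k cf).
have [h1 h2] := cintegral_shift a h; rewrite -h2 -(cintegralZ _ h1).2.
congr cintegral; apply/funext => x.
by rewrite ekD mulrA; congr (_ * _); rewrite mulrCA -ekD addNr /ek /inner /= !mulr0 addr0 mulr0 expi0 mulr1.
Qed.

(** Each shift contributes a phase, so the exponential sum of the weighted points factors out. This
    is how supertile sums enter the spectrum. *)
Lemma fourier_comb f (s : seq (R[i] * P)) k : Cc f ->
 fourier (fun x : P => \sum_(p <- s) p.1 * f (x + p.2)) (- k) =
 (\sum_(p <- s) p.1 * ek k (- p.2)) * fourier f (- k).
Proof.
move=> cf; rewrite fourierN.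
have e : (fun x : P => ek k x * (\sum_(p <- s) p.1 * f (x + p.2))) =
  (fun x => \sum_(p <- s) (p.1 * (ek k x * f (x + p.2)))).
 by apply/funext => x; rewrite mulr_sumr; apply: eq_bigr => p _; rewrite mulrCA.
have h (p : R[i] * P) : crint (leb2 R) (fun x : P => ek k x * f (x + p.2))
 by apply: Cc_crint; [exact: leb2_locally_finite|apply/Cc_ekM/Cc_shift].
rewrite e (cintegral_sum s (fun p => (cintegralZ p.1 (h p)).1)).2 mulr_suml.
by apply: eq_bigr => p _; rewrite (cintegralZ _ (h p)).2 -fourierN fourier_shift// mulrA.
Qed.

Definition pow_spec f k : R := normc (fourier f (- k)) ^+ 2.

Definition w2 (e : R) k : R := wexp e k.1 * wexp e k.2.
Definition K2 (e : R) x : R := poisson e x.1 * poisson e x.2.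

Lemma w2_gt0 e k : 0 < w2 e k. Proof. by rewrite mulr_gt0 ?wexp_gt0. Qed.

Lemma normr_w2M_le e k (c : R) : `|c| <= 1 -> `|w2 e k * c| <= w2 e k.
Proof. by move=> c1; rewrite normrM gtr0_norm ?w2_gt0// ler_piMr// ltW// w2_gt0. Qed.

Lemma rint_w2 e : 0 < e -> rint2 (w2 e).
Proof. by move=> e0; have [] := Int_prod (rint_wexp e0) (rint_wexp e0). Qed.

Lemma meas_w2 e : mfun (w2 e).
Proof.
apply: mfunM; apply: mcomp (meas_wexp e) _; [exact: measurable_fst|exact: measurable_snd].
Qed.

Lemma Int_w2_cos e x : 0 < e ->
 Int2 (fun k => w2 e k * cos (2 * pi * inner k x)) = K2 e x /\
 Int2 (fun k => w2 e k * sin (2 * pi * inner k x)) = 0.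
Proof.
move=> e0.
have cb (y : R) : `|cos y| <= 1 by rewrite ler_norml cos_geN1 cos_le1.
have sb (y : R) : `|sin y| <= 1 by rewrite ler_norml sin_geN1 sin_le1.
have ic a := rint_wexpM e0 (@continuous_cos_lin R a) (fun y : R => cb (a * y)).
have irs a := rint_wexpM e0 (@continuous_sin_lin R a) (fun y : R => sb (a * y)).
pose a1 := 2 * pi * x.1; pose a2 := 2 * pi * x.2.
have [h1 E1] := Int_prod (ic a1) (ic a2).
have [h2 E2] := Int_prod (irs a1) (irs a2).
have [h3 E3] := Int_prod (irs a1) (ic a2).
have [h4 E4] := Int_prod (ic a1) (irs a2).
have arg k : 2 * pi * inner k x = a1 * k.1 + a2 * k.2 by rewrite /inner /a1 /a2; ring.
split.
 transitivity (Int L2 (fun k : P => (wexp e k.1 * cos (a1 * k.1)) * (wexp e k.2 * cos (a2 * k.2)) -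
   (wexp e k.1 * sin (a1 * k.1)) * (wexp e k.2 * sin (a2 * k.2)))).
  by apply: eq_Int => k; rewrite arg cosD /w2; ring.
 rewrite IntB// E1 E2 !Int_wexp_sin// mul0r subr0 /K2 -!Int_wexp_cos//.
transitivity (Int L2 (fun k : P => (wexp e k.1 * sin (a1 * k.1)) * (wexp e k.2 * cos (a2 * k.2)) +
   (wexp e k.1 * cos (a1 * k.1)) * (wexp e k.2 * sin (a2 * k.2)))).
 by apply: eq_Int => k; rewrite arg sinD /w2; ring.
by rewrite IntD// E3 E4 !Int_wexp_sin// mul0r mulr0 addr0.
Qed.

Lemma K2_integral : rint2 (K2 1) /\ Int2 (K2 1) = 1.
Proof.
have [h1 h2] := @poisson1_integral R; have [h3 h4] := Int_prod h1 h1.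
by split => //; move: h4; rewrite h2 mulr1.
Qed.

Section Plancherel.
Variables (f : P -> R[i]) (cf : Cc f).
Let f1 x := cRe (f x).
Let f2 x := cIm (f x).
Let kf1 : kc f1. Proof. by have [] := Cc_kc cf. Qed.
Let kf2 : kc f2. Proof. by have [] := Cc_kc cf. Qed.
Let fc k x := cRe (ek k x * f x).
Let fs k x := cIm (ek k x * f x).
Let v x := `|f1 x| + `|f2 x|.
Let A k := Int2 (fc k).
Let B k := Int2 (fs k).
Let V := Int2 v.

Let rv : rint2 v.
Proof. by apply: rintD; apply: rint_norm; apply: kc_rint => //; exact: leb2_locally_finite. Qed.

Let rfc k : rint2 (fc k).
Proof. by have [] := Cc_crint leb2_lf (Cc_ekM k cf). Qed.
Let rfs k : rint2 (fs k).
Proof. by have [] := Cc_crint leb2_lf (Cc_ekM k cf). Qed.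

Let normc_ek_f k x : normc (ek k x * f x) <= v x.
Proof. by rewrite normcM normc_ek mul1r normc_le_ReIm. Qed.

Let fcv k x : `|fc k x| <= v x.
Proof. exact: le_trans (normr_Re_le _) (normc_ek_f k x). Qed.
Let fsv k x : `|fs k x| <= v x.
Proof. exact: le_trans (normr_Im_le _) (normc_ek_f k x). Qed.

Let V0 : 0 <= V. Proof. by apply: Int_ge0 => x; rewrite addr_ge0. Qed.

Let AV k : `|A k| <= V.
Proof. by rewrite (le_trans (Int_norm (rfc k)))//; apply: le_Int; [exact: rint_norm|exact: rv|exact: fcv]. Qed.
Let BV k : `|B k| <= V.
Proof. by rewrite (le_trans (Int_norm (rfs k)))//; apply: le_Int; [exact: rint_norm|exact: rv|exact: fsv]. Qed.

Lemma pow_specE k : pow_spec f k = A k ^+ 2 + B k ^+ 2.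
Proof. by rewrite /pow_spec fourierN sqr_normcE cintegralE. Qed.

Let fdiff k k' : exists2 M : R, 0 <= M & forall k k',
 Int2 (fun x => normc (ek k x - ek k' x) * v x) <= M * (`|k.1 - k'.1| + `|k.2 - k'.2|) /\
 rint2 (fun x => normc (ek k x - ek k' x) * v x).
Proof.
have [_ [L L0 sf1]] := kf1; have [_ [L' L'0 sf2]] := kf2.
pose M := 4 * pi * (L + L') * V.
have p0 : 0 <= 4 * pi * (L + L') by rewrite !mulr_ge0 ?pi_ge0 ?addr_ge0.
exists M; first by rewrite mulr_ge0.
move=> {k k'}k k'; set D := `|k.1 - k'.1| + `|k.2 - k'.2|.
have D0 : 0 <= D by rewrite addr_ge0.
have H x : normc (ek k x - ek k' x) * v x <= 4 * pi * (L + L') * D * v x.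
 have v0 : 0 <= v x by rewrite addr_ge0. have [b|nb] := pselect (`|x.1| <= L + L' /\ `|x.2| <= L + L').
  rewrite ler_wpM2r// (le_trans (ek_lip _ _ _))// -!mulrA !ler_wpM2l ?pi_ge0//. case: b => b1 b2.
  have := normr_ge0 (k.1 - k'.1); have := normr_ge0 (k.2 - k'.2); rewrite /D; nra.
 have -> : v x = 0 by rewrite /v (supp_in_le _ sf1 nb) ?lerDl// (supp_in_le _ sf2 nb) ?lerDr// !normr0 addr0. by rewrite !mulr0.
have mm : mfun (fun x => normc (ek k x - ek k' x) * v x).
 apply: cont_mfun => x; apply: cvgM.
  have cR : continuous (fun x => cRe (ek k x - ek k' x))
   by move=> y; under eq_fun do rewrite ReB; apply: cvgB; exact: continuous_cos_inner.
  have cI : continuous (fun x => cIm (ek k x - ek k' x))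
   by move=> y; under eq_fun do rewrite ImB; apply: cvgB; exact: continuous_sin_inner.
  have -> : (fun x => normc (ek k x - ek k' x)) =
   (fun x => Num.sqrt (cRe (ek k x - ek k' x) ^+ 2 + cIm (ek k x - ek k' x) ^+ 2)).
   by apply/funext => y; rewrite -sqr_normcE sqrtr_sqr ger0_norm ?normc_ge0.
  apply: continuous_comp; last exact: sqrt_continuous.
  by apply: cvgD; rewrite expr2; apply: cvgM; [exact: cR|exact: cR|exact: cI|exact: cI].
 by apply: cvgD; apply: cvg_norm; [case: kf1 => c _; exact: c|case: kf2 => c _; exact: c].
have rr : rint2 (fun x => normc (ek k x - ek k' x) * v x).
 apply: (rint_le mm _ (rintZ (4 * pi * (L + L') * D) rv)) => x. by rewrite ger0_norm ?H// mulr_ge0 ?normc_ge0 ?addr_ge0.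
split => //; rewrite (le_trans (le_Int rr (rintZ (4 * pi * (L + L') * D) rv) H))//.
by rewrite IntZ// /M -/V; rewrite -mulrA [D * V]mulrC !mulrA.
Qed.

Let cA : continuous A.
Proof.
have [M M0 HM] := fdiff 0 0.
apply: (continuous_plane_le (K := M)) => k k'; have [h1 h2] := HM k k'.
rewrite (le_trans _ h1)// /A -IntB// (le_trans (Int_norm (rintB (rfc k) (rfc k'))))//.
apply: le_Int; [exact/rint_norm/rintB|exact: h2|].
move=> x; rewrite /fc -ReB -mulrBl (le_trans (normr_Re_le _))//.
by rewrite normcM ler_wpM2l ?normc_ge0// normc_le_ReIm.
Qed.

Let cB : continuous B.
Proof.
have [M M0 HM] := fdiff 0 0.
apply: (continuous_plane_le (K := M)) => k k'; have [h1 h2] := HM k k'.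
rewrite (le_trans _ h1)// /B -IntB// (le_trans (Int_norm (rintB (rfs k) (rfs k'))))//.
apply: le_Int; [exact/rint_norm/rintB|exact: h2|].
move=> x; rewrite /fs -ImB -mulrBl (le_trans (normr_Im_le _))//.
by rewrite normcM ler_wpM2l ?normc_ge0// normc_le_ReIm.
Qed.

Lemma continuous_pow_spec : continuous (pow_spec f).
Proof.
have -> : pow_spec f = (fun k => A k * A k + B k * B k) by apply/funext => k; rewrite pow_specE !expr2.
by move=> k; apply: cvgD; apply: cvgM; [exact: cA|exact: cA|exact: cB|exact: cB].
Qed.

Let mA : mfun A.
Proof. exact: cont_mfun. Qed.
Let mB : mfun B.
Proof. exact: cont_mfun. Qed.

Let minner : measurable_fun setT ((fun z => inner z.1 z.2) : BP * BP -> mR).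
Proof.
apply: measurable_funD; apply: mfunM.
- exact: (mcomp measurable_fst measurable_fst).
- exact: (mcomp measurable_fst measurable_snd).
- exact: (mcomp measurable_snd measurable_fst).
- exact: (mcomp measurable_snd measurable_snd).
Qed.

Let mphase : measurable_fun setT ((fun z => 2 * pi * inner z.1 z.2) : BP * BP -> mR).
Proof. by apply: mfunM. Qed.

Let mf1 : measurable_fun setT ((fun z => f1 z.2) : BP * BP -> mR).
Proof. exact: (mcomp (kc_meas kf1) measurable_snd). Qed.
Let mf2 : measurable_fun setT ((fun z => f2 z.2) : BP * BP -> mR).
Proof. exact: (mcomp (kc_meas kf2) measurable_snd). Qed.
Let mcos : measurable_fun setT ((fun z => cos (2 * pi * inner z.1 z.2)) : BP * BP -> mR).
Proof.
by apply: mcomp mphase; apply: continuous_measurable_fun; exact: continuous_cos.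
Qed.
Let msin : measurable_fun setT ((fun z => sin (2 * pi * inner z.1 z.2)) : BP * BP -> mR).
Proof.
by apply: mcomp mphase; apply: continuous_measurable_fun; exact: continuous_sin.
Qed.

Let mfc : measurable_fun setT ((fun z => fc z.1 z.2) : BP * BP -> mR).
Proof.
have -> : (fun z : BP * BP => fc z.1 z.2) = (fun z => cos (2 * pi * inner z.1 z.2) * f1 z.2 - sin (2 * pi * inner z.1 z.2) * f2 z.2)
 by apply/funext => z; rewrite /fc cReM.
by apply: measurable_funB; apply: mfunM.
Qed.
Let mfs : measurable_fun setT ((fun z => fs z.1 z.2) : BP * BP -> mR).
Proof.
have -> : (fun z : BP * BP => fs z.1 z.2) = (fun z => cos (2 * pi * inner z.1 z.2) * f2 z.2 + sin (2 * pi * inner z.1 z.2) * f1 z.2)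
 by apply/funext => z; rewrite /fs cImM.
by apply: measurable_funD; apply: mfunM.
Qed.

Let m_1 (h : P -> R) : mfun h ->
 measurable_fun setT ((fun z => h z.1) : BP * BP -> mR).
Proof. by move=> mh; exact: (mcomp mh measurable_fst). Qed.

Let G x y := f1 x * f1 y + f2 x * f2 y.

(** The damping [w2 e] makes the double integral absolutely convergent, so the frequency can be
    integrated first. This leaves the kernel [K2 e] at the difference of the two positions; the sine
    part vanishes by oddness. *)
Let wspec e : 0 < e ->
 [/\ rint2 (fun k => w2 e k * pow_spec f k),
  rint2 (fun x => Int2 (fun y => G x y * K2 e (x - y))) &
 Int2 (fun k => w2 e k * pow_spec f k) =
 Int2 (fun x => Int2 (fun y => G x y * K2 e (x - y)))].
Proof.
move=> e0.
pose F (z : BP * BP) := w2 e z.1 * (A z.1 * fc z.1 z.2 + B z.1 * fs z.1 z.2).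
have mF : measurable_fun setT (F : BP * BP -> mR).
 apply: mfunM; first exact: (m_1 (meas_w2 e)). by apply: measurable_funD; apply: mfunM => //; [exact: (m_1 mA)|exact: (m_1 mB)].
have Fb k x : `|F (k, x)| <= (w2 e k * (V + V)) * v x.
 exact: (normr_mulD_le (w2_gt0 e k) (AV k) (fcv k x) (BV k) (fsv k x)).
have iu : rint2 (fun k => w2 e k * (V + V)) by under eq_fun do rewrite mulrC; apply: rintZ; exact: rint_w2.
have [r1 r2 E1] := leb2_swap mF Fb iu rv.
have I1 k : Int2 (fun x => F (k, x)) = w2 e k * pow_spec f k.
 rewrite /F /= (IntZ _ (rintD (rintZ (A k) (rfc k)) (rintZ (B k) (rfs k)))).
 rewrite (IntD (rintZ (A k) (rfc k)) (rintZ (B k) (rfs k))). by rewrite (IntZ _ (rfc k)) (IntZ _ (rfs k)) pow_specE !expr2.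
have I2 x : Int2 (fun k => F (k, x)) = Int2 (fun y => G x y * K2 e (x - y)).
 pose F2 (z : BP * BP) := w2 e z.1 * (fc z.1 z.2 * fc z.1 x + fs z.1 z.2 * fs z.1 x).
 have mx (h : P -> P -> R) : measurable_fun setT ((fun z => h z.1 z.2) : BP * BP -> mR) ->
   measurable_fun setT ((fun z => h z.1 x) : BP * BP -> mR).
  move=> mh; apply: (m_1 (h := fun k => h k x)). exact: (mcomp mh (measurable_pair2 x)).
 have mF2 : measurable_fun setT (F2 : BP * BP -> mR).
  apply: mfunM; first exact: (m_1 (meas_w2 e)).
  apply: measurable_funD; apply: mfunM; [exact: mfc|exact: (mx fc mfc)|exact: mfs|exact: (mx fs mfs)].
 have F2b k y : `|F2 (k, y)| <= (w2 e k * (v x + v x)) * v y.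
  rewrite /F2 /= [fc k y * _]mulrC [fs k y * _]mulrC. exact: (normr_mulD_le (w2_gt0 e k) (fcv k x) (fcv k y) (fsv k x) (fsv k y)).
 have iu2 : rint2 (fun k => w2 e k * (v x + v x)) by under eq_fun do rewrite mulrC; apply: rintZ; exact: rint_w2.
 have [_ _ E2] := leb2_swap mF2 F2b iu2 rv. transitivity (Int2 (fun k => Int2 (fun y => F2 (k, y)))).
  apply: eq_Int => k; rewrite /F2 /F /=. have r3 := rintZ (fc k x) (rfc k); have r4 := rintZ (fs k x) (rfs k).
  rewrite (_ : (fun y : P => w2 e k * (fc k y * fc k x + fs k y * fs k x)) =
   (fun y => w2 e k * (fc k x * fc k y + fs k x * fs k y))); last first.
   by apply/funext => y; rewrite [fc k y * _]mulrC [fs k y * _]mulrC.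
  rewrite (IntZ _ (rintD r3 r4)) (IntD r3 r4) (IntZ _ (rfc k)) (IntZ _ (rfs k)). by rewrite [A k * _]mulrC [B k * _]mulrC.
 rewrite E2; apply: eq_Int => y; have [c1 c2] := Int_w2_cos (x - y) e0. pose H := f2 x * f1 y - f1 x * f2 y.
 have ic : rint2 (fun k => w2 e k * cos (2 * pi * inner k (x - y))).
  apply: (rint_le _ _ (rint_w2 e0)).
   apply: mfunM; first exact: meas_w2. exact: (mcomp mcos (measurable_pair2 (x - y))).
  by move=> k; apply: normr_w2M_le; rewrite ler_norml cos_geN1 cos_le1.
 have irs : rint2 (fun k => w2 e k * sin (2 * pi * inner k (x - y))).
  apply: (rint_le _ _ (rint_w2 e0)).
   apply: mfunM; first exact: meas_w2. exact: (mcomp msin (measurable_pair2 (x - y))).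
  by move=> k; apply: normr_w2M_le; rewrite ler_norml sin_geN1 sin_le1.
 transitivity (Int2 (fun k => G x y * (w2 e k * cos (2 * pi * inner k (x - y))) -
   H * (w2 e k * sin (2 * pi * inner k (x - y))))).
  apply: eq_Int => k; rewrite /F2 /= innerB mulrBr cosB sinB /fc /fs !cReM !cImM /= /G /H /f1 /f2. by ring.
 by rewrite (IntB (rintZ _ ic) (rintZ _ irs)) (IntZ _ ic) (IntZ _ irs) c1 c2 mulr0 subr0.
split.
- by have := r1; under [X in rint _ X]eq_fun do rewrite I1.
- by have := r2; under [X in rint _ X]eq_fun do rewrite I2.
- by under eq_Int do rewrite -I1; rewrite E1; apply: eq_Int.
Qed.

(** As the damping is removed, [K2 e] acts as an approximate identity and the spatial side tends to
    the diagonal [G x x] by dominated convergence. The spectral side increases, and monotone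
    convergence also yields the integrability of [pow_spec f]. *)
Theorem plancherel : rint2 (pow_spec f) /\
 Int2 (pow_spec f) = Int2 (fun x => normc (f x) ^+ 2).
Proof.
have [M1 M10 fM1] := kc_bounded kf1; have [M2 M20 fM2] := kc_bounded kf2.
pose M := M1 + M2.
have GM x y : `|G x y| <= M * v x.
 rewrite /G (le_trans (ler_normD _ _))// !normrM /M /v. have := fM1 y; have := fM2 y.
 have := normr_ge0 (f1 x); have := normr_ge0 (f2 x); have := normr_ge0 (f1 y); have := normr_ge0 (f2 y). nra.
have cG x : continuous (G x).
 case: kf1 => c1 _; case: kf2 => c2 _ y. by apply: cvgD; apply: cvgM; [exact: cvg_cst|exact: c1|exact: cvg_cst|exact: c2].
have [rK IK] := K2_integral.
pose e n : R := n.+1%:R^-1.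
have e0 n : 0 < e n by rewrite invr_gt0.
(* The substitution [y = x + e z] turns the shrinking kernel into the fixed [K2 1], which then
   serves as majorant. *)
have sub n x : Int2 (fun y => G x y * K2 (e n) (x - y)) =
  Int2 (fun z => G x (affine2 (e n) x z) * K2 1 z).
 have cK : continuous (fun y => G x y * K2 (e n) (x - y)).
  have cs (a : R) : continuous (fun t : R => poisson (e n) (a - t)).
   move=> t; apply: (@continuous_comp _ _ _ (fun t : R => a - t) (poisson (e n))); last exact: continuous_poisson.
   by apply: cvgB; [exact: cvg_cst|exact: cvg_id].
  move=> y; apply: cvgM; first exact: cG.
  apply: (@cvgM _ _ _ _ (fun y : P => poisson (e n) (x.1 - y.1)) (fun y : P => poisson (e n) (x.2 - y.2))).
   by apply: (@continuous_comp _ _ _ (fst : P -> R) (fun t => poisson (e n) (x.1 - t))); [exact: cvg_fst|exact: cs].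
  by apply: (@continuous_comp _ _ _ (snd : P -> R) (fun t => poisson (e n) (x.2 - t))); [exact: cvg_snd|exact: cs].
 have [_ [L L0 s1]] := kf1; have [_ [L' L'0 s2]] := kf2. have r : rint2 (fun y => G x y * K2 (e n) (x - y)).
  apply: kc_rint; first exact: leb2_locally_finite. split => //; exists (L + L'); first exact: addr_ge0.
  move=> y /= nb; by rewrite /G (supp_in_le _ s1 nb) ?lerDl// (supp_in_le _ s2 nb) ?lerDr// !mulr0 addr0 mul0r.
 have := Rintegral_affine2 x (e0 n) r. rewrite -/(Int _ _) -/(Int _ _) => /(congr1 (fun t => e n ^+ 2 * t)).
 rewrite mulrA mulfV ?expf_neq0 ?gt_eqF// mul1r => <-. rewrite -IntZ; last exact: (integrable_affine2 x (e0 n) r).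
 apply: eq_Int => z; rewrite /K2 /affine2 /=. rewrite (_ : x.1 - (e n * z.1 + x.1) = - (e n * z.1)); last by ring.
 rewrite (_ : x.2 - (e n * z.2 + x.2) = - (e n * z.2)); last by ring. by rewrite !poissonN -!(poisson_scale _ (e0 n)); ring.
have e_cvg : e n @[n --> \oo] --> 0 by exact: cvg_harmonic.
pose J n x := Int2 (fun y => G x y * K2 (e n) (x - y)).
have JG x : J n x @[n --> \oo] --> G x x.
 rewrite /J; under eq_fun do rewrite sub. have [||||_] := @Int_dominated _ BP _ (leb2 R) (fun n z => G x (affine2 (e n) x z) * K2 1 z)
   (fun z => G x x * K2 1 z) (fun z => M * v x * K2 1 z).
 - move=> n; apply: mfunM; last exact: rint_meas rK.
  apply: (mcomp (cont_mfun (cG x))). exact: measurable_affine2.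
 - exact: rintZ.
 - move=> n z; have K0 : 0 <= K2 1 z by rewrite mulr_ge0 ?ltW ?poisson_gt0.
  by rewrite normrM (ger0_norm K0) ler_wpM2r.
 - move=> z; apply: cvgM; last exact: cvg_cst.
  apply: (cvg_comp (fun n => affine2 (e n) x z) (G x)); last exact: cG. have h (t s : R) : e n * t + s @[n --> \oo] --> s
   by rewrite -[X in _ --> X]add0r -(mul0r t); apply: cvgD; [apply: cvgM => //; exact: cvg_cst|exact: cvg_cst].
  exact: (cvg_pair (h z.1 x.1) (h z.2 x.2)).
 by rewrite IntZ// IK mulr1.
have Jv n x : `|J n x| <= M * v x.
 have mm : mfun (fun z => G x (affine2 (e n) x z) * K2 1 z).
  apply: mfunM; last exact: rint_meas rK. apply: (mcomp (cont_mfun (cG x))). exact: measurable_affine2.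
 have K0 z : 0 <= K2 1 z by rewrite mulr_ge0 ?ltW ?poisson_gt0.
 have b z : `|G x (affine2 (e n) x z) * K2 1 z| <= M * v x * K2 1 z by rewrite normrM (ger0_norm (K0 z)) ler_wpM2r.
 have r := rint_le mm b (rintZ (M * v x) rK). rewrite /J sub (le_trans (Int_norm r))//.
 rewrite (le_trans (le_Int (rint_norm r) (rintZ (M * v x) rK) b))//. by rewrite IntZ// IK mulr1.
have [||||_ lim1] := @Int_dominated _ BP _ (leb2 R) J (fun x => G x x) (fun x => M * v x).
- by move=> n; have [_ /rint_meas] := wspec (e0 n).
- exact: rintZ.
- exact: Jv.
- exact: JG.
have GE : (fun x => G x x) = (fun x => normc (f x) ^+ 2) by apply/funext => x; rewrite /G sqr_normcE !expr2.
rewrite GE in lim1.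
have lim2 : Int2 (fun k => w2 (e n) k * pow_spec f k) @[n --> \oo] --> Int2 (fun x => normc (f x) ^+ 2)
 by under eq_fun => n do [have [_ _ ->] := wspec (e0 n)]; exact: lim1.
have mW : mfun (pow_spec f) by apply: cont_mfun; exact: continuous_pow_spec.
have W0 k : 0 <= pow_spec f k by exact: sqr_ge0.
have mono := @cvg_monotone_convergence _ BP R (leb2 R) setT measurableT
 (fun n k => (w2 (e n) k * pow_spec f k)%:E).
have wlim k : (w2 (e n) k * pow_spec f k)%:E @[n --> \oo] --> (pow_spec f k)%:E.
 apply: cvg_EFin; first exact: nearW. rewrite -[X in _ --> X]mul1r; apply: cvgM; last exact: cvg_cst.
 rewrite -[X in _ --> X](mulr1 1). have h (t : R) : wexp (e n) t @[n --> \oo] --> (1 : R).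
  rewrite -(@expR0 R); apply: continuous_cvg; first exact: continuous_expR.
  by rewrite -oppr0; apply: cvgN; rewrite -(mul0r `|t|); apply: cvgM => //; exact: cvg_cst.
 by apply: cvgM; exact: h.
have iW : (\int[leb2 R]_k (pow_spec f k)%:E = (Int2 (fun x => normc (f x) ^+ 2))%:E)%E.
 have -> : (\int[leb2 R]_k (pow_spec f k)%:E = \int[leb2 R]_k limn (fun n => (w2 (e n) k * pow_spec f k)%:E))%E
  by apply: eq_integral => k _; apply/esym/cvg_lim => //; exact: wlim.
 rewrite monotone_convergence//.
 - apply/cvg_lim => //.
  under eq_fun => n do [have [r _ _] := wspec (e0 n); rewrite -Int_EFin//]. by apply: cvg_EFin => //; exact: nearW.
 - by move=> n; have [/rint_meas h _ _] := wspec (e0 n); exact/measurable_EFinP.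
 - by move=> n k _; rewrite lee_fin mulr_ge0// ltW// w2_gt0.
 - move=> k _ a b ab; rewrite lee_fin ler_wpM2r// /w2.
  have h (t : R) : wexp (e a) t <= wexp (e b) t.
   rewrite ler_expR lerN2 ler_wpM2r// /e lef_pV2 ?posrE//. by rewrite ler_nat.
  by apply: ler_pM; rewrite ?h// ltW// wexp_gt0.
have r : rint2 (pow_spec f) by apply: ge0_rint => //; rewrite iW ltry.
by split => //; apply: EFin_inj; rewrite Int_EFin.
Qed.

End Plancherel.
End Fourier.

Lemma le_Int0 (d : measure_display) (T : measurableType d) (mu : {measure set T -> \bar R}) (f g : T -> R) :
 measurable_fun setT f -> (forall x, 0 <= f x) -> rint mu g -> (forall x, f x <= g x) ->
 rint mu f /\ Int mu f <= Int mu g.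
Proof.
move=> mf f0 ig fg; have h : rint mu f by apply: rint_le mf _ ig => x; rewrite ger0_norm.
by split => //; exact: le_Int.
Qed.

(** * Piecewise linear cut-off functions *)

Section Plateau.
Implicit Types (x y : P).

Definition clamp (t : R) : R := if t <= 0 then 0 else if t <= 1 then t else 1.

Lemma clampP t : [/\ 0 <= clamp t, clamp t <= 1, t <= 0 -> clamp t = 0 & 1 <= t -> clamp t = 1].
Proof.
by rewrite /clamp; case: (leP t 0) => ?; [split => //; lra|case: (leP t 1) => ?; split => //; lra].
Qed.

Lemma clamp_lip s t : `|clamp s - clamp t| <= `|s - t|.
Proof.
by rewrite ler_norml /clamp; case: (ger0P (s - t)) => ?; case: (leP s 0) => ?; case: (leP t 0) => ?;
 try case: (leP s 1) => ?; try case: (leP t 1) => ?; apply/andP; split; lra.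
Qed.

(* Equal to 1 where [`|x.i| <= r - s^-1] and to 0 where [r <= `|x.i|] for some i. *)
Definition plateau (s r : R) x := clamp (s * (r - `|x.1|)) * clamp (s * (r - `|x.2|)).

Lemma plateauP s r x : 0 < s ->
 [/\ 0 <= plateau s r x, plateau s r x <= 1,
   (`|x.1| <= r - s^-1 -> `|x.2| <= r - s^-1 -> plateau s r x = 1) &
   ((r <= `|x.1|) || (r <= `|x.2|) -> plateau s r x = 0)].
Proof.
move=> s0; rewrite /plateau.
have [a0 a1 a2 a3] := clampP (s * (r - `|x.1|)); have [b0 b1 b2 b3] := clampP (s * (r - `|x.2|)).
have h (t : R) : t <= r - s^-1 -> 1 <= s * (r - t) by move=> ht; rewrite -(mulfV (lt0r_neq0 s0)) ler_pM2l//; lra.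
split; [exact: mulr_ge0|by rewrite -[1]mulr1; exact: ler_pM|by move=> /h/a3 -> /h/b3 ->; rewrite mulr1|].
by case/orP => ht; [rewrite a2 ?mul0r//|rewrite b2 ?mulr0//]; nra.
Qed.

Lemma continuous_clamp_coord s r (pr : P -> R) : 0 < s -> (forall x y, `|pr x - pr y| <= `|x.1 - y.1| + `|x.2 - y.2|) ->
 continuous (fun x => clamp (s * (r - `|pr x|))).
Proof.
move=> s0 hp; apply: (@continuous_plane_le _ _ s) => x y.
rewrite (le_trans (clamp_lip _ _))// -mulrBr normrM gtr0_norm// ler_pM2l//.
rewrite (_ : r - _ - _ = `|pr y| - `|pr x|); last by ring.
by rewrite distrC (le_trans (ler_dist_dist _ _))//.
Qed.

Lemma continuous_plateau s r : 0 < s -> continuous (plateau s r).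
Proof.
move=> s0 x; apply: cvgM.
 by apply: (@continuous_clamp_coord s r fst s0) => a b; rewrite lerDl.
by apply: (@continuous_clamp_coord s r snd s0) => a b; rewrite lerDr.
Qed.

Lemma kc_plateau s r : 0 < s -> kc (plateau s r).
Proof.
move=> s0; split; first exact: continuous_plateau.
exists `|r| => // x nb; have [_ _ _ ->//] := plateauP r x s0.
apply/negP => /negP; rewrite negb_or -!ltNge => /andP[a b]; apply: nb.
by split; rewrite ltW// (lt_le_trans _ (ler_norm r)).
Qed.

End Plateau.

(** * A large sieve inequality for separated points *)

Section Bessel.
Implicit Types (k x y : P) (s : seq (R[i] * P)) (h : P -> R[i]).

(** Distance at least 1 in the maximum norm. All sides of tiles have length at least 1, so the
    corners of non-overlapping tiles satisfy it. *)
Definition sepr (x y : P) : bool := (1 <= `|x.1 - y.1|) || (1 <= `|x.2 - y.2|).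

Lemma floor_lt1 (a b : R) : Num.floor a = Num.floor b -> `|a - b| < 1.
Proof.
move=> e; have := mem_rg1_floor a; have := mem_rg1_floor b.
by rewrite e /range1 /= => /andP[? ?] /andP[? ?]; rewrite ltr_norml; apply/andP; split; lra.
Qed.

(** Separated points have distinct pairs of integer parts. *)
Lemma sep_count (s : seq P) (l : nat) : pairwise sepr s ->
 all (fun x => (`|x.1| <= l%:R) && (`|x.2| <= l%:R)) s -> (size s <= (2 * l + 1) ^ 2)%N.
Proof.
move=> sp sl.
pose ix (t : R) := absz (Num.floor t + l%:Z).
have fl (t : R) : `|t| <= l%:R -> 0 <= Num.floor t + l%:Z /\ Num.floor t + l%:Z <= (2 * l)%:Z.
 rewrite ler_norml => /andP[t1 t2]; split.
  by rewrite -(@opprK _ l%:Z) subr_ge0 floor_ge_int rmorphN.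
 have : Num.floor t <= l%:Z by rewrite -(ler_int R) (le_trans (floor_le_tmp t)). by rewrite mul2n -addnn PoszD lerD2r.
pose f (x : P) := (ix x.1, ix x.2).
have : size [seq f x | x <- s] = size s by rewrite size_map.
move=> <-.
have -> : ((2 * l + 1) ^ 2 = size [seq (a, b) | a <- iota 0 (2 * l + 1), b <- iota 0 (2 * l + 1)])%N
 by rewrite size_allpairs size_iota mulnn.
apply: uniq_leq_size; last first.
 move=> _ /mapP[x xs ->]; have /andP[/fl[a1 a2] /fl[b1 b2]] := allP sl x xs.
 apply/allpairsP; exists (f x); rewrite /f /= !mem_iota /= !add0n addn1 !ltnS. by split => //; rewrite -lez_nat /ix gez0_abs.
elim: s sp sl => // x s ih /=; rewrite -/(pairwise _ _) => /andP[xs sp] /andP[/andP[x1 x2] sl].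
rewrite ih// andbT; apply/mapP => -[y ys [e1 e2]].
have /andP[y1 y2] := allP sl y ys.
have := allP xs y ys; rewrite /sepr.
have e (a b : R) : `|a| <= l%:R -> `|b| <= l%:R -> ix a = ix b -> `|a - b| < 1.
 move=> /fl[a0 _] /fl[b0 _] ab; apply: floor_lt1. by apply: (addIr l%:Z); rewrite -(gez0_abs a0) -(gez0_abs b0) -/(ix a) ab.
by rewrite !leNgt !e.
Qed.

Lemma sqr_sum_le (I : Type) (r : seq I) (a : I -> R) : (forall i, 0 <= a i) ->
 (\sum_(i <- r) a i) ^+ 2 <= (size r)%:R * \sum_(i <- r) a i ^+ 2.
Proof.
move=> a0; elim: r => [|i r ih]; first by rewrite !big_nil expr0n mulr0.
rewrite !big_cons /=.
set S := \sum_(j <- r) a j; set Q := \sum_(j <- r) a j ^+ 2.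
rewrite -/S -/Q in ih; have S0 : 0 <= S by exact: sumr_ge0.
have hn : 2 * (a i * S) <= (size r)%:R * a i ^+ 2 + Q.
 rewrite /S /Q; elim: (r) => [|j t iht]; first by rewrite !big_nil !mulr0 mul0r addr0. rewrite !big_cons /= -natr1.
 have := sqr_ge0 (a i - a j); nra.
have -> : (a i + S) ^+ 2 = a i ^+ 2 + 2 * (a i * S) + S ^+ 2 by ring.
rewrite -natr1; lra.
Qed.

Definition tsum s k : R[i] := \sum_(p <- s) p.1 * ek k (- p.2).
Definition comb s h x : R[i] := \sum_(p <- s) p.1 * h (x + p.2).
Definition wt s : R := \sum_(p <- s) normc p.1 ^+ 2.

Lemma wt_ge0 s : 0 <= wt s. Proof. by apply: sumr_ge0 => p _; exact: sqr_ge0. Qed.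

Lemma Cc_comb s h : Cc h -> Cc (comb s h).
Proof. by move=> ch; apply: Cc_sum; [move=> p; exact/CcZ/Cc_shift|exists h]. Qed.

Lemma pow_spec_comb s h k : Cc h -> pow_spec (comb s h) k = normc (tsum s k) ^+ 2 * pow_spec h k.
Proof. by move=> ch; rewrite /pow_spec fourier_comb// normcM exprMn. Qed.

Lemma plancherel_comb s h : Cc h ->
 rint2 (fun k => normc (tsum s k) ^+ 2 * pow_spec h k) /\
 Int2 (fun k => normc (tsum s k) ^+ 2 * pow_spec h k) = Int2 (fun x => normc (comb s h x) ^+ 2).
Proof.
move=> ch; have [h1 h2] := plancherel (Cc_comb s ch).
have e : pow_spec (comb s h) = (fun k => normc (tsum s k) ^+ 2 * pow_spec h k) by apply/funext => k; rewrite pow_spec_comb.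
by rewrite e in h1 h2.
Qed.

Lemma kc_normc2 h : Cc h -> kc (fun x => normc (h x) ^+ 2).
Proof.
move=> /Cc_kc[h1 h2]; have [c1 _] := h1; have [c2 _] := h2.
have := kcD (kcM h1 c1) (kcM h2 c2); congr kc.
by apply/funext => x; rewrite sqr_normcE !expr2.
Qed.

Lemma rint_kc (g : P -> R) : kc g -> rint2 g.
Proof. exact: (kc_rint leb2_lf). Qed.

(** At a fixed [x] only the points [p.2] with [x + p.2] in the support of [h] contribute, and
    separation bounds their number; then Cauchy-Schwarz over these terms. *)
Lemma normc_comb_le s h (l : nat) x : pairwise sepr (unzip2 s) ->
 (forall x, ~ (`|x.1| <= l%:R /\ `|x.2| <= l%:R) -> h x = 0) ->
 normc (comb s h x) ^+ 2 <= ((2 * l + 1) ^ 2)%:R * \sum_(p <- s) normc p.1 ^+ 2 * normc (h (x + p.2)) ^+ 2.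
Proof.
move=> sp hl.
pose inb (p : R[i] * P) := (`|(x + p.2).1| <= l%:R) && (`|(x + p.2).2| <= l%:R).
pose r := [seq p <- s | inb p].
have nin p : ~~ inb p -> h (x + p.2) = 0 by move=> /negP np; apply: hl => -[a b]; apply: np; rewrite /inb a b.
have E (F : R[i] * P -> R) : (forall p, ~~ inb p -> F p = 0) -> \sum_(p <- s) F p = \sum_(p <- r) F p.
 move=> F0; rewrite big_filter [RHS]big_mkcond; apply: eq_bigr => p _. by case: ifPn => // /F0.
have n0 : normc (0 : R[i]) = 0 by exact: ComplexField.Normc.normc0.
rewrite (E (fun p => normc p.1 ^+ 2 * normc (h (x + p.2)) ^+ 2)); last first.
 by move=> p /nin ->; rewrite n0 expr0n mulr0.
apply: (le_via ((\sum_(p <- r) normc (p.1 * h (x + p.2))) ^+ 2)).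
 rewrite lerXn2r ?nnegrE ?normc_ge0 ?sumr_ge0//; try by move=> p _; exact: normc_ge0.
 rewrite -(E (fun p => normc (p.1 * h (x + p.2)))) ?normc_sum// => p /nin ->. by rewrite mulr0.
rewrite (le_trans (sqr_sum_le _ _))// => [p|]; first exact: normc_ge0.
under eq_bigr do rewrite normcM exprMn.
rewrite ler_wpM2r ?sumr_ge0// => [p _|]; first by rewrite mulr_ge0 ?sqr_ge0.
rewrite ler_nat -(size_map (fun p => x + p.2)); apply: sep_count.
 rewrite pairwise_map; have : pairwise sepr (unzip2 r).
  by apply: subseq_pairwise sp; apply: map_subseq; exact: filter_subseq.
 rewrite pairwise_map; congr (is_true _); apply: eq_pairwise => a b. have e (u v w : R) : u + v - (u + w) = v - w by ring.
 by rewrite /sepr /= !e.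
by apply/allP => _ /mapP[p pr ->]; move: pr; rewrite mem_filter => /andP[].
Qed.

(** Plancherel followed by the pointwise bound. The constant does not involve the number or the
    position of the points, which keeps all supertile densities bounded on boxes. *)
Lemma bessel s h (l : nat) : pairwise sepr (unzip2 s) -> Cc h ->
 (forall x, ~ (`|x.1| <= l%:R /\ `|x.2| <= l%:R) -> h x = 0) ->
 Int2 (fun k => normc (tsum s k) ^+ 2 * pow_spec h k) <=
 ((2 * l + 1) ^ 2)%:R * wt s * Int2 (fun x => normc (h x) ^+ 2).
Proof.
move=> sp ch hl; rewrite (plancherel_comb s ch).2.
have k1 := kc_normc2 ch.
pose F (p : R[i] * P) x := normc p.1 ^+ 2 * normc (h (x + p.2)) ^+ 2.
have rF p : rint2 (F p) by apply: rintZ; have [] := Int_shift p.2 (rint_kc k1).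
have rS := rintZ ((2 * l + 1) ^ 2)%:R (rint_sum s rF).
rewrite (le_trans (le_Int (rint_kc (kc_normc2 (Cc_comb s ch))) rS _))//.
 by move=> x; exact: normc_comb_le.
rewrite IntZ; last exact: rint_sum.
rewrite Int_sum// -mulrA ler_wpM2l// /wt mulr_suml ler_sum// => p _.
have [g1 g2] := Int_shift p.2 (rint_kc k1).
by rewrite /F IntZ// g2.
Qed.

Definition phase (a : P) s := [seq (p.1 * ek a (- p.2), p.2) | p <- s].

Lemma ekDl k k' x : ek (k + k') x = ek k x * ek k' x.
Proof. by rewrite /ek -expiD; congr expi; rewrite /inner /=; ring. Qed.

Lemma tsum_phase a s k : tsum (phase a s) k = tsum s (k + a).
Proof.
rewrite /tsum big_map; apply: eq_bigr => p _ /=.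
by rewrite ekDl -mulrA [ek a _ * _]mulrC.
Qed.

Lemma wt_phase a s : wt (phase a s) = wt s.
Proof.
rewrite /wt big_map; apply: eq_bigr => p _ /=.
by rewrite normcM normc_ek mulr1.
Qed.

Lemma continuous_tsum s : continuous (fun k => normc (tsum s k) ^+ 2).
Proof.
pose L : R := \sum_(p <- s) normc p.1 * (4 * pi * (`|p.2.1| + `|p.2.2|)).
have L0 : 0 <= L by apply: sumr_ge0 => p _; rewrite !mulr_ge0 ?normc_ge0 ?pi_ge0 ?addr_ge0.
have lip k k' : normc (tsum s k - tsum s k') <= L * (`|k.1 - k'.1| + `|k.2 - k'.2|).
 rewrite /tsum -sumrB (le_trans (normc_sum _ _ _))// /L mulr_suml ler_sum// => p _.
 rewrite -mulrBr normcM -!mulrA ler_wpM2l ?normc_ge0//.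
 rewrite (le_trans (ek_lip _ _ _))// -!mulrA ler_wpM2l// ler_wpM2l ?pi_ge0//= !normrN.
 have := normr_ge0 (k.1 - k'.1); have := normr_ge0 (k.2 - k'.2). have := normr_ge0 p.2.1; have := normr_ge0 p.2.2; nra.
have h : (fun k => normc (tsum s k) ^+ 2) = (fun k => cRe (tsum s k) * cRe (tsum s k) + cIm (tsum s k) * cIm (tsum s k))
 by apply/funext => k; rewrite sqr_normcE !expr2.
rewrite h.
have c1 : continuous (fun k => cRe (tsum s k)).
 apply: (@continuous_plane_le _ _ L) => k k'. by rewrite -ReB (le_trans (normr_Re_le _)).
have c2 : continuous (fun k => cIm (tsum s k)).
 apply: (@continuous_plane_le _ _ L) => k k'. by rewrite -ImB (le_trans (normr_Im_le _)).
by move=> k; apply: cvgD; apply: cvgM; [exact: c1|exact: c1|exact: c2|exact: c2].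
Qed.

Lemma meas_tsum s : mfun (fun k => normc (tsum s k) ^+ 2).
Proof. by apply: cont_mfun; exact: continuous_tsum. Qed.

(** The transform of a bump of width [e] stays above half its integral while the phases are at most
    1/2, where the cosine is at least 1/2. With [pi <= 4] the factor 32 in [e] ensures this. *)
Lemma pow_spec_narrow (rho : R) : 0 < rho -> exists h (c : R),
 [/\ Cc h, forall x, ~ (`|x.1| <= 1 /\ `|x.2| <= 1) -> h x = 0, 0 < c &
   forall k, `|k.1| <= rho -> `|k.2| <= rho -> c <= pow_spec h k].
Proof.
move=> rho0; pose e : R := (1 + 32 * rho)^-1.
have e0 : 0 < e by rewrite invr_gt0; lra.
have e1 : e <= 1 by rewrite invf_le1; lra.
have er : 32 * rho * e <= 1 by rewrite /e ler_pdivrMr ?mul1r; lra.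
pose g : P -> R := plateau (2 / e) e.
have s0 : 0 < 2 / e by rewrite divr_gt0.
have kg : kc g by exact: kc_plateau.
have gP x := plateauP e x s0.
have g0 x : 0 <= g x by have [] := gP x.
pose h x : R[i] := (g x)%:C%C.
have ch : Cc h.
 apply: kc_Cc; first by rewrite /h. have := kcZ 0 kg; congr kc; by apply/funext => x; rewrite /h /= mul0r.
have hz x : ~ (`|x.1| <= e /\ `|x.2| <= e) -> g x = 0.
 move=> nb; rewrite /g; have [_ _ _ ->//] := gP x. apply/negP => /negP; rewrite negb_or -!ltNge => /andP[a b]; apply: nb.
 by split; exact: ltW.
have rg := rint_kc kg.
have Ig : 0 < Int2 g.
 have e4 : 0 < e / 4 by rewrite divr_gt0. have bb := @Int_box R (- (e / 4)) (e / 4) (- (e / 4)) (e / 4).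
 apply: (@lt_le_trans _ _ (Int2 (\1_(box (- (e / 4)) (e / 4) (- (e / 4)) (e / 4))))).
  by rewrite bb ?mulr_gt0//; lra.
 apply: le_Int; [exact: (indic_box_rint leb2_lf)|exact: rg|]. move=> x; rewrite indicE; case: (boolP (_ \in _)) => [|_]; last exact: g0.
 rewrite inE => /sub_box[a b]; rewrite /g; have [_ _ -> //] := gP x.
  by rewrite invf_div; lra.
 by rewrite invf_div; lra.
exists h, ((Int2 g / 2) ^+ 2); split => //.
- move=> x nb; rewrite /h hz// => -[a b]; apply: nb.
 by split; rewrite (le_trans _ e1).
- by rewrite exprn_gt0// divr_gt0.
move=> k k1 k2; rewrite /pow_spec; apply: lerXn2r; rewrite ?nnegrE ?normc_ge0 ?divr_ge0 ?(ltW Ig)//.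
apply: le_trans (le_trans (ler_norm _) (normr_Re_le _)).
rewrite fourierN cintegralE /= mulrC -IntZ//.
have rc : rint2 (fun x => cRe (ek k x * h x)) by have [] := Cc_crint leb2_lf (Cc_ekM k ch).
apply: le_Int => //; first exact: rintZ.
move=> x; rewrite mulr0 subr0.
have [[b1 b2]|nb] := pselect (`|x.1| <= e /\ `|x.2| <= e); last by rewrite hz// !mulr0.
rewrite ler_wpM2r// /ek /expi /=.
have := cos_lip (2 * pi * inner k x) 0; rewrite cos0 subr0.
have : `|2 * pi * inner k x| <= 2^-1.
 rewrite normrM (ger0_norm (mulr_ge0 _ (pi_ge0 R)))//. have h1 : `|inner k x| <= 2 * (rho * e).
  rewrite (le_trans (normr_inner_le _ _))//.
  have := normr_ge0 x.1; have := normr_ge0 x.2; have := normr_ge0 k.1; have := normr_ge0 k.2; nra.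
 have pi4 : (pi : R) <= 4 by have := pihalf_lt2 R; lra. have := pi_ge0 R; move: pi pi4 => p p4 p0; have := normr_ge0 (inner k x); nra.
by move=> h1 h2; have := le_trans h2 h1; rewrite ler_norml => /andP[h3 _]; lra.
Qed.

(** The inequality [bessel] divided by the lower bound of a narrow spectrum. The shift [a] is
    absorbed into the phases of the weights, so [C] is uniform in [a]. *)
Lemma box_bound (rho : R) : 0 < rho -> exists2 C : R, 0 <= C & forall s a,
 pairwise sepr (unzip2 s) ->
 rint2 (fun k : P => \1_(sq rho) k * normc (tsum s (k + a)) ^+ 2) /\
 Int2 (fun k : P => \1_(sq rho) k * normc (tsum s (k + a)) ^+ 2) <= C * wt s.
Proof.
move=> /pow_spec_narrow[h [c [ch hz c0 hc]]].
pose I := Int2 (fun x => normc (h x) ^+ 2).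
have I0 : 0 <= I by apply: Int_ge0 => x; exact: sqr_ge0.
exists (c^-1 * (9 * I)); first by rewrite !mulr_ge0// invr_ge0 ltW.
move=> s a sp; set B : set P := box _ _ _ _.
have sp' : pairwise sepr (unzip2 (phase a s)) by rewrite /unzip2 -map_comp.
have [r1 _] := plancherel_comb (phase a s) ch.
have r2 := rintZ c^-1 r1.
have bd k : \1_B k * normc (tsum s (k + a)) ^+ 2 <= c^-1 * (normc (tsum (phase a s) k) ^+ 2 * pow_spec h k).
 rewrite tsum_phase indicE; case: (boolP (_ \in _)) => [|_]; last first.
  by rewrite mul0r mulr_ge0 ?invr_ge0 ?(ltW c0)// mulr_ge0// sqr_ge0.
 rewrite inE mul1r => /sub_box[k1 k2]. by rewrite mulrCA ler_peMr ?sqr_ge0// -(mulVf (lt0r_neq0 c0)) ler_pM2l ?invr_gt0// hc.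
have m1 : mfun (fun k : P => \1_B k * normc (tsum s (k + a)) ^+ 2).
 apply: mfunM; first by apply: measurable_indic; exact: measurable_box.
 have := meas_tsum (phase a s); congr (measurable_fun _ _). by apply/funext => k; rewrite tsum_phase.
have p0 (k : P) : 0 <= \1_B k * normc (tsum s (k + a)) ^+ 2 by rewrite mulr_ge0 ?sqr_ge0// indicE.
have [r3 le3] := le_Int0 m1 p0 r2 bd.
split => //; rewrite (le_trans le3)// IntZ// -mulrA ler_pM2l ?invr_gt0//.
rewrite (le_trans (bessel (l := 1) sp' ch hz))// wt_phase -mulrA [wt s * _]mulrC mulrA.
by rewrite -/I.
Qed.

End Bessel.

(** * Tails of a density from its characteristic function *)

Section Tail.

(** Integrating [1 - cos (2 pi pr s)] against [wexp e s] gives [2 / e - poisson e pr], which is at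
    least [1 / e] where [e <= |pr|]. After exchanging the integrals, the range [|s| <= eta] is
    controlled by the hypothesis and the rest by the decay of the weight. *)
Lemma tail_bound (Psi pr : P -> R) (C e eps eta : R) :
 mfun pr -> (forall k, 0 <= Psi k) -> rint2 Psi -> Int2 Psi <= C ->
 0 <= eps -> 0 < e ->
 (forall s : R, `|s| <= eta -> Int2 (fun k : P => Psi k * (1 - cos (2 * pi * pr k * s))) <= eps) ->
 Int2 (fun k : P => Psi k * (e <= `|pr k|)%R%:R) <= 2 * eps + 8 * C * expR (- (e * eta / 2)).
Proof.
move=> mpr Psi0 rPsi PsiC eps0 e0 H.
have mPsi := rint_meas rPsi.
have C0 : 0 <= C by rewrite (le_trans _ PsiC)// Int_ge0.
pose c (k : BP) (s : R) := 1 - cos (2 * pi * pr k * s).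
have c0 k s : 0 <= c k s by rewrite subr_ge0 cos_le1.
have c2 k s : c k s <= 2 by rewrite /c; have := cos_geN1 (2 * pi * pr k * s); lra.
pose F (z : BP * mR) : mR := Psi z.1 * c z.1 z.2 * wexp e z.2.
have mcz : measurable_fun setT ((fun z => c z.1 z.2) : BP * mR -> mR).
 apply: measurable_funB; first exact: measurable_cst. apply: (@mcomp _ _ _ _ _ _ (@cos R : mR -> mR)).
  by apply: continuous_measurable_fun; exact: continuous_cos.
 apply: mfunM; last exact: measurable_snd. by apply: mfunM; [exact: measurable_cst|exact: (mcomp mpr measurable_fst)].
have mF : measurable_fun setT F.
 apply: mfunM; last exact: (mcomp (meas_wexp e) measurable_snd). by apply: mfunM => //; exact: (mcomp mPsi measurable_fst).
have w0 e' (s : R) : 0 < wexp e' s by exact: expR_gt0.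
have bF k s : `|F (k, s)| <= (2 * Psi k) * wexp e s.
 rewrite /F /= ger0_norm; last by rewrite !mulr_ge0// ltW. by rewrite ler_wpM2r ?(ltW (w0 _ _))// mulrC ler_wpM2r.
have [_ E] := @Int_swap _ _ _ _ _ (@leb2s) leb F _ _ mF bF (rintZ 2 rPsi) (rint_wexp e0).
have rcw k : rint leb (fun s => wexp e s * cos (2 * pi * pr k * s)).
 apply: rint_wexpM => //; first exact: continuous_cos_lin. by move=> s; rewrite ler_norml cos_geN1 cos_le1.
have I1 k : Int leb (fun s => F (k, s)) = Psi k * (2 / e - poisson e (pr k)).
 transitivity (Int leb (fun s => Psi k * (wexp e s - wexp e s * cos (2 * pi * pr k * s)))).
  by apply: eq_Int => s; rewrite /F /c /=; ring.
 rewrite IntZ; last by apply: rintB => //; exact: rint_wexp. by rewrite IntB//; [rewrite Int_wexp// Int_wexp_cos|exact: rint_wexp].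
have mcs s : mfun (fun k => c k s).
 exact: (mcomp mcz (measurable_pair2 (s : mR))).
have rc s : rint2 (fun k => Psi k * c k s) /\ Int2 (fun k => Psi k * c k s) <= 2 * C.
 have h1 k : 0 <= Psi k * c k s by rewrite mulr_ge0. have h2 k : Psi k * c k s <= 2 * Psi k by rewrite mulrC ler_wpM2r.
 have [r1 r2] := le_Int0 (mfunM mPsi (mcs s)) h1 (rintZ 2 rPsi) h2. by split => //; rewrite (le_trans r2)// IntZ// ler_wpM2l.
have eh : 0 < e / 2 by rewrite divr_gt0.
(* One half of the exponent pays for the decay beyond [eta]; the other half keeps the integral over
   [s] finite. *)
pose X := expR (- (e * eta / 2)).
have X0 : 0 < X by exact: expR_gt0.
have I2 s : Int (@leb2s) (fun k => F (k, s)) <= eps * wexp e s + 2 * C * X * wexp (e / 2) s.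
 have -> : Int (@leb2s) (fun k => F (k, s)) = wexp e s * Int2 (fun k => Psi k * c k s).
  have [r _] := rc s. transitivity (Int2 (fun k => wexp e s * (Psi k * c k s))).
   by apply: eq_Int => k; rewrite /F /= mulrC.
  exact: IntZ.
 have [sn|sn] := leP `|s| eta.
  rewrite mulrC ler_wpDr//.
   by rewrite !mulr_ge0// ltW.
  by rewrite ler_wpM2r ?(ltW (w0 _ _))// H.
 rewrite ler_wpDl//; first by rewrite mulr_ge0// ltW. have -> : 2 * C * X * wexp (e / 2) s = (X * wexp (e / 2) s) * (2 * C) by ring.
 apply: ler_pM; [exact: ltW|by apply: Int_ge0 => k; rewrite mulr_ge0| |by have [] := rc s]. rewrite /X /wexp -expRD ler_expR. nra.
have rw : rint leb (fun s => eps * wexp e s + 2 * C * X * wexp (e / 2) s) by apply: rintD; apply: rintZ; exact: rint_wexp.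
have rs := @rint_swap _ _ _ _ _ (@leb2s) leb F _ _ mF bF (rintZ 2 rPsi) (rint_wexp e0).
have main : Int2 (fun k => Psi k * (2 / e - poisson e (pr k))) <= eps * (2 / e) + 2 * C * X * (4 / e).
 have -> : Int2 (fun k => Psi k * (2 / e - poisson e (pr k))) = Int leb (fun s => Int (@leb2s) (fun k => F (k, s)))
  by rewrite -E; apply: eq_Int => k; rewrite -I1.
 rewrite (le_trans (le_Int rs rw I2))// IntD; [|by apply: rintZ; exact: rint_wexp..]. rewrite !IntZ; [|exact: rint_wexp..].
 rewrite !Int_wexp//. by rewrite (_ : 2 / (e / 2) = 4 / e)//; field; rewrite gt_eqF.
have pb (x : R) : poisson e x <= 2 / e.
 rewrite /poisson ler_pdivrMr; last by rewrite ltr_pwDl ?exprn_gt0// sqr_ge0.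
 rewrite mulrDr (_ : 2 / e * e ^+ 2 = 2 * e); last by field; rewrite gt_eqF. by rewrite lerDl mulr_ge0 ?sqr_ge0// divr_ge0// ltW.
have mpo : mfun (fun k => poisson e (pr k)).
 apply: (mcomp _ mpr); apply: continuous_measurable_fun; exact: continuous_poisson.
have rQ : rint2 (fun k => Psi k * (2 / e - poisson e (pr k))).
 apply: (rint_le _ _ (rintZ (2 / e) rPsi)).
  by apply: mfunM => //; apply: measurable_funB => //; exact: measurable_cst.
 move=> k; have := pb (pr k); have := poisson_gt0 (pr k) e0 => p0 p1.
 by rewrite ger0_norm; [rewrite mulrC ler_wpM2r//; lra|rewrite mulr_ge0//; lra].
have mi : mfun (fun k => Psi k * (e <= `|pr k|)%R%:R).
 apply: mfunM => //. have -> : (fun k => (e <= `|pr k|)%R%:R) = (\1_[set k | e <= `|pr k|] : BP -> R)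
  by apply/funext => k; rewrite indicE; congr (nat_of_bool _)%:R; apply/idP/idP; rewrite inE.
 apply: measurable_indic. have mn : mfun (fun k => `|pr k|) by apply: (mcomp _ mpr); exact: normr_measurable.
 have mt : measurable [set true] by []. by have := measurable_fun_ler (measurable_cst e) mn measurableT mt; rewrite setTI.
have h1 (k : BP) : 0 <= Psi k * (e <= `|pr k|)%R%:R by rewrite mulr_ge0.
have h2 (k : BP) : Psi k * (e <= `|pr k|)%R%:R <= e * (Psi k * (2 / e - poisson e (pr k))).
 rewrite mulrCA ler_wpM2l// mulrBr mulrCA mulfV ?gt_eqF// mulr1. have := pb (pr k) => pk. case: (leP e `|pr k|) => ek; last first.
  by rewrite subr_ge0 -(ler_pdivlMl _ _ e0) mulrC.
 suff : e * poisson e (pr k) <= 1 by move=> ?; rewrite mulr1n; lra.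
 rewrite /poisson mulrA ler_pdivrMr; last by rewrite ltr_pwDl ?exprn_gt0// sqr_ge0.
 rewrite mul1r exprMn -[pr k ^+ 2]real_normK ?num_real//. have pi1 : 1 <= (pi : R) by have := pi_ge2 R; clear; lra.
 have q1 : e ^+ 2 <= `|pr k| ^+ 2 by rewrite lerXn2r ?nnegrE// ltW.
 have q2 : `|pr k| ^+ 2 <= (2 * pi) ^+ 2 * `|pr k| ^+ 2 by rewrite ler_peMl ?sqr_ge0// -[1](expr1n _ 2) lerXn2r ?nnegrE//; move: pi1; clear; lra.
 by rewrite mulrCA -expr2; lra.
have [_ le1] := le_Int0 mi h1 (rintZ e rQ) h2.
rewrite (le_trans le1)// IntZ// (le_trans (ler_wpM2l (ltW e0) main))//.
apply: eqW; rewrite -/X; field; exact: lt0r_neq0.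
Qed.

End Tail.

(** * Exact arithmetic of the dissection *)

Definition o0 : 'I_4 := @Ordinal 4 0 isT.
Definition o1 : 'I_4 := @Ordinal 4 1 isT.
Definition o2 : 'I_4 := @Ordinal 4 2 isT.
Definition o3 : 'I_4 := @Ordinal 4 3 isT.
Definition ord4 := [:: o0; o1; o2; o3].

Lemma ord4_ind (P : 'I_4 -> Prop) : P o0 -> P o1 -> P o2 -> P o3 -> forall i, P i.
Proof.
move=> p0 p1 p2 p3 -[[|[|[|[|//]]]] h].
- by rewrite (_ : Ordinal h = o0)//; exact: val_inj.
- by rewrite (_ : Ordinal h = o1)//; exact: val_inj.
- by rewrite (_ : Ordinal h = o2)//; exact: val_inj.
- by rewrite (_ : Ordinal h = o3)//; exact: val_inj.
Qed.

Lemma mem_ord4 i : i \in ord4. Proof. by elim/ord4_ind: i. Qed.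

Lemma big_ord4 (V : nmodType) (F : 'I_4 -> V) : \sum_(i < 4) F i = F o0 + F o1 + F o2 + F o3.
Proof.
rewrite !big_ord_recl big_ord0 addr0 !addrA.
by congr (_ + _ + _ + _); congr F; exact: val_inj.
Qed.

(* A pair [(a, b)] stands for [a + b lambda]. *)
Definition zl := (int * int)%type.
Definition pt := (zl * zl)%type.
(** Multiplication by [lambda] in the basis [1, lambda], from [lambda^2 = lambda + 3]. *)
Definition zlam (a : zl) : zl := (3 * a.2, a.1 + a.2).
Definition plam (p : pt) : pt := (zlam p.1, zlam p.2).
Definition zc (a b : nat) : zl := (Posz a, Posz b).

(** An integer copy of [displacements], on which the geometry of the dissection is decided by
    computation. *)
Definition disp (i j : 'I_4) : seq pt :=
 nth [::] (nth [::]
  [:: [:: [:: (zc 2 0, zc 2 0)]; [:: (zc 0 0, zc 0 0)]; [:: (zc 0 0, zc 0 0)]; [:: (zc 0 0, zc 0 0)] ];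
    [:: [:: (zc 2 0, zc 0 0); (zc 2 0, zc 1 0); (zc 0 0, zc 2 1)];
      [::];
      [:: (zc 0 0, zc 0 1); (zc 0 0, zc 1 1); (zc 0 0, zc 2 1)];
      [::] ];
    [:: [:: (zc 0 0, zc 2 0); (zc 1 0, zc 2 0); (zc 2 1, zc 0 0)];
      [:: (zc 0 1, zc 0 0); (zc 1 1, zc 0 0); (zc 2 1, zc 0 0)];
      [::];
      [::] ];
    [:: [:: (zc 0 0, zc 0 0); (zc 1 0, zc 0 0); (zc 0 0, zc 1 0); (zc 1 0, zc 1 0);
        (zc 2 1, zc 0 1); (zc 0 1, zc 2 1); (zc 1 1, zc 2 1); (zc 2 1, zc 1 1); (zc 2 1, zc 2 1)];
      [::]; [::]; [::] ] ] i) j.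

Definition idec (j : 'I_4) : seq ('I_4 * pt) := flatten [seq [seq (i, t) | t <- disp i j] | i <- ord4].

(* Sufficient for [0 <= a + b lambda], since [2.3 <= lambda <= 2.31]. *)
Definition zpos (a : zl) : bool := (0 <= 10 * a.1 + 23 * a.2) && (0 <= 100 * a.1 + 231 * a.2).
Definition iw (i : 'I_4) : zl := nth (zc 0 0) [:: zc 0 1; zc 0 1; zc 1 0; zc 1 0] i.
Definition ih (i : 'I_4) : zl := nth (zc 0 0) [:: zc 0 1; zc 1 0; zc 0 1; zc 1 0] i.

Definition inside j (p : 'I_4 * pt) :=
 [&& zpos p.2.1, zpos (zlam (iw j) - (p.2.1 + iw p.1)), zpos p.2.2 & zpos (zlam (ih j) - (p.2.2 + ih p.1))].
Definition idj (p q : 'I_4 * pt) :=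
 [|| zpos (q.2.1 - (p.2.1 + iw p.1)), zpos (p.2.1 - (q.2.1 + iw q.1)),
   zpos (q.2.2 - (p.2.2 + ih p.1)) | zpos (p.2.2 - (q.2.2 + ih q.1))].

(** Subtiles stay inside the inflated prototile, and any two of them are separated by a horizontal
    or vertical line. That they also fill it enters through the areas, see [ar_rdec]. *)
Lemma idec_check : all (fun j => all (inside j) (idec j) && pairwise idj (idec j)) ord4.
Proof. by vm_compute. Qed.

(** * Supertiles and the spectrum of the inflation matrix *)

Section Supertiles.
Implicit Types (n m : nat) (i j : 'I_4) (p q : tl) (s S : seq tl).

Lemma lamE : lam ^+ 2 = lam + 3.
Proof.
have s13 : Num.sqrt 13 ^+ 2 = 13 :> R by rewrite sqr_sqrtr.
rewrite /lambda expr_div_n sqrrD s13; lra.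
Qed.

Lemma lam_bounds : 23 / 10 < lam /\ lam < 231 / 100.
Proof.
have l0 : 0 <= lam by rewrite divr_ge0 ?addr_ge0 ?sqrtr_ge0.
have := lamE; split; nra.
Qed.

Lemma lam_gt0 : 0 < lam. Proof. by have [? _] := lam_bounds; lra. Qed.
Lemma lam_ge1 : 1 <= lam. Proof. by have [? _] := lam_bounds; lra. Qed.
Lemma lamX_ge1 n : 1 <= lam ^+ n. Proof. exact: exprn_ege1 lam_ge1. Qed.
Lemma lamX_gt0 n : 0 < lam ^+ n. Proof. by rewrite exprn_gt0// lam_gt0. Qed.

Definition zv (a : zl) : R := a.1%:~R + a.2%:~R * lam.
Definition pv (p : pt) : P := (zv p.1, zv p.2).

Lemma zvB a b : zv (a - b) = zv a - zv b.
Proof. by rewrite /zv /= !rmorphB /=; ring. Qed.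
Lemma zvD a b : zv (a + b) = zv a + zv b.
Proof. by rewrite /zv /= !rmorphD /=; ring. Qed.
Lemma zv_lam a : zv (zlam a) = lam * zv a.
Proof.
rewrite /zv /zlam /= rmorphM rmorphD /= mulrDr.
have := lamE; rewrite expr2 => e; ring: e.
Qed.

Lemma zv_pos a : zpos a -> 0 <= zv a.
Proof.
case/andP => a1 a2; have [l1 l2] := lam_bounds; rewrite /zv.
have : 0 <= (10 * a.1 + 23 * a.2)%:~R :> R by rewrite ler0z.
have : 0 <= (100 * a.1 + 231 * a.2)%:~R :> R by rewrite ler0z.
rewrite !rmorphD !rmorphM /=; move: (a.1%:~R) (a.2%:~R) => u v; nra.
Qed.

Lemma iwE i : zv (iw i) = w i.
Proof. by elim/ord4_ind: i; rewrite /zv /width /=; ring. Qed.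
Lemma ihE i : zv (ih i) = h i.
Proof. by elim/ord4_ind: i; rewrite /zv /height /=; ring. Qed.

Lemma displacementsE i j : displacements R i j = map pv (disp i j).
Proof.
by elim/ord4_ind: i; elim/ord4_ind: j; rewrite /displacements /= /pv /zv /=;
 repeat (congr (_ :: _)); try congr (_, _); try ring.
Qed.

Lemma wh_bounds i : [/\ 1 <= w i, w i <= 3, 1 <= h i & h i <= 3].
Proof. by have [? ?] := lam_bounds; elim/ord4_ind: i; rewrite /width /height /=; split; lra. Qed.

Definition sc (c : R) (x : P) : P := (c * x.1, c * x.2).
Definition rdec j : seq tl := [seq (p.1, pv p.2) | p : 'I_4 * pt <- idec j].

(* Scaled half-open boxes with these corners are disjoint. *)
Definition rdj (c : R) p q : bool :=
 [|| p.2.1 + c * w p.1 <= q.2.1, q.2.1 + c * w q.1 <= p.2.1,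
   p.2.2 + c * h p.1 <= q.2.2 | q.2.2 + c * h q.1 <= p.2.2].

Definition rin (c : R) j p : bool :=
 [&& 0 <= p.2.1, p.2.1 + w p.1 <= c * w j, 0 <= p.2.2 & p.2.2 + h p.1 <= c * h j].

Lemma rdec_in j : all (rin lam j) (rdec j).
Proof.
have /allP/(_ _ (mem_ord4 j))/andP[/allP H _] := idec_check.
apply/allP => _ /mapP[p pj ->]; have /and4P[h1 h2 h3 h4] := H p pj.
move/zv_pos: h1; move/zv_pos: h2; move/zv_pos: h3; move/zv_pos: h4.
by rewrite !zvB !zvD !zv_lam !iwE !ihE /rin /= => h4 -> h2 -> /=; apply/andP; split; lra.
Qed.

Lemma rdec_dj j : pairwise (rdj 1) (rdec j).
Proof.
have /allP/(_ _ (mem_ord4 j))/andP[_] := idec_check.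
rewrite pairwise_map; apply: sub_pairwise => p q.
by rewrite /rdj /= !mul1r; case/or4P => /zv_pos; rewrite zvB zvD ?iwE ?ihE subr_ge0 => ->; rewrite ?orbT.
Qed.

(** The tiles of the level-[n] supertile with corner at 0. The outermost dissection is expanded
    first; [rsup_add] supplies every other grouping. *)
Fixpoint rsup n j : seq tl :=
 if n is n'.+1 then
  flatten [seq [seq (x.1, sc (lam ^+ n') p.2 + x.2) | x <- rsup n' p.1] | p <- rdec j]
 else [:: (j, 0)].

(** Only the type is inflated and the corner is kept; positions are scaled separately by [scl].
    Supertiles of a translated tiling can thus be placed anywhere. *)
Definition blk n p : seq tl := [seq (x.1, p.2 + x.2) | x <- rsup n p.1].
Definition asm n S : seq tl := flatten [seq blk n p | p <- S].
Definition scl (c : R) S : seq tl := [seq (p.1, sc c p.2) | p <- S].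

Lemma rsupS n j : rsup n.+1 j = asm n (scl (lam ^+ n) (rdec j)).
Proof. by rewrite /asm /scl -map_comp. Qed.

Lemma scD c x y : sc c (x + y) = sc c x + sc c y.
Proof. by rewrite /sc /=; congr pair; rewrite mulrDr. Qed.
Lemma scA c d x : sc c (sc d x) = sc (c * d) x.
Proof. by rewrite /sc /=; congr pair; rewrite mulrA. Qed.
Lemma sc1 x : sc 1 x = x.
Proof. by case: x => a b; rewrite /sc /= !mul1r. Qed.
Lemma sc0 c : sc c 0 = 0.
Proof. by rewrite /sc /= !mulr0. Qed.

Lemma blk0 n j : blk n (j, 0) = rsup n j.
Proof. by rewrite /blk /= -[RHS]map_id; apply: eq_map => -[i x] /=; rewrite add0r. Qed.

Lemma asm_cat n S S' : asm n (S ++ S') = asm n S ++ asm n S'.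
Proof. by rewrite /asm map_cat flatten_cat. Qed.

Lemma scl_cat c S S' : scl c (S ++ S') = scl c S ++ scl c S'.
Proof. by rewrite /scl map_cat. Qed.
Lemma scl_cons c p S : scl c (p :: S) = (p.1, sc c p.2) :: scl c S.
Proof. by []. Qed.
Lemma asm_cons n p S : asm n (p :: S) = blk n p ++ asm n S.
Proof. by []. Qed.

(** Associativity of inflation. This regrouping serves all estimates that fix [n] and let [m]
    grow. *)
Lemma rsup_add n m j : rsup (n + m) j = asm n (scl (lam ^+ n) (rsup m j)).
Proof.
elim: m j => [|m ih] j.
 by rewrite addn0 /= /asm /= cats0 sc0 blk0.
rewrite addnS !rsupS.
elim: (rdec j) => [|p s ihs]; first by [].
rewrite !scl_cons !asm_cons scl_cat asm_cat ihs; congr cat.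
rewrite /blk /= ih /asm /scl map_flatten -!map_comp.
congr flatten; apply: eq_map => q /=; rewrite /blk -!map_comp; apply: eq_map => y /=.
by congr pair; rewrite scD scA addrA exprD.
Qed.

Lemma rsup1 j : rsup 1 j = rdec j.
Proof.
rewrite rsupS expr0 /scl /asm -map_comp -[RHS]map_id.
elim: (rdec j) => //= p s ->; rewrite /blk /= addr0 sc1.
by case: p.
Qed.

Lemma rsup_in n j : all (rin (lam ^+ n) j) (rsup n j).
Proof.
elim: n j => [|n ih] j; first by rewrite /= /rin /= expr0 !mul1r !add0r !lexx.
rewrite rsupS /asm /scl -map_comp; apply/allP => _ /flattenP[_ /mapP[p pj ->] /mapP[x xp ->]].
have /and4P[a1 a2 a3 a4] := allP (rdec_in j) p pj; rewrite /= in xp *.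
have /and4P[b1 b2 b3 b4] := allP (ih p.1) x xp.
have l0 := lamX_gt0 n.
rewrite /rin /= exprSr -(mulrA _ lam (w j)) -(mulrA _ lam (h j)) !addr_ge0 ?mulr_ge0 ?(ltW l0)//=.
apply/andP; split.
 by rewrite -addrA (le_trans (lerD (lexx _) b2))// -mulrDr ler_wpM2l// ltW.
by rewrite -addrA (le_trans (lerD (lexx _) b4))// -mulrDr ler_wpM2l// ltW.
Qed.

Lemma asm_dj n S : pairwise (rdj (lam ^+ n)) S -> (forall j, pairwise (rdj 1) (rsup n j)) ->
 pairwise (rdj 1) (asm n S).
Proof.
move=> pS pn; elim: S pS => //= p S ih /andP[pq pS].
rewrite /asm /= pairwise_cat -/(asm n S) ih// andbT; apply/andP; split; last first.
 rewrite /blk pairwise_map; have := pn p.1; congr (is_true _); apply: eq_pairwise => x y. by rewrite /rdj /= -!addrA !lerD2l.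
apply/allrelP => x y; rewrite /blk /asm => /mapP[x' x'p ->] /flattenP[_ /mapP[q qS ->] /mapP[y' y'q ->]].
have /and4P[a1 a2 a3 a4] := allP (rsup_in n p.1) x' x'p.
have /and4P[b1 b2 b3 b4] := allP (rsup_in n q.1) y' y'q.
rewrite /rdj /= !mul1r.
have /or4P[c|c|c|c] := allP pq q qS; apply/or4P.
- by apply: Or41; lra.
- by apply: Or42; lra.
- by apply: Or43; lra.
- by apply: Or44; lra.
Qed.

Lemma scl_dj c d S : 0 < c -> pairwise (rdj d) S -> pairwise (rdj (c * d)) (scl c S).
Proof.
move=> c0; rewrite pairwise_map; congr (is_true _); apply: eq_pairwise => p q.
by rewrite /rdj /= -!mulrA -!mulrDr !ler_pM2l.
Qed.

Lemma rsup_dj n j : pairwise (rdj 1) (rsup n j).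
Proof.
elim: n j => // n ih j; rewrite rsupS; apply: asm_dj => //.
by have := scl_dj (lamX_gt0 n) (rdec_dj j); rewrite mulr1.
Qed.

Lemma rdj_sepr p q : rdj 1 p q -> sepr p.2 q.2.
Proof.
rewrite /rdj /sepr !mul1r !ler_normr.
have [a _ c _] := wh_bounds p.1; have [b _ d _] := wh_bounds q.1.
by case/or4P => e; apply/orP; [left|left|right|right]; apply/orP; [right|left|right|left]; lra.
Qed.

Lemma rsup_sepr n j : pairwise (@sepr) (unzip2 (rsup n j)).
Proof. by rewrite /unzip2 pairwise_map; apply: sub_pairwise (rsup_dj n j) => p q /rdj_sepr. Qed.

Definition ar i : R := w i * h i.
Definition lsum S : R := \sum_(p <- S) ar p.1.

Lemma ar_ge1 i : 1 <= ar i.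
Proof. by have [a _ b _] := wh_bounds i; rewrite /ar; nra. Qed.
Lemma ar_le9 i : ar i <= 9.
Proof. by have [a b c d] := wh_bounds i; rewrite /ar; nra. Qed.

Lemma size_le_lsum S : (size S)%:R <= lsum S.
Proof.
rewrite -sum1_size natr_sum; apply: ler_sum => p _; exact: ar_ge1.
Qed.

(* The right Perron eigenvector of the inflation matrix, normalised against [ar]; it gives the
  number of tiles of each type per unit area. *)
Definition fd i : R := nth 0 [:: 1; lam - 1; lam - 1; 4 - lam] i / 13.

Lemma fd_gt0 i : 0 < fd i.
Proof. by have [? ?] := lam_bounds; elim/ord4_ind: i; rewrite /fd /=; lra. Qed.

Lemma fd_ar : \sum_i fd i * ar i = 1.
Proof.
rewrite big_ord4 /fd /ar /width /height /=; have := lamE; rewrite expr2 => e.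
by field: e.
Qed.

(** The coefficients are the columns of the inflation matrix; the eigenvalue identities below are
    all verified through this formula. *)
Lemma sum_rdec (G : 'I_4 -> R) j : \sum_(p <- rdec j) G p.1 =
 nth 0 [:: G o0 + 3 * G o1 + 3 * G o2 + 9 * G o3; G o0 + 3 * G o2; G o0 + 3 * G o1; G o0] j.
Proof.
by rewrite /rdec big_map; elim/ord4_ind: j; rewrite /idec /= !big_cons big_nil /=; ring.
Qed.

Lemma sum_asm (F : tl -> R) n S : \sum_(x <- asm n S) F x = \sum_(p <- S) \sum_(x <- blk n p) F x.
Proof. by rewrite /asm big_flatten /= big_map. Qed.

Lemma sum_blk (F : tl -> R) n p : \sum_(x <- blk n p) F x = \sum_(x <- rsup n p.1) F (x.1, p.2 + x.2).
Proof. by rewrite /blk big_map. Qed.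

Definition gsum (G : 'I_4 -> R) n j : R := \sum_(x <- rsup n j) G x.1.

Lemma gsumS G n j : gsum G n.+1 j = \sum_(p <- rdec j) gsum G n p.1.
Proof.
rewrite /gsum rsupS sum_asm /scl big_map; apply: eq_bigr => p _; by rewrite sum_blk.
Qed.

Lemma gsum_asm G n S : \sum_(x <- asm n S) G x.1 = \sum_(p <- S) gsum G n p.1.
Proof. by rewrite sum_asm; apply: eq_bigr => p _; rewrite sum_blk. Qed.

Lemma gsum_fd G n : \sum_j fd j * gsum G n j = lam ^+ (2 * n) * \sum_i fd i * G i.
Proof.
elim: n => [|n ih].
 by rewrite muln0 expr0 mul1r; apply: eq_bigr => j _; rewrite /gsum /= big_seq1.
transitivity (lam ^+ 2 * \sum_j fd j * gsum G n j); last by rewrite ih mulrA -exprD mulnS.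
under eq_bigr do rewrite gsumS sum_rdec.
rewrite !big_ord4 /fd /=; move: (gsum G n o0) (gsum G n o1) (gsum G n o2) (gsum G n o3) => a b c d.
by have := lamE; rewrite expr2 => e; field: e.
Qed.

Lemma lsum_rsup n j : lsum (rsup n j) = lam ^+ (2 * n) * ar j.
Proof.
rewrite /lsum -/(gsum ar n j); elim: n j => [|n ih] j; first by rewrite /gsum /= big_seq1 muln0 expr0 mul1r.
rewrite gsumS; under eq_bigr do rewrite ih.
rewrite -mulr_sumr sum_rdec mulnS exprD [lam ^+ 2 * _]mulrC -[RHS]mulrA; congr (_ * _).
by have := lamE; rewrite expr2 => e; elim/ord4_ind: j; rewrite /ar /width /height /=; ring: e.
Qed.

Lemma size_rsup n j : (size (rsup n j))%:R <= 9 * lam ^+ (2 * n).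
Proof.
rewrite (le_trans (size_le_lsum _))// lsum_rsup mulrC ler_wpM2r ?ar_le9//.
by rewrite ltW// lamX_gt0.
Qed.

(** Besides [lambda^2] the inflation matrix has the eigenvalues [lambda (1 - lambda) = -3] and
    [(1 - lambda)^2 = 4 - lambda]. The left side applies the quadratic polynomial with these two
    roots, so only the Perron direction survives. *)
Lemma gsum_rec2 G n j : gsum G n.+2 j + (lam - 1) * gsum G n.+1 j - (12 - 3 * lam) * gsum G n j =
 13 * lam * ar j * \sum_i fd i * gsum G n i.
Proof.
have := lamE; rewrite expr2 => e.
by elim/ord4_ind: j; rewrite !gsumS sum_rdec !gsumS !sum_rdec big_ord4 /fd /ar /width /height /=;
 move: (gsum G n o0) (gsum G n o1) (gsum G n o2) (gsum G n o3) => a b c d; field: e.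
Qed.

(** The second largest eigenvalue has modulus 3. After removal of the main term,
    [e (n + 1) - (4 - lambda) * e n] is geometric with ratio -3, and since [4 - lambda < 3] the
    error itself grows at most like [3 ^ n]. *)
Lemma gsum_rate G B n j : (forall i, `|G i| <= B) ->
 `|gsum G n j - lam ^+ (2 * n) * ar j * \sum_i fd i * G i| <= 100 * B * 3 ^+ n.
Proof.
move=> GB; set g := \sum_i _; pose e n := gsum G n j - lam ^+ (2 * n) * ar j * g.
have [l1 l2] := lam_bounds; have ll := lamE.
have rec n' : e n'.+2 - (4 - lam) * e n'.+1 = - 3 * (e n'.+1 - (4 - lam) * e n').
 have E1 : lam ^+ (2 * n'.+1) = lam ^+ 2 * lam ^+ (2 * n') by rewrite mulnS exprD.
 have E2 : lam ^+ (2 * n'.+2) = lam ^+ 2 * (lam ^+ 2 * lam ^+ (2 * n')) by rewrite mulnS exprD E1.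
 have := gsum_rec2 G n' j; rewrite (gsum_fd G n') -/g /e E1 E2.
 move: (gsum _ _ _) (gsum _ _ _) (gsum _ _ _) (lam ^+ (2 * n')) => a b c d. rewrite ll => E.
 have -> : c = 13 * lam * ar j * (d * g) - (lam - 1) * b + (12 - 3 * lam) * a by rewrite -E; ring.
 by have e2 := ll; rewrite expr2 in e2; ring: e2.
have B0 : 0 <= B by exact: le_trans (GB j).
have gB : `|g| <= B.
 rewrite (le_trans (ler_norm_sum _ _ _))//. apply: (le_via (\sum_i fd i * ar i * B)).
  apply: ler_sum => i _; rewrite normrM (gtr0_norm (fd_gt0 i)) -mulrA ler_pM2l ?fd_gt0//.
  by rewrite (le_trans (GB i))// ler_peMl// ar_ge1.
 by rewrite -mulr_suml fd_ar mul1r.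
have e0 : `|e 0%N| <= 10 * B.
 rewrite /e muln0 expr0 mul1r /gsum /= big_seq1 /= (le_trans (ler_normB _ _))//.
 have := GB j; rewrite normrM (ger0_norm (le_trans ler01 (ar_ge1 j))). have := ar_le9 j; have := ar_ge1 j; have := normr_ge0 g; nra.
(* The inflated type 1 has 1 + 3 + 3 + 9 = 16 subtiles, the most of all types; 48 bounds
   [9 * lambda^2]. *)
have e1 : `|e 1%N| <= 64 * B.
 rewrite /e (le_trans (ler_normB _ _))//. have a1 : `|gsum G 1 j| <= 16 * B.
  rewrite gsumS (le_trans (ler_norm_sum _ _ _))//.
  rewrite (_ : \sum_(p <- rdec j) `|gsum G 0 p.1| = \sum_(p <- rdec j) `|G p.1|); last first.
   by apply: eq_bigr => p _; rewrite /gsum /= big_seq1.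
  rewrite (sum_rdec (fun i => `|G i|)).
  by have := GB o0; have := GB o1; have := GB o2; have := GB o3; move: (j); elim/ord4_ind; rewrite /=; lra.
 have : `|lam ^+ (2 * 1) * ar j * g| <= 48 * B.
  rewrite muln1 ll normrM ger0_norm; last by rewrite mulr_ge0 ?(le_trans ler01 (ar_ge1 j))//; lra.
  have := ar_le9 j; have := ar_ge1 j; have := normr_ge0 g => *. apply: (le_via ((lam + 3) * 9 * B)); last by nra.
  by apply: ler_pM => //; nra.
 lra.
have d n' : `|e n'.+1 - (4 - lam) * e n'| <= 84 * B * 3 ^+ n'.
 elim: n' => [|n' ih]; last first.
  by rewrite (exprS 3 n') rec normrM normrN (ger0_norm (ler0n _ 3)); lra.
 rewrite expr0 mulr1 (le_trans (ler_normB _ _))// normrM ger0_norm; last lra. have := normr_ge0 (e 0%N); nra.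
rewrite -/(e n); elim: n => [|n ih]; first by rewrite expr0; lra.
have dn := d n; rewrite exprS.
have p3 : 0 < 3 ^+ n :> R by rewrite exprn_gt0.
have -> : e n.+1 = (e n.+1 - (4 - lam) * e n) + (4 - lam) * e n by ring.
rewrite (le_trans (ler_normD _ _))// normrM (ger0_norm (_ : 0 <= 4 - lam)); last lra.
have bp : 0 <= B * 3 ^+ n by rewrite mulr_ge0// ltW.
have q : (4 - lam) * `|e n| <= (4 - lam) * (100 * B * 3 ^+ n) by rewrite ler_wpM2l//; lra.
have q2 : (4 - lam) * (100 * B * 3 ^+ n) <= 170 * (B * 3 ^+ n) by rewrite -[100 * B * _]mulrA; move: bp; move: (B * 3 ^+ n) => bn bp; nra.
lra.
Qed.

End Supertiles.

Lemma sum_bool (T : Type) (s : seq T) (P : pred T) :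
 \sum_(x <- s) (P x)%:R = (size (seq.filter P s))%:R :> R.
Proof. by rewrite size_filter -sum1_count natr_sum [RHS]big_mkcond; apply: eq_bigr => x _; case: (P x). Qed.

(** The intervals of radius [c n] around [u n] meet pairwise, so the supremum of their left ends
    lies in all of them. *)
Lemma nested_limit (u c : nat -> R) : (forall n m, `|u (n + m)%N - u n| <= c n) ->
 exists l, forall n, `|u n - l| <= c n.
Proof.
move=> H; have H' n m : u n - c n <= u m + c m.
 have [nm|/ltnW mn] := leqP n m.
  by have := H n (m - n)%N; rewrite subnKC// ler_norml => /andP[a b]; have := le_trans (normr_ge0 _) (H m 0%N); lra.
 by have := H m (n - m)%N; rewrite subnKC// ler_norml => /andP[a b]; have := le_trans (normr_ge0 _) (H n 0%N); lra.
pose X := range (fun n => u n - c n).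
have X0 : X !=set0 by exists (u 0%N - c 0%N), 0%N.
exists (sup X) => n; rewrite ler_norml; apply/andP; split.
 rewrite lerBrDl -lerBrDr opprK addrC; apply: ge_sup => // _ [m _ <-]; rewrite [leRHS]addrC; exact: H'.
rewrite lerBlDr addrC -lerBlDr; apply: ub_le_sup; last by exists n.
by exists (u 0%N + c 0%N) => _ [m _ <-]; exact: H'.
Qed.

(** * Pair statistics of supertiles *)

Section PairStat.
Implicit Types (n m : nat) (i j : 'I_4) (p q : tl) (s t S : seq tl) (B L : R).
Implicit Types F G : 'I_4 -> 'I_4 -> P -> R.

Lemma sep_count_box (s : seq P) a b c d : a <= b -> c <= d -> pairwise (@sepr) s ->
 (forall x, x \in s -> [/\ a <= x.1, x.1 <= b, c <= x.2 & x.2 <= d]) ->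
 (size s)%:R <= (b - a + 2) * (d - c + 2).
Proof.
move=> ab cd sp sl.
pose ix (a t : R) := absz (Num.floor t - Num.floor a).
pose N (a b : R) := (ix a b).+1.
have NE (u v : R) : u <= v -> (N u v)%:R <= v - u + 2.
 move=> uv; have fuv : 0 <= Num.floor v - Num.floor u by rewrite subr_ge0 le_floor.
 rewrite /N -natr1 (_ : (ix u v)%:R = (Posz (ix u v))%:~R :> R)// /ix gez0_abs// rmorphB /=.
 by have := floor_le_tmp v; have := floorD1_gt u; rewrite rmorphD /=; lra.
have ixP (u v t : R) : u <= t -> t <= v -> (ix u t < N u v)%N /\ Posz (ix u t) = Num.floor t - Num.floor u.
 move=> ut tv; have h1 : 0 <= Num.floor t - Num.floor u by rewrite subr_ge0 le_floor.
 have h2 : 0 <= Num.floor v - Num.floor u by rewrite subr_ge0 le_floor// (le_trans ut).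
 by split; [rewrite ltnS -lez_nat /ix !gez0_abs// lerD2r le_floor|rewrite /ix gez0_abs].
apply: (le_via (N a b * N c d)%:R); last by rewrite natrM; apply: ler_pM => //; exact: NE.
rewrite ler_nat -(size_map (fun x => (ix a x.1, ix c x.2))).
have -> : (N a b * N c d = size [seq (u, v) | u <- iota 0 (N a b), v <- iota 0 (N c d)])%N by rewrite size_allpairs !size_iota.
apply: uniq_leq_size; last first.
 move=> _ /mapP[x xs ->]; have [x1 x2 x3 x4] := sl x xs. have [i1 _] := ixP _ _ _ x1 x2; have [i2 _] := ixP _ _ _ x3 x4.
 by apply/allpairsP; exists (ix a x.1, ix c x.2); rewrite !mem_iota /= !add0n.
elim: s sp sl => // x s IH /=; rewrite -/(pairwise _ _) => /andP[xs sp] sl.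
rewrite IH// ?andbT; last by move=> y ys; apply: sl; rewrite inE ys orbT.
apply/mapP => -[y ys [e1 e2]].
have [x1 x2 x3 x4] := sl x (mem_head _ _).
have [|y1 y2 y3 y4] := sl y; first by rewrite inE ys orbT.
have e (u v t t' : R) : u <= t -> t <= v -> u <= t' -> t' <= v -> ix u t = ix u t' -> `|t - t'| < 1.
 move=> a1 a2 b1 b2 tt; apply: floor_lt1; apply: (addIr (- Num.floor u)).
 by have [_ <-] := ixP _ _ _ a1 a2; have [_ <-] := ixP _ _ _ b1 b2; rewrite tt.
by have := allP xs y ys; rewrite /sepr !leNgt (e a b)// (e c d).
Qed.

Definition near0 L (x : P) : bool := (`|x.1| <= L) && (`|x.2| <= L).
Definition pairsum F s t : R := \sum_(p <- s) \sum_(q <- t) F p.1 q.1 (q.2 - p.2).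
Definition bnd F B L : Prop := (forall i i' x, `|F i i' x| <= B) /\ (forall i i' x, ~~ near0 L x -> F i i' x = 0).

Lemma bnd_near F B L i i' x : bnd F B L -> `|F i i' x| <= B * (near0 L x)%:R.
Proof. by move=> [H1 H2]; case: (boolP (near0 L x)) => [_|/H2 ->]; rewrite ?mulr1// normr0 mulr0. Qed.

Lemma pairsum_near F B L s t : bnd F B L ->
 `|pairsum F s t| <= B * \sum_(p <- s) \sum_(q <- t) (near0 L (q.2 - p.2))%:R.
Proof.
move=> bF; rewrite /pairsum (le_trans (ler_norm_sum _ _ _))// mulr_sumr ler_sum// => p _.
rewrite (le_trans (ler_norm_sum _ _ _))// mulr_sumr ler_sum// => q _; exact: bnd_near.
Qed.

Lemma nbr_count L s (y : P) : 0 <= L -> pairwise (@sepr) (unzip2 s) ->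
 \sum_(q <- s) (near0 L (q.2 - y))%:R <= (2 * L + 2) ^+ 2.
Proof.
move=> L0 sp; rewrite sum_bool -(size_map snd).
have e (a : R) : 2 * L + 2 = (a + L) - (a - L) + 2 by ring.
rewrite expr2 {1}(e y.1) (e y.2); apply: sep_count_box; [lra|lra| |].
 by apply: subseq_pairwise sp; apply: map_subseq; exact: filter_subseq.
move=> x /mapP[q]; rewrite mem_filter => /andP[/andP[/=]]; rewrite !ler_norml.
by move=> /andP[? ?] /andP[? ?] _ ->; split; lra.
Qed.

Definition bdry L n j (x : P) : bool :=
 [|| x.1 <= L, lam ^+ n * w j - L <= x.1, x.2 <= L | lam ^+ n * h j - L <= x.2].

Lemma bdry_count L n j : 0 <= L ->
 \sum_(x <- rsup n j) (bdry L n j x.2)%:R <= 20 * (L + 2) * lam ^+ n.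
Proof.
move=> L0; have l1 := lamX_ge1 n.
have [w1 w3 h1 h3] := wh_bounds j.
have cnt (Q : pred P) a b c d : a <= b -> c <= d -> (b - a + 2) * (d - c + 2) <= 5 * (L + 2) * lam ^+ n ->
  (forall x, x \in rsup n j -> Q x.2 -> [/\ a <= x.2.1, x.2.1 <= b, c <= x.2.2 & x.2.2 <= d]) ->
  \sum_(x <- rsup n j) (Q x.2)%:R <= 5 * (L + 2) * lam ^+ n.
 move=> ab cd H1 H2; rewrite sum_bool -(size_map snd); apply: le_trans H1. apply: sep_count_box => //.
  by apply: subseq_pairwise (rsup_sepr n j); apply: map_subseq; exact: filter_subseq.
 by move=> y /mapP[q]; rewrite mem_filter => /andP[Qq qr ->]; exact: H2.
have inn x : x \in rsup n j -> [/\ 0 <= x.2.1, x.2.1 <= lam ^+ n * w j, 0 <= x.2.2 & x.2.2 <= lam ^+ n * h j].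
 move=> /(allP (rsup_in n j))/and4P[a b c d]. by have [? _ ? _] := wh_bounds x.1; split; lra.
have lw : lam ^+ n * w j <= 3 * lam ^+ n by rewrite mulrC ler_wpM2r//; lra.
have lh : lam ^+ n * h j <= 3 * lam ^+ n by rewrite mulrC ler_wpM2r//; lra.
have lw0 : 1 <= lam ^+ n * w j by nra.
have lh0 : 1 <= lam ^+ n * h j by nra.
under eq_bigr do rewrite /bdry.
move: (lam ^+ n) (lam ^+ n * w j) (lam ^+ n * h j) lw lh lw0 lh0 l1 inn cnt => l W H lw lh lw0 lh0 l1 inn cnt.
have c1 : \sum_(x <- rsup n j) (x.2.1 <= L)%R%:R <= 5 * (L + 2) * l.
 apply: (cnt (fun x => x.1 <= L) 0 L 0 H) => //; [lra|nra|]. by move=> x /inn[? ? ? ?] ?; split; lra.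
have c2 : \sum_(x <- rsup n j) (W - L <= x.2.1)%R%:R <= 5 * (L + 2) * l.
 apply: (cnt (fun x => W - L <= x.1) (W - L) W 0 H) => //; [lra|lra|nra|]. by move=> x /inn[? ? ? ?] ?; split; lra.
have c3 : \sum_(x <- rsup n j) (x.2.2 <= L)%R%:R <= 5 * (L + 2) * l.
 apply: (cnt (fun x => x.2 <= L) 0 W 0 L) => //; [lra|nra|]. by move=> x /inn[? ? ? ?] ?; split; lra.
have c4 : \sum_(x <- rsup n j) (H - L <= x.2.2)%R%:R <= 5 * (L + 2) * l.
 apply: (cnt (fun x => H - L <= x.2) 0 W (H - L) H) => //; [lra|lra|nra|]. by move=> x /inn[? ? ? ?] ?; split; lra.
apply: (le_via (\sum_(x <- rsup n j) ((x.2.1 <= L)%R%:R + (W - L <= x.2.1)%R%:R + (x.2.2 <= L)%R%:R + (H - L <= x.2.2)%R%:R))).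
 apply: ler_sum => x _. have b4 (b1 b2 b3 b4 : bool) : [|| b1, b2, b3 | b4]%:R <= b1%:R + b2%:R + b3%:R + b4%:R :> R
  by clear; rewrite -!natrD ler_nat; case: b1; case: b2; case: b3; case: b4.
 exact: b4.
rewrite !big_split /=; lra.
Qed.

Lemma asm_sepr n S : pairwise (rdj (lam ^+ n)) S -> pairwise (@sepr) (unzip2 (asm n S)).
Proof.
move=> pS; rewrite /unzip2 pairwise_map; apply: sub_pairwise (asm_dj pS (rsup_dj n)).
by move=> p q /rdj_sepr.
Qed.

(** A corner away from the sides of its supertile has no neighbour within [L] in another one. The
    boundary layer has of the order of [lambda^n] corners, each with boundedly many neighbours. *)
Lemma cross_count L n p S : 0 <= L -> all (rdj (lam ^+ n) p) S -> pairwise (rdj (lam ^+ n)) S ->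
 \sum_(x <- blk n p) \sum_(y <- asm n S) (near0 L (y.2 - x.2))%:R <= (2 * L + 2) ^+ 2 * (20 * (L + 2) * lam ^+ n).
Proof.
move=> L0 pS SS; rewrite sum_blk.
apply: (le_via (\sum_(x <- rsup n p.1) (2 * L + 2) ^+ 2 * (bdry L n p.1 x.2)%:R)); last first.
 by rewrite -mulr_sumr ler_wpM2l ?sqr_ge0// bdry_count.
apply: ler_sum => x _; case: (boolP (bdry L n p.1 x.2)) => [_|].
 by rewrite mulr1; apply: nbr_count => //; exact: asm_sepr.
rewrite /bdry !negb_or -!ltNge => /and4P[b1 b2 b3 b4].
rewrite mulr0 big1_seq// => y /andP[_].
rewrite /asm => /flattenP[_ /mapP[q qS ->] /mapP[y' y'q ->]].
case: (boolP (near0 _ _)) => // /andP[/=]; rewrite !ler_norml => /andP[n1 n2] /andP[n3 n4].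
have /and4P[a1 a2 a3 a4] := allP (rsup_in n q.1) y' y'q.
have [? _ ? _] := wh_bounds y'.1.
by have /or4P[c|c|c|c] := allP pS q qS; exfalso; lra.
Qed.

Definition Apair F n j : R := pairsum F (rsup n j) (rsup n j).

Lemma pairsum_blk F n p : pairsum F (blk n p) (blk n p) = Apair F n p.1.
Proof.
rewrite /pairsum /blk big_map; apply: eq_bigr => x _; rewrite big_map; apply: eq_bigr => y _ /=.
by congr (F _ _ _); rewrite opprD addrACA subrr add0r.
Qed.

Lemma pairsum_cat F s t : pairsum F (s ++ t) (s ++ t) =
 pairsum F s s + pairsum F s t + pairsum F t s + pairsum F t t.
Proof.
rewrite /pairsum !big_cat /=; under eq_bigr do rewrite big_cat /=.
rewrite big_split /= -!addrA; congr (_ + (_ + _)).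
by under eq_bigr do rewrite big_cat /=; rewrite big_split.
Qed.

Definition cst L : R := (2 * L + 2) ^+ 2 * (40 * (L + 2)).
Lemma cst_ge0 L : 0 <= L -> 0 <= cst L.
Proof. by move=> L0; rewrite /cst mulr_ge0 ?sqr_ge0//; lra. Qed.

Lemma bnd_ge0 F B L : bnd F B L -> 0 <= B.
Proof. by move=> [H _]; exact: le_trans (normr_ge0 _) (H o0 o0 0). Qed.

(** Pairs from different supertiles are a boundary effect. Supertiles are added one at a time, each
    at the cost of two cross sums. *)
Lemma pairsum_asm F B L n S : bnd F B L -> 0 <= L -> pairwise (rdj (lam ^+ n)) S ->
 `|pairsum F (asm n S) (asm n S) - \sum_(p <- S) Apair F n p.1| <= B * cst L * lam ^+ n * (size S)%:R.
Proof.
move=> bF L0; have B0 := bnd_ge0 bF.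
elim: S => [_|p S IH /=]; first by rewrite /asm /pairsum !big_nil subrr normr0 mulr0.
rewrite -/(pairwise _ _) => /andP[pS SS].
rewrite asm_cons pairsum_cat big_cons pairsum_blk.
have c1 := cross_count L0 pS SS.
have x1 : `|pairsum F (blk n p) (asm n S)| <= B * ((2 * L + 2) ^+ 2 * (20 * (L + 2) * lam ^+ n))
 by rewrite (le_trans (pairsum_near _ _ bF))// ler_wpM2l.
have x2 : `|pairsum F (asm n S) (blk n p)| <= B * ((2 * L + 2) ^+ 2 * (20 * (L + 2) * lam ^+ n)).
 rewrite (le_trans (pairsum_near _ _ bF))// ler_wpM2l// exchange_big /=.
 rewrite (le_trans _ c1)// ler_sum// => x _; rewrite ler_sum// => y _. by rewrite /near0 -opprB /= !normrN.
have := IH SS; rewrite /cst (_ : (size S).+1%:R = (size S)%:R + 1 :> R) ?natr1//.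
set a := Apair _ _ _; set b := pairsum F (blk n p) _ in x1 *; set c := pairsum F (asm n S) (blk n p) in x2 *; set d := pairsum _ _ _; set e := \sum_(_ <- _) _.
move=> h1; have -> : a + b + c + d - (a + e) = (b + c) + (d - e) by ring.
rewrite (le_trans (ler_normD _ _))// (le_trans (lerD (ler_normD _ _) (lexx _)))//.
rewrite (le_trans (lerD (lerD x1 x2) h1))//; apply: eqW; ring.
Qed.

Lemma Apair_bound F B L n j : bnd F B L -> 0 <= L ->
 `|Apair F n j| <= B * (2 * L + 2) ^+ 2 * 9 * lam ^+ (2 * n).
Proof.
move=> bF L0; rewrite /Apair (le_trans (pairsum_near _ _ bF))//.
rewrite (_ : B * _ * 9 * _ = B * ((2 * L + 2) ^+ 2 * (9 * lam ^+ (2 * n)))); last by ring.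
rewrite ler_wpM2l ?(bnd_ge0 bF)//.
apply: (le_via (\sum_(x <- rsup n j) (2 * L + 2) ^+ 2)).
 by apply: ler_sum => x _; apply: nbr_count => //; exact: rsup_sepr.
by rewrite sum_cst -[leLHS]mulr_natr ler_wpM2l ?sqr_ge0// size_rsup.
Qed.

Lemma Apair_step F B L n m j : bnd F B L -> 0 <= L ->
 `|Apair F (n + m) j - gsum (Apair F n) m j| <= 9 * B * cst L * lam ^+ n * lam ^+ (2 * m).
Proof.
move=> bF L0; pose S := scl (lam ^+ n) (rsup m j).
have pS : pairwise (rdj (lam ^+ n)) S by have := scl_dj (lamX_gt0 n) (rsup_dj m j); rewrite mulr1.
have := pairsum_asm bF L0 pS; rewrite /S -rsup_add big_map /= -/(gsum _ _ _) => H.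
rewrite (le_trans H)// size_map (le_trans (ler_wpM2l _ (size_rsup m j)))//.
 by rewrite mulr_ge0 ?(ltW (lamX_gt0 n))// mulr_ge0 ?cst_ge0 ?(bnd_ge0 bF).
by apply: eqW; ring.
Qed.

(** With the eigenvector [fd] as weights the sum inside supertiles scales exactly by [lambda^(2 m)]
    ([gsum_fd]), so two means differ by boundary terms only and the limit [gam] exists. *)
Definition amean F n : R := lam ^- (2 * n) * \sum_j fd j * Apair F n j.
Definition gam F : R := limn (amean F).

Lemma amean_cauchy F B L n m : bnd F B L -> 0 <= L ->
 `|amean F (n + m) - amean F n| <= 9 * B * cst L * lam ^- n.
Proof.
move=> bF L0; rewrite /amean.
have l2 := lamX_gt0 (2 * n); have l3 := lamX_gt0 (2 * m); have l1 := lamX_gt0 n.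
have e1 : lam ^+ (2 * (n + m)) = lam ^+ (2 * n) * lam ^+ (2 * m) by rewrite mulnDr exprD.
have e2 : lam ^+ (2 * n) = lam ^+ n * lam ^+ n by rewrite mul2n -addnn exprD.
have -> : lam ^- (2 * n) * \sum_j fd j * Apair F n j =
  (lam ^+ (2 * (n + m)))^-1 * \sum_j fd j * gsum (Apair F n) m j.
 by rewrite gsum_fd e1; field; rewrite !lt0r_neq0.
rewrite -mulrBr -sumrB normrM gtr0_norm ?invr_gt0 ?lamX_gt0//.
rewrite ler_pdivrMl ?lamX_gt0//.
apply: (le_via (\sum_j fd j * ar j * (9 * B * cst L * lam ^+ n * lam ^+ (2 * m)))).
 rewrite (le_trans (ler_norm_sum _ _ _))// ler_sum// => j _. rewrite -mulrBr normrM (gtr0_norm (fd_gt0 j)) -mulrA ler_pM2l ?fd_gt0//.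
 have H := Apair_step n m j bF L0; rewrite (le_trans H)// ler_peMl ?ar_ge1// (le_trans _ H)//.
rewrite -mulr_suml fd_ar mul1r; apply: eqW.
by rewrite e1 e2; field; rewrite lt0r_neq0.
Qed.

Lemma lamV_cvg : lam ^- n @[n --> \oo] --> (0 : R).
Proof.
under eq_fun do rewrite -exprVn; apply: cvg_expr.
by rewrite ger0_norm ?invr_ge0 ?ltW ?lam_gt0// invf_lt1 ?lam_gt0//; have [? _] := lam_bounds; lra.
Qed.

Lemma gamP F B L : bnd F B L -> 0 <= L -> amean F n @[n --> \oo] --> gam F /\
 forall n, `|amean F n - gam F| <= 9 * B * cst L * lam ^- n.
Proof.
move=> bF L0; have [l H] := nested_limit (fun n m => amean_cauchy n m bF L0).
have c : amean F n @[n --> \oo] --> l.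
 rewrite -subr_cvg0; apply: (cvg0_le (g := fun n => 9 * B * cst L * lam ^- n)).
  by apply: nearW => n; exact: H.
 by rewrite -[X in _ --> X](mulr0 (9 * B * cst L)); apply: cvgM_cst; exact: lamV_cvg.
by have -> : gam F = l by apply/cvg_lim.
Qed.

(** Two scales are separated: the boundary effects at level [n] give [lambda^-n], the
    equidistribution of types over [m] further inflations gives [(3 / lambda^2)^m], and the
    level-[n] mean is compared with [gam]. *)
Lemma Apair_rate F B L n m j : bnd F B L -> 0 <= L ->
 `|Apair F (n + m) j - lam ^+ (2 * (n + m)) * ar j * gam F| <=
 lam ^+ (2 * (n + m)) * (B * (90 * cst L + 900 * (2 * L + 2) ^+ 2) * (lam ^- n + (3 / lam ^+ 2) ^+ m)).
Proof.
move=> bF L0; have B0 := bnd_ge0 bF.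
have l2 := lamX_gt0 (2 * n); have l3 := lamX_gt0 (2 * m); have l1 := lamX_gt0 n.
have e1 : lam ^+ (2 * (n + m)) = lam ^+ (2 * n) * lam ^+ (2 * m) by rewrite mulnDr exprD.
have e2 : lam ^+ (2 * n) = lam ^+ n * lam ^+ n by rewrite mul2n -addnn exprD.
have [_ H1] := gamP bF L0; have {H1} := H1 n.
have H2 := Apair_step n m j bF L0.
have H3 := gsum_rate m j (fun i => Apair_bound n i bF L0).
have am : \sum_i fd i * Apair F n i = lam ^+ (2 * n) * amean F n by rewrite /amean mulrA mulfV ?mul1r// lt0r_neq0.
rewrite am in H3; set a := amean F n in H3 *; set g := gam F => H1.
have K0 := cst_ge0 L0; set K := cst L in K0 H1 H2 *.
have Q0 : 0 <= (2 * L + 2) ^+ 2 by exact: sqr_ge0.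
set Q := (2 * L + 2) ^+ 2 in Q0 H3 *.
pose V := lam ^- n; rewrite -/V in H1 *.
pose T : R := (3 / lam ^+ 2) ^+ m; rewrite -/T.
have TE : 3 ^+ m = T * lam ^+ (2 * m) by rewrite /T exprM -exprMn mulfVK// expf_neq0// lt0r_neq0// lam_gt0.
have T0 : 0 <= T by rewrite exprn_ge0// divr_ge0// exprn_ge0// ltW// lam_gt0.
have V0 : 0 <= V by rewrite invr_ge0 ltW.
have lV : lam ^+ n = lam ^+ (2 * n) * V by rewrite e2 /V mulfK// lt0r_neq0.
rewrite {}TE in H3; rewrite {}lV in H2; rewrite e1; clearbody V T a g K Q; clear e1 e2 am.
move: (lam ^+ (2 * n)) (lam ^+ (2 * m)) l2 l3 H2 H3 => X Y X0 Y0 H2 H3.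
have ar9 := ar_le9 j; have ar1 := ar_ge1 j; have ar0 := le_trans ler01 ar1.
set U := Apair F (n + m) j in H2 *; set W := gsum _ m j in H2 H3.
have -> : U - X * Y * ar j * g = (U - W) + (W - Y * ar j * (X * a)) + X * Y * ar j * (a - g) by ring.
rewrite (le_trans (ler_normD _ _))// (le_trans (lerD (ler_normD _ _) (lexx _)))//.
have H4 : `|X * Y * ar j * (a - g)| <= X * Y * (81 * B * K * V).
 rewrite normrM ger0_norm; last by rewrite mulr_ge0// mulr_ge0 ?ltW.
 rewrite -[X * Y * _ * _]mulrA ler_pM2l ?mulr_gt0//; apply: (le_via (9 * (9 * (B * (K * V))))); last lra.
 by apply: ler_pM; rewrite ?(le_trans ler01 ar1)//; rewrite (le_trans H1)//; lra.
rewrite (le_trans (lerD (lerD H2 H3) H4))//.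
have b1 : 0 <= X * Y * B * K * T by rewrite !mulr_ge0// ltW.
have b2 : 0 <= X * Y * B * Q * V by rewrite !mulr_ge0// ltW.
rewrite -subr_ge0.
have -> : X * Y * (B * (90 * K + 900 * Q) * (V + T)) -
 (9 * B * K * (X * V) * Y + 100 * (B * Q * 9 * X) * (T * Y) + X * Y * (81 * B * K * V)) =
 90 * (X * Y * B * K * T) + 900 * (X * Y * B * Q * V) by ring.
exact: addr_ge0 (mulr_ge0 (ler0n _ _) b1) (mulr_ge0 (ler0n _ _) b2).
Qed.

(** [N0] does not depend on [F]. This uniformity is needed when pair functions are produced by
    iterating a transfer operator. *)
Lemma Apair_unif L (eps : R) : 0 <= L -> 0 < eps -> exists N0 : nat, forall F B, bnd F B L ->
 forall N j, (N0 <= N)%N -> `|Apair F N j - lam ^+ (2 * N) * ar j * gam F| <= lam ^+ (2 * N) * (B * eps).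
Proof.
move=> L0 e0; set K := 90 * cst L + 900 * (2 * L + 2) ^+ 2.
have K0 : 0 <= K.
 exact: addr_ge0 (mulr_ge0 (ler0n _ _) (cst_ge0 L0)) (mulr_ge0 (ler0n _ _) (sqr_ge0 _)).
have ee : 0 < eps / (2 * K + 1) by rewrite divr_gt0//; lra.
have [n0 Hn] : exists n0 : nat, lam ^- n0 <= eps / (2 * K + 1).
 have [n0 H] := cvg0_ev lamV_cvg ee; by exists n0; exact: H.
have [m0 Hm] : exists m0 : nat, forall m, (m0 <= m)%N -> (3 / lam ^+ 2) ^+ m <= eps / (2 * K + 1).
 have c : (3 / lam ^+ 2) ^+ m @[m --> \oo] --> (0 : R).
  apply: cvg_expr; have l3 : 3 < lam ^+ 2 by rewrite lamE; have := lam_gt0; lra.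
  by rewrite ger0_norm ?divr_ge0 ?ltr_pdivrMr ?mul1r//; lra.
 exact: cvg0_ev c ee.
exists (n0 + m0)%N => F B bF N j NN.
have -> : N = (n0 + (N - n0))%N by rewrite subnKC// (leq_trans _ NN)// leq_addr.
rewrite (le_trans (Apair_rate _ _ _ bF L0))// ler_pM2l ?lamX_gt0// -mulrA ler_wpM2l ?(bnd_ge0 bF)// -/K.
have Hm' : (3 / lam ^+ 2) ^+ (N - n0) <= eps / (2 * K + 1) by apply: Hm; rewrite leq_subRL// (leq_trans _ NN)// leq_addr.
rewrite (le_trans (ler_wpM2l K0 (lerD Hn Hm')))//.
have : eps / (2 * K + 1) * (2 * K + 1) = eps by rewrite mulfVK// lt0r_neq0//; lra.
move: (eps / (2 * K + 1)) ee => y y0 <-; nra.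
Qed.

End PairStat.

Lemma mem_sum_le (T : eqType) (s : seq T) (f : T -> R) p : (forall q, 0 <= f q) ->
 p \in s -> f p <= \sum_(q <- s) f q.
Proof.
move=> f0; elim: s => // q s IH; rewrite inE big_cons => /predU1P[->|ps].
 by rewrite lerDl sumr_ge0.
by rewrite (le_trans (IH ps))// lerDr.
Qed.

(** * From supertiles to discs in elements of the hull *)

Section Disc.
Implicit Types (p q : tl) (s S E : seq tl) (c r : R) (T X : tileset R).

Definition en (x : P) : R := Num.sqrt (inner x x).

Lemma enE x : en x = normc (x.1 +i* x.2)%C.
Proof. by rewrite /en /inner /= !expr2. Qed.
Lemma en_ge0 x : 0 <= en x. Proof. exact: sqrtr_ge0. Qed.
Lemma enD x y : en (x + y) <= en x + en y.
Proof. by rewrite !enE; exact: (normcD (x.1 +i* x.2)%C (y.1 +i* y.2)%C). Qed.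
Lemma enN x : en (- x) = en x.
Proof. by rewrite /en /inner /= !mulrNN. Qed.
Lemma en_le x : en x <= `|x.1| + `|x.2|.
Proof. by rewrite enE; exact: normc_le_ReIm. Qed.
Lemma en_ge1 x : `|x.1| <= en x.
Proof. by rewrite enE; exact: (normr_Re_le (x.1 +i* x.2)%C). Qed.
Lemma en_ge2 x : `|x.2| <= en x.
Proof. by rewrite enE; exact: (normr_Im_le (x.1 +i* x.2)%C). Qed.
Lemma en_sc c x : 0 <= c -> en (sc c x) = c * en x.
Proof.
move=> c0; rewrite /en /inner /= (_ : _ + _ = c ^+ 2 * (x.1 * x.1 + x.2 * x.2)); last by ring.
by rewrite sqrtrM ?sqr_ge0// sqrtr_sqr ger0_norm.
Qed.

Lemma continuous_en : continuous en.
Proof.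
apply: (@continuous_plane_le _ _ 1) => x y; rewrite mul1r.
have h1 := enD (x - y) y; have h2 := enD (y - x) x; rewrite !subrK in h1 h2.
have h3 := en_le (x - y); have := enN (x - y); rewrite opprB => h4.
by rewrite ler_norml; apply/andP; split; rewrite /= in h3; lra.
Qed.

Lemma measurable_disc r : measurable (disc r : set BP).
Proof.
have m : mfun en := cont_mfun continuous_en.
have mt : measurable [set true] by [].
by have := measurable_fun_ltr m (measurable_cst r) measurableT mt; rewrite setTI.
Qed.

Lemma disc_supp r : supp_in r (ind (disc r)).
Proof.
move=> x nb; rewrite indicE memNset// => xr; apply: nb.
by split; apply: ltW; [exact: le_lt_trans (en_ge1 x) xr|exact: le_lt_trans (en_ge2 x) xr].
Qed.

Lemma rint_indic (A : set P) (L : R) : measurable (A : set BP) -> supp_in L (ind A) ->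
 rint2 (ind A) /\ Int2 (ind A) = area A.
Proof.
move=> mA sA; split; last by rewrite /Int /Rintegral integral_indic// setIT.
apply: (rint_bdd leb2_lf (M := 1) _ _ sA); first exact: measurable_indic.
by move=> x; rewrite indicE; case: (_ \in _); rewrite ?normr1 ?normr0.
Qed.

Lemma rint_disc r : rint2 (ind (disc r)) /\ Int2 (ind (disc r)) = area (disc r).
Proof. exact: rint_indic (measurable_disc r) (@disc_supp r). Qed.

Lemma area_disc r : 0 < r -> area (disc r) = r ^+ 2 * area (disc (1 : R)).
Proof.
move=> r0; have [h1 h2] := rint_disc 1; have [_ <-] := rint_disc r; rewrite -h2.
have rv : 0 < r^-1 by rewrite invr_gt0.
have := Rintegral_affine2 P0 rv h1; rewrite -!/(Int _ _) => e.
have -> : Int2 \1_(disc r) = Int2 (fun x => \1_(disc 1) (affine2 r^-1 P0 x)) :> R.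
 apply: eq_Int => x; rewrite !indicE; congr (nat_of_bool _)%:R.
 have e2 : affine2 r^-1 P0 x = sc r^-1 x by rewrite /affine2 /sc /= !addr0. have : (disc r x) <-> (disc 1 (affine2 r^-1 P0 x)).
  rewrite e2 /disc /= -!/(en _) en_sc ?ltW//. by split => H; [rewrite ltr_pdivrMl// mulr1|rewrite -(mulr1 r) -ltr_pdivrMl].
 by move=> [a b]; apply/idP/idP; rewrite !inE.
by rewrite e -exprVn invrK.
Qed.

Lemma area_disc1_gt0 : 0 < area (disc (1 : R)).
Proof.
have [h1 <-] := rint_disc 1.
have b := @Int_box R (- (1 / 4)) (1 / 4) (- (1 / 4)) (1 / 4).
apply: (@lt_le_trans _ _ (Int2 (ind (box (- (1 / 4)) (1 / 4) (- (1 / 4)) (1 / 4))))).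
 by rewrite b; [apply: mulr_gt0; lra|lra|lra].
apply: le_Int => //; first exact: (indic_box_rint leb2_lf).
move=> x; rewrite !indicE ler_nat; case: (boolP (x \in box _ _ _ _)) => // /set_mem/sub_box[a1 a2].
by rewrite mem_set// /disc /= -/(en _); have := en_le x; lra.
Qed.

(** Half-open boxes of neighbouring supertiles never overlap, which suits packing; the closed [cbox]
    suits covering. *)
Definition hbox c p : set P :=
 [set` `[p.2.1, p.2.1 + c * w p.1[] `*` [set` `[p.2.2, p.2.2 + c * h p.1[].
Definition cbox c p : set P := box p.2.1 (p.2.1 + c * w p.1) p.2.2 (p.2.2 + c * h p.1).

Lemma hbox_int c p : 0 < c -> rint2 (ind (hbox c p)) /\
 Int2 (ind (hbox c p)) = c ^+ 2 * ar p.1.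
Proof.
move=> c0; have [w1 _ h1 _] := wh_bounds p.1.
have mb : measurable (hbox c p : set BP) by apply: measurableX; exact: measurable_itv.
have m0 : mfun (ind (hbox c p)) by exact: measurable_indic.
have cw : 0 < c * w p.1 by rewrite mulr_gt0//; lra.
have ch : 0 < c * h p.1 by rewrite mulr_gt0//; lra.
have rb := indic_box_rint leb2_lf p.2.1 (p.2.1 + c * w p.1) p.2.2 (p.2.2 + c * h p.1).
have sub (x : P) : `|\1_(hbox c p) x : R| <= \1_(box p.2.1 (p.2.1 + c * w p.1) p.2.2 (p.2.2 + c * h p.1)) x.
 rewrite !indicE ger0_norm// ler_nat; case: (boolP (x \in hbox _ _)) => // /set_mem[/=].
 rewrite !in_itv/= => /andP[a1 a2] /andP[a3 a4]. by rewrite mem_set//; split => /=; rewrite in_itv/= ?a1 ?a3 ltW.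
split; first exact: rint_le m0 sub rb.
rewrite /Int /Rintegral integral_indic// setIT leb2_itv !lebesgue_measure_itv /= !lte_fin.
by rewrite !ltrDl cw ch -EFinM /= /ar; ring.
Qed.

Lemma hbox_sum_le1 c S (x : P) : pairwise (rdj c) S -> \sum_(p <- S) \1_(hbox c p) x <= 1 :> R.
Proof.
elim: S => [|p S IH /=]; first by rewrite big_nil.
rewrite -/(pairwise _ _) => /andP[pS SS]; rewrite big_cons.
case: (pselect (hbox c p x)) => px; last by rewrite indicE memNset// add0r IH.
rewrite indicE mem_set// big1_seq ?addr0// => q /andP[_ qS].
rewrite indicE memNset// => qx; move: px qx => [/=].
rewrite !in_itv/= => /andP[a1 a2] /andP[a3 a4] []/=; rewrite !in_itv/= => /andP[b1 b2] /andP[b3 b4].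
by have /or4P[e|e|e|e] := allP pS q qS; lra.
Qed.

Lemma area_le_pack c S (A : set P) (L : R) : 0 < c -> measurable (A : set BP) -> supp_in L (ind A) ->
 pairwise (rdj c) S -> (forall p, p \in S -> hbox c p `<=` A) -> c ^+ 2 * lsum S <= area A.
Proof.
move=> c0 mA sA pS SA; have [rA <-] := rint_indic mA sA.
have -> : c ^+ 2 * lsum S = Int2 (fun x => \sum_(p <- S) \1_(hbox c p) x).
 rewrite Int_sum => [|p]; last by have [] := hbox_int p c0.
 by rewrite /lsum mulr_sumr; apply: eq_bigr => p _; have [_ ->] := hbox_int p c0.
apply: le_Int => //; first by apply: rint_sum => p; have [] := hbox_int p c0.
move=> x; case: (pselect (A x)) => Ax; last first.
 rewrite big1_seq ?indicE// => p /andP[_ pS']; rewrite indicE memNset// => hx; apply: Ax; exact: SA hx.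
by rewrite [leRHS]indicE mem_set//; exact: hbox_sum_le1.
Qed.

Lemma area_le_cover c S (A : set P) (L : R) : 0 < c -> measurable (A : set BP) -> supp_in L (ind A) ->
 (forall x, A x -> exists2 p, p \in S & cbox c p x) -> area A <= c ^+ 2 * lsum S.
Proof.
move=> c0 mA sA cov; have [rA <-] := rint_indic mA sA.
have ib p : Int2 (ind (cbox c p)) = c ^+ 2 * ar p.1.
 have [w1 _ h1 _] := wh_bounds p.1. by rewrite Int_box ?lerDl ?mulr_ge0 ?(ltW c0) ?(le_trans ler01)// /ar; ring.
have rb p : rint2 (ind (cbox c p)) by exact: (indic_box_rint leb2_lf).
have -> : c ^+ 2 * lsum S = Int2 (fun x => \sum_(p <- S) \1_(cbox c p) x) by rewrite Int_sum// /lsum mulr_sumr; apply: eq_bigr.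
apply: le_Int => //; first exact: rint_sum.
move=> x; rewrite [leLHS]indicE; case: (boolP (x \in A)) => [/set_mem/cov[p pS px]|_]; last first.
 by apply: sumr_ge0 => p _; rewrite indicE.
have := @mem_sum_le _ S (fun p => \1_(cbox c p) x) p (fun q => _) pS.
by rewrite [X in X <= _]indicE mem_set//; apply => q; rewrite indicE.
Qed.

(** A unit square at each point packs into a slightly thicker annulus. The types are replaced by
    [o3] because its tile is the unit square. *)
Lemma annulus_count s r1 r2 : 0 < r1 - 2 -> 0 < r2 -> r1 <= r2 -> pairwise (@sepr) (unzip2 s) ->
 (forall p, p \in s -> r1 <= en p.2 /\ en p.2 < r2) ->
 (size s)%:R <= area (disc (1 : R)) * ((r2 + 2) ^+ 2 - (r1 - 2) ^+ 2).
Proof.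
move=> r10 r20 r12 ps sr.
pose s' : seq tl := [seq (o3, p.2) | p <- s].
pose A : set P := disc (r2 + 2) `\` disc (r1 - 2).
have mA : measurable (A : set BP) by apply: measurableD; exact: measurable_disc.
have sA : supp_in (r2 + 2) (ind A).
 move=> x nb; rewrite indicE memNset// => -[xr _]; apply: nb.
 by split; apply: ltW; [exact: le_lt_trans (en_ge1 x) xr|exact: le_lt_trans (en_ge2 x) xr].
have e : area A = area (disc (1 : R)) * ((r2 + 2) ^+ 2 - (r1 - 2) ^+ 2).
 have [rA <-] := rint_indic mA sA. have [d1 e1] := rint_disc (r2 + 2); have [d2 e2] := rint_disc (r1 - 2).
 rewrite mulrBr ![area (disc 1) * _]mulrC -!area_disc; [|by clear -r10 r20; lra|by clear -r10 r20; lra].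
 rewrite -e1 -e2 -IntB//; apply: eq_Int => x; rewrite !indicE. case: (pselect (disc (r1 - 2) x)) => x1.
  have x2 : disc (r2 + 2) x by apply: lt_trans x1 _; lra. by rewrite (mem_set x1) (mem_set x2) memNset ?subrr// => -[].
 rewrite (memNset x1) subr0; congr (nat_of_bool _)%:R.
 by apply/idP/idP => /set_mem; [case=> xx _; exact: mem_set|move=> xx; apply: mem_set].
rewrite -e -(size_map (fun p => (o3, p.2) : tl)) (le_trans (size_le_lsum _))//.
rewrite -[lsum _]mul1r -[X in X * _](expr1n R 2).
apply: (area_le_pack (L := r2 + 2)) => //.
 rewrite pairwise_map; rewrite /unzip2 pairwise_map in ps; apply: sub_pairwise ps => p q.
 rewrite /sepr /rdj /= /width /height /= !mulr1 !ler_normr.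
 by case/orP => /orP[a|a]; apply/or4P; [apply: Or42|apply: Or41|apply: Or44|apply: Or43]; clear -a; lra.
move=> _ /mapP[p pS ->] x [/=]; rewrite !in_itv /width /height/= !mulr1 => /andP[a1 a2] /andP[a3 a4].
have [p1 p2] := sr p pS.
have d1 := enD (x - p.2) p.2; have d2 := enD (p.2 - x) x; rewrite !subrK in d1 d2.
have d3 := en_le (x - p.2); have d4 := enN (x - p.2); rewrite opprB in d4.
have : `|(x - p.2).1| <= 1 by rewrite /= ler_norml; apply/andP; split; clear -a1 a2; lra.
have : `|(x - p.2).2| <= 1 by rewrite /= ler_norml; apply/andP; split; clear -a3 a4; lra.
move=> d5 d6; split; first by rewrite /disc /= -/(en _); lra.
by rewrite /disc /= -/(en _) => d7; lra.
Qed.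

Lemma rsup_add1 n j : rsup n.+1 j = asm 1 (scl (lambda R ^+ 1) (rsup n j)).
Proof. by rewrite -rsup_add add1n. Qed.

(** Uniform separation passes to limits in the rubber topology, and it stands in for the tiling
    property inside the hull. *)
Definition usep X : Prop := forall p q, X p -> X q -> p <> q -> sepr p.2 q.2.

Lemma sepr_sym (x y : P) : sepr x y = sepr y x.
Proof. by rewrite /sepr (distrC x.1) (distrC x.2). Qed.

Lemma list_pairwise (T : eqType) (r : rel T) (s : seq T) : uniq s ->
 (forall p q : T, p \in s -> q \in s -> p <> q -> r p q) -> pairwise r s.
Proof.
elim: s => //= p s IH /andP[ps us] H; rewrite -/(pairwise _ _) IH// ?andbT; last first.
 by move=> a b aS bS; apply: H; rewrite inE ?aS ?bS orbT.
by apply/allP => q qs; apply: H; rewrite ?mem_head ?inE ?qs ?orbT// => e; move: ps; rewrite e qs.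
Qed.

Lemma usep_pairwise X s : usep X -> uniq s -> (forall p, p \in s -> X p) -> pairwise (@sepr) (unzip2 s).
Proof.
move=> uX us sX; rewrite /unzip2 pairwise_map; apply: list_pairwise => // p q ps qs pq.
by apply: uX => //; exact: sX.
Qed.

Lemma usep_enum X r : usep X -> exists s, uniq s /\ forall p, p \in s <-> (X p /\ en p.2 < r).
Proof.
move=> uX; pose A : set tl := [set p | X p /\ en p.2 < r].
suff fA : finite_set A.
 exists (enum_fset (fset_set A)); split; first exact: fset_uniq. by move=> p; have := in_fset_set fA p => e; split => [|H];
  [rewrite -[_ \in _]/(p \in fset_set A) e => /set_mem|rewrite -[_ \in _]/(p \in fset_set A) e; exact: mem_set].
have [//|/infinite_set_fset H] := pselect (finite_set A).
pose l : nat := Num.bound `|r|.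
have lr : `|r| <= l%:R by apply: ltW; exact: archi_boundP.
have [B BA] := H ((2 * l + 1) ^ 2).+1.
suff : (size (enum_fset B) <= (2 * l + 1) ^ 2)%N by move=> e1 e2; have := leq_trans e2 e1; rewrite ltnn.
rewrite -(size_map snd); apply: (@sep_count).
 by apply: (usep_pairwise uX) => [|p pB]; [exact: fset_uniq|have [] := BA p pB].
apply/allP => _ /mapP[p pB ->]; have [_ pr] := BA p pB.
have a1 := en_ge1 p.2; have a2 := en_ge2 p.2; have a3 := ler_norm r.
by apply/andP; split; lra.
Qed.

Lemma hull_approx T0 T : hull T0 T -> forall e : R, 0 < e -> exists t,
 rubber_sub e T (translate t T0) /\ rubber_sub e (translate t T0) T.
Proof.
move=> hT e e0; pose B := [set T' | rubber_close e (T, T')].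
have nB : nbhs T B.
 apply/nbhsP; exists (rubber_close e); first by exists e. by move=> T' /=; rewrite /xsection /= inE.
by have [_ [[t _ <-] [h1 h2]]] := hT B nB; exists t.
Qed.

Lemma usep_translate X t : usep X -> usep (translate t X).
Proof.
move=> uX p q; rewrite /translate /= => Xp Xq pq.
have := uX _ _ Xp Xq; have e (a b c : R) : a - c - (b - c) = a - b by ring.
rewrite /sepr /= !e; apply => -[e1 e2 e3]; apply: pq.
rewrite (pairE p) (pairE q) e1; congr pair.
rewrite (pairE p.2) (pairE q.2).
by congr pair; [exact: (addIr (- t.1))|exact: (addIr (- t.2))].
Qed.

Lemma not_sepr (x y : P) : ~~ sepr x y = (`|x.1 - y.1| < 1) && (`|x.2 - y.2| < 1).
Proof. by rewrite /sepr negb_or -!ltNge. Qed.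

Lemma ball_en (x : P) (e : R) : en x < e -> ball P0 e x.
Proof.
move=> xe; apply/plane_ballP; rewrite /= !sub0r !normrN.
by split; [exact: le_lt_trans (en_ge1 x) xe|exact: le_lt_trans (en_ge2 x) xe].
Qed.

(** Two tiles of [T] closer than 1 have approximants closer than 1 in one translate of [T0], so
    these coincide. Then the types agree and the distance is below [2 e] in both coordinates,
    against the choice of [e]. *)
Lemma usep_hull T0 T : usep T0 -> hull T0 T -> usep T.
Proof.
move=> u0 hT p q Tp Tq pq; apply: contrapT => /negP; rewrite not_sepr => /andP[d1 d2].
(* Equal types force distinct corners, so [D] is a positive distance; for distinct types the
   approximants cannot coincide and 1 is a default. *)
pose D : R := if p.1 == q.1 then en (p.2 - q.2) else 1.
have D0 : 0 < D.
 rewrite /D; case: eqP => // e1; rewrite lt_neqAle en_ge0 andbT; apply/eqP => e2; apply: pq.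
 have a1 := en_ge1 (p.2 - q.2); have a2 := en_ge2 (p.2 - q.2); rewrite -e2 /= in a1 a2. rewrite (pairE p) (pairE q) e1; congr pair.
 rewrite (pairE p.2) (pairE q.2). by congr pair; apply/eqP; rewrite -subr_eq0 -normr_le0.
pose e := Num.min (Num.min ((1 - `|p.2.1 - q.2.1|) / 4) ((1 - `|p.2.2 - q.2.2|) / 4))
         (Num.min (D / 8) (1 + en p.2 + en q.2)^-1).
have en0 := en_ge0 p.2; have en1 := en_ge0 q.2.
have e0 : 0 < e by rewrite !lt_min !divr_gt0 ?invr_gt0 ?subr_gt0//; lra.
have [e1 e2 e3 e4] : [/\ e <= (1 - `|p.2.1 - q.2.1|) / 4, e <= (1 - `|p.2.2 - q.2.2|) / 4, e <= D / 8 & 1 + en p.2 + en q.2 <= e^-1].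
 split; rewrite ?ge_min ?lexx ?orbT//. by rewrite -[X in X <= _]invrK lef_pV2 ?posrE ?invr_gt0//; [rewrite /e !ge_min lexx !orbT|lra].
have [t [h1 _]] := hull_approx hT e0.
have [||p' Tp' /plane_ballP[p1 p2]] := h1 p.1 p.2; [by apply: ball_en; lra|by case: (p) Tp|].
have [||q' Tq' /plane_ballP[q1 q2]] := h1 q.1 q.2; [by apply: ball_en; lra|by case: (q) Tq|].
have ut := usep_translate (t := t) u0.
have [eq|neq] := pselect ((p.1, p') = (q.1, q')); last first.
 have H := ut _ _ Tp' Tq' neq; move: H; rewrite /sepr /= !ler_normr => H.
 move: H p1 p2 q1 q2 d1 d2 e1 e2; clear; rewrite !ltr_norml => H /andP[? ?] /andP[? ?] /andP[? ?] /andP[? ?] d1 d2.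
 have := ler_norm (p.2.1 - q.2.1); have := ler_norm (p.2.2 - q.2.2).
 have := ler_norm (- (p.2.1 - q.2.1)); have := ler_norm (- (p.2.2 - q.2.2)); rewrite !normrN => *.
 by case/orP: H => /orP[?|?]; lra.
case: eq => e5 e6; move: e3; rewrite /D e5 eqxx.
have := en_le (p.2 - q.2); rewrite /=; subst q'.
have a1 : `|p.2.1 - q.2.1| < 2 * e by have := ler_distD p'.1 p.2.1 q.2.1; rewrite (distrC p'.1); lra.
have a2 : `|p.2.2 - q.2.2| < 2 * e by have := ler_distD p'.2 p.2.2 q.2.2; rewrite (distrC p'.2); lra.
lra.
Qed.

Lemma interior_tile i (x z : P) : x.1 < z.1 -> z.1 < x.1 + w i -> x.2 < z.2 -> z.2 < x.2 + h i ->
 interior (tile i x) z.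
Proof.
move=> a1 a2 a3 a4; rewrite /interior /=.
exists ([set` `]x.1, x.1 + w i[], [set` `]x.2, x.2 + h i[]) => /=.
 by split; apply: near_in_itvoo; rewrite in_itv/= ?a1 ?a2 ?a3 ?a4.
move=> [u v] [/=]; rewrite !in_itv/= => /andP[? ?] /andP[? ?].
by split => /=; rewrite in_itv/=; apply/andP; split; apply: ltW.
Qed.

Lemma tiling_rdj T : is_tiling T -> forall p q, T p -> T q -> p <> q -> rdj 1 p q.
Proof.
move=> [_ H] p q Tp Tq pq; apply: contrapT => /negP.
rewrite /rdj !mul1r !negb_or -!ltNge => /and4P[a1 a2 a3 a4].
have := H p.1 p.2 q.1 q.2; rewrite -!pairE => /(_ Tp Tq pq) /seteqP[H' _].
have [? _ ? _] := wh_bounds p.1.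
have [? _ ? _] := wh_bounds q.1.
have mid (a b c d : R) : a < b -> c < d -> a < d -> c < b -> exists z, [/\ a < z, z < b, c < z & z < d].
 clear; move=> ab cd ad cb; have [ac|ca] := leP a c.
  by have [bd|db] := leP b d; [exists ((c + b) / 2)|exists ((c + d) / 2)]; split; lra.
 by have [bd|db] := leP b d; [exists ((a + b) / 2)|exists ((a + d) / 2)]; split; lra.
have [||||z1 [b1 b2 b3 b4]] := mid p.2.1 (p.2.1 + w p.1) q.2.1 (q.2.1 + w q.1); [lra|lra|lra|lra|].
have [||||z2 [c1 c2 c3 c4]] := mid p.2.2 (p.2.2 + h p.1) q.2.2 (q.2.2 + h q.1); [lra|lra|lra|lra|].
by apply: (H' (z1, z2)); split; apply: interior_tile.
Qed.

Lemma inflateP T p : inflate T p <-> exists2 q, T q & p \in blk 1 (q.1, sc lam q.2).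
Proof.
have mem i j (t : P) : (t \in displacements R i j) = ((i, t) \in rdec j).
 rewrite displacementsE; apply/mapP/mapP.
  move=> [d dd ->]; exists (i, d) => //; apply/flattenP; exists [seq (i, t) | t <- disp i j].
   by apply/mapP; exists i => //; exact: mem_ord4.
  by apply/mapP; exists d.
 by move=> [[i' d] /flattenP[_ /mapP[i'' _ ->] /mapP[d' dd' [-> ->]]] [-> ->]]; exists d'.
split.
 move=> [j [y [t [Ty td e]]]]; exists (j, y) => //; rewrite /blk rsup1 /=. by apply/mapP; exists (p.1, t); rewrite -?mem// (pairE p) e.
move=> [q Tq]; rewrite /blk rsup1 => /mapP[x xq ->].
by exists q.1, q.2, x.2; split => //=; [rewrite -pairE|rewrite mem -pairE].
Qed.

Lemma inflate_iterP n T p : iter n (@inflate R) T p <-> exists2 q, T q & p \in blk n (q.1, sc (lam ^+ n) q.2).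
Proof.
elim: n p => [|n IH] p.
 split => [Tp|[q Tq]].
  by exists p => //; rewrite /blk /= sc1 addr0 -pairE mem_seq1.
 by rewrite /blk /= sc1 addr0 -pairE mem_seq1 => /eqP ->.
rewrite iterS; split.
 move=> /inflateP[q /IH[q' Tq' /mapP[y yq ->]] /mapP[x xy ->]]; exists q' => //.
 rewrite /blk rsup_add1; apply/mapP; exists (x.1, sc lam y.2 + x.2) => /=; last by congr pair; rewrite scD scA exprS addrA.
 apply/flattenP; exists (blk 1 (y.1, sc (lam ^+ 1) y.2)); first by apply: map_f; apply/mapP; exists y. by apply/mapP; exists x.
move=> [q Tq /mapP[x]]; rewrite rsup_add1 => /flattenP[_ /mapP[_ /mapP[y yq ->] ->] /mapP[z zy ->]] ->.
apply/inflateP; exists (y.1, sc (lam ^+ n) q.2 + y.2).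
 by apply/IH; exists q => //; apply/mapP; exists y.
by apply/mapP; exists z => //=; congr pair; rewrite scD scA expr1 exprS addrA.
Qed.

Lemma inflate_fixP T n p : inflate (inflate T) = T -> T p <-> exists2 q, T q & p \in blk (2 * n) (q.1, sc (lam ^+ (2 * n)) q.2).
Proof.
move=> hT; rewrite -inflate_iterP; have -> // : iter (2 * n) (@inflate R) T = T.
by elim: n => // n IH; rewrite mulnS iterD IH.
Qed.

(** As [T] is fixed by the squared inflation, for [c = lambda^(2 n)] these are the supertiles
    composing [translate t T]. *)
Definition superset c (t : P) T : tileset R := [set p | exists2 q, T q & p = (q.1, sc c q.2 + t)].

Lemma blk_shift n j (y t : P) p : p \in blk n (j, y) <-> (p.1, p.2 + t) \in blk n (j, y + t).
Proof.
split => /mapP[x xj]; first by move=> ->; apply/mapP; exists x => //=; congr pair; rewrite addrAC.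
move=> e; have /= e1 := congr1 fst e; have e2 : p.2 + t = y + t + x.2 := congr1 snd e.
have -> : p = (x.1, y + x.2) by rewrite (pairE p) e1; congr pair; apply: (addIr t); rewrite e2 addrAC.
exact: (map_f (fun x => (x.1, y + x.2)) xj).
Qed.

Lemma superP T n t p : inflate (inflate T) = T ->
 translate t T p <-> exists2 q, superset (lam ^+ (2 * n)) t T q & p \in blk (2 * n) q.
Proof.
move=> hT; rewrite /translate /= (inflate_fixP n _ hT); split.
 move=> [q Tq pq]; exists (q.1, sc (lam ^+ (2 * n)) q.2 + t); first by exists q.
 by move/(blk_shift _ _ _ t): pq; rewrite /= subrK -pairE.
move=> [_ [q Tq ->] pq]; exists q => //.
by apply/(blk_shift _ _ _ t); rewrite /= subrK -pairE.
Qed.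

Lemma super_rdj T c t p q : 0 < c -> is_tiling T -> superset c t T p -> superset c t T q -> p <> q -> rdj c p q.
Proof.
move=> c0 hT [p' Tp' ->] [q' Tq' ->] pq.
have : rdj 1 p' q' by apply: tiling_rdj hT _ _ Tp' Tq' _ => e; apply: pq; rewrite e.
rewrite /rdj /= !mul1r.
have e (a b u v : R) : (c * a + u + c * b <= c * v + u) = (a + b <= v) by rewrite addrAC lerD2r -mulrDr ler_pM2l.
by rewrite !e.
Qed.

Lemma super_cover T c t (x : P) : 0 < c -> is_tiling T -> exists2 p, superset c t T p & cbox c p x.
Proof.
move=> c0 [H _]; have [i [y [Ty [/=]]]] := H (sc c^-1 (x - t)).
rewrite !in_itv/= => /andP[a1 a2] /andP[a3 a4].
exists (i, sc c y + t); first by exists (i, y).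
have e (a b v u : R) : (a <= c^-1 * (v - u)) = (c * a + u <= v)  by rewrite ler_pdivlMl// lerBrDr.
have e' (a b v u : R) : (c^-1 * (v - u) <= a + b) = (v <= c * a + u + c * b) by rewrite ler_pdivrMl// lerBlDr mulrDr addrAC.
by split; rewrite /= in_itv/= -?e -?e' ?a1 ?a2 ?a3 ?a4//; apply/andP; split; rewrite -?e -?e'//.
Qed.

Lemma en_blk n p x : x \in blk n p -> en (x.2 - p.2) <= 6 * lam ^+ n.
Proof.
move=> /mapP[y yp ->] /=; rewrite addrC addKr.
have /and4P[a1 a2 a3 a4] := allP (rsup_in n p.1) y yp.
have l0 := lamX_gt0 n.
have [? ? ? ?] := wh_bounds y.1.
have [? ? ? ?] := wh_bounds p.1.
rewrite (le_trans (en_le _))// !ger0_norm//.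
have : lam ^+ n * w p.1 <= lam ^+ n * 3 by rewrite ler_wpM2l// ltW.
have : lam ^+ n * h p.1 <= lam ^+ n * 3 by rewrite ler_wpM2l// ltW.
lra.
Qed.

Lemma dist_diff (p p' q q' e d : R) : `|p - p'| < e -> `|q - q'| < e -> e <= d / 2 ->
 `|(q' - p') - (q - p)| < d.
Proof. by rewrite !ltr_norml => /andP[? ?] /andP[? ?] ?; apply/andP; split; lra. Qed.

Lemma norm_add5 (a b c d e a' b' c' d' e' : R) : `|a| <= a' -> `|b| <= b' -> `|c| <= c' ->
 `|d| <= d' -> `|e| <= e' -> `|a + (b + (c + (d + e)))| <= a' + (b' + (c' + (d' + e'))).
Proof.
by move=> *; do 4 (rewrite (le_trans (ler_normD _ _))// lerD//).
Qed.

Lemma norm_le_D1 (a b L : R) : `|a| <= L -> `|b - a| <= 1 -> `|b| <= L + 1.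
Proof. by move=> aL ba; rewrite -(subrK a b) (le_trans (ler_normD _ _))// addrC lerD. Qed.

(** Corners of an element of the hull are known only up to small individual displacements, hence
    pair functions must tolerate them. *)
Definition ucont (F : 'I_4 -> 'I_4 -> P -> R) : Prop := forall e : R, 0 < e -> exists2 d : R, 0 < d &
 forall i i' (x y : P), `|x.1 - y.1| < d -> `|x.2 - y.2| < d -> `|F i i' x - F i i' y| < e.

Lemma pairsum_perm (F : 'I_4 -> 'I_4 -> P -> R) s t : perm_eq s t -> pairsum F s s = pairsum F t t.
Proof.
move=> st; rewrite /pairsum (perm_big _ st) /=; apply: eq_bigr => p _; exact: perm_big.
Qed.

(** A nearby translate of [T0] is cut into level-[2 n] supertiles, of which those well inside the
    disc form [S]. The map [g] sends each of their tiles to its displaced copy in [T]; separation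
    makes it injective and makes it reach all tiles of [T] away from the rim. *)
Lemma hull_patch T0 T n r : is_tiling T0 -> inflate (inflate T0) = T0 -> hull T0 T -> 0 < r ->
 forall e : R, 0 < e -> e <= 1 / 2 -> r + 1 <= e^-1 ->
 let L := lam ^+ (2 * n) in
 exists S (g : tl -> tl),
 [/\ pairwise (rdj L) S,
   L ^+ 2 * lsum S <= area (disc r),
   area (disc (r - 16 * L - 1)) <= L ^+ 2 * lsum S &
   let s := asm (2 * n) S in
   [/\ uniq (map g s), (forall p, p \in s -> [/\ T (g p), en (g p).2 < r, (g p).1 = p.1, `|p.2.1 - (g p).2.1| < e & `|p.2.2 - (g p).2.2| < e]) &
     forall q, T q -> en q.2 < r - 16 * L - 2 -> q \in map g s]].
Proof.
move=> t0 fix0 hT r0 e e0 e2 er L.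
have L0 : 0 < L by exact: lamX_gt0.
have L1 : 1 <= L by exact: lamX_ge1.
have [t [Tt tT]] := hull_approx hT e0.
have u0 : usep T0 by move=> p q Tp Tq pq; exact: rdj_sepr (tiling_rdj t0 Tp Tq pq).
have uT := usep_hull u0 hT.
have ut := usep_translate (t := t) u0.
have uS : usep (superset L t T0).
 move=> p q Sp Sq pq; have := super_rdj L0 t0 Sp Sq pq; move=> H; apply: rdj_sepr.
 have [? _ ? _] := wh_bounds p.1. have [? _ ? _] := wh_bounds q.1.
 have b (x : R) : 1 <= x -> x <= L * x by move=> x1; rewrite ler_peMl//; lra.
 have := b (width R p.1); have := b (height R p.1); have := b (width R q.1); have := b (height R q.1).
 by rewrite /rdj !mul1r => b1 b2 b3 b4; case/or4P: H => H; apply/or4P; [apply: Or41|apply: Or42|apply: Or43|apply: Or44]; lra.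
(* A supertile extends at most [6 L] from its corner. The margin [8 L] keeps its tiles inside the
   disc, and [16 L] suffices for the reverse inclusion. *)
have [S [uqS mS]] := usep_enum (r - 8 * L - 1) uS.
have pS : pairwise (rdj L) S.
 apply: list_pairwise => // p q /mS[Sp _] /mS[Sq _]; exact: super_rdj L0 t0 Sp Sq.
have enbox p x : cbox L p x -> en (x - p.2) <= 6 * L.
 move=> [/=]; rewrite !in_itv/= => /andP[a1 a2] /andP[a3 a4]. have [? w3 ? h3] := wh_bounds p.1.
 rewrite (le_trans (en_le _))//= !ger0_norm ?subr_ge0//. have : L * width R p.1 <= L * 3 by rewrite ler_wpM2l// ltW.
 have : L * height R p.1 <= L * 3 by rewrite ler_wpM2l// ltW. lra.
have tri (x y : P) : en x <= en (x - y) + en y by have := enD (x - y) y; rewrite subrK.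
have tri' (x y : P) : en y <= en (x - y) + en x by have := tri y x; rewrite -opprB enN.
pose s := asm (2 * n) S.
have sT p : p \in s -> translate t T0 p /\ en p.2 < r - 1.
 move=> /flattenP[_ /mapP[q qS ->] pq]; have [Sq q1] := (mS q).1 qS. split; first by apply/(superP n t p fix0); exists q.
 by have := en_blk pq; have := tri p.2 q.2; rewrite -/L; lra.
have Ts p : translate t T0 p -> en p.2 < r - 16 * L - 1 -> p \in s.
 move=> /(superP n t p fix0)[q Sq pq] p1; apply/flattenP; exists (blk (2 * n) q) => //. apply: map_f; apply/mS; split => //.
 by have := en_blk pq; have := tri' p.2 q.2; rewrite -/L; lra.
have [g Hg] : exists g : tl -> tl, forall p, p \in s -> [/\ T (g p), (g p).1 = p.1, `|p.2.1 - (g p).2.1| < e & `|p.2.2 - (g p).2.2| < e].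
 have /choice[g Hg] : forall p, exists q, p \in s -> [/\ T q, q.1 = p.1, `|p.2.1 - q.2.1| < e & `|p.2.2 - q.2.2| < e].
  move=> p; have [ps|] := boolP (p \in s); last by exists p. have [Tp p1] := sT p ps.
  have [||y Ty /plane_ballP[y1 y2]] := tT p.1 p.2; [by apply: ball_en; lra|by rewrite -pairE|]. by exists (p.1, y).
 by exists g.
exists S, g; split => //.
- apply: (area_le_pack (L := r) L0 (measurable_disc r) (@disc_supp r) pS) => p /mS[_ p1] x px.
 have bx : cbox L p x.
  move: px => [/=]; rewrite !in_itv/= => /andP[a1 a2] /andP[a3 a4]. by split => /=; rewrite in_itv/=; apply/andP; split; lra.
 by have := enbox _ _ bx; have := tri x p.2; rewrite /disc /= -/(en _); lra.
- apply: (area_le_cover (L := r - 16 * L - 1) L0 (measurable_disc _) (@disc_supp _)) => x x1.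
 have [p Sp px] := super_cover t x L0 t0; exists p => //; apply/mS; split => //. rewrite /disc /= -/(en _) in x1.
 by have := enbox _ _ px; have := tri' x p.2; lra.
have us : uniq s.
 have := asm_dj pS (rsup_dj (2 * n)); rewrite -/s => /pairwise_uniq; apply => p.
 have [? _ ? _] := wh_bounds p.1. by apply/negP; rewrite /rdj !mul1r => /or4P[]; lra.
split.
- rewrite map_inj_in_uniq// => p q ps qs gpq; apply: contrapT => pq.
 have [Tp _] := sT p ps; have [Tq _] := sT q qs. have [_ p1 p2 p3] := Hg p ps; have [_ q1 q2 q3] := Hg q qs; rewrite -gpq in q2 q3.
 have := ut p q Tp Tq pq; apply/negP; rewrite not_sepr; move: p2 p3 q2 q3; clear -e2; rewrite !ltr_norml.
 move=> /andP[? ?] /andP[? ?] /andP[? ?] /andP[? ?]. by apply/andP; split; apply/andP; split; lra.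
- move=> p ps; have [g1 g2 g3 g4] := Hg p ps; split => //.
 have [_ p1] := sT p ps; have := tri' p.2 (g p).2; have := en_le (p.2 - (g p).2); rewrite /=; lra.
move=> q Tq q1.
have [||y Ty /plane_ballP[y1 y2]] := Tt q.1 q.2; [by apply: ball_en; lra|by rewrite -pairE|].
have ps : (q.1, y) \in s.
 apply: Ts => //=; have := tri' q.2 y; have := en_le (q.2 - y); rewrite /=. lra.
have [g1 g2 g3 g4] := Hg _ ps; rewrite /= in g2 g3 g4.
apply/mapP; exists (q.1, y) => //; apply: contrapT => ne.
have := uT q (g (q.1, y)) Tq g1 ne; apply/negP; rewrite not_sepr; move: y1 y2 g3 g4; clear -e2; rewrite !ltr_norml.
move=> /andP[? ?] /andP[? ?] /andP[? ?] /andP[? ?].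
by apply/andP; split; apply/andP; split; lra.
Qed.

Lemma asm_lsum n S : lsum (asm n S) = (lam ^+ n) ^+ 2 * lsum S.
Proof.
rewrite /lsum gsum_asm mulr_sumr; apply: eq_bigr => p _.
by have := lsum_rsup n p.1; rewrite /lsum -/(gsum _ _ _) mulnC exprM => ->.
Qed.

(** Five errors add up: tiles near the rim, individual displacements, pairs across supertiles,
    deviation from [gam] inside a supertile, and the area missed by the patch. The first and last
    grow like [r], the others are small multiples of the area. *)
Theorem hull_pairstat T0 T F B L : is_tiling T0 -> inflate (inflate T0) = T0 -> hull T0 T ->
 bnd F B L -> 0 <= L -> ucont F -> forall eps : R, 0 < eps -> exists r0 : R, forall r, r0 <= r ->
 forall E, uniq E -> (forall p, p \in E <-> (T p /\ en p.2 < r)) ->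
 `|pairsum F E E - area (disc r) * gam F| <= eps * area (disc r).
Proof.
move=> t0 fix0 hT bF L0 uF eps eps0.
have B0 := bnd_ge0 bF; have K0 := cst_ge0 L0.
pose N : R := (2 * (L + 1) + 2) ^+ 2.
have N0 : 0 < N by rewrite exprn_gt0//; lra.
have N'N : (2 * L + 2) ^+ 2 <= N by rewrite lerXn2r ?nnegrE//; lra.
pose D := 1 + N + B * cst L + B.
have D0 : 0 < D by rewrite /D; have := mulr_ge0 B0 K0; lra.
pose e1 := eps / (4 * D).
have e10 : 0 < e1 by rewrite divr_gt0// mulr_gt0.
have e1D : 4 * (D * e1) = eps by rewrite /e1; field; exact: lt0r_neq0.
have [n0 Hn0] := Apair_unif L0 e10.
have [n1 Hn1] : exists n1 : nat, forall n, (n1 <= n)%N -> lam ^- n <= e1.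
 exact: cvg0_ev lamV_cvg e10.
(* The level is fixed before the radius, so [La] is a constant as [r] grows. *)
pose n := maxn n0 n1; pose La := lam ^+ (2 * n).
have La1 : 1 <= La by exact: lamX_ge1.
have La0 : 0 < La by exact: lamX_gt0.
have n0n : (n0 <= 2 * n)%N by rewrite mul2n -addnn (leq_trans (leq_maxl n0 n1))// leq_addr.
have n1n : (n1 <= 2 * n)%N by rewrite mul2n -addnn (leq_trans (leq_maxr n0 n1))// leq_addr.
have Hinv : La^-1 <= e1 by exact: Hn1.
have [d d0 Hd] := uF e1 e10.
pose a := area (disc (1 : R)); have a0 : 0 < a := area_disc1_gt0.
pose G := `|gam F|; have G0 : 0 <= G by exact: normr_ge0.
pose W := a * (4 * (20 + 17 * La)).
have W0 : 0 < W by rewrite !mulr_gt0//; lra.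
pose C := 3 * B * N * W + G * W.
have C0 : 0 <= C by rewrite /C; have := mulr_ge0 (mulr_ge0 B0 (ltW N0)) (ltW W0); have := mulr_ge0 G0 (ltW W0); lra.
pose r0 := 20 + 20 * La + 4 * C / (a * eps).
exists r0 => r rr E uE mE.
have q0 : 0 <= 4 * C / (a * eps) by rewrite divr_ge0 ?mulr_ge0//; lra.
have r1 : 20 + 20 * La <= r by rewrite /r0 in rr; lra.
have r_gt0 : 0 < r by lra.
(* Rubber closeness compares tiles only within distance [1 / e] of 0, whence [(r + 1)^-1]; the
   difference of two displaced corners moves by up to [2 e], whence [d / 2]. *)
pose e := Num.min (Num.min (1 / 2) (r + 1)^-1) (d / 2).
have e0 : 0 < e by rewrite !lt_min !divr_gt0// invr_gt0; lra.
have [ea eb ec] : [/\ e <= 1 / 2, r + 1 <= e^-1 & e <= d / 2].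
 split; rewrite ?ge_min ?lexx ?orbT//. by rewrite -[X in X <= _]invrK lef_pV2 ?posrE ?invr_gt0//; [rewrite /e !ge_min lexx !orbT|lra].
have [S [g [pS Sup Slo [ug Hg Hq]]]] := hull_patch n t0 fix0 hT r_gt0 e0 ea eb.
rewrite -/La in pS Sup Slo Hq; set s := asm _ S in ug Hg Hq.
have u0 : usep T0 by move=> p q Tp Tq pq; exact: rdj_sepr (tiling_rdj t0 Tp Tq pq).
have uT := usep_hull u0 hT.
pose A := area (disc r).
have AE : A = r ^+ 2 * a by exact: area_disc.
have A0 : 0 < A by rewrite AE; exact: mulr_gt0 (exprn_gt0 _ r_gt0) a0.
pose rest := [seq p <- E | p \notin map g s].
have pE : perm_eq E (map g s ++ rest).
 apply: uniq_perm => //.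
  rewrite cat_uniq ug filter_uniq// andbT /=; apply/hasPn => p. by rewrite mem_filter => /andP[].
 move=> p; rewrite mem_cat mem_filter; case: (boolP (p \in map g s)) => //= /mapP[q qs ->]. by apply/mE; have [] := Hg q qs.
have sepE : pairwise (@sepr) (unzip2 E) by apply: (usep_pairwise uT uE) => p /mE[].
have ssep : pairwise (@sepr) (unzip2 s) by exact: asm_sepr pS.
have szs : (size s)%:R <= A by apply: le_trans (size_le_lsum _) _; rewrite /s asm_lsum.
have szS : La * (size S)%:R <= A * La^-1.
 rewrite (ler_pdivlMr _ _ La0) mulrAC -expr2 mulrC; apply: le_trans Sup. by rewrite mulrC ler_wpM2l ?sqr_ge0// size_le_lsum.
have restW : (size rest)%:R <= W * r.
 have h1 : (size rest)%:R <= a * ((r + 2) ^+ 2 - ((r - 16 * La - 2) - 2) ^+ 2).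
  apply: annulus_count; [by clear -r1 La1; lra|by []|by clear -La1; lra| |].
   by apply: subseq_pairwise sepE; apply: map_subseq; exact: filter_subseq.
  move=> p; rewrite mem_filter => /andP[ng /mE[Tp p1]]; split => //.
  by rewrite leNgt; apply/negP => p2; move/negP: ng; apply; exact: Hq.
 apply: (le_trans h1); rewrite /W -mulrA (ler_pM2l a0); clear -r1 La1; nra.
have areaW : A - W * r <= La ^+ 2 * lsum S.
 apply: le_trans Slo; rewrite area_disc; last by clear -r1 La1; lra. rewrite AE /W -/a.
 have -> : r ^+ 2 * a - a * (4 * (20 + 17 * La)) * r = a * (r ^+ 2 - 4 * (20 + 17 * La) * r) by ring.
 rewrite [leRHS]mulrC (ler_pM2l a0); clear -r1 La1; nra.
have s1 : `|pairsum F E E - pairsum F (map g s) (map g s)| <= 3 * B * N * (W * r).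
 rewrite (pairsum_perm F pE) pairsum_cat.
 set u := pairsum F _ _; set v := pairsum F _ rest; set x := pairsum F rest _; set y := pairsum F rest rest.
 have nb (X Y : seq tl) : subseq Y (map g s ++ rest) -> (\sum_(p <- X) \sum_(q <- Y) (near0 L (q.2 - p.2))%:R : R) <= N * (size X)%:R.
  move=> sY; apply: (le_via (\sum_(p <- X) N)); last first.
   by rewrite sum_cst -[leLHS]mulr_natr.
  apply: ler_sum => p _; apply: le_trans N'N; apply: nbr_count => //.
  apply: (@subseq_pairwise _ _ _ (unzip2 (map g s ++ rest))); first exact: map_subseq.
  apply: (usep_pairwise uT); first by rewrite -(perm_uniq pE). by move=> q; rewrite -(perm_mem pE) => /mE[].
 have sg : subseq (map g s) (map g s ++ rest) by exact: prefix_subseq. have sr : subseq rest (map g s ++ rest) by exact: suffix_subseq.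
 have bW : N * (size rest)%:R <= N * (W * r) by rewrite ler_pM2l.
 have b1 : `|x| <= B * (N * (W * r)) by rewrite (le_trans (pairsum_near _ _ bF))// ler_wpM2l// (le_trans (nb _ _ sg)).
 have b2 : `|y| <= B * (N * (W * r)) by rewrite (le_trans (pairsum_near _ _ bF))// ler_wpM2l// (le_trans (nb _ _ sr)).
 have b3 : `|v| <= B * (N * (W * r)).
  rewrite (le_trans (pairsum_near _ _ bF))// ler_wpM2l// (le_trans _ bW)// (le_trans _ (nb _ _ sg))//.
  rewrite exchange_big /= ler_sum// => p _; rewrite ler_sum// => q _. by rewrite /near0 -opprB /= !normrN.
 have -> : u + v + x + y - u = v + x + y by ring.
 rewrite (le_trans (ler_normD _ _))// (le_trans (lerD (ler_normD _ _) (lexx _)))//; clear -b1 b2 b3; lra.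
have s2 : `|pairsum F (map g s) (map g s) - pairsum F s s| <= e1 * N * A.
 rewrite /pairsum big_map -sumrB (le_trans (ler_norm_sum _ _ _))//. apply: (le_via (\sum_(p <- s) e1 * N)); last first.
  by rewrite sum_cst -[leLHS]mulr_natr ler_pM2l// mulr_gt0.
 rewrite big_seq [leRHS]big_seq; apply: ler_sum => p ps. rewrite big_map -sumrB (le_trans (ler_norm_sum _ _ _))//.
 apply: (le_via (\sum_(q <- s) e1 * (near0 (L + 1) (q.2 - p.2))%:R)); last first.
  by rewrite -mulr_sumr ler_pM2l//; apply: nbr_count => //; rewrite addr_ge0.
 rewrite big_seq [leRHS]big_seq; apply: ler_sum => q qs. have [_ _ p1 p2 p3] := Hg p ps; have [_ _ q1 q2 q3] := Hg q qs; rewrite p1 q1.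
 have d1 := dist_diff p2 q2 ec; have d2 := dist_diff p3 q3 ec.
 have f1 := dist_diff p2 q2 (_ : e <= 1 / 2); have f2 := dist_diff p3 q3 (_ : e <= 1 / 2). case: (boolP (near0 (L + 1) _)) => [_|nn].
  by rewrite mulr1; apply/ltW/Hd.
 have z (x : P) : (forall k : R, `|x.1| <= L -> `|x.2| <= L -> near0 (L + 1) (q.2 - p.2)) -> F p.1 q.1 x = 0.
  move=> H; have [_ ->//] := bF; apply/negP => /andP[x1 x2]; move/negP: nn; apply; exact: (H 0).
 rewrite mulr0 !z ?subrr ?normr0//.
  by move=> _ x1 x2; apply/andP; split; rewrite (le_trans x1, le_trans x2)// lerDl.
 move=> _ x1 x2; apply/andP; split.
  by apply: norm_le_D1 x1 _; rewrite distrC; apply/ltW/f1.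
 by apply: norm_le_D1 x2 _; rewrite distrC; apply/ltW/f2.
have s3 : `|pairsum F s s - \sum_(p <- S) Apair F (2 * n) p.1| <= B * cst L * (A * e1).
 rewrite (le_trans (pairsum_asm bF L0 pS))// -[B * cst L * _ * _]mulrA (ler_wpM2l (mulr_ge0 B0 K0))//.
 by rewrite -/La (le_trans szS)// ler_pM2l.
have s4 : `|\sum_(p <- S) Apair F (2 * n) p.1 - La ^+ 2 * lsum S * gam F| <= B * e1 * A.
 rewrite /lsum mulr_sumr mulr_suml -sumrB (le_trans (ler_norm_sum _ _ _))//.
 have LE : lam ^+ (2 * (2 * n)) = La ^+ 2 by rewrite mulnC exprM. apply: (le_via (\sum_(p <- S) La ^+ 2 * (B * e1))).
  by apply: ler_sum => p _; have := Hn0 F B bF (2 * n)%N p.1 n0n; rewrite LE.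
 rewrite sum_cst -[leLHS]mulr_natr. rewrite (_ : _ * _ * _ = (B * e1) * (La ^+ 2 * (size S)%:R)); last by ring.
 apply: ler_wpM2l; first exact: mulr_ge0 B0 (ltW e10). by apply: le_trans Sup; rewrite ler_wpM2l ?sqr_ge0// size_le_lsum.
have s5 : `|La ^+ 2 * lsum S * gam F - A * gam F| <= W * r * G.
 have Sup' : La ^+ 2 * lsum S <= A := Sup; have Wr := mulr_ge0 (ltW W0) (ltW r_gt0).
 rewrite -mulrBl normrM ler_wpM2r// ler_norml. by clear -Sup' Wr areaW; apply/andP; split; lra.
have Cr : C * r <= eps / 4 * A.
 clear -rr a0 eps0 La0 AE r_gt0; have : 4 * C / (a * eps) <= r by rewrite /r0 in rr; lra. rewrite ler_pdivrMr ?mulr_gt0// AE => H.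
 have := ler_wpM2r (ltW r_gt0) H; rewrite expr2; lra.
rewrite -/A.
have -> : pairsum F E E - A * gam F = (pairsum F E E - pairsum F (map g s) (map g s)) +
 ((pairsum F (map g s) (map g s) - pairsum F s s) + ((pairsum F s s - \sum_(p <- S) Apair F (2 * n) p.1) +
 ((\sum_(p <- S) Apair F (2 * n) p.1 - La ^+ 2 * lsum S * gam F) + (La ^+ 2 * lsum S * gam F - A * gam F)))) by ring.
apply: le_trans (norm_add5 s1 s2 s3 s4 s5) _.
have : 0 <= e1 * A := mulr_ge0 (ltW e10) (ltW A0).
move: Cr; rewrite -e1D /C /D => Cr eA.
have h1 : 0 <= N * (e1 * A) by rewrite mulr_ge0// ltW.
have h2 : 0 <= B * cst L * (e1 * A) by rewrite mulr_ge0// mulr_ge0.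
have h3 : 0 <= B * (e1 * A) by rewrite mulr_ge0.
clear -Cr eA h1 h2 h3; lra.
Qed.

End Disc.

Lemma ge0_integral_mrestr d (T : measurableType d) (mu : {measure set T -> \bar R})
 (D : set T) (mD : measurable D) (f : T -> \bar R) : measurable_fun setT f -> (forall x, 0 <= f x)%E ->
 (\int[mrestr mu mD]_x f x = \int[mu]_x (f x * (\1_D x)%:E))%E.
Proof.
move=> mf f0.
have z : mrestr mu mD (~` D) = 0%E by rewrite /mrestr setICl measure0.
rewrite (ge0_negligible_integral (measurableC mD) measurableT mf _ z)//.
rewrite setTD setCK (eq_measure_integral mu).
 rewrite integral_mkcond; apply: eq_integral => x _. by rewrite epatch_indic.
by move=> A mA AD; rewrite -[LHS]/(mu (A `&` D)) setIidl.
Qed.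

(** * A measure from consistent masses on dyadic cells *)

Section Tree.
Variable m : nat -> zz -> R.
Hypothesis m0 : forall n p, 0 <= m n p.
(** The two binary digits of [c] select the half of the parent cell in each coordinate. *)
Definition ch (p : zz) (c : nat) : zz := (2 * p.1 + (c %% 2)%N%:Z, 2 * p.2 + (c %/ 2)%N%:Z).
Hypothesis mS : forall n p, m n p = m n.+1 (ch p 0) + m n.+1 (ch p 1) + m n.+1 (ch p 2) + m n.+1 (ch p 3).

Fixpoint desc d p : seq zz := if d is d'.+1 then
 desc d' (ch p 0) ++ desc d' (ch p 1) ++ desc d' (ch p 2) ++ desc d' (ch p 3) else [:: p].

(* The quantile map: [a, a + m n p) is cut into consecutive intervals whose lengths are the masses of the
  children of [p]; [run d n p a t] is the descendant at depth [d] whose interval contains [t]. *)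
Fixpoint run d n p (a t : R) : zz := if d is d'.+1 then
 let a1 := a + m n.+1 (ch p 0) in let a2 := a1 + m n.+1 (ch p 1) in let a3 := a2 + m n.+1 (ch p 2) in
 if t < a1 then run d' n.+1 (ch p 0) a t else if t < a2 then run d' n.+1 (ch p 1) a1 t
 else if t < a3 then run d' n.+1 (ch p 2) a2 t else run d' n.+1 (ch p 3) a3 t
 else p.

Lemma runS d n p a t : run d.+1 n p a t =
 if t < a + m n.+1 (ch p 0) then run d n.+1 (ch p 0) a t
 else if t < a + m n.+1 (ch p 0) + m n.+1 (ch p 1) then run d n.+1 (ch p 1) (a + m n.+1 (ch p 0)) t
 else if t < a + m n.+1 (ch p 0) + m n.+1 (ch p 1) + m n.+1 (ch p 2)
    then run d n.+1 (ch p 2) (a + m n.+1 (ch p 0) + m n.+1 (ch p 1)) t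
 else run d n.+1 (ch p 3) (a + m n.+1 (ch p 0) + m n.+1 (ch p 1) + m n.+1 (ch p 2)) t.
Proof. by []. Qed.

Lemma run_mem d n p a t : run d n p a t \in desc d p.
Proof.
elim: d n p a => [|d IH] n p a /=; first by rewrite mem_head.
by rewrite !mem_cat; do !case: ifP => _; rewrite IH ?orbT.
Qed.

(** Although [run] recurses from the root, a longer run only appends a child at the end. The cells
    along a run are therefore nested and their corners monotone. *)
Lemma run_ch d n p a t : exists2 c, (c < 4)%N & run d.+1 n p a t = ch (run d n p a t) c.
Proof.
elim: d n p a => [|d IH] n p a.
 by rewrite /=; do !case: ifP => _; [exists 0%N|exists 1%N|exists 2%N|exists 3%N].
rewrite (runS d n p a t) (runS d.+1 n p a t).
by case: ifP => _; [exact: IH|]; case: ifP => _; [exact: IH|]; case: ifP => _; exact: IH.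
Qed.

Lemma run_meas (G : zz -> R) d n p a :
 measurable_fun setT ((fun t => G (run d n p a t)) : mR -> mR).
Proof.
elim: d n p a => [|d IH] n p a /=; first exact: measurable_cst.
have ml (c : R) : measurable_fun setT ((fun t => t < c) : mR -> bool)
 by apply: measurable_fun_ltr; [exact: measurable_id|exact: measurable_cst].
set b1 := a + _; set b2 := b1 + _; set b3 := b2 + _.
have -> : (fun t => G (if t < b1 then run d n.+1 (ch p 0) a t else if t < b2 then run d n.+1 (ch p 1) b1 t
   else if t < b3 then run d n.+1 (ch p 2) b2 t else run d n.+1 (ch p 3) b3 t)) =
  (fun t => if t < b1 then G (run d n.+1 (ch p 0) a t) else if t < b2 then G (run d n.+1 (ch p 1) b1 t)
   else if t < b3 then G (run d n.+1 (ch p 2) b2 t) else G (run d n.+1 (ch p 3) b3 t)).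
 by apply/funext => t; do !case: ifP.
by do 3 (apply: measurable_fun_ifT; [exact: ml|exact: IH|]); exact: IH.
Qed.

Definition chi (a b t : R) : R := ((a <= t) && (t < b))%R%:R.

Lemma chiE a b : chi a b = (\1_(`[a, b[%classic) : R -> R).
Proof.
apply/funext => t; rewrite indicE /chi; congr (nat_of_bool _)%:R.
by apply/idP/idP => [H|/set_mem]; [apply: mem_set|]; rewrite /= in_itv/=.
Qed.

Lemma chi_meas a b : measurable_fun setT (chi a b : mR -> mR).
Proof. by rewrite chiE; apply: measurable_indic; exact: measurable_itv. Qed.

Lemma chi_int a b : a <= b -> rint leb (chi a b) /\ Int leb (chi a b) = b - a.
Proof.
move=> ab.
have e : (\int[leb]_x (chi a b x)%:E = (b - a)%:E)%E.
 have mi : measurable (`[a, b[%classic : set (mR)) by exact: measurable_itv. rewrite chiE integral_indic// ?setIT.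
 apply: etrans (lebesgue_measure_itv _) _; rewrite /= lte_fin; move: ab; rewrite le_eqVlt => /predU1P[->|->//]. by rewrite ltxx subrr.
have r : rint leb (chi a b) by apply: ge0_rint => [|t|]; [exact: chi_meas|rewrite /chi|rewrite e ltry].
by split => //; apply: EFin_inj; rewrite Int_EFin// e.
Qed.

Lemma chi4 a b1 b2 b3 b4 t w0 w1 w2 w3 : a <= b1 -> b1 <= b2 -> b2 <= b3 -> b3 <= b4 ->
 chi a b4 t * (if t < b1 then w0 else if t < b2 then w1 else if t < b3 then w2 else w3) =
 chi a b1 t * w0 + (chi b1 b2 t * w1 + (chi b2 b3 t * w2 + chi b3 b4 t * w3)).
Proof.
move=> a1 a2 a3 a4; rewrite /chi.
have [t1|t1] := ltP t b1.
 rewrite [b2 <= t]leNgt (lt_le_trans t1 a2) [b3 <= t]leNgt (lt_le_trans t1 (le_trans a2 a3)).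
 by rewrite (lt_le_trans t1 (le_trans a2 (le_trans a3 a4))) /= !mul0r !addr0.
rewrite andbF mul0r add0r (le_trans a1 t1) /=.
have [t2|t2] := ltP t b2.
 rewrite [b3 <= t]leNgt (lt_le_trans t2 a3). by rewrite (lt_le_trans t2 (le_trans a3 a4)) /= !mul0r !addr0.
rewrite mul0r add0r.
have [t3|t3] := ltP t b3; last by rewrite mul0r add0r.
by rewrite (lt_le_trans t3 a4) /= mul0r addr0.
Qed.

Lemma chi_run_rint (G : zz -> R) a b d n p a' : a <= b ->
 rint leb (fun t => chi a b t * G (run d n p a' t)).
Proof.
move=> ab; have [r _] := chi_int ab.
apply: (rint_le _ _ (rintZ (\sum_(q <- desc d p) `|G q|) r)).
 by apply: mfunM; [exact: chi_meas|exact: run_meas].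
move=> t; rewrite normrM ger0_norm ?ler0n// mulrC ler_wpM2r ?ler0n//.
by apply: (mem_sum_le (f := fun q => `|G q|)) => //; exact: run_mem.
Qed.

(** At every depth the quantile map carries Lebesgue measure to the masses of the descendants,
    because the intervals of the children cut up that of the parent ([chi4]). *)
Lemma run_int (G : zz -> R) d n p a :
 Int leb (fun t => chi a (a + m n p) t * G (run d n p a t)) = \sum_(q <- desc d p) m (n + d) q * G q.
Proof.
elim: d n p a => [|d IH] n p a /=.
 rewrite big_seq1 addn0. transitivity (Int leb (fun t => G p * chi a (a + m n p) t)); first by apply: eq_Int => t; rewrite mulrC.
 have ale : a <= a + m n p by rewrite lerDl. have [r e] := chi_int ale; rewrite IntZ// e; ring.
have p0 := m0 n.+1 (ch p 0); have p1 := m0 n.+1 (ch p 1); have p2 := m0 n.+1 (ch p 2); have p3 := m0 n.+1 (ch p 3).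
pose b1 := a + m n.+1 (ch p 0); pose b2 := b1 + m n.+1 (ch p 1); pose b3 := b2 + m n.+1 (ch p 2).
have e4 : a + m n p = b3 + m n.+1 (ch p 3) by rewrite mS /b3 /b2 /b1 !addrA.
pose H c b t := chi b (b + m n.+1 (ch p c)) t * G (run d n.+1 (ch p c) b t).
have rH c b : rint leb (H c b) by apply: chi_run_rint; rewrite lerDl.
rewrite [RHS]/= !big_cat /= -!addSnnS.
rewrite -(IH n.+1 (ch p 0) a) -(IH n.+1 (ch p 1) b1) -(IH n.+1 (ch p 2) b2) -(IH n.+1 (ch p 3) b3).
rewrite -!/(H _ _) -(IntD (rH 2%N b2) (rH 3%N b3)) -(IntD (rH 1%N b1)); last exact: rintD.
rewrite -IntD//; last by apply: rintD => //; exact: rintD.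
apply: eq_Int => t; rewrite /H e4.
have a1 : a <= b1 by rewrite lerDl.
have a2 : b1 <= b2 by rewrite lerDl.
have a3 : b2 <= b3 by rewrite lerDl.
have a4 : b3 <= b3 + m n.+1 (ch p 3) by rewrite lerDl.
by rewrite -(chi4 t _ _ _ _ a1 a2 a3 a4) (fun_if G) (fun_if G) (fun_if G).
Qed.

Variable z : zz.
Definition crn d (q : zz) : P := (q.1%:~R / 2 ^+ d, q.2%:~R / 2 ^+ d).
Definition qx d t : R := (crn d (run d 0 z 0 t)).1.
Definition qy d t : R := (crn d (run d 0 z 0 t)).2.

Lemma run_bnd d t : [/\ qx d t <= qx d.+1 t, qx d t + 2 ^- d <= z.1%:~R + 1,
 qy d t <= qy d.+1 t & qy d t + 2 ^- d <= z.2%:~R + 1].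
Proof.
have stp d' : [/\ qx d' t <= qx d'.+1 t, qx d'.+1 t + 2 ^- d'.+1 <= qx d' t + 2 ^- d',
  qy d' t <= qy d'.+1 t & qy d'.+1 t + 2 ^- d'.+1 <= qy d' t + 2 ^- d'].
 rewrite /qx /qy /crn; have [c' c'4 e] := run_ch d' 0 z 0 t; rewrite e /ch /=. rewrite !rmorphD !rmorphM /= !exprS.
 have e0 : 0 < 2 ^- d' :> R by rewrite invr_gt0 exprn_gt0. rewrite !invfM; move: (2 ^- d') e0 => y y0.
 move: ((run d' 0 z 0 t).1%:~R) ((run d' 0 z 0 t).2%:~R) => u v.
 have [r1 r2] : (c' %% 2)%N%:R <= 1 :> R /\ (c' %/ 2)%N%:R <= 1 :> R by rewrite !(ler_nat _ _ 1); move: c'4; case: c' {e} => [|[|[|[|]]]].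
 have s1 : 0 <= (c' %% 2)%N%:R :> R by []. have s2 : 0 <= (c' %/ 2)%N%:R :> R by [].
 have -> : ((c' %% 2)%N%:Z)%:~R = (c' %% 2)%N%:R :> R by []. have -> : ((c' %/ 2)%N%:Z)%:~R = (c' %/ 2)%N%:R :> R by [].
 move: ((c' %% 2)%N%:R : R) ((c' %/ 2)%N%:R : R) r1 r2 s1 s2 => b1 b2 *. by split; nra.
have [s1 s2 s3 s4] := stp d; split => //.
 elim: d {s1 s2 s3 s4} => [|d IH]; last by have [_ h _ _] := stp d; exact: le_trans h IH. by rewrite /qx /crn /= expr0 invr1 !mulr1.
elim: d {s1 s2 s3 s4} => [|d IH]; last by have [_ _ _ h] := stp d; exact: le_trans h IH.
by rewrite /qy /crn /= expr0 invr1 !mulr1.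
Qed.

(** The limit may lie on the upper or right side of its cell, so the image measure need not give
    each half-open cell its prescribed mass. Integrals of continuous functions are recovered, which
    is what vague limits require. *)
Definition qmap (t : R) : P := (limn (qx^~ t), limn (qy^~ t)).

Lemma qmap_cvg t : qx d t @[d --> \oo] --> (qmap t).1 /\ qy d t @[d --> \oo] --> (qmap t).2.
Proof.
have e0 d : 0 < 2 ^- d :> R by rewrite invr_gt0 exprn_gt0.
split; apply: nondecreasing_is_cvgn.
- by apply/nondecreasing_seqP => d; have [] := run_bnd d t.
- by exists (z.1%:~R + 1) => _ [d _ <-]; have [_ h _ _] := run_bnd d t; have := e0 d; lra.
- by apply/nondecreasing_seqP => d; have [] := run_bnd d t.
- by exists (z.2%:~R + 1) => _ [d _ <-]; have [_ _ _ h] := run_bnd d t; have := e0 d; lra.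
Qed.

Lemma qmap_meas : measurable_fun setT (qmap : mR -> borel_plane R).
Proof.
apply/measurable_fun_pairP; split.
 apply: (measurable_fun_cvg (h := fun d => (qx d : mR -> mR))) => [d|t _].
  exact: (run_meas (fun q => (crn d q).1)).
 by have [] := qmap_cvg t.
apply: (measurable_fun_cvg (h := fun d => (qy d : mR -> mR))) => [d|t _].
 exact: (run_meas (fun q => (crn d q).2)).
by have [] := qmap_cvg t.
Qed.

Definition cell_measure : PM :=
 image_measure (mrestr leb (measurable_itv `[0, m 0 z[)) qmap_meas.

Lemma cell_measure_int (f : P -> R) : kc f -> (forall x, 0 <= f x) ->
 exists2 I : R, (\int[cell_measure]_x (f x)%:E = I%:E)%E &
  \sum_(q <- desc d z) m d q * f (crn d q) @[d --> \oo] --> I.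
Proof.
move=> kf f0; have [M M0 fM] := kc_bounded kf; have [cf _] := kf.
pose F d t := chi 0 (m 0 z) t * f (crn d (run d 0 z 0 t)).
have [rc _] := chi_int (m0 0 z).
have [||||ri lim] := @Int_dominated _ _ _ leb F (fun t => chi 0 (m 0 z) t * f (qmap t)) (fun t => M * chi 0 (m 0 z) t).
- by move=> d; apply: mfunM; [exact: chi_meas|exact: (run_meas (fun q => f (crn d q)))].
- exact: rintZ.
- by move=> d t; rewrite normrM mulrC (ger0_norm (ler0n _ _)) ler_wpM2r ?ler0n.
- move=> t; apply: cvgM; first exact: cvg_cst.
 have [c1 c2] := qmap_cvg t. apply: (cvg_comp (fun d => crn d (run d 0 z 0 t)) f); last exact: cf. exact: (cvg_pair c1 c2).
exists (Int leb (fun t => chi 0 (m 0 z) t * f (qmap t))).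
 rewrite /cell_measure ge0_integral_pushforward//; last 3 first.
 - exact: qmap_meas.
 - by apply/measurable_EFinP; exact: kc_meas.
 - by move=> x _; rewrite lee_fin. rewrite preimage_setT ge0_integral_mrestr//; last 2 first.
 - apply/measurable_EFinP; exact: (mcomp (kc_meas kf) qmap_meas).
 - by move=> x; rewrite lee_fin. rewrite Int_EFin//; apply: eq_integral => t _ /=. by rewrite -EFinM mulrC -chiE.
apply: cvg_trans lim; apply: near_eq_cvg; near=> d.
by have := run_int (fun q => f (crn d q)) d 0 z 0; rewrite !add0r add0n => <-.
Unshelve. all: by end_near.
Qed.

End Tree.

(** * Vague limits along an ultrafilter *)

Section Vague.
Variables (U : set_system nat) (UU : UltraFilter U) (phi : nat -> P -> R).
Hypothesis mphi : forall N, mfun (phi N).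
Hypothesis phi0 : forall N k, 0 <= phi N k.
Hypothesis bphi : forall rho : R, 0 < rho -> exists2 C : R, 0 <= C & forall N,
 rint2 (fun k : P => \1_(sq rho) k * phi N k) /\
 Int2 (fun k : P => \1_(sq rho) k * phi N k) <= C.
Implicit Types f g : P -> R.

Definition adm f : Prop := [/\ mfun f,
 exists M, forall x, `|f x| <= M & exists2 L : R, 0 < L & supp_in L f].
(** Along an ultrafilter the limit exists for all admissible functions at once, including the
    indicators of cells whose limit masses feed the tree construction. *)
Definition lm f : R := lim ((fun N => Int2 (fun k => f k * phi N k)) @ U).

Lemma adm_rint f : adm f -> exists2 C : R, 0 <= C & forall N,
 rint2 (fun k => f k * phi N k) /\ `|Int2 (fun k => f k * phi N k)| <= C.
Proof.
move=> [mf [M fM] [L L0 sf]]; have [C C0 HC] := bphi L0.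
have M0 : 0 <= M by exact: le_trans (fM 0).
exists (M * C); first exact: mulr_ge0.
move=> N; have [r1 r2] := HC N.
have b (k : P) : `|f k * phi N k| <= M * (\1_(box (- L) L (- L) L : set P) k * phi N k).
 rewrite normrM (ger0_norm (phi0 N k)) mulrA ler_wpM2r// indicE. case: (boolP (_ \in _)) => [_|nk]; first by rewrite mulr1.
 by rewrite mulr0 sf ?normr0// => /sub_box kb; move: nk; rewrite mem_set.
have r : rint2 (fun k => f k * phi N k).
 exact: (rint_le (mfunM mf (mphi N)) b (rintZ M r1)).
split => //; rewrite (le_trans (Int_norm r))// (le_trans (le_Int (rint_norm r) (rintZ M r1) b))//.
by rewrite IntZ// ler_wpM2l.
Qed.

Lemma lm_cvg f : adm f -> Int2 (fun k => f k * phi N k) @[N --> U] --> lm f.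
Proof. by move=> af; have [C _ H] := adm_rint af; apply: (ulim_cvg (M := C)) => N; have [] := H N. Qed.

Lemma admD f g : adm f -> adm g -> adm (fun x => f x + g x).
Proof.
move=> [mf [M fM] [L L0 sf]] [mg [M' gM] [L' L'0 sg]]; split; first exact: measurable_funD.
 by exists (M + M') => x; rewrite (le_trans (ler_normD _ _))// lerD.
exists (L + L'); first exact: addr_gt0.
by move=> x nb; rewrite (supp_in_le _ sf nb) ?(supp_in_le _ sg nb) ?addr0 ?lerDl ?lerDr// ltW.
Qed.

Lemma admM f g : adm f -> adm g -> adm (fun x => f x * g x).
Proof.
move=> [mf [M fM] [L L0 sf]] [mg [M' gM] _]; split; first exact: mfunM.
 by exists (M * M') => x; rewrite normrM ler_pM.
by exists L => // x nb; rewrite sf// mul0r.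
Qed.

Lemma admZ c f : adm f -> adm (fun x => c * f x).
Proof.
move=> [mf [M fM] [L L0 sf]]; split; first by apply: mfunM => //; exact: measurable_cst.
 by exists (`|c| * M) => x; rewrite normrM ler_wpM2l.
by exists L => // x nb; rewrite sf// mulr0.
Qed.

Lemma adm_sum (I : Type) (s : seq I) (F : I -> P -> R) : (forall i, adm (F i)) -> (exists f, adm f) ->
 adm (fun x => \sum_(i <- s) F i x).
Proof.
move=> h [f0 hf0]; elim: s => [|i s IH].
 by have := admZ 0 hf0; congr adm; apply/funext => x; rewrite big_nil mul0r.
by have := admD (h i) IH; congr adm; apply/funext => x; rewrite big_cons.
Qed.

Lemma lmD f g : adm f -> adm g -> lm (fun x => f x + g x) = lm f + lm g.
Proof.
move=> af ag; have [C _ H] := adm_rint af; have [C' _ H'] := adm_rint ag.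
rewrite {1}/lm; apply: cvg_lim => //.
have -> : (fun N => Int2 (fun k : P => (f k + g k) * phi N k)) =
 (fun N => Int2 (fun k => f k * phi N k) + Int2 (fun k => g k * phi N k)).
 apply/funext => N; rewrite -IntD; [|by have [] := H N|by have [] := H' N]. by apply: eq_Int => k; rewrite mulrDl.
by apply: cvgD; exact: lm_cvg.
Qed.

Lemma lmZ c f : adm f -> lm (fun x => c * f x) = c * lm f.
Proof.
move=> af; have [C _ H] := adm_rint af.
rewrite {1}/lm; apply: cvg_lim => //.
have -> : (fun N => Int2 (fun k : P => (c * f k) * phi N k)) = (fun N => c * Int2 (fun k => f k * phi N k)).
 apply/funext => N; rewrite -IntZ; last by have [] := H N. by apply: eq_Int => k; rewrite mulrA.
by apply: cvgM_cst; exact: lm_cvg.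
Qed.

Lemma lm_sum (I : Type) (s : seq I) (F : I -> P -> R) : (forall i, adm (F i)) -> (exists f, adm f) ->
 lm (fun x => \sum_(i <- s) F i x) = \sum_(i <- s) lm (F i).
Proof.
move=> h ef; elim: s => [|i s IH].
 have [f0 hf0] := ef; rewrite big_nil -[RHS](mul0r (lm f0)) -lmZ//; congr lm. by apply/funext => x; rewrite big_nil mul0r.
rewrite big_cons -IH -lmD//; last exact: adm_sum.
by congr lm; apply/funext => x; rewrite big_cons.
Qed.

Lemma le_lm f g : adm f -> adm g -> (forall x, f x <= g x) -> lm f <= lm g.
Proof.
move=> af ag fg; have [C _ H] := adm_rint af; have [C' _ H'] := adm_rint ag.
apply: ler_lim; [exact: cvgP (lm_cvg af)|exact: cvgP (lm_cvg ag)|].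
apply: nearW => N; apply: le_Int; [by have [] := H N|by have [] := H' N|].
by move=> k; rewrite ler_wpM2r.
Qed.

Lemma adm_kc f : kc f -> adm f.
Proof.
move=> kf; have [M M0 fM] := kc_bounded kf; have [_ [L L0 sf]] := kf; split; first exact: kc_meas.
 by exists M.
by exists (L + 1); [exact: ltr_pwDr|apply: supp_in_le sf; rewrite lerDl].
Qed.

Lemma adm_cell n (p : zz) : adm (ind (@cell R n p)).
Proof.
split; first by apply: measurable_indic; exact: measurable_cell.
 by exists 1 => x; rewrite indicE; case: (_ \in _); rewrite ?normr1 ?normr0.
pose L : R := `|p.1%:~R| + `|p.2%:~R| + 2.
have L0 : 0 < L by rewrite ltr_wpDl ?addr_ge0.
exists L => // x nb; rewrite indicE memNset// => cx; apply: nb; move: cx => [/=]; rewrite !in_itv/=.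
have e0 : 0 < 2 ^- n :> R by rewrite invr_gt0 exprn_gt0.
have e1 : 2 ^- n <= 1 :> R by rewrite invf_le1 ?exprn_gt0// exprn_ege1// ler1n.
rewrite !rmorphD /= /L; move: (2 ^- n : R) (p.1%:~R : R) (p.2%:~R : R) e0 e1 => e a b e0 e1 /andP[a1 a2] /andP[b1 b2].
have q (u : R) : - `|u| <= u * e /\ (u + 1) * e <= `|u| + 1.
 have := ler_norm u; have := ler_norm (- u); rewrite normrN => *.
 have : `|u * e| <= `|u| by rewrite normrM (gtr0_norm e0) ler_piMr. by rewrite ler_norml => /andP[? ?]; split; lra.
have [q1 q2] := q a; have [q3 q4] := q b; have := normr_ge0 a; have := normr_ge0 b.
by split; rewrite ler_norml; apply/andP; split; lra.
Qed.

Definition mm n (p : zz) : R := lm (\1_(@cell R n p)).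

Lemma lm0 : lm (fun=> 0) = 0.
Proof.
have e := lmZ 0 (adm_cell 0 0); rewrite mul0r in e; rewrite -[RHS]e; congr lm; apply/funext => x.
by rewrite mul0r.
Qed.

Lemma mm_ge0 n p : 0 <= mm n p.
Proof.
rewrite -lm0; apply: le_lm; [|exact: adm_cell|by move=> x; rewrite indicE].
have := admZ 0 (adm_cell 0 0); congr adm; apply/funext => x; by rewrite mul0r.
Qed.

Lemma cell_split n p (x : P) : \1_(@cell R n p) x =
 \1_(@cell R n.+1 (ch p 0)) x + \1_(@cell R n.+1 (ch p 1)) x + \1_(@cell R n.+1 (ch p 2)) x + \1_(@cell R n.+1 (ch p 3)) x :> R.
Proof.
have i k q : \1_(@cell R k q) x = (q == cell_of k x)%:R :> R.
 rewrite indicE; congr (nat_of_bool _)%:R; apply/idP/eqP => [/set_mem/cell_ofP//|h]. by apply: mem_set; apply/cell_ofP.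
rewrite !i /cell_of /ch /= !xpair_eqE.
have fl (t : R) : exists b : bool, Num.floor (t * 2 ^+ n.+1) = 2 * Num.floor (t * 2 ^+ n) + b%:Z.
 set u := t * 2 ^+ n; have -> : t * 2 ^+ n.+1 = 2 * u by rewrite /u exprS; ring.
 have f1 := floor_le_tmp u; have f2 := floorD1_gt u; rewrite rmorphD /= in f2. have [h|h] := ltP (2 * u) (2 * (Num.floor u)%:~R + 1).
  by exists false; rewrite addr0; apply: floor_def; rewrite !rmorphD !rmorphM /=; apply/andP; split; lra.
 by exists true; apply: floor_def; rewrite !rmorphD !rmorphM /=; apply/andP; split; lra.
have [b1 ->] := fl x.1; have [b2 ->] := fl x.2.
have par (a c : int) (b d : bool) : (2 * a + d%:Z == 2 * c + b%:Z) = (a == c) && (d == b)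
 by apply/eqP/andP => [|[/eqP -> /eqP ->]//]; case: b; case: d => /= H; split; apply/eqP; lia.
rewrite !(par _ _ _ true) !(par _ _ _ false).
case: p => p1 p2; rewrite xpair_eqE /=; case: (p1 == _) => /=; last by rewrite !addr0.
by case: (p2 == _); rewrite ?andbF /=; case: b1; case: b2 => /=; rewrite ?addr0 ?add0r.
Qed.

Lemma mm_split n p : mm n p = mm n.+1 (ch p 0) + mm n.+1 (ch p 1) + mm n.+1 (ch p 2) + mm n.+1 (ch p 3).
Proof.
have a c := adm_cell n.+1 (ch p c).
rewrite /mm -lmD// -lmD//; last exact: admD.
rewrite -lmD//; last by apply: admD => //; exact: admD.
by congr lm; apply/funext => x; rewrite cell_split.
Qed.

Lemma cell_desc d n p (x : P) : \1_(@cell R n p) x = \sum_(q <- desc d p) \1_(@cell R (n + d) q) x :> R.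
Proof.
elim: d n p => [|d IH] n p; first by rewrite /= big_seq1 addn0.
by rewrite cell_split !(IH n.+1) /= !big_cat /= -addSnnS !addrA.
Qed.

(** By uniform continuity the sums over cell corners approximate the functional. The same sums
    converge to the integral against [cell_measure], so the two limits agree. *)
Lemma desc_lm (f : P -> R) (z : zz) : kc f ->
 \sum_(q <- desc d z) mm d q * f (crn d q) @[d --> \oo] --> lm (fun x => f x * \1_(@cell R 0 z) x).
Proof.
move=> kf; apply/cvgrPdist_le => e e0.
have mz := mm_ge0 0 z; pose e' := e / (mm 0 z + 1).
have e'0 : 0 < e' by rewrite divr_gt0// ltr_pwDr.
have [d d0 Hd] := kc_unif kf e'0.
have [n0 hn0] := exp2N_lt d0.
near=> n; have nn : (n0 <= n)%N by near: n; exact: nbhs_infty_ge.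
have hn : 2 ^- n < d by apply: le_lt_trans hn0; rewrite lef_pV2 ?posrE ?exprn_gt0// ler_weXn2l// ler1n.
have -> : \sum_(q <- desc n z) mm n q * f (crn n q) = lm (fun x => \sum_(q <- desc n z) f (crn n q) * \1_(@cell R n q) x).
 rewrite lm_sum; [|by move=> q; exact/admZ/adm_cell|by exists f; exact: adm_kc].
 by apply: eq_bigr => q _; rewrite (lmZ _ (adm_cell n q)) mulrC.
have am : adm (fun x => f x * \1_(@cell R 0 z) x) by apply: admM; [exact: adm_kc|exact: adm_cell].
have as' : adm (fun x => \sum_(q <- desc n z) f (crn n q) * \1_(@cell R n q) x)
 by apply: adm_sum; [move=> q; exact/admZ/adm_cell|exists f; exact: adm_kc].
have ae : adm (fun x => e' * \1_(@cell R 0 z) x) by apply: admZ; exact: adm_cell.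
have bd x : `|f x * \1_(@cell R 0 z) x - \sum_(q <- desc n z) f (crn n q) * \1_(@cell R n q) x| <= e' * \1_(@cell R 0 z) x.
 rewrite (cell_desc n 0 z) add0n !mulr_sumr -sumrB (le_trans (ler_norm_sum _ _ _))// ler_sum// => q _.
 rewrite -mulrBl normrM (ger0_norm (_ : 0 <= \1_(@cell R n q) x)) ?indicE//.
 case: (boolP (x \in _)) => [/set_mem xq|_]; last by rewrite !mulr0. rewrite !mulr1; apply: ltW.
 have cq : @cell R n q (crn n q) by split; rewrite /= in_itv/= lexx ltr_pM2r ?invr_gt0 ?exprn_gt0// ltr_int ltrDl.
 have [h1 h2] := cell_diam xq cq. by apply: Hd; [exact: lt_trans h1 hn|exact: lt_trans h2 hn].
have h1 : lm (fun x => f x * \1_(@cell R 0 z) x) <= lm (fun x => \sum_(q <- desc n z) f (crn n q) * \1_(@cell R n q) x) + e' * mm 0 z.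
 rewrite /mm -lmZ; last exact: adm_cell. rewrite -lmD//; apply: le_lm => //; first exact: admD.
 by move=> x; have := bd x; rewrite ler_norml => /andP[_]; rewrite lerBlDl addrC.
have h2 : lm (fun x => \sum_(q <- desc n z) f (crn n q) * \1_(@cell R n q) x) <= lm (fun x => f x * \1_(@cell R 0 z) x) + e' * mm 0 z.
 rewrite /mm -lmZ; last exact: adm_cell. rewrite -lmD//; apply: le_lm => //; first exact: admD.
 by move=> x; have := bd x; rewrite ler_norml => /andP[h _]; lra.
have h3 : e' * mm 0 z <= e by rewrite /e' mulrAC ler_pdivrMr ?ltr_pwDr// ler_pM2l// lerDl.
by rewrite ler_norml; apply/andP; split; lra.
Unshelve. all: by end_near.
Qed.

Definition mz (k : nat) : PM :=
 if @choice.pickle_inv zz k is Some z then cell_measure mm z else mzero.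

Definition vlim : PM := mseries mz 0.

(** A compact support meets finitely many unit cells, so the series of cell integrals is eventually
    constant. *)
Lemma vlim_int f : kc f -> (forall x, 0 <= f x) -> (\int[vlim]_x (f x)%:E = (lm f)%:E)%E.
Proof.
move=> kf f0; have [_ [L L0 sf]] := kf.
rewrite /vlim ge0_integral_measure_series//; last 2 first.
- by move=> x _; rewrite lee_fin.
- by apply/measurable_EFinP; exact: kc_meas.
pose I k : R := if @choice.pickle_inv zz k is Some z then lm (fun x => f x * \1_(@cell R 0 z) x) else 0.
have Ik k : (\int[mz k]_x (f x)%:E = (I k)%:E)%E.
 rewrite /mz /I; case: (@choice.pickle_inv zz k) => [z|]; last by rewrite integral_measure_zero.
 have [J -> cJ] := cell_measure_int mm_ge0 mm_split z kf f0. have cl := desc_lm (z := z) kf; congr EFin.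
 by rewrite -(cvg_lim (@norm_hausdorff _ R) cJ); exact: cvg_lim cl.
under eq_eseriesr do rewrite Ik.
have [K HK] : exists K, forall x, f x != 0 -> (@choice.pickle zz (cell_of 0 x) < K)%N.
 pose l : nat := (Num.bound L).+1.
 pose rng := [seq (i%:Z - l%:Z, j%:Z - l%:Z) | i <- iota 0 (2 * l + 1), j <- iota 0 (2 * l + 1)] : seq zz.
 exists (\max_(q <- rng) (@choice.pickle zz q)).+1 => x fx; rewrite ltnS.
 suff : cell_of 0 x \in rng by move=> h; apply: (@leq_bigmax_seq _ rng xpredT (@choice.pickle zz)).
 have [b1 b2] : `|x.1| <= L /\ `|x.2| <= L by apply: contrapT => nb; move: fx; rewrite sf ?eqxx.
 have lL : L + 1 <= l%:R by rewrite /l -natr1 lerD2r ltW// archi_boundP.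
 have fl (t : R) : `|t| <= L -> exists2 i, (i < 2 * l + 1)%N & Num.floor (t * 2 ^+ 0) = i%:Z - l%:Z.
  rewrite expr0 mulr1 => tL; have f1 := floor_le_tmp t; have f2 := floorD1_gt t; rewrite rmorphD /= in f2.
  move: tL; rewrite ler_norml => /andP[t1 t2]. have h1 : 0 <= Num.floor t + l%:Z by rewrite -(ler_int R) rmorphD /=; lra.
  exists (absz (Num.floor t + l%:Z)); last by rewrite gez0_abs// addrK.
  rewrite -ltz_nat gez0_abs// -(ltr_int R) rmorphD /= -!pmulrn !natrD natrM; lra.
 have [i il ei] := fl _ b1; have [j jl ej] := fl _ b2. by apply/allpairsP; exists (i, j); rewrite !mem_iota /= /cell_of ei ej.
have Ifin n : (K <= n)%N -> \sum_(0 <= k < n) I k = lm f.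
 move=> Kn.
 have -> : \sum_(0 <= k < n) I k = lm (fun x => \sum_(k <- index_iota 0 n) (if @choice.pickle_inv zz k is Some z then f x * \1_(@cell R 0 z) x else 0)).
  have ad k : adm (fun x => if @choice.pickle_inv zz k is Some z then f x * \1_(@cell R 0 z) x else 0).
   case: (@choice.pickle_inv zz k) => [z|]; first by apply: admM; [exact: adm_kc|exact: adm_cell].
   by have := admZ 0 (adm_kc kf); congr adm; apply/funext => x; rewrite mul0r.
  rewrite lm_sum//; last by exists f; exact: adm_kc.
  by apply: eq_bigr => k _; rewrite /I; case: (@choice.pickle_inv zz k) => // ; rewrite lm0.
 congr lm; apply/funext => x; have [fx|fx] := eqVneq (f x) 0.
  by rewrite fx; apply: big1 => k _; case: (@choice.pickle_inv zz k) => // z; rewrite mul0r.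
 rewrite (bigD1_seq (@choice.pickle zz (cell_of 0 x))) ?iota_uniq//=; last first.
  by rewrite mem_index_iota /= (leq_trans (HK x fx)).
 rewrite choice.pickleK_inv indicE mem_set; last exact/cell_ofP.
 rewrite mulr1 big1 ?addr0// => k kx; case E : (@choice.pickle_inv zz k) => [z|//].
 rewrite indicE memNset ?mulr0// => /cell_ofP zx; move/eqP: kx; apply; rewrite -zx. by have := @choice.pickle_invK zz k; rewrite E /=.
apply/cvg_lim => //; apply: cvg_near_cst; exists K => // n /= Kn.
by rewrite sumEFin Ifin.
Qed.

Lemma vlim_lf : locally_finite vlim.
Proof.
move=> K cK; have [L L0 KL] := compact_sub_box cK.
have s0 : (0 : R) < 1 by [].
have kp := kc_plateau (L + 1) s0.
have p0 x : 0 <= plateau 1 (L + 1) x by have [] := plateauP (L + 1) x s0.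
have mK : measurable (K : set BP).
 rewrite -(setCK K); apply: measurableC; apply: open_plane_measurable.
 by rewrite openC; apply: compact_closed => //; exact: (@norm_hausdorff R).
apply: (@le_lt_trans _ _ (\int[vlim]_x (plateau 1 (L + 1) x)%:E)%E); last by rewrite vlim_int// ltry.
rewrite -[vlim K]mul1e -integral_cst// integral_mkcond /=; apply: ge0_le_integral => //.
- by move=> x _; rewrite patchE; case: ifP.
- by apply/measurable_restrict => //; rewrite ?setIT.
- by apply/measurable_EFinP; exact: kc_meas.
move=> x _; rewrite patchE; case: ifPn => [/set_mem/KL/sub_box[a b]|_]; last by rewrite lee_fin.
have [_ _ -> //] := plateauP (L + 1) x s0; by rewrite invr1 addrK.
Qed.

End Vague.

Lemma dist_div (a s x e : R) : 0 < a -> `|s - a * x| <= e * a -> `|x - a^-1 * s| <= e.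
Proof.
move=> a0 h; rewrite distrC -[x in _ - x](mulKf (lt0r_neq0 a0)) -mulrBr normrM gtr0_norm ?invr_gt0//.
by rewrite mulrC ler_pdivrMr.
Qed.

(** * Autocorrelation and diffraction *)

Section Autocorrelation.
Implicit Types (c : R[i]) (u : 'I_4 -> R[i]) (g : P -> R[i]) (T : tileset R) (s : seq (R[i] * P)) (f : P -> R) (mu : PM).

Definition umax u : R := \sum_i normc (u i).

Lemma umax_ge u i : normc (u i) <= umax u.
Proof. by rewrite /umax (bigD1 i)//= lerDl sumr_ge0// => j _; exact: normc_ge0. Qed.

Lemma umax_ge0 u : 0 <= umax u.
Proof. by apply: le_trans (umax_ge u o0); exact: normc_ge0. Qed.

(* The constant c is 1 or -i, which gives the real or the imaginary part. *)
Definition corr c u g (i i' : 'I_4) (x : P) : R := cRe (c * (u i * (u i')^*%C * g (- x))).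

Lemma corr_le c u g i i' x : normc c = 1 -> `|corr c u g i i' x| <= umax u ^+ 2 * normc (g (- x)).
Proof.
move=> c1; rewrite (le_trans (normr_Re_le _))// !normcM c1 mul1r normc_conj ler_wpM2r ?normc_ge0// expr2.
by rewrite ler_pM ?normc_ge0 ?umax_ge.
Qed.

Lemma corr_bnd c u g (M L : R) : normc c = 1 -> (forall x, normc (g x) <= M) ->
 (forall x, ~ (`|x.1| <= L /\ `|x.2| <= L) -> g x = 0) -> bnd (corr c u g) (umax u ^+ 2 * M) L.
Proof.
move=> c1 gM sg; split => i i' x; first by rewrite (le_trans (corr_le _ _ _ _ _ c1))// ler_wpM2l ?sqr_ge0.
rewrite /near0 => /negP nb; rewrite /corr sg ?mulr0// => -[/=]; rewrite !normrN => a b.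
by apply: nb; rewrite a b.
Qed.

Lemma Cc_supp g : Cc g -> exists2 L : R, 0 <= L & forall x, ~ (`|x.1| <= L /\ `|x.2| <= L) -> g x = 0.
Proof.
move=> [_ [X cX gX]]; have [L L0 XL] := compact_sub_box cX; exists L => // x nb.
by apply: gX => /XL/sub_box.
Qed.

Lemma Cc_bounded g : Cc g -> exists2 M : R, 0 <= M & forall x, normc (g x) <= M.
Proof.
move=> /Cc_kc[/kc_bounded[M M0 h] /kc_bounded[M' M'0 h']]; exists (M + M'); first exact: addr_ge0.
by move=> x; rewrite (le_trans (normc_le_ReIm _))// lerD.
Qed.

Lemma Cc_unif g : Cc g -> forall e : R, 0 < e -> exists2 d : R, 0 < d &
 forall x y, `|x.1 - y.1| < d -> `|x.2 - y.2| < d -> normc (g x - g y) < e.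
Proof.
move=> /Cc_kc[k1 k2] e e0; have e2 : 0 < e / 2 by rewrite divr_gt0.
have [d d0 h] := kc_unif k1 e2; have [d' d'0 h'] := kc_unif k2 e2.
exists (Num.min d d'); first by rewrite lt_min d0.
move=> x y; rewrite !lt_min => /andP[a1 a2] /andP[b1 b2].
have := h x y a1 b1; have := h' x y a2 b2; have := normc_le_ReIm (g x - g y); rewrite ReB ImB; lra.
Qed.

Lemma corr_ucont c u g : normc c = 1 -> Cc g -> ucont (corr c u g).
Proof.
move=> c1 cg e e0; have m0 := umax_ge0 u.
have e'0 : 0 < e / (umax u ^+ 2 + 1) by rewrite divr_gt0// ltr_wpDl ?sqr_ge0.
have [d d0 h] := Cc_unif cg e'0; exists d => // i i' x y h1 h2.
rewrite /corr -ReB -mulrBr -mulrBr.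
have -> : cRe (c * (u i * (u i')^*%C * (g (- x) - g (- y)))) = corr c u (fun z => g (- x) - g (- y)) i i' 0 by [].
have h3 : normc (g (- x) - g (- y)) < e / (umax u ^+ 2 + 1) by apply: h => /=; rewrite -opprD normrN.
rewrite (le_lt_trans (corr_le _ _ _ _ _ c1))//.
move: h3; rewrite ltr_pdivlMr ?ltr_wpDl ?sqr_ge0// => h3; apply: le_lt_trans h3.
by rewrite mulrC ler_wpM2l ?normc_ge0// lerDl.
Qed.

Definition csum u g (E : seq tl) : R[i] :=
 \sum_(p <- E) \sum_(q <- E) u p.1 * (u q.1)^*%C * g (p.2 - q.2).

Lemma csumE u g E : csum u g E = (pairsum (corr 1 u g) E E +i* pairsum (corr (- 'i)%C u g) E E)%C.
Proof.
apply: complex_eqP => /=; rewrite /csum /pairsum ?Re_sum ?Im_sum; apply: eq_bigr => p _;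
 rewrite ?Re_sum ?Im_sum; apply: eq_bigr => q _; rewrite /corr opprB; first by rewrite mul1r.
by rewrite [RHS]cReM /=; ring.
Qed.

Definition wcomb u T (x : P) : R[i] := \sum_(i < 4) u i * \1_(control_points T i) x.

Lemma wcomb_in u T p : usep T -> T p -> wcomb u T p.2 = u p.1.
Proof.
move=> sT Tp; rewrite /wcomb (bigD1 p.1)//= indicE mem_set; last by case: p Tp.
rewrite mulr1 big1 ?addr0// => i ip; rewrite indicE memNset ?mulr0// => Ti.
have np : (i, p.2) <> p by move=> e; move/eqP: ip; apply; rewrite -e.
by have := sT _ _ Ti Tp np; rewrite /sepr /= !subrr normr0 ler10.
Qed.

Lemma dirac_combE u T r E g : usep T -> uniq E -> (forall p, p \in E <-> (T p /\ en p.2 < r)) ->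
 dirac_comb (fun x => wcomb u T x * \1_(disc r) x) g = \sum_(p <- E) u p.1 * g p.2.
Proof.
move=> sT uE hE; rewrite /dirac_comb.
have inj : {in E &, injective (fun p : tl => p.2)}.
 move=> p q /hE[Tp _] /hE[Tq _] e; apply: contrapT => npq. by have := sT _ _ Tp Tq npq; rewrite e /sepr !subrr normr0 ler10.
have uu : uniq (map (fun p : tl => p.2) E) by rewrite map_inj_in_uniq.
rewrite (@fsbigE _ _ _ _ _ _ _ uu)//; last first.
 move=> x _ /= nx; have [xr|xr] := boolP (x \in disc r); last by rewrite indicE (negbTE xr) mulr0 mul0r.
 rewrite /wcomb big1 ?mul0r// => i _; rewrite indicE memNset ?mulr0// => Ti.
 have h : (i, x) \in E by apply/hE; split => //; exact: set_mem xr. by move/negP: nx; apply; exact: (map_f (fun p : tl => p.2) h).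
transitivity (\sum_(x <- [seq p.2 | p <- E]) (wcomb u T x * \1_(disc r) x * g x)).
 by apply: eq_bigl => x; rewrite in_setT.
rewrite [LHS]big_map; apply: eq_big_seq => p /hE[Tp pr].
by rewrite wcomb_in// indicE mem_set ?mulr1.
Qed.

Definition acorr u : functional R := fun g => (gam (corr 1 u g) +i* gam (corr (- 'i)%C u g))%C.

(** The finite correlation sums are pair sums of a continuous pair function, so their limit and its
    independence of [T] both come from [hull_pairstat]. *)
Lemma hull_autocorrelation u T0 T : is_tiling T0 -> inflate (inflate T0) = T0 -> hull T0 T ->
 is_autocorrelation (wcomb u T) (acorr u).
Proof.
move=> tT0 fT0 hT g cg.
have sT : usep T by apply: usep_hull hT => p q Tp Tq pq; apply: rdj_sepr; exact: (tiling_rdj tT0).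
have [M M0 gM] := Cc_bounded cg; have [L L0 gL] := Cc_supp cg.
have convE (r : R) : exists E : seq tl, [/\ uniq E, forall p, p \in E <-> (T p /\ en p.2 < r) &
  conv (restricted_comb (wcomb u T) r) (tilde (restricted_comb (wcomb u T) r)) g = csum u g E].
 have [E [uE hE]] := usep_enum r sT; exists E; split => //.
 rewrite /conv /restricted_comb (dirac_combE _ _ sT uE hE); apply: eq_bigr => p _.
 rewrite /tilde (dirac_combE _ _ sT uE hE) rmorph_sum mulr_sumr; apply: eq_bigr => q _. by rewrite /tilde_fun rmorphM /= conjCK mulrA.
have key c : normc c = 1 -> forall eps : R, 0 < eps -> exists r0 : R, forall r, r0 <= r ->
  forall E, uniq E -> (forall p, p \in E <-> (T p /\ en p.2 < r)) ->
 `|pairsum (corr c u g) E E - area (disc r) * gam (corr c u g)| <= eps * area (disc r).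
 move=> c1; apply: (hull_pairstat tT0 fT0 hT (corr_bnd u c1 gM gL) L0); exact: corr_ucont.
have lim c (F : R -> R) : normc c = 1 -> (forall r, exists E : seq tl, [/\ uniq E, forall p, p \in E <-> (T p /\ en p.2 < r) &
  F r = pairsum (corr c u g) E E]) -> (area (disc r))^-1 * F r @[r --> +oo] --> gam (corr c u g).
 move=> c1 hF; apply/cvgrPdist_le => e e0; have [r0 H] := key c c1 e e0. near=> r; have [E [uE hE ->]] := hF r.
 have r1 : 0 < r by near: r; apply: nbhs_pinfty_gt; rewrite num_real.
 have ap : 0 < area (disc r) by rewrite area_disc// mulr_gt0 ?exprn_gt0 ?area_disc1_gt0.
 have rr : r0 <= r by near: r; apply: nbhs_pinfty_ge; rewrite num_real. have := H r rr E uE hE. exact: dist_div.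
have i1 : normc (1 : R[i]) = 1 by rewrite (normc_real 1) normr1.
have i2 : normc (- 'i : R[i])%C = 1 by apply/eqP; rewrite -(eqrXn2 (n := 2)) ?normc_ge0// sqr_normcE /= oppr0 expr0n sqrrN add0r expr1n.
apply: cvg_complex.
 have -> : (fun r => cRe (((area (disc r))^-1)%:C%C * conv (restricted_comb (wcomb u T) r) (tilde (restricted_comb (wcomb u T) r)) g)) =
  (fun r => (area (disc r))^-1 * cRe (conv (restricted_comb (wcomb u T) r) (tilde (restricted_comb (wcomb u T) r)) g)).
  by apply/funext => r; rewrite cReM /= mul0r subr0.
 apply: lim => // r; have [E [uE hE ->]] := convE r; exists E; split => //. by rewrite csumE.
have -> : (fun r => cIm (((area (disc r))^-1)%:C%C * conv (restricted_comb (wcomb u T) r) (tilde (restricted_comb (wcomb u T) r)) g)) =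
  (fun r => (area (disc r))^-1 * cIm (conv (restricted_comb (wcomb u T) r) (tilde (restricted_comb (wcomb u T) r)) g)).
 by apply/funext => r; rewrite cImM /= mul0r addr0.
apply: lim => // r; have [E [uE hE ->]] := convE r; exists E; split => //.
by rewrite csumE.
Unshelve. all: by end_near.
Qed.

Definition aconv g : P -> R[i] := conv_fun g (tilde_fun g).

Lemma aconvE g x : aconv g x = cintegral (leb2 R) (fun y => g y * (g (y - x))^*%C).
Proof. by rewrite /aconv /conv_fun /tilde_fun; congr cintegral; apply/funext => y; rewrite opprB. Qed.

Lemma Cc_MJ g h : Cc g -> Cc h -> Cc (fun x => g x * (h x)^*%C).
Proof.
move=> cg ch; have [g1 g2] := Cc_kc cg; have [[h1 _] [h2 _]] := Cc_kc ch.
apply: kc_Cc.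
 have -> : (fun x => cRe (g x * (h x)^*%C)) = (fun x => cRe (g x) * cRe (h x) + cIm (g x) * cIm (h x))
  by apply/funext => x; rewrite cReM ReJ ImJ mulrN opprK.
 by apply: kcD; exact: kcM.
have -> : (fun x => cIm (g x * (h x)^*%C)) = (fun x => cIm (g x) * cRe (h x) - cRe (g x) * cIm (h x))
 by apply/funext => x; rewrite cImM ReJ ImJ mulrN addrC.
by apply: kcB; exact: kcM.
Qed.

Lemma aconv_shift g (p q : P) : Cc g ->
 cintegral (leb2 R) (fun x => g (x + p) * (g (x + q))^*%C) = aconv g (p - q).
Proof.
move=> cg; rewrite aconvE.
have cm : Cc (fun y => g y * (g (y - (p - q)))^*%C) by apply: Cc_MJ => //; exact: Cc_shift.
have [_ <-] := cintegral_shift p (Cc_crint leb2_lf cm).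
congr cintegral; apply/funext => x; congr (_ * (g _)^*%C).
by rewrite opprB [q - p]addrC addrA addrK.
Qed.

Lemma aconv_bounded g : Cc g -> exists2 M : R, 0 <= M & forall x, normc (aconv g x) <= M.
Proof.
move=> cg; have [M M0 gM] := Cc_bounded cg; have [r1 r2] := Cc_crint leb2_lf cg.
pose v (y : P) := `|cRe (g y)| + `|cIm (g y)|.
have rv : rint2 (fun y => M * v y) by apply: rintZ; apply: rintD; exact: rint_norm.
exists (Int2 (fun y => M * v y) + Int2 (fun y => M * v y)).
 by rewrite addr_ge0// Int_ge0// => y; rewrite mulr_ge0// addr_ge0.
move=> x; rewrite aconvE.
have cm : Cc (fun y => g y * (g (y - x))^*%C) by apply: Cc_MJ => //; exact: Cc_shift.
have rm := Cc_crint leb2_lf cm.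
have b y : normc (g y * (g (y - x))^*%C) <= M * v y
 by rewrite normcM normc_conj mulrC ler_pM ?normc_ge0// normc_le_ReIm.
rewrite (le_trans (normc_cintegral_le rm))// lerD//; (apply: le_Int => //; [by apply: rint_norm; case: rm|move=> y]).
 by apply: le_trans (b y); exact: normr_Re_le.
by apply: le_trans (b y); exact: normr_Im_le.
Qed.

Lemma aconv_supp g (L : R) : (forall x, ~ (`|x.1| <= L /\ `|x.2| <= L) -> g x = 0) ->
 forall x, ~ (`|x.1| <= 2 * L /\ `|x.2| <= 2 * L) -> aconv g x = 0.
Proof.
move=> sg x nb; rewrite aconvE -[RHS](cintegral0 (leb2 R)).2; congr cintegral; apply/funext => y.
have [[y1 y2]|ny] := pselect (`|y.1| <= L /\ `|y.2| <= L); last by rewrite sg// mul0r.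
have [[/= z1 z2]|nz] := pselect (`|(y - x).1| <= L /\ `|(y - x).2| <= L); last by rewrite (sg (y - x))// conjc0 mulr0.
case: nb; move: y1 y2 z1 z2; rewrite !ler_norml => /andP[? ?] /andP[? ?] /andP[? ?] /andP[? ?].
by split; apply/andP; split; lra.
Qed.

(** The supertile of the unit prototile, whose area is exactly [lambda^(2 N)], the normalisation
    used in [dens]. *)
Definition wsup u N : seq (R[i] * P) := [seq (u p.1, p.2) | p <- rsup N o3].

Lemma wsup_sepr u N : pairwise (@sepr) (unzip2 (wsup u N)).
Proof. by rewrite /unzip2 -map_comp; exact: rsup_sepr. Qed.

Lemma wt_wsup u N : wt (wsup u N) <= 9 * umax u ^+ 2 * lam ^+ (2 * N).
Proof.
rewrite /wt big_map; apply: (le_via (\sum_(p <- rsup N o3) umax u ^+ 2)).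
 by apply: ler_sum => p _; rewrite lerXn2r ?nnegrE ?normc_ge0 ?umax_ge0 ?umax_ge.
rewrite sum_cst -[leLHS]mulr_natr.
have -> : 9 * umax u ^+ 2 * lam ^+ (2 * N) = umax u ^+ 2 * (9 * lam ^+ (2 * N)) by ring.
by rewrite ler_wpM2l ?sqr_ge0// size_rsup.
Qed.

(** The autoconvolution of [g] at [p - q] is the inner product of two translates of [g], so the
    double sum is a squared norm, hence real. *)
Lemma csum_aconv u g (E : seq tl) : Cc g ->
 csum u (aconv g) E = (Int2 (fun x => normc (comb [seq (u p.1, p.2) | p <- E] g x) ^+ 2))%:C%C.
Proof.
move=> cg; have lf := @leb2_locally_finite R.
have cpq (p q : tl) : Cc (fun x => g (x + p.2) * (g (x + q.2))^*%C) by apply: Cc_MJ; exact: Cc_shift.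
have rpq (p q : tl) := cintegralZ (u p.1 * (u q.1)^*%C) (Cc_crint lf (cpq p q)).
have rp (p : tl) := cintegral_sum E (fun q => (rpq p q).1).
have [_ e] := cintegral_sum E (fun p => (rp p).1).
transitivity (cintegral (leb2 R) (fun x => (normc (comb [seq (u p.1, p.2) | p <- E] g x) ^+ 2)%:C%C)); last first.
 by rewrite cintegralE /=; congr (_ +i* _)%C; exact: Int0.
transitivity (cintegral (leb2 R) (fun x => \sum_(p <- E) \sum_(q <- E) u p.1 * (u q.1)^*%C * (g (x + p.2) * (g (x + q.2))^*%C))).
 rewrite e; apply: eq_bigr => p _; rewrite (rp p).2; apply: eq_bigr => q _. by rewrite (rpq p q).2 aconv_shift.
congr cintegral; apply/funext => x; rewrite -mulcJ /comb big_map rmorph_sum mulr_suml; apply: eq_bigr => p _.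
by rewrite mulr_sumr; apply: eq_bigr => q _; rewrite rmorphM /=; ring.
Qed.

Lemma Apair_aconv u g N : Cc g ->
 Apair (corr 1 u (aconv g)) N o3 = Int2 (fun k => normc (tsum (wsup u N) k) ^+ 2 * pow_spec g k) /\
 Apair (corr (- 'i)%C u (aconv g)) N o3 = 0.
Proof.
move=> cg; have := csum_aconv u (rsup N o3) cg; rewrite csumE => -[e1 e2]; split => //.
by rewrite /Apair e1 -(plancherel_comb _ cg).2.
Qed.

Definition dens u N k : R := lam ^- (2 * N) * normc (tsum (wsup u N) k) ^+ 2.

Lemma dens_ge0 u N k : 0 <= dens u N k.
Proof. by rewrite mulr_ge0 ?sqr_ge0// invr_ge0 ltW ?lamX_gt0. Qed.

Lemma meas_dens u N : mfun (dens u N).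
Proof. by apply: mfunM; [exact: measurable_cst|exact: meas_tsum]. Qed.

Lemma ar_o3 : ar o3 = 1.
Proof. by rewrite /ar /width /height /= mulr1. Qed.

(** Inside one supertile, Plancherel turns the pair sum of the autoconvolution into an integral of
    [pow_spec g] against the density; the rate for pair sums then provides the limit. *)
Lemma gam_aconv u g : Cc g ->
 Int2 (fun k => pow_spec g k * dens u N k) @[N --> \oo] --> gam (corr 1 u (aconv g)) /\
 gam (corr (- 'i)%C u (aconv g)) = 0.
Proof.
move=> cg; have [M M0 gM] := aconv_bounded cg; have [L L0 /aconv_supp gL] := Cc_supp cg.
have i1 : normc (1 : R[i]) = 1 by rewrite (normc_real 1) normr1.
have i2 : normc (- 'i : R[i])%C = 1 by apply/eqP; rewrite -(eqrXn2 (n := 2)) ?normc_ge0// sqr_normcE /= oppr0 expr0n sqrrN add0r expr1n.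
have LL : 0 <= 2 * L by rewrite mulr_ge0.
have lims c : normc c = 1 -> lam ^- (2 * N) * Apair (corr c u (aconv g)) N o3 @[N --> \oo] --> gam (corr c u (aconv g)).
 move=> c1; have b := corr_bnd u c1 gM gL. apply/cvgrPdist_le => e e0. have B0 : 0 <= umax u ^+ 2 * M by rewrite mulr_ge0 ?sqr_ge0.
 have e'0 : 0 < e / (umax u ^+ 2 * M + 1) by rewrite divr_gt0// ltr_wpDl.
 have [N0 H] := Apair_unif LL e'0; exists N0 => // N /= NN. apply: dist_div; first exact: lamX_gt0.
 have := H _ _ b N o3 NN; rewrite ar_o3 mulr1 => /le_trans; apply.
 rewrite mulrC ler_wpM2r ?(ltW (lamX_gt0 _))// mulrA ler_pdivrMr ?ltr_wpDl// mulrC ler_wpM2l ?lerDl//; exact: ltW.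
split; last first.
 have := lims _ i2; have -> : (fun N => lam ^- (2 * N) * Apair (corr (- 'i)%C u (aconv g)) N o3) = (fun=> 0).
  by apply/funext => N; rewrite (Apair_aconv u N cg).2 mulr0.
 by move=> h; rewrite -(cvg_lim (@norm_hausdorff _ R) h); apply: (cvg_lim (@norm_hausdorff _ R)); exact: cvg_cst.
have -> : (fun N => Int2 (fun k => pow_spec g k * dens u N k)) =
  (fun N => lam ^- (2 * N) * Apair (corr 1 u (aconv g)) N o3).
 apply/funext => N; rewrite (Apair_aconv u N cg).1 -IntZ; last exact: (plancherel_comb _ cg).1.
 by apply: eq_Int => k; rewrite /dens [LHS]mulrC [RHS]mulrA.
exact: lims.
Qed.

(** Subtracting a translate produces the factor [2 (1 - cos)] that [tail_bound] consumes. *)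
Lemma pow_spec_diff g (a k : P) : Cc g ->
 pow_spec (comb [:: (1, 0); (-1, a)] g) k = 2 * (1 - cos (2 * pi * inner k a)) * pow_spec g k.
Proof.
move=> cg; rewrite pow_spec_comb//; congr (_ * _).
have i0 : inner k 0 = 0 by rewrite /inner /= !mulr0 addr0.
have -> : tsum [:: (1, 0); (-1, a)] k = 1 - ek k (- a).
 by rewrite /tsum 2!big_cons big_nil [(_, _).1]/= [(_, _).2]/= oppr0 mul1r mulN1r addr0 /ek i0 mulr0 expi0.
rewrite ekN sqr_normcE ReB ImB ReJ ImJ /ek /expi /=.
have := cos2Dsin2 (2 * pi * inner k a); move: (cos _) (sin _) => x y; nra.
Qed.

Lemma diff_small g : Cc g -> forall eps : R, 0 < eps -> exists2 eta : R, 0 < eta & forall a : P,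
 `|a.1| <= eta -> `|a.2| <= eta ->
 Int2 (fun x => normc (comb [:: (1, 0); (-1, a)] g x) ^+ 2) <= eps.
Proof.
move=> cg eps eps0; have [L L0 sg] := Cc_supp cg.
pose A := (2 * (L + 1)) ^+ 2 + 1 : R.
have A0 : 0 < A by rewrite ltr_wpDl ?sqr_ge0.
pose e := Num.min 1 (eps / A).
have e0 : 0 < e by rewrite lt_min ltr01 divr_gt0.
have [d d0 H] := Cc_unif cg e0.
exists (Num.min (d / 2) 1); first by rewrite lt_min divr_gt0/=.
move=> a; rewrite !le_min => /andP[a1 a1'] /andP[a2 a2'].
have bb x : normc (comb [:: (1, 0); (-1, a)] g x) ^+ 2 <= e * (\1_(box (- (L + 1)) (L + 1) (- (L + 1)) (L + 1)) x).
 rewrite /comb big_cons big_cons big_nil /= addr0 mul1r mulN1r addr0 indicE. have [xb|nb] := boolP (x \in _).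
  rewrite mulr1; have h : normc (g x - g (x + a)) < e.
   have dd : d / 2 < d by move: d0; clear; lra. by apply: H => /=; rewrite opprD addrA subrr sub0r normrN; apply: le_lt_trans dd.
  have e1 : e <= 1 by rewrite ge_min lexx.
  by rewrite expr2 (le_trans (ler_pM (normc_ge0 _) (normc_ge0 _) (ltW h) (ltW h)))// ler_piMr// ltW.
 have nx : ~ (`|x.1| <= L + 1 /\ `|x.2| <= L + 1) by move=> /sub_box h; move: nb; rewrite mem_set.
 rewrite sg; last by move=> [h1 h2]; apply: nx; split; [apply: (le_trans h1)|apply: (le_trans h2)]; rewrite lerDl.
 rewrite sg; last first.
  move=> [/= h1 h2]; apply: nx; move: h1 h2 a1' a2'; rewrite !ler_norml => /andP[? ?] /andP[? ?] /andP[? ?] /andP[? ?].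
  by split; apply/andP; split; lra.
 by rewrite subr0 /normc /= expr0n /= addr0 sqrtr0 mulr0 expr0n.
have L1 : - (L + 1) <= L + 1 by move: L0; clear; lra.
have rb := indic_box_rint leb2_lf (- (L + 1)) (L + 1) (- (L + 1)) (L + 1).
have rc : rint2 (fun x => normc (comb [:: (1, 0); (-1, a)] g x) ^+ 2).
 by apply: rint_kc; apply: kc_normc2; exact: Cc_comb.
apply: le_trans (le_Int rc (rintZ e rb) bb) _.
rewrite IntZ// Int_box// opprK -!mulr2n -expr2 -[(L + 1) *+ 2]mulr_natl.
apply: (le_via (eps / A * A)); last by rewrite divfK// lt0r_neq0.
apply: ler_pM; [exact: ltW|exact: sqr_ge0|by rewrite ge_min lexx orbT|by rewrite /A lerDl].
Qed.

Lemma tail_calc (eps et D n : R) : 0 < eps -> 0 < et -> 0 <= D -> 4 * (D + 1) / (eps * et) <= n ->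
 D * expR (- (n * et / 2)) <= eps / 2.
Proof.
move=> eps0 et0 D0 nn; have D1 : 0 < D + 1 by rewrite ltr_wpDl.
have n_0 : 0 < n by apply: lt_le_trans nn; rewrite divr_gt0 ?mulr_gt0.
have ee : expR (- (n * et / 2)) <= 2 / (n * et).
 have x0 : 0 < n * et / 2 by rewrite divr_gt0// mulr_gt0.
 rewrite expRN -[leRHS]invrK lef_pV2 ?posrE ?expR_gt0 ?invr_gt0 ?divr_gt0 ?mulr_gt0//.
 by rewrite invf_div (le_trans _ (expR_ge1Dx _))// lerDr.
have e2 : 2 / (n * et) <= eps / (2 * (D + 1)).
 rewrite ler_pdivrMr ?mulr_gt0// mulrAC ler_pdivlMr ?mulr_gt0//. move: nn; rewrite ler_pdivrMr ?mulr_gt0// => nn.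
 have -> : 2 * (2 * (D + 1)) = 4 * (D + 1) by ring. by have -> : eps * (n * et) = n * (eps * et) by ring.
apply: le_trans (ler_wpM2l D0 (le_trans ee e2)) _.
rewrite mulrA ler_pdivrMr ?mulr_gt0//.
have -> : eps / 2 * (2 * (D + 1)) = D * eps + eps by field.
by rewrite lerDl ltW.
Qed.

(** The inequality [bessel] for [g] minus a small translate supplies the hypothesis of [tail_bound],
    proportionally to [wt s] and uniformly in the points. It prevents spectral mass from escaping to
    infinity, which vague convergence would not notice. *)
Lemma spec_tail g : Cc g -> forall eps : R, 0 < eps -> exists n0 : R, forall s n, pairwise (@sepr) (unzip2 s) -> n0 <= n ->
 Int2 (fun k : P => normc (tsum s k) ^+ 2 * pow_spec g k * (n <= `|k.1|)%R%:R) <= eps * wt s /\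
 Int2 (fun k : P => normc (tsum s k) ^+ 2 * pow_spec g k * (n <= `|k.2|)%R%:R) <= eps * wt s.
Proof.
move=> cg eps eps0; have [L L0 sg] := Cc_supp cg.
have [l lL] : exists l : nat, L + 1 <= l%:R by exists (Num.bound (L + 1)); apply: ltW; apply: archi_boundP; rewrite addr_ge0.
pose A : R := ((2 * l + 1) ^ 2)%:R.
have A1 : 0 < A by rewrite ltr0n expn_gt0 addn1.
pose I := Int2 (fun x => normc (g x) ^+ 2).
have I0 : 0 <= I by apply: Int_ge0 => x; exact: sqr_ge0.
have e10 : 0 < eps / (2 * A) by rewrite divr_gt0// mulr_gt0.
have [eta eta0 H] := diff_small cg e10.
pose et := Num.min eta 1.
have et0 : 0 < et by rewrite lt_min eta0/=.
pose D := 8 * (A * I).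
have D0 : 0 <= D by rewrite !mulr_ge0// ltW.
exists (4 * (D + 1) / (eps * et)) => s n ss nn; set n0 := 4 * _ / _ in nn.
have n00 : 0 < n0 by rewrite divr_gt0 ?mulr_gt0 ?ltr_wpDl.
have n_0 : 0 < n by exact: lt_le_trans n00 nn.
have [rs _] := plancherel_comb s cg; have W0 := wt_ge0 s.
have sl (h : P -> R[i]) : (forall x, ~ (`|x.1| <= L + 1 /\ `|x.2| <= L + 1) -> h x = 0) ->
  forall x, ~ (`|x.1| <= l%:R /\ `|x.2| <= l%:R) -> h x = 0.
 by move=> hh x nb; apply: hh => -[h1 h2]; apply: nb; split; [apply: (le_trans h1)|apply: (le_trans h2)].
have sg' : forall x, ~ (`|x.1| <= L + 1 /\ `|x.2| <= L + 1) -> g x = 0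
 by move=> x nb; apply: sg => -[h1 h2]; apply: nb; split; [apply: (le_trans h1)|apply: (le_trans h2)]; rewrite lerDl.
have C1 := bessel ss cg (sl _ sg').
have small (a : P) : `|a.1| <= et -> `|a.2| <= et ->
  Int2 (fun k => normc (tsum s k) ^+ 2 * pow_spec g k * (1 - cos (2 * pi * inner k a))) <= eps / 4 * wt s.
 move=> a1 a2; pose ga := comb [:: (1, 0); (-1, a)] g. have cga : Cc ga by exact: Cc_comb.
 have a1' : `|a.1| <= 1 by apply: le_trans a1 _; rewrite ge_min lexx orbT.
 have a2' : `|a.2| <= 1 by apply: le_trans a2 _; rewrite ge_min lexx orbT.
 have sga x : ~ (`|x.1| <= L + 1 /\ `|x.2| <= L + 1) -> ga x = 0.
  move=> nx; rewrite /ga /comb big_cons big_cons big_nil /= addr0 mul1r mulN1r addr0 sg' ?sub0r//.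
  rewrite sg ?oppr0// => -[/= h1 h2]; apply: nx; move: h1 h2 a1' a2'; rewrite !ler_norml => /andP[? ?] /andP[? ?] /andP[? ?] /andP[? ?].
  by split; apply/andP; split; lra.
 have b := bessel ss cga (sl _ sga). have rga := (plancherel_comb s cga).1.
 have -> : Int2 (fun k => normc (tsum s k) ^+ 2 * pow_spec g k * (1 - cos (2 * pi * inner k a))) =
   2^-1 * Int2 (fun k => normc (tsum s k) ^+ 2 * pow_spec ga k).
  rewrite -IntZ//; apply: eq_Int => k; rewrite pow_spec_diff//; move: (normc _ ^+ 2) (pow_spec g k) (cos _) => x y z. by field.
 have h : Int2 (fun x => normc (ga x) ^+ 2) <= eps / (2 * A)
  by apply: H; [apply: le_trans a1 _|apply: le_trans a2 _]; rewrite ge_min lexx.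
 have -> : eps / 4 * wt s = 2^-1 * (A * wt s * (eps / (2 * A))) by field; exact: lt0r_neq0.
 rewrite ler_pM2l ?invr_gt0//; apply: le_trans b _; rewrite ler_wpM2l// mulr_ge0//; exact: ltW.
have fin : 2 * (eps / 4 * wt s) + 8 * (A * wt s * I) * expR (- (n * et / 2)) <= eps * wt s.
 have e3 : D * expR (- (n * et / 2)) <= eps / 2 by exact: tail_calc.
 have -> : 8 * (A * wt s * I) * expR (- (n * et / 2)) = wt s * (D * expR (- (n * et / 2))) by rewrite /D; ring.
 have := ler_wpM2l W0 e3; move: (wt s * (D * _)) => z; lra.
have Psi0 k : 0 <= normc (tsum s k) ^+ 2 * pow_spec g k by rewrite mulr_ge0 ?sqr_ge0.
have ep0 : 0 <= eps / 4 * wt s by rewrite mulr_ge0 ?divr_ge0// ltW.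
have m1 : mfun (fun k : P => k.1) by exact: measurable_fst.
have m2 : mfun (fun k : P => k.2) by exact: measurable_snd.
split; apply: le_trans fin.
 apply: (tail_bound m1 Psi0 rs C1 ep0 n_0) => t tt. have := small (t, 0) tt; rewrite /= normr0 => /(_ (ltW et0)); congr (_ <= _).
 by apply: eq_Int => k; rewrite /inner /= mulr0 addr0 mulrA.
apply: (tail_bound m2 Psi0 rs C1 ep0 n_0) => t tt.
have := small (0, t); rewrite /= normr0 => /(_ (ltW et0) tt); congr (_ <= _).
by apply: eq_Int => k; rewrite /inner /= mulr0 add0r mulrA.
Qed.

(* A cluster point in the vague topology of the measures with densities [phi N]. *)
Definition vague_cluster (phi : nat -> P -> R) mu : Prop := locally_finite mu /\
 forall f, kc f -> (forall x, 0 <= f x) -> forall C N0,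
  ((forall N, (N0 <= N)%N -> Int2 (fun k => f k * phi N k) <= C) -> (\int[mu]_x (f x)%:E <= C%:E)%E) /\
  ((forall N, (N0 <= N)%N -> C <= Int2 (fun k => f k * phi N k)) -> (C%:E <= \int[mu]_x (f x)%:E)%E).

(** Along an ultrafilter finer than [\oo], bounds that hold eventually pass to the limit. *)
Lemma vague_cluster_ex (phi : nat -> P -> R) :
 (forall N, mfun (phi N)) -> (forall N k, 0 <= phi N k) ->
 (forall rho : R, 0 < rho -> exists2 C : R, 0 <= C & forall N,
  rint2 (fun k : P => \1_(sq rho) k * phi N k) /\
  Int2 (fun k : P => \1_(sq rho) k * phi N k) <= C) ->
 exists mu, vague_cluster phi mu.
Proof.
move=> mphi phi0 bphi.
have [U [UU ooU]] := @ultraFilterLemma nat \oo _.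
exists (vlim U phi); split; first exact: (vlim_lf UU mphi phi0 bphi).
move=> f kf f0 C N0; rewrite (vlim_int UU mphi phi0 bphi)// !lee_fin.
have af := adm_kc kf; have cf := lm_cvg UU mphi phi0 bphi af.
have U0 : U [set N | (N0 <= N)%N] by apply: ooU; exact: nbhs_infty_ge.
split => h.
 by apply: limr_le; [exact: cvgP cf|apply: filterS U0 => N /= /h].
by apply: limr_ge; [exact: cvgP cf|apply: filterS U0 => N /= /h].
Qed.

Lemma dens_box u (rho : R) : 0 < rho -> exists2 C : R, 0 <= C & forall N,
 rint2 (fun k : P => \1_(sq rho) k * dens u N k) /\
 Int2 (fun k : P => \1_(sq rho) k * dens u N k) <= C.
Proof.
move=> rho0; have [C C0 H] := box_bound rho0.
exists (C * (9 * umax u ^+ 2)); first by rewrite mulr_ge0// mulr_ge0 ?sqr_ge0.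
move=> N; have [r b] := H (wsup u N) 0 (wsup_sepr u N).
pose D k : R := \1_(box (- rho) rho (- rho) rho) k * normc (tsum (wsup u N) (k + 0)) ^+ 2.
have e : (fun k : P => \1_(sq rho) k * dens u N k) = (fun k => lam ^- (2 * N) * D k)
 by apply/funext => k; rewrite /D /dens addr0 mulrCA.
rewrite e; split; first exact: rintZ.
rewrite IntZ// mulrC ler_pdivrMr ?lamX_gt0//; apply: (le_trans b).
by rewrite -mulrA ler_wpM2l// wt_wsup.
Qed.

Lemma dens_cluster_ex u : exists mu, vague_cluster (dens u) mu.
Proof.
by apply: vague_cluster_ex; [exact: meas_dens|exact: dens_ge0|exact: dens_box].
Qed.

Lemma plateau_mono (r r' : R) x : r <= r' -> plateau 1 r x <= plateau 1 r' x.
Proof.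
move=> rr; have cm (s t : R) : s <= t -> clamp s <= clamp t.
 move=> st; rewrite {1}/clamp; case: (leP s 0) => s0; first by have [h _ _ _] := clampP t.
 rewrite /clamp (leNgt t) (lt_le_trans s0 st) /=; case: (leP t 1) => t1; first by rewrite (le_trans st t1). by case: ifP.
have c0 (t : R) : 0 <= clamp t by have [] := clampP t.
by rewrite /plateau !mul1r ler_pM// cm// lerB.
Qed.

(** [pow_spec g] need not have compact support. Truncation by plateaus and monotone convergence give
    the upper bound; the lower bound needs the tail estimate. *)
Lemma cluster_fourier u mu : vague_cluster (dens u) mu -> is_fourier_transform (acorr u) mu.
Proof.
move=> [lfm H]; split => // g cg; rewrite -/(aconv g).
have [limG im0] := gam_aconv u cg.
split => //; rewrite [RHS]/=; set G := gam _ in limG *.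
pose W := pow_spec g; have W0 k : 0 <= W k by exact: sqr_ge0.
have cW : continuous W by exact: continuous_pow_spec.
have rW N : rint2 (fun k => W k * dens u N k).
 have [r _] := plancherel_comb (wsup u N) cg.
 have -> : (fun k => W k * dens u N k) = (fun k => lam ^- (2 * N) * (normc (tsum (wsup u N) k) ^+ 2 * W k))
  by apply/funext => k; rewrite /dens [LHS]mulrC [RHS]mulrA.
 exact: rintZ.
pose F n k : R := plateau 1 (n%:R + 1) k * W k.
have p01 n k : 0 <= plateau 1 (n%:R + 1 : R) k <= 1 by have [-> -> _ _] := plateauP (n%:R + 1) k (ltr01 : 0 < (1 : R)).
have kF n : kc (F n) by apply: kcM => //; exact: (kc_plateau (n%:R + 1) (ltr01 : 0 < (1 : R))).
have F0 n k : 0 <= F n k by rewrite mulr_ge0//; have /andP[] := p01 n k.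
have FW n k : F n k <= W k by rewrite ler_piMl//; have /andP[] := p01 n k.
have rF n N : rint2 (fun k => F n k * dens u N k).
 apply: (rint_le _ _ (rW N)).
  by apply: mfunM; [exact: kc_meas|exact: meas_dens].
 by move=> k; rewrite normrM (ger0_norm (F0 n k)) (ger0_norm (dens_ge0 u N k)) ler_wpM2r ?dens_ge0.
have mW : mfun W by exact: cont_mfun.
have upper n e : 0 < e -> (\int[mu]_x (F n x)%:E <= (G + e)%:E)%E.
 move=> e0; have /cvgrPdist_le /(_ e e0) [N0 _ HN] := limG. apply: (H (F n) (kF n) (F0 n) (G + e) N0).1 => N NN.
 apply: (le_via (Int2 (fun k => W k * dens u N k))).
  by apply: le_Int => // k; rewrite ler_wpM2r ?dens_ge0.
 by have := HN N NN; rewrite /= distrC ler_norml => /andP[_]; rewrite lerBlDl.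
have lower e : 0 < e -> ((G - e)%:E <= \int[mu]_x (W x)%:E)%E.
 move=> e0; have e2 : 0 < e / 2 by rewrite divr_gt0. have /cvgrPdist_le /(_ _ e2) [N0 _ HN] := limG.
 pose Z := 9 * umax u ^+ 2; have Z0 : 0 <= Z by rewrite mulr_ge0 ?sqr_ge0.
 have eZ : 0 < e / (4 * (Z + 1)) by rewrite divr_gt0 ?mulr_gt0 ?ltr_wpDl. have [n0 Hn] := spec_tail cg eZ.
 pose n := Num.bound `|n0|. have nn : n0 <= n%:R by apply: le_trans (ler_norm _) _; apply: ltW; exact: archi_boundP.
 apply: (le_via (\int[mu]_x (F n x)%:E)%E); last first.
  apply: ge0_le_integral => //.
  - by move=> x _; rewrite lee_fin.
  - by apply/measurable_EFinP; exact: kc_meas.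
  - by apply/measurable_EFinP.
  - by move=> x _; rewrite lee_fin.
 apply: (H (F n) (kF n) (F0 n) (G - e) N0).2 => N NN. have := HN N NN; rewrite /= ler_norml => /andP[_ h1].
 have [t1 t2] := Hn _ _ (wsup_sepr u N) nn. pose T1 (k : P) := normc (tsum (wsup u N) k) ^+ 2 * W k * (n%:R <= `|k.1|)%R%:R.
 pose T2 (k : P) := normc (tsum (wsup u N) k) ^+ 2 * W k * (n%:R <= `|k.2|)%R%:R. pose l := lam ^- (2 * N).
 have l0 : 0 < l by rewrite invr_gt0 lamX_gt0. have tb (pr : P -> R) : mfun pr ->
   rint2 (fun k => normc (tsum (wsup u N) k) ^+ 2 * W k * (n%:R <= `|pr k|)%R%:R).
  move=> mp; apply: (rint_le _ _ (plancherel_comb (wsup u N) cg).1).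
   apply: mfunM; first by apply: mfunM => //; exact: meas_tsum. apply: (mcomp (f := fun b : bool => b%:R : mR)) => //.
   apply: measurable_fun_ler; first exact: measurable_cst. exact: mcomp.
  move=> k; have q0 : 0 <= normc (tsum (wsup u N) k) ^+ 2 * W k by rewrite mulr_ge0 ?sqr_ge0.
  rewrite normrM (ger0_norm q0) (ger0_norm (ler0n _ _)) ler_piMr//. by rewrite lern1 leq_b1.
 have r1 : rint2 T1 by apply: tb; exact: measurable_fst. have r2 : rint2 T2 by apply: tb; exact: measurable_snd.
 have le1 : Int2 (fun k => W k * dens u N k) <= Int2 (fun k => F n k * dens u N k + l * (T1 k + T2 k)).
  apply: le_Int => //; first by apply: rintD => //; apply: rintZ; exact: rintD. move=> k; rewrite /T1 /T2 /F /dens -/l.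
  have [/andP[a1 a2]|nk] := boolP ((`|k.1| <= n%:R) && (`|k.2| <= n%:R)).
   have [_ _ p1 _] := plateauP (n%:R + 1) k (ltr01 : 0 < (1 : R)); rewrite p1 ?invr1 ?addrK//.
   by rewrite mul1r lerDl mulr_ge0 ?(ltW l0)// addr_ge0// mulr_ge0 ?ler0n// mulr_ge0 ?sqr_ge0.
  have q0 : 0 <= normc (tsum (wsup u N) k) ^+ 2 * W k by rewrite mulr_ge0 ?sqr_ge0.
  apply: ler_wpDl; first by rewrite mulr_ge0 ?F0// mulr_ge0 ?sqr_ge0// ltW.
  rewrite mulrCA ler_pM2l// [W k * _]mulrC -mulrDr ler_peMr//. move: nk; rewrite negb_and -!ltNge => /orP[/ltW ->|/ltW ->].
   by rewrite lerDl ler0n.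
  by rewrite lerDr ler0n.
 move: le1; rewrite IntD//; last by apply: rintZ; exact: rintD. rewrite IntZ ?IntD//; last exact: rintD.
 have l1 : l * (Int2 T1 + Int2 T2) <= e / 2.
  have w := wt_wsup u N; rewrite mulrC ler_pdivrMr ?lamX_gt0//. apply: (le_trans (lerD t1 t2)); rewrite -mulrDr.
  have -> : e / 2 * lam ^+ (2 * N) = e / (4 * (Z + 1)) * (2 * ((Z + 1) * lam ^+ (2 * N))) by field; rewrite lt0r_neq0// ltr_wpDl.
  apply: ler_wpM2l; first exact: ltW.
  have {}w : wt (wsup u N) <= (Z + 1) * lam ^+ (2 * N) by apply: le_trans w _; apply: ler_wpM2r; [exact: ltW (lamX_gt0 _)|rewrite lerDl].
  by move: w; clear; lra.
 by move: h1 l1; clear; lra.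
apply/eqP; rewrite eq_le; apply/andP; split.
 apply/lee_addgt0Pr => e e0; rewrite -EFinD. have cv := cvg_monotone_convergence measurableT (mu := mu) (g' := fun n x => (F n x)%:E).
 have lim1 (x : P) : limn (fun n => (F n x)%:E) = (W x)%:E.
  apply: cvg_lim => //; apply: cvg_near_cst. exists (Num.bound (`|x.1| + `|x.2|)) => // n /= nn. have h : `|x.1| + `|x.2| <= n%:R.
   apply: (le_via (Num.bound (`|x.1| + `|x.2|))%:R); last by rewrite ler_nat. by apply: ltW; apply: archi_boundP; rewrite addr_ge0.
  rewrite /F; have [_ _ p1 _] := plateauP (n%:R + 1) x (ltr01 : 0 < (1 : R)); rewrite p1 ?mul1r//.
   by rewrite invr1 addrK (le_trans _ h)// lerDl.
  by rewrite invr1 addrK (le_trans _ h)// lerDr.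
 have -> : (\int[mu]_x (normc (fourier g (- x)) ^+ 2)%:E)%E = (\int[mu]_x limn (fun n => (F n x)%:E))%E
  by apply: eq_integral => x _; rewrite lim1.
 have cvi : (\int[mu]_x (F n x)%:E)%E @[n --> \oo] --> (\int[mu]_x limn (fun n => (F n x)%:E))%E.
  apply: cv.
  - by move=> n; apply/measurable_EFinP; exact: kc_meas.
  - by move=> n x _; rewrite lee_fin.
  - by move=> x _ m n mn; rewrite lee_fin ler_wpM2r// plateau_mono// lerD2r ler_nat.
 rewrite -(cvg_lim _ cvi)//; apply: lime_le; first by apply/cvg_ex; eexists; exact: cvi. by apply: nearW => n; exact: upper.
by apply/lee_addgt0Pr => e e0; rewrite -leeBlDr//; exact: lower.
Qed.

Lemma diffraction_ex u T0 T : is_tiling T0 -> inflate (inflate T0) = T0 -> hull T0 T ->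
 exists2 mu, is_diffraction (wcomb u T) mu & vague_cluster (dens u) mu.
Proof.
move=> t f h; have [mu cm] := dens_cluster_ex u; exists mu => //; exists (acorr u); split.
 exact: hull_autocorrelation t f h.
exact: cluster_fourier.
Qed.

End Autocorrelation.

(** * Density and relative frequencies *)

Section Density.
Implicit Types (G : 'I_4 -> R) (E s : seq tl) (T : tileset R).

(** At separated corners this bump sees coincident pairs only, so pair statistics also count single
    tiles. *)
Definition tent G (i i' : 'I_4) (x : P) : R := G i * plateau 1 1 x.

Lemma plateau11_0 : plateau 1 1 P0 = 1.
Proof. by have [_ _ h _] := plateauP 1 P0 (ltr01 : 0 < (1 : R)); apply: h; rewrite /= normr0 invr1 subrr. Qed.

Lemma pairsum_tent G E : uniq E -> pairwise (@sepr) (unzip2 E) -> pairsum (tent G) E E = \sum_(p <- E) G p.1.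
Proof.
move=> uE; rewrite /pairsum.
have sep (p q : tl) : sepr p.2 q.2 -> plateau 1 1 (q.2 - p.2) = 0.
 move=> h; have [_ _ _] := plateauP 1 (q.2 - p.2) (ltr01 : 0 < (1 : R)); apply.
 by move: h; rewrite /sepr /= distrC [in X in _ || X]distrC.
rewrite /unzip2 pairwise_map => /pairwiseP pE.
have key (p q : tl) : p \in E -> q \in E -> p != q -> plateau 1 1 (q.2 - p.2) = 0.
 move=> pi qi pq; apply: sep. have ip : (index p E < size E)%N by rewrite index_mem.
 have iq : (index q E < size E)%N by rewrite index_mem. have [lt|gt|eq] := ltngtP (index p E) (index q E).
 - by have := pE p _ _ ip iq lt; rewrite !nth_index.
 - by have := pE p _ _ iq ip gt; rewrite !nth_index// sepr_sym.
 - by move/eqP: pq; case; rewrite -(nth_index p pi) eq nth_index.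
apply: eq_big_seq => p pi; rewrite (bigD1_seq p)//= /tent subrr plateau11_0 mulr1 big1_seq ?addr0// => q /andP[qp qi].
by rewrite (key p q)// ?mulr0// eq_sym.
Qed.

Lemma tent_bnd G : bnd (tent G) (\sum_i `|G i|) 1.
Proof.
have p01 (x : P) := plateauP 1 x (ltr01 : 0 < (1 : R)).
split => i i' x; have [a b _ d] := p01 x; rewrite /tent.
 by rewrite normrM (ger0_norm a) (le_trans (ler_piMr _ b))// (bigD1 i)//= lerDl sumr_ge0.
rewrite /near0 negb_and -!ltNge => h; rewrite d ?mulr0//.
by case/orP: h => /ltW ->; rewrite ?orbT.
Qed.

Lemma tent_ucont G : ucont (tent G).
Proof.
move=> e e0; have kp := kc_plateau 1 (ltr01 : 0 < (1 : R)).
pose B := \sum_i `|G i| + 1; have B0 : 0 < B by rewrite ltr_wpDl ?sumr_ge0.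
have e'0 : 0 < e / B by rewrite divr_gt0.
have [d d0 h] := kc_unif kp e'0; exists d => // i i' x y h1 h2.
rewrite /tent -mulrBr normrM mulrC (le_lt_trans (y := `|plateau 1 1 x - plateau 1 1 y| * B))//.
 by rewrite ler_wpM2l// /B (bigD1 i)//= -addrA lerDl addr_ge0// sumr_ge0.
by rewrite -ltr_pdivlMr//; exact: h.
Qed.

Lemma gam_tent G : gam (tent G) = \sum_i fd i * G i.
Proof.
have e : amean (tent G) = (fun=> \sum_i fd i * G i).
 apply/funext => n; rewrite /amean -[RHS](mulKf (lt0r_neq0 (lamX_gt0 (2 * n)))) -gsum_fd.
 congr (_ * _); apply: eq_bigr => j _; congr (_ * _); apply: pairsum_tent; last exact: rsup_sepr.
 have /= := rsup_sepr n j; rewrite /unzip2 pairwise_map => h.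
 apply: (@pairwise_uniq _ (fun p q : tl => sepr p.2 q.2)) => //. by move=> p; rewrite /= /sepr !subrr normr0 ler10.
rewrite /gam e; apply: (cvg_lim (@norm_hausdorff _ R)); exact: cvg_cst.
Qed.

Section HullCount.
Variables (T0 T : tileset R) (tT0 : is_tiling T0) (fT0 : inflate (inflate T0) = T0) (hT : hull T0 T).

Let sT : usep T.
Proof. by apply: usep_hull hT => p q Tp Tq pq; apply: rdj_sepr; exact: (tiling_rdj tT0). Qed.

Lemma hull_count G (A : set P) :
 (forall r E, uniq E -> (forall p, p \in E <-> (T p /\ en p.2 < r)) -> npoints A r = \sum_(p <- E) G p.1) ->
 npoints A r / area (disc r) @[r --> +oo] --> \sum_i fd i * G i.
Proof.
move=> hA; apply/cvgrPdist_le => e e0.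
have [r0 H] := hull_pairstat tT0 fT0 hT (tent_bnd G) ler01 (@tent_ucont G) e0.
near=> r; have [E [uE hE]] := usep_enum r sT.
have r1 : 0 < r by near: r; apply: nbhs_pinfty_gt; rewrite num_real.
have ap : 0 < area (disc r) by rewrite area_disc// mulr_gt0 ?exprn_gt0 ?area_disc1_gt0.
have rr : r0 <= r by near: r; apply: nbhs_pinfty_ge; rewrite num_real.
have := H r rr E uE hE; rewrite gam_tent pairsum_tent//; last by apply: (usep_pairwise sT uE) => p /hE[].
by rewrite (mulrC (npoints A r)) (hA r E uE hE); exact: dist_div.
Unshelve. all: by end_near.
Qed.

Lemma npoints_enum (r : R) E (A : set P) (c : pred 'I_4) : uniq E -> (forall p, p \in E <-> (T p /\ en p.2 < r)) ->
 (forall x, A x <-> exists2 i, c i & T (i, x)) -> npoints A r = \sum_(p <- E) (c p.1)%:R.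
Proof.
move=> uE hE hA.
pose X : {fset P} := [fset x in [seq p.2 | p <- E & c p.1]]%fset.
have inj : {in E &, injective (fun p : tl => p.2)}.
 move=> p q /hE[Tp _] /hE[Tq _] e; apply: contrapT => npq. by have := sT Tp Tq npq; rewrite e /sepr !subrr normr0 ler10.
have -> : npoints A r = #|` X|%:R.
 rewrite /npoints (_ : A `&` disc r = [set` X]) ?set_fsetK//. apply/seteqP; split => [x [/hA[i ci Ti] xr]|x /=].
  rewrite /= /X inE /=; apply/mapP; exists (i, x) => //; rewrite mem_filter ci /=; exact/hE.
 rewrite /X inE /= => /mapP[p]; rewrite mem_filter => /andP[cp /hE[Tp pr]] ->.
 by split; [apply/hA; exists p.1 => //; case: p Tp {cp pr}|].
rewrite card_fseq undup_id; last first.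
 rewrite map_inj_in_uniq ?filter_uniq// => p q; rewrite !mem_filter => /andP[_ ?] /andP[_ ?]; exact: inj.
by rewrite size_map sum_bool.
Qed.

Lemma sum_fd : \sum_i fd i * 1 = fr_density R.
Proof. by rewrite big_ord4 /fd /fr_density /=; field. Qed.

Lemma hull_density : has_density (all_control_points T) (fr_density R).
Proof.
rewrite /has_density -sum_fd; apply: hull_count => r E uE hE.
rewrite (npoints_enum (c := xpredT) uE hE); first by apply: eq_bigr.
by move=> x; split => [[i _ Ti]|[i _ Ti]]; exists i.
Qed.

Lemma fd_frequency i : fd i = fr_density R * fr_frequency R i.
Proof.
by have l2 := lamE; elim/ord4_ind: i; rewrite /fd /fr_density /fr_frequency /=; field: l2.
Qed.

Lemma hull_frequency i : has_rel_frequency (control_points T i) (all_control_points T) (fr_frequency R i).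
Proof.
have d0 : 0 < fr_density R by rewrite divr_gt0// ltr_wpDl// lam_gt0.
have h1 : npoints (control_points T i) r / area (disc r) @[r --> +oo] --> fd i.
 have -> : fd i = \sum_j fd j * (j == i)%:R by rewrite (bigD1 i)//= eqxx mulr1 big1 ?addr0// => j /negbTE ->; rewrite mulr0.
 apply: hull_count => r E uE hE; apply: (npoints_enum (c := pred1 i) uE hE). by move=> x; split => [Ti|[j /eqP -> Tj]//]; exists i => /=.
have h2 := hull_density; rewrite /has_rel_frequency.
have -> : fr_frequency R i = fd i * (fr_density R)^-1 by rewrite fd_frequency mulrC mulKf// lt0r_neq0.
have h3 : (npoints (control_points T i) r / area (disc r)) * (npoints (all_control_points T) r / area (disc r))^-1
  @[r --> +oo] --> fd i / fr_density R.
 by apply: cvgM h1 _; apply: cvgV h2; exact: lt0r_neq0.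
apply: cvg_trans h3; apply: near_eq_cvg; near=> r.
have r1 : 0 < r by near: r; apply: nbhs_pinfty_gt; rewrite num_real.
have ap : 0 < area (disc r) by rewrite area_disc// mulr_gt0 ?exprn_gt0 ?area_disc1_gt0.
by rewrite /= invf_div mulrA divfK// lt0r_neq0.
Unshelve. all: by end_near.
Qed.

End HullCount.

End Density.

(** * Mean squares of sums at dilated frequencies *)

Section ScaledBox.
Implicit Types (k x : P) (s : seq (R[i] * P)).

Definition cbx (k0 : P) (r : R) : set P := box (k0.1 - r) (k0.1 + r) (k0.2 - r) (k0.2 + r).

Lemma cbxP k0 r k : cbx k0 r k <-> `|k.1 - k0.1| <= r /\ `|k.2 - k0.2| <= r.
Proof.
rewrite /cbx /box /= !in_itv /= !ler_norml; split.
 by move=> [/andP[? ?] /andP[? ?]]; split; apply/andP; split; lra.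
by move=> [/andP[? ?] /andP[? ?]]; split; apply/andP; split; lra.
Qed.

Lemma measurable_cbx k0 r : measurable (cbx k0 r : set BP).
Proof. exact: measurable_box. Qed.

Definition igrid (M : nat) : seq P := [seq (i%:R * 2 - M%:R, j%:R * 2 - M%:R) | i <- iota 0 M.+1, j <- iota 0 M.+1].

Lemma igrid_cover (M : nat) k : cbx 0 M%:R k -> exists2 a, a \in igrid M & cbx a 1 k.
Proof.
have one (t : R) : `|t| <= M%:R -> exists2 i, (i \in iota 0 M.+1) & `|t - (i%:R * 2 - M%:R)| <= 1.
 rewrite ler_norml => /andP[t1 t2]. pose u := (t + M%:R + 1) / 2; have u0 : 0 <= u by rewrite /u; have := t1; lra. exists (Num.truncn u).
  rewrite mem_iota /= add0n ltnS; have := truncn_le u; rewrite u0.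
  by have [//|] := leqP (Num.truncn u) M; rewrite -(ler_nat R) -natr1 /u; lra.
 have := truncn_le u; rewrite u0 => a1; have := truncnS_gt u; rewrite -natr1 => a2.
 by move: a1 a2; rewrite /u ler_norml => ? ?; apply/andP; split; lra.
move=> /cbxP[/= ]; rewrite !subr0 => /one[i il hi] /one[j jl hj].
exists (i%:R * 2 - M%:R, j%:R * 2 - M%:R); last exact/cbxP.
by apply/allpairsP; exists (i, j).
Qed.

(** The dilated box is covered by at most [(c r + 2)^2] boxes of half-side 1, and [box_bound] with a
    shifted frequency treats each of them. *)
Lemma scaled_box_bound : exists2 C : R, 0 <= C & forall s (k0 : P) (c r : R), pairwise (@sepr) (unzip2 s) ->
 0 < c -> 0 <= r ->
 rint2 (fun k : P => \1_(cbx k0 r) k * normc (tsum s (sc c k)) ^+ 2) /\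
 Int2 (fun k : P => \1_(cbx k0 r) k * normc (tsum s (sc c k)) ^+ 2) <=
  C * (c * r + 2) ^+ 2 * c ^- 2 * wt s.
Proof.
have [C C0 H] := box_bound (ltr01 : 0 < (1 : R)).
exists C => // s k0 c r ss c0 r0; have W0 := wt_ge0 s.
have cr0 : 0 <= c * r by rewrite mulr_ge0// ltW.
pose M' := Num.truncn (c * r).
have M1 : c * r <= (M'.+1)%:R by apply: ltW; exact: truncnS_gt.
have M2 : M'%:R <= c * r by have := truncn_le (c * r); rewrite cr0.
pose F (k : P) : R := \sum_(a <- igrid M'.+1) \1_(box (-1) 1 (-1) 1) (k - a) * normc (tsum s (k - a + (a + sc c k0))) ^+ 2.
have rF a : rint2 (fun k : P => \1_(box (-1) 1 (-1) 1 : set P) (k - a) * normc (tsum s (k - a + (a + sc c k0))) ^+ 2) /\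
  Int2 (fun k : P => \1_(box (-1) 1 (-1) 1 : set P) (k - a) * normc (tsum s (k - a + (a + sc c k0))) ^+ 2) <= C * wt s.
 have [r1 b1] := H s (a + sc c k0) ss. by have [r2 ->] := Int_shift (- a) r1.
have [rF1 iF] : rint2 F /\ Int2 F <= C * (c * r + 2) ^+ 2 * wt s.
 split; first by apply: rint_sum => a; have [] := rF a. rewrite Int_sum; last by move=> a; have [] := rF a.
 apply: (le_via (\sum_(a <- igrid M'.+1) C * wt s)).
  by apply: ler_sum => a _; have [] := rF a.
 rewrite sum_cst size_allpairs !size_iota -[leLHS]mulr_natr natrM.
 have -> : C * (c * r + 2) ^+ 2 * wt s = C * wt s * ((c * r + 2) * (c * r + 2)) by ring.
 have q0 : 0 <= C * wt s by exact: mulr_ge0. have h : M'.+2%:R <= c * r + 2 by rewrite -2!natr1; move: M2; clear; lra.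
 by apply: ler_wpM2l => //; apply: ler_pM.
have e (k : P) : \1_(cbx k0 r) k * normc (tsum s (sc c k)) ^+ 2 <= F (affine2 c (- sc c k0) k).
 have t0 (a : P) : 0 <= \1_(box (-1) 1 (-1) 1 : set P) (affine2 c (- sc c k0) k - a) * normc (tsum s (affine2 c (- sc c k0) k - a + (a + sc c k0))) ^+ 2
  by rewrite mulr_ge0 ?sqr_ge0// indicE ler0n.
 rewrite indicE; have [/set_mem/cbxP[h1 h2]|_] := boolP (k \in _); last by rewrite mul0r sumr_ge0.
 have [|a ag /cbxP[g1 g2]] := @igrid_cover M'.+1 (affine2 c (- sc c k0) k).
  have hh (x y : R) : `|x - y| <= r -> `|c * x - c * y| <= M'.+1%:R
   by move=> h; rewrite -mulrBr normrM (gtr0_norm c0) (le_trans _ M1)// ler_pM2l.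
  by apply/cbxP; rewrite /= !subr0; split; exact: hh.
 apply: le_trans (mem_sum_le t0 ag).
 have -> : affine2 c (- sc c k0) k - a + (a + sc c k0) = sc c k by rewrite addrA subrK; congr pair; rewrite /= subrK.
 by rewrite indicE mem_set ?mul1r//; apply/sub_box.
have rA := integrable_affine2 (- sc c k0) c0 rF1.
have mi : mfun (ind (cbx k0 r)) by apply: measurable_indic; exact: measurable_cbx.
have mt : mfun (fun k : P => normc (tsum s (sc c k)) ^+ 2).
 have := mcomp (meas_tsum s) (measurable_affine2 c P0).
 by congr measurable_fun; apply/funext => k /=; congr (normc (tsum s _) ^+ 2); rewrite /affine2 /sc !addr0.
have p0 (k : P) : 0 <= \1_(cbx k0 r) k * normc (tsum s (sc c k)) ^+ 2 by rewrite mulr_ge0 ?sqr_ge0// indicE ler0n.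
have [r1 b1] := le_Int0 (mfunM mi mt) p0 rA e.
split => //; apply: (le_trans b1).
have := Rintegral_affine2 (- sc c k0) c0 rF1; rewrite -!/(Int _ _) => ->.
have -> : C * (c * r + 2) ^+ 2 * c ^- 2 * wt s = c ^- 2 * (C * (c * r + 2) ^+ 2 * wt s) by ring.
by rewrite ler_wpM2l// invr_ge0 sqr_ge0.
Qed.

End ScaledBox.

(** * Factorisation of supertile sums and absence of atoms off 0 *)

Section CoefSum.
Implicit Types (u : 'I_4 -> R[i]) (v : 'I_4 -> P -> R[i]) (k x : P).

Definition psum v n j k : R[i] := \sum_(x <- rsup n j) v x.1 k * ek k (- x.2).
Definition delta4 (i i' : 'I_4) : R[i] := (i == i')%:R.

Lemma ek_sc (c : R) k x : ek k (sc c x) = ek (sc c k) x.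
Proof. by rewrite /ek /inner /sc /=; congr (expi (_ * _)); ring. Qed.

Lemma sum_asm_blk (V : nmodType) (F : tl -> V) n S :
 \sum_(x <- asm n S) F x = \sum_(p <- S) \sum_(x <- rsup n p.1) F (x.1, p.2 + x.2).
Proof. by rewrite /asm big_flatten /= big_map; apply: eq_bigr => p _; rewrite /blk big_map. Qed.

Lemma psum_add v n m j k : psum v (n + m) j k =
 \sum_(p <- rsup m j) ek (sc (lam ^+ n) k) (- p.2) * psum v n p.1 k.
Proof.
rewrite /psum rsup_add sum_asm_blk /scl big_map; apply: eq_bigr => p _.
rewrite mulr_sumr; apply: eq_bigr => x _ /=.
have -> : - (sc (lam ^+ n) p.2 + x.2) = sc (lam ^+ n) (- p.2) - x.2 by rewrite opprD; congr (_ - _); rewrite /sc /= !mulrN.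
by rewrite ekD ek_sc mulrCA.
Qed.

(** The inner sum depends only on the type of the level-[n] supertile. Grouping by type separates
    the sum at [k] from sums at the dilated frequency [lambda^n k]. *)
Lemma psum_fac v n m k : psum v (n + m) o3 k =
 \sum_i psum v n i k * tsum (wsup (delta4 i) m) (sc (lam ^+ n) k).
Proof.
rewrite psum_add.
transitivity (\sum_(p <- rsup m o3) \sum_i psum v n i k * (delta4 i p.1 * ek (sc (lam ^+ n) k) (- p.2))).
 apply: eq_bigr => p _; rewrite (bigD1 p.1)//= /delta4 eqxx mul1r big1 ?addr0 1?mulrC// => i /negbTE ->. by rewrite mul0r mulr0.
rewrite exchange_big /=; apply: eq_bigr => i _; rewrite -mulr_sumr; congr (_ * _).
by rewrite /tsum /wsup big_map.
Qed.

Lemma psum_fac_le v n m k : normc (psum v (n + m) o3 k) ^+ 2 <=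
 \sum_i 4 * (normc (psum v n i k) ^+ 2 * normc (tsum (wsup (delta4 i) m) (sc (lam ^+ n) k)) ^+ 2).
Proof.
rewrite psum_fac.
apply: (le_via ((\sum_i normc (psum v n i k * tsum (wsup (delta4 i) m) (sc (lam ^+ n) k))) ^+ 2)).
 by rewrite lerXn2r ?nnegrE ?normc_ge0 ?sumr_ge0// ?normc_sum// => i _; exact: normc_ge0.
rewrite !big_ord4 !normcM -!exprMn.
have sq (a b c d : R) : (a + b + c + d) ^+ 2 <= 4 * a ^+ 2 + 4 * b ^+ 2 + 4 * c ^+ 2 + 4 * d ^+ 2.
 have := sqr_ge0 (a - b); have := sqr_ge0 (a - c); have := sqr_ge0 (a - d).
 have := sqr_ge0 (b - c); have := sqr_ge0 (b - d); have := sqr_ge0 (c - d); nra.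
exact: sq.
Qed.

Lemma umax_delta4 i : umax (delta4 i) = 1.
Proof.
rewrite /umax (bigD1 i)//= /delta4 eqxx big1; first by rewrite addr0 (normc_real 1) normr1.
by move=> j; rewrite eq_sym => /negbTE ->; rewrite (normc_real 0) normr0.
Qed.

(** A bound at the single level [n] controls all later densities: the remaining factor lives at the
    frequency [lambda^n k], where its mean square is bounded uniformly in [m]. This serves both the
    atoms and the singularity. *)
Lemma conc_bound : exists2 C : R, 0 <= C & forall v n m k0 r f A,
 0 <= r -> 0 <= A -> mfun f -> (forall k, 0 <= f k) ->
 (forall k, ~ cbx k0 r k -> f k = 0) ->
 mfun (fun k => normc (psum v (n + m) o3 k) ^+ 2) ->
 (forall i k, f k * normc (psum v n i k) ^+ 2 <= A) ->
 let F (k : P) := f k * ((lam ^+ (2 * (n + m)))^-1 * normc (psum v (n + m) o3 k) ^+ 2) in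
 rint2 F /\ Int2 F <= A * C * (lam ^+ n * r + 2) ^+ 2 * lam ^- (2 * n) ^+ 2.
Proof.
have [C C0 H] := scaled_box_bound; exists (4 * (4 * (C * 9))); first by rewrite !mulr_ge0.
move=> v n m k0 r f A r0 A0 mf f0 sf mp hA F.
pose l := (lam ^+ (2 * (n + m)))^-1; have l0 : 0 < l by rewrite invr_gt0 lamX_gt0.
pose B i (k : P) : R := \1_(cbx k0 r) k * normc (tsum (wsup (delta4 i) m) (sc (lam ^+ n) k)) ^+ 2.
have rB i := H _ k0 (lam ^+ n) r (wsup_sepr (delta4 i) m) (lamX_gt0 n) r0.
pose G (k : P) := \sum_i (4 * l * A) * B i k.
have rG : rint2 G by apply: rint_sum => i; apply: rintZ; exact: (rB i).1.
have F0 k : 0 <= F k by rewrite mulr_ge0// mulr_ge0 ?sqr_ge0// ltW.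
have FG k : F k <= G k.
 rewrite /F /G -/l; have [kb|kb] := pselect (cbx k0 r k); last first.
  rewrite sf// mul0r sumr_ge0// => i _; rewrite mulr_ge0//; last by rewrite mulr_ge0 ?sqr_ge0// indicE ler0n.
  by apply: mulr_ge0 => //; apply: mulr_ge0 => //; exact: ltW.
 rewrite mulrCA; apply: (le_via (l * (f k * \sum_i 4 * (normc (psum v n i k) ^+ 2 * normc (tsum (wsup (delta4 i) m) (sc (lam ^+ n) k)) ^+ 2)))).
  by rewrite ler_pM2l// ler_wpM2l// psum_fac_le.
 rewrite !mulr_sumr; apply: ler_sum => i _; rewrite /B indicE mem_set// mul1r.
 have := ler_wpM2r (sqr_ge0 (normc (tsum (wsup (delta4 i) m) (sc (lam ^+ n) k)))) (hA i k).
 move: (normc _ ^+ 2) (normc (psum _ _ _ _) ^+ 2) (f k) => x y z h. have -> : l * (z * (4 * (y * x))) = 4 * l * (z * y * x) by ring.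
 by rewrite -[leRHS]mulrA; apply: ler_wpM2l => //; rewrite mulr_ge0// ltW.
have mF : mfun F by apply: mfunM => //; apply: mfunM => //; exact: measurable_cst.
have [rF iF] := le_Int0 mF F0 rG FG; split => //; apply: (le_trans iF).
rewrite Int_sum; last by move=> i; apply: rintZ; exact: (rB i).1.
apply: (le_via (\sum_(i < 4) A * C * 36 * (lam ^+ n * r + 2) ^+ 2 * lam ^- (2 * n) ^+ 2)); last first.
 by rewrite sumr_const card_ord -[leLHS]mulr_natr; apply: eqW; ring.
apply: ler_sum => i _; rewrite IntZ; last exact: (rB i).1.
have w := wt_wsup (delta4 i) m; rewrite umax_delta4 expr1n mulr1 in w.
have c0 : 0 <= 4 * l * A by apply: mulr_ge0 => //; apply: mulr_ge0 => //; exact: ltW.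
apply: (le_trans (ler_wpM2l c0 (rB i).2)).
have c1 : 0 <= C * (lam ^+ n * r + 2) ^+ 2 * (lam ^+ n) ^- 2 by apply: mulr_ge0; [apply: mulr_ge0 => //; exact: sqr_ge0|rewrite invr_ge0 sqr_ge0].
apply: (le_trans (ler_wpM2l c0 (ler_wpM2l c1 w))).
apply: eqW.
have ll : l * lam ^+ (2 * m) = lam ^- (2 * n).
 rewrite /l mulnDr exprD invfM; field; by rewrite !lt0r_neq0 ?lamX_gt0.
have -> : (lam ^+ n) ^- 2 = lam ^- (2 * n) by rewrite -exprM mulnC.
by rewrite -ll; ring.
Qed.

(** For [a] nonzero the relation gives [(2 b - a)^2 = 13 a^2], impossible by the parity of the
    exponent of 13. *)
Lemma lam_irrational (a b : int) : b%:~R = lam * a%:~R -> a = 0.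
Proof.
move=> h; apply/eqP; apply/negPn/negP => a0.
have l2 := lamE.
have e1 : (2 * b%:~R - a%:~R) ^+ 2 = 13 * a%:~R ^+ 2 :> R by rewrite h; ring: l2.
have e2 : (2 * b - a) ^+ 2 = 13 * a ^+ 2 :> int by apply/eqP; rewrite !expr2 -(eqr_int R) !rmorphM rmorphB !rmorphM /= -!expr2 e1.
have e3 : (`|(2 * b - a)%R|%N ^ 2 = 13 * `|a|%N ^ 2)%N.
 have := congr1 absz e2; rewrite abszM !abszX => e. exact: e.
have a1 : (0 < `|a|)%N by rewrite absz_gt0.
have x1 : (0 < `|(2 * b - a)%R|)%N
 by move: e3; case: (`|_|%N) => //; rewrite exp0n// => /esym/eqP; rewrite muln_eq0 expn_eq0 /= (gtn_eqF a1).
have := congr1 (logn 13) e3; rewrite lognM ?expn_gt0 ?a1// !lognX (_ : logn 13 13 = 1%N)//.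
lia.
Qed.

(* Once lam^n t is close to an integer z_n for all large n, the deviations e_n = lam^n t - z_n satisfy
  3 e_n = e_(n+2) - e_(n+1) exactly, and this forces them to vanish. *)
Lemma int_orbit (t : R) n0 : (forall n, (n0 <= n)%N -> exists z : int, `|lam ^+ n * t - z%:~R| < 10^-1) -> t = 0.
Proof.
move=> H.
have [z hz] : exists z : nat -> int, forall n, (n0 <= n)%N -> `|lam ^+ n * t - (z n)%:~R| < 10^-1.
 have h n : exists z : int, (n0 <= n)%N -> `|lam ^+ n * t - z%:~R| < 10^-1 by have [/H[z zz]|] := leqP n0 n; [exists z|exists 0].
 by have [z hz] := choice h; exists z.
pose e n := lam ^+ n * t - (z n)%:~R.
have l2 := lamE.
have rec n : (n0 <= n)%N -> 3 * e n = e n.+2 - e n.+1.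
 move=> nn; have h0 := hz n nn; have h1 := hz n.+1 (leqW nn); have h2 := hz n.+2 (leqW (leqW nn)).
 have d : (3 * z n - (z n.+2 - z n.+1))%:~R = - (3 * e n - (e n.+2 - e n.+1)) :> R.
  have l3 : lam ^+ n.+2 = lam ^+ n.+1 + 3 * lam ^+ n by rewrite !exprS; move: (lam ^+ n) => x; ring: l2.
  by rewrite /e l3 rmorphB rmorphM rmorphB /=; ring.
 (* With deviations below 1/10 this integer is below (3 + 1 + 1)/10 in modulus, so it vanishes. *)
 have d1 : `|(3 * z n - (z n.+2 - z n.+1))%:~R : R| < 1.
  rewrite d normrN; move: h0 h1 h2; rewrite -!/(e _); clear; move: (e n) (e n.+1) (e n.+2) => x y w.
  by rewrite !ltr_norml => /andP[? ?] /andP[? ?] /andP[? ?]; apply/andP; split; lra.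
 have d0 : 3 * z n - (z n.+2 - z n.+1) = 0 by move: d1; rewrite -intr_norm -(mulr1z 1) ltr_int; move: (3 * z n - _) => x; lia.
 by move: d; rewrite d0 => /eqP; rewrite eq_sym oppr_eq0 subr_eq0 => /eqP.
(* Two later deviations divided by 3 bound the present one, so each use of the recursion gains the
   factor 2/3. *)
have small (k n : nat) : (n0 <= n)%N -> `|e n| <= (2 / 3) ^+ k / 10.
 elim: k n => [|k IH] n nn; first by rewrite expr0 mul1r; exact/ltW/hz.
 have h1 := IH n.+1 (leqW nn); have h2 := IH n.+2 (leqW (leqW nn)); have r := rec n nn.
 rewrite exprS; move: h1 h2 r; move: (e n) (e n.+1) (e n.+2) ((2 / 3) ^+ k) => x y w q; clear.
 rewrite !ler_norml => /andP[? ?] /andP[? ?] ?; apply/andP; split; lra.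
have e0 n : (n0 <= n)%N -> e n = 0.
 move=> nn; apply/normr0_eq0/le_anti; rewrite normr_ge0 andbT; apply/ler_addgt0Pr => d d0; rewrite add0r.
 have c : (2 / 3 : R) ^+ k @[k --> \oo] --> (0 : R) by apply: cvg_expr; rewrite ger0_norm; lra.
 have d10 : 0 < 10 * d by rewrite mulr_gt0.
 move/cvgrPdist_le: c => /(_ _ d10)[k _ /(_ k (leqnn k))]; rewrite /= sub0r normrN ger0_norm ?exprn_ge0// => hk.
 by apply: le_trans (small k n nn) _; move: hk; lra.
have z0 := e0 n0 (leqnn _); have z1 := e0 n0.+1 (leqnSn _).
have zz : (z n0.+1)%:~R = lam * (z n0)%:~R :> R
 by move/eqP: z0; move/eqP: z1; rewrite /e !subr_eq0 => /eqP <- /eqP <-; rewrite exprS mulrA.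
move: z0; rewrite /e (lam_irrational zz) subr0 => /eqP; rewrite mulf_eq0 (gt_eqF (lamX_gt0 n0)) /=.
by move/eqP.
Qed.

Lemma cos_period (x : R) (z : int) : cos (x + z%:~R * (2 * pi)) = cos x.
Proof.
have h (n : nat) (y : R) : cos (y + n%:R * (2 * pi)) = cos y.
 rewrite (_ : n%:R * (2 * pi) = (pi *+ 2) *+ n); first exact: (periodicn (@cosD2pi R)). by rewrite -[RHS]mulr_natl -[pi *+ 2]mulr_natl.
case: z => n; first exact: h.
by rewrite -(h n.+1 (_ + _)) NegzE mulrNz mulNr -addrA addNr addr0.
Qed.

(** Modulo 1 the distance of [t] to the nearest integer lies between 1/10 and 1/2, so the angle lies
    between [pi / 5] and [pi], where the cosine decreases. *)
Lemma far_cos (t : R) : (forall z : int, 10^-1 <= `|t - z%:~R|) -> cos (2 * pi * t) <= cos (pi / 5).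
Proof.
move=> far; have pi0 := pi_gt0 R.
pose z := Num.floor (t + 2^-1); pose e := t - z%:~R.
have z1 := floor_le_tmp (t + 2^-1); have z2 := floorD1_gt (t + 2^-1); rewrite rmorphD /= -/z in z2; rewrite -/z in z1.
have -> : cos (2 * pi * t) = cos (2 * pi * `|e|).
 have -> : 2 * pi * `|e| = `|2 * pi * e| by rewrite normrM ger0_norm// mulr_ge0// ltW.
 by rewrite cos_norm -[RHS](cos_period _ z); congr cos; rewrite /e; ring.
have e1 : 10^-1 <= `|e| by exact: far.
have e2 : `|e| <= 2^-1 by rewrite ler_norml /e; apply/andP; split; move: z1 z2; lra.
rewrite leNgt ltr_cos ?in_itv /=; last 2 first.
- by apply/andP; split; nra.
- by apply/andP; split; nra.
by rewrite -leNgt; nra.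
Qed.

(** [lambda^(2 n) * ar j] is the area of the supertile, so [b] is a bound per unit area; one more
    inflation cannot spoil it ([bd_step]). *)
Definition bd v (k0 : P) n (b : R) := forall j, normc (psum v n j k0) <= b * lam ^+ (2 * n) * ar j.

Lemma psumS_le v k n j : normc (psum v n.+1 j k) <= \sum_(p <- rdec j) normc (psum v n p.1 k).
Proof.
rewrite -addn1 psum_add rsup1 (le_trans (normc_sum _ _ _))//; apply: ler_sum => p _.
by rewrite normcM normc_ek mul1r.
Qed.

Lemma ar_rdec j : \sum_(p <- rdec j) ar p.1 = lam ^+ 2 * ar j.
Proof. by have := lsum_rsup 1 j; rewrite rsup1 muln1. Qed.

Lemma bd_step v k n b : bd v k n b -> bd v k n.+1 b.
Proof.
move=> H j; rewrite (le_trans (psumS_le _ _ _ _))//.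
rewrite (le_trans (ler_sum _ (fun p _ => H p.1)))// -mulr_sumr ar_rdec mulnS exprD.
by apply: eqW; ring.
Qed.

(** By the half-angle formula this is [|1 + expi (pi / 5)| / 2], the damping of a two-term sum at
    distance 1/10 from the integers. *)
Definition q0 : R := Num.sqrt ((1 + cos (pi / 5)) / 2).

Lemma q0P : 0 <= q0 /\ q0 < 1.
Proof.
split; first exact: sqrtr_ge0.
rewrite -[ltRHS]sqrtr1 ltr_sqrt// ltr_pdivrMr// mul1r.
have : cos (pi / 5) < cos (0 : R).
 have p0 := pi_gt0 R; rewrite ltr_cos ?in_itv /=; first by rewrite divr_gt0.
  by rewrite lexx ltW.
 by apply/andP; split; lra.
by rewrite cos0; lra.
Qed.

Definition far (k : P) := (forall z : int, 10^-1 <= `|k.1 - z%:~R|) \/ (forall z : int, 10^-1 <= `|k.2 - z%:~R|).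

(** The phases of the four unit squares form a product of two two-term sums; a coordinate far from
    the integers damps one factor. *)
Lemma far_four (k : P) : far k ->
 normc (ek k (- (0, 0)) + ek k (- (1, 0)) + ek k (- (0, 1)) + ek k (- (1, 1)) : R[i]) <= 4 * q0.
Proof.
move=> fk; have [q00 _] := q0P.
have one (x : P) : (forall z : int, 10^-1 <= `|inner k x - z%:~R|) -> normc (1 + ek k (- x)) <= 2 * q0.
 move=> /far_cos h; rewrite -(@ler_pXn2r _ 2)// ?nnegrE ?normc_ge0 ?mulr_ge0//.
 have h2 : 0 <= (1 + cos (pi / 5)) / 2 :> R by have := cos_geN1 (pi / 5 : R); lra.
 rewrite [leRHS]exprMn [q0 ^+ 2]sqr_sqrtr// sqr_normcE ReD ImD ekN ReJ ImJ /ek /expi /=.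
 have := cos2Dsin2 (2 * pi * inner k x); move: h; move: (cos (2 * pi * inner k x)) (sin (2 * pi * inner k x)) (cos (pi / 5)) => a b c; nra.
have two (x : P) : normc (1 + ek k (- x)) <= 2 by apply: le_trans (normcD _ _) _; rewrite normc_ek (normc_real 1) normr1.
have -> : ek k (- (0, 0)) + ek k (- (1, 0)) + ek k (- (0, 1)) + ek k (- (1, 1)) = (1 + ek k (- (1, 0))) * (1 + ek k (- (0, 1))).
 have -> : ek k (- (0, 0) : P) = 1 by rewrite /ek /inner /= !oppr0 !mulr0 addr0 mulr0 expi0.
 have -> : ek k (- (1, 1) : P) = ek k (- (1, 0)) * ek k (- (0, 1))
  by rewrite -ekD; congr (ek k _); congr pair; rewrite /= ?oppr0 ?addr0 ?add0r.
 by ring.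
rewrite normcM; have -> : 4 * q0 = (2 * q0) * 2 by ring.
case: fk => h.
 by apply: ler_pM; rewrite ?normc_ge0//; apply: one => z; rewrite /inner /= mulr1 mulr0 addr0.
by rewrite mulrC; apply: ler_pM; rewrite ?normc_ge0//; apply: one => z; rewrite /inner /= mulr1 mulr0 add0r.
Qed.

Definition four : seq tl := [:: (o3, (0, 0)); (o3, (1, 0)); (o3, (0, 1)); (o3, (1, 1))].

Lemma rdec_four : exists s t, rdec o0 = s ++ four ++ t.
Proof.
(* Ahead of its unit tiles, [idec o0] lists 1 + 3 + 3 tiles of the other types. *)
exists [seq (p.1, pv p.2) | p <- take 7 (idec o0)], [seq (p.1, pv p.2) | p <- drop 11 (idec o0)].
rewrite /rdec -{1}(cat_take_drop 7 (idec o0)) map_cat; congr (_ ++ _).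
rewrite -{1}(cat_take_drop 4 (drop 7 (idec o0))) map_cat drop_drop; congr (_ ++ _).
by rewrite /four /= /pv /zv /= !mul0r !addr0.
Qed.

Lemma rdec_head j : exists x s, rdec j = (o0, x) :: s.
Proof. by elim/ord4_ind: j; rewrite /rdec /=; do 2 eexists. Qed.

(** Each supertile of level [n + 2] contains one of type 1 at level [n + 1], which contains four
    unit supertiles of level [n] whose phases partly cancel. A fixed proportion of the trivial bound
    is lost; 100 is a crude bound for [lambda^4 * ar j / 4]. *)
Lemma bd_far v k n b : 0 <= b -> bd v k n b -> far (sc (lam ^+ n) k) ->
 bd v k n.+2 (b * (1 - (1 - q0) / 100)).
Proof.
move=> b0 H fk; have [q00 q01] := q0P; have L0 := lamX_gt0 (2 * n).
have [l1 l2] := lam_bounds.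
pose M := b * lam ^+ (2 * n); have M0 : 0 <= M by rewrite mulr_ge0// ltW.
have A3 := ar_o3.
have h0 : normc (psum v n.+1 o0 k) <= M * (lam ^+ 2 * ar o0 - 4 * (1 - q0)).
 have [s [t e]] := rdec_four. have e2 := ar_rdec o0; rewrite e !big_cat /= !big_cons big_nil /= A3 in e2.
 rewrite -addn1 psum_add rsup1 e !big_cat /= !big_cons big_nil /= addr0 -!mulrDl !addrA.
 have bs (s' : seq tl) : normc (\sum_(p <- s') ek (sc (lam ^+ n) k) (- p.2) * psum v n p.1 k) <= M * \sum_(p <- s') ar p.1.
  rewrite (le_trans (normc_sum _ _ _))// mulr_sumr; apply: ler_sum => p _. by rewrite normcM normc_ek mul1r; exact: H.
 apply: le_trans (normcD _ _) _. apply: le_trans (lerD (normcD _ _) (bs t)) _. rewrite normcM.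
 have f4 := ler_pM (normc_ge0 _) (normc_ge0 _) (far_four fk) (H o3). have := lerD (bs s) f4; rewrite A3 mulr1 -/M -e2.
 move: (normc _) (\sum_(_ <- s) _) (\sum_(_ <- t) _) => x y z; clear -M0; rewrite /=; nra.
move=> j; have [x [s e]] := rdec_head j.
have h1 : bd v k n.+1 b by exact: bd_step.
apply: le_trans (psumS_le _ _ _ _) _; rewrite e big_cons /=.
have e2 := ar_rdec j; rewrite e big_cons /= in e2.
have e3 : lam ^+ (2 * n.+1) = lam ^+ 2 * lam ^+ (2 * n) by rewrite mulnS exprD.
have e4 : lam ^+ (2 * n.+2) = lam ^+ 2 * (lam ^+ 2 * lam ^+ (2 * n)) by rewrite mulnS exprD e3.
have hs : \sum_(p <- s) normc (psum v n.+1 p.1 k) <= b * (lam ^+ 2 * lam ^+ (2 * n)) * \sum_(p <- s) ar p.1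
 by rewrite mulr_sumr; apply: ler_sum => p _; rewrite -e3; exact: h1.
apply: (le_trans (lerD h0 hs)); rewrite e4.
have -> : \sum_(p <- s) ar p.1 = lam ^+ 2 * ar j - ar o0 by rewrite -e2 addrAC subrr add0r.
have a9 := ar_le9 j; have a1 := ar_ge1 j.
have key : (1 - q0) / 100 * (lam ^+ 2 * lam ^+ 2 * ar j) <= 4 * (1 - q0).
 have -> : (1 - q0) / 100 * (lam ^+ 2 * lam ^+ 2 * ar j) = (1 - q0) * (lam ^+ 2 * lam ^+ 2 * ar j / 100) by ring.
 have w : lam ^+ 2 <= 6 by rewrite lamE; lra. have w0 : 0 <= lam ^+ 2 by rewrite sqr_ge0.
 rewrite [leRHS]mulrC; apply: ler_wpM2l; first by rewrite subr_ge0 ltW.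
 rewrite ler_pdivrMr//; move: (lam ^+ 2) (ar j) w w0 a9 a1 => y z; clear; nra.
have := ler_wpM2l M0 key; rewrite /M.
move: (lam ^+ (2 * n)) (lam ^+ 2) (ar j) (ar o0) q0 => y z w a c; clear; lra.
Qed.

(** Otherwise both coordinates of [lambda^n k] would stay near the integers for all large [n], and
    [int_orbit] would give [k = 0]. *)
Lemma far_inf (k : P) n0 : k != 0 -> exists2 n, (n0 <= n)%N & far (sc (lam ^+ n) k).
Proof.
move=> k0; apply: contrapT => H.
have near n : (n0 <= n)%N -> (exists z : int, `|lam ^+ n * k.1 - z%:~R| < 10^-1) /\ (exists z : int, `|lam ^+ n * k.2 - z%:~R| < 10^-1).
 move=> nn; split; apply: contrapT => h; apply: H; exists n => //; [left|right] => z /=; rewrite leNgt; apply/negP => hz; apply: h; by exists z.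
move/eqP: k0; apply; rewrite [k]pairE; congr pair; apply: (@int_orbit _ n0) => n /near[? ?] //.
Qed.

Lemma bd_small u (k : P) (e : R) : k != 0 -> 0 < e -> exists n, bd (fun i _ => u i) k n e.
Proof.
move=> k0 e0; have [q00 q01] := q0P; pose q := 1 - (1 - q0) / 100.
have [q1 q2] : 0 <= q /\ q < 1 by rewrite /q; split; lra.
have U0 := umax_ge0 u.
have H (l : nat) : exists n, bd (fun i _ => u i) k n (umax u * q ^+ l).
 elim: l => [|l [n IH]].
  exists 0%N => j; rewrite muln0 !expr0 !mulr1 /psum /= big_seq1 normcM normc_ek mulr1 /=.
  by apply: le_trans (umax_ge u j) _; rewrite ler_peMr// ar_ge1.
 have [m nm fm] := far_inf n k0. exists m.+2; rewrite exprSr mulrA; apply: bd_far => //; first by rewrite mulr_ge0// exprn_ge0.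
 rewrite -(subnKC nm); elim: (m - n)%N => [|d]; first by rewrite addn0. by rewrite addnS; exact: bd_step.
have c : umax u * q ^+ l @[l --> \oo] --> umax u * (0 : R) by apply: cvgM; [exact: cvg_cst|apply: cvg_expr; rewrite ger0_norm].
rewrite mulr0 in c; move/cvgrPdist_le: c => /(_ e e0)[l _ /(_ l (leqnn l))]; rewrite /= sub0r normrN ger0_norm ?mulr_ge0 ?exprn_ge0// => le.
have [n hn] := H l; exists n => j; apply: le_trans (hn j) _.
by apply: ler_wpM2r; [exact: le_trans ler01 (ar_ge1 j)|apply: ler_wpM2r => //; exact: ltW (lamX_gt0 _)].
Qed.

Definition bmp (k0 : P) (r : R) (k : P) : R := plateau r^-1 r (k - k0).

Lemma bmpP k0 r k : 0 < r -> [/\ 0 <= bmp k0 r k, bmp k0 r k <= 1, (~ cbx k0 r k -> bmp k0 r k = 0) & bmp k0 r k0 = 1].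
Proof.
move=> r0; have ri : 0 < r^-1 by rewrite invr_gt0.
have [a b _ d] := plateauP r (k - k0) ri; split => //.
 move=> nk; apply: d; apply/negPn/negP; rewrite negb_or -!ltNge => /andP[/ltW h1 /ltW h2]. by apply: nk; apply/cbxP.
have [_ _ c _] := plateauP r (k0 - k0) ri; apply: c; rewrite subrr /= normr0 invrK subrr//.
Qed.

Lemma kc_bmp k0 r : 0 < r -> kc (bmp k0 r).
Proof. by move=> r0; apply: (kc_shift (- k0)); apply: kc_plateau; rewrite invr_gt0. Qed.

Lemma measurable_pt (k0 : P) : measurable ([set k0] : set BP).
Proof.
suff -> : [set k0] = cbx k0 0 by exact: measurable_cbx.
apply/seteqP; split => k /=; first by move=> ->; apply/cbxP; rewrite !subrr normr0.
move=> /cbxP[]; rewrite !normr_le0 !subr_eq0 => /eqP h1 /eqP h2.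
by rewrite [k]pairE [k0]pairE h1 h2.
Qed.

Lemma set_le_int (mu : PM) (S : set P) (f : P -> R) : measurable (S : set BP) ->
 mfun f ->
 (forall k, 0 <= f k) -> (forall k, S k -> 1 <= f k) -> (mu S <= \int[mu]_x (f x)%:E)%E.
Proof.
move=> mS mf f0 f1; rewrite (_ : mu S = mu (S `&` setT)) ?setIT// -[in leLHS](setIT S) -integral_indic//.
apply: ge0_le_integral => //.
- by apply/measurable_EFinP; apply: measurable_indic.
- by apply/measurable_EFinP.
move=> x _; rewrite lee_fin indicE; have [/set_mem h|_] := boolP (x \in _); [exact: f1|exact: f0].
Qed.

(** Positions in the supertile are at most [3 lambda^n], so moving the frequency by [rho / lambda^n]
    turns each phase by a multiple of [rho]. *)
Lemma psum_near v (U V : R) (k k0 : P) n j (rho : R) : 0 <= U -> 0 <= V -> 0 <= rho ->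
 (forall i, normc (v i k) <= U) ->
 (forall i, normc (v i k - v i k0) <= V * (`|k.1 - k0.1| + `|k.2 - k0.2|)) ->
 cbx k0 (rho / lam ^+ n) k ->
 normc (psum v n j k - psum v n j k0) <= 9 * lam ^+ (2 * n) * (rho * (24 * pi * U + 2 * V)).
Proof.
move=> U0 V0 rho0 vU vV /cbxP[d1 d2]; have pi0 := pi_gt0 R; have L1 := lamX_ge1 n; have L0 := lamX_gt0 n.
have [l1 l2] : [/\ `|k.1 - k0.1| * lam ^+ n <= rho & `|k.2 - k0.2| * lam ^+ n <= rho] by split; rewrite -ler_pdivlMr.
have one (p : tl) : p \in rsup n j ->
  normc (v p.1 k * ek k (- p.2) - v p.1 k0 * ek k0 (- p.2)) <= rho * (24 * pi * U + 2 * V).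
 move=> pin; have /allP/(_ p pin)/and4P[a1 a2 a3 a4] := rsup_in n j. have [w1 w3 h1 h3] := wh_bounds j.
 have [w1' _ h1' _] := wh_bounds p.1. have b1 : `|p.2.1| <= 3 * lam ^+ n
  by rewrite ger0_norm//; apply: (le_via (lam ^+ n * width R j)); [move: a2 w1'; clear; lra|rewrite mulrC ler_pM2r].
 have b2 : `|p.2.2| <= 3 * lam ^+ n
  by rewrite ger0_norm//; apply: (le_via (lam ^+ n * height R j)); [move: a4 h1'; clear; lra|rewrite mulrC ler_pM2r].
 have -> : v p.1 k * ek k (- p.2) - v p.1 k0 * ek k0 (- p.2) =
   v p.1 k * (ek k (- p.2) - ek k0 (- p.2)) + (v p.1 k - v p.1 k0) * ek k0 (- p.2) by ring.
 apply: le_trans (normcD _ _) _; rewrite !normcM normc_ek mulr1. have e1 : normc (ek k (- p.2) - ek k0 (- p.2)) <=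
   4 * pi * (`|k.1 - k0.1| * `|p.2.1| + `|k.2 - k0.2| * `|p.2.2|).
  by rewrite -(normrN p.2.1) -(normrN p.2.2); exact: ek_lip.
 have e2 : 4 * pi * (`|k.1 - k0.1| * `|p.2.1| + `|k.2 - k0.2| * `|p.2.2|) <= 24 * pi * rho.
  have m1 : `|k.1 - k0.1| * `|p.2.1| <= 3 * rho by apply: le_trans (ler_wpM2l (normr_ge0 _) b1) _; rewrite mulrCA; apply: ler_wpM2l.
  have m2 : `|k.2 - k0.2| * `|p.2.2| <= 3 * rho by apply: le_trans (ler_wpM2l (normr_ge0 _) b2) _; rewrite mulrCA; apply: ler_wpM2l.
  have -> : 24 * pi * rho = 4 * pi * (3 * rho + 3 * rho) by ring. by apply: ler_wpM2l; [rewrite mulr_ge0// ltW|exact: lerD].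
 have e3 := ler_pM (normc_ge0 _) (normc_ge0 _) (vU p.1) (le_trans e1 e2). have e4 : V * (`|k.1 - k0.1| + `|k.2 - k0.2|) <= V * (2 * rho).
  apply: ler_wpM2l => //; have x1 : `|k.1 - k0.1| <= rho by apply: le_trans l1; rewrite ler_peMr.
  by have x2 : `|k.2 - k0.2| <= rho; [apply: le_trans l2; rewrite ler_peMr|move: x1 x2; clear; lra].
 apply: le_trans (lerD e3 (le_trans (vV p.1) e4)) _. by apply: eqW; ring.
rewrite /psum -sumrB (le_trans (normc_sum _ _ _))//.
rewrite big_seq; apply: le_trans (ler_sum _ (fun p pin => one p pin)) _.
rewrite -big_seq sum_cst -[leLHS]mulr_natl.
apply: ler_wpM2r; last exact: size_rsup.
by rewrite mulr_ge0// addr_ge0// ?mulr_ge0// ltW.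
Qed.

(** On a bump of radius [rho / lambda^n] the squared sums of size [lambda^(4 n)] cancel the factor
    [lambda^(-4 n)] of [conc_bound], and the bound is free of both levels. *)
Lemma near_conc : exists2 C : R, 0 <= C & forall v (U V : R) n m (k0 : P) (b rho : R),
 0 <= U -> 0 <= V -> 0 <= b -> 0 < rho -> rho <= 1 ->
 (forall i k, normc (v i k) <= U) ->
 (forall i k, normc (v i k - v i k0) <= V * (`|k.1 - k0.1| + `|k.2 - k0.2|)) ->
 (forall i, normc (psum v n i k0) <= b * lam ^+ (2 * n)) ->
 mfun (fun k => normc (psum v (n + m) o3 k) ^+ 2) ->
 let F (k : P) := bmp k0 (rho / lam ^+ n) k * ((lam ^+ (2 * (n + m)))^-1 * normc (psum v (n + m) o3 k) ^+ 2) in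
 rint2 F /\ Int2 F <= C * (b + 9 * (rho * (24 * pi * U + 2 * V))) ^+ 2.
Proof.
have [C C0 H] := conc_bound; exists (C * 9); first by rewrite mulr_ge0.
move=> v U V n m k0 b rho U0 V0 b0 rho0 rho1 vU vV hb mp F.
have L0 := lamX_gt0 n; have L20 := lamX_gt0 (2 * n).
have r0 : 0 < rho / lam ^+ n by rewrite divr_gt0.
pose a := b + 9 * (rho * (24 * pi * U + 2 * V)).
have a0 : 0 <= a.
 rewrite addr_ge0// mulr_ge0// mulr_ge0 ?(ltW rho0)// addr_ge0 ?mulr_ge0//. by rewrite ltW// pi_gt0.
have hA i k : bmp k0 (rho / lam ^+ n) k * normc (psum v n i k) ^+ 2 <= (a * lam ^+ (2 * n)) ^+ 2.
 have [f0 f1 fz _] := bmpP k0 k r0. have [kb|/fz ->] := pselect (cbx k0 (rho / lam ^+ n) k); last by rewrite mul0r sqr_ge0.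
 have h := psum_near i U0 V0 (ltW rho0) (fun i => vU i k) (fun i => vV i k) kb. have h2 : normc (psum v n i k) <= a * lam ^+ (2 * n).
  rewrite -[psum v n i k](subrK (psum v n i k0)) (le_trans (normcD _ _))// /a.
  have -> : (b + 9 * (rho * (24 * pi * U + 2 * V))) * lam ^+ (2 * n) =
    9 * lam ^+ (2 * n) * (rho * (24 * pi * U + 2 * V)) + b * lam ^+ (2 * n) by ring.
  exact: lerD.
 apply: (le_via (normc (psum v n i k) ^+ 2)); first by rewrite ler_piMl// sqr_ge0. by rewrite lerXn2r ?nnegrE ?normc_ge0 ?mulr_ge0// ltW.
have [rF iF] := H v n m k0 (rho / lam ^+ n) (bmp k0 (rho / lam ^+ n)) _ (ltW r0) (sqr_ge0 _)
 (kc_meas (kc_bmp k0 r0)) (fun k => let: And4 h _ _ _ := bmpP k0 k r0 in h)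
 (fun k => let: And4 _ _ h _ := bmpP k0 k r0 in h) mp hA.
split => //; apply: (le_trans iF).
have -> : lam ^+ n * (rho / lam ^+ n) = rho by rewrite mulrC divfK// lt0r_neq0.
have -> : (a * lam ^+ (2 * n)) ^+ 2 * C * (rho + 2) ^+ 2 * lam ^- (2 * n) ^+ 2 = C * (rho + 2) ^+ 2 * a ^+ 2
 by rewrite exprMn exprVn; field; exact: lt0r_neq0.
apply: ler_wpM2r; first exact: sqr_ge0.
by apply: ler_wpM2l => //; move: rho0 rho1; clear; nra.
Qed.

Lemma dens_psum u N k : dens u N k = lam ^- (2 * N) * normc (psum (fun i _ => u i) N o3 k) ^+ 2.
Proof. by rewrite /dens /tsum /wsup big_map. Qed.

Lemma meas_psum u N : mfun (fun k => normc (psum (fun i _ => u i) N o3 k) ^+ 2).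
Proof.
have := meas_tsum (wsup u N); congr measurable_fun; apply/funext => k.
by rewrite /tsum /wsup big_map.
Qed.

(** At a level [n] where the sums at [k0] are at most [t] per unit area, a bump of radius
    [t / lambda^n] carries mass of the order [t^2] under all later densities. *)
Lemma atom_zero u mu (k0 : P) : vague_cluster (dens u) mu -> k0 != 0 -> mu [set k0] = 0%E.
Proof.
move=> [_ H] k00; have [C C0 HC] := near_conc; have U0 := umax_ge0 u.
pose D := 9 + 9 * (24 * pi * umax u + 2 * 0).
have D0 : 0 <= D by rewrite /D mulr0 addr0 addr_ge0// mulr_ge0// mulr_ge0// mulr_ge0// ltW// pi_gt0.
apply/eqP; rewrite eq_le measure_ge0 andbT; apply/lee_addgt0Pr => e e0; rewrite add0e.
pose t := Num.min 1 (e / (C * D ^+ 2 + 1)).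
have K0 : 0 < C * D ^+ 2 + 1 by rewrite ltr_wpDl// mulr_ge0// sqr_ge0.
have t0 : 0 < t by rewrite lt_min ltr01 divr_gt0.
have t1 : t <= 1 by rewrite ge_min lexx.
have t2 : (C * D ^+ 2 + 1) * t <= e by rewrite mulrC -ler_pdivlMr// ge_min lexx orbT.
have [n hn] := bd_small u k00 t0.
have r0 : 0 < t / lam ^+ n by rewrite divr_gt0// lamX_gt0.
apply: (le_via (\int[mu]_x (bmp k0 (t / lam ^+ n) x)%:E)%E).
 apply: set_le_int => //.
 - exact: measurable_pt.
 - exact: kc_meas (kc_bmp k0 r0).
 - by move=> k; have [] := bmpP k0 k r0.
 - by move=> k ->; have [_ _ _ ->] := bmpP k0 k0 r0.
have f0 k : 0 <= bmp k0 (t / lam ^+ n) k by have [] := bmpP k0 k r0.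
apply: (H _ (kc_bmp k0 r0) f0 e n).1 => N nN.
have hb i : normc (psum (fun i _ => u i) n i k0) <= (9 * t) * lam ^+ (2 * n).
 apply: le_trans (hn i) _; rewrite mulrAC; apply: ler_wpM2r; first exact: ltW (lamX_gt0 _).
 by rewrite mulrC; apply: ler_wpM2r; [exact: ltW|exact: ar_le9].
have uV (i : 'I_4) (k : P) : normc (u i - u i) <= 0 * (`|k.1 - k0.1| + `|k.2 - k0.2|) by rewrite subrr (normc_real 0) normr0 mul0r.
have hF := HC (fun i _ => u i) (umax u) 0 n (N - n)%N k0 (9 * t) t U0 (lexx 0) (mulr_ge0 (ler0n _ 9) (ltW t0)) t0 t1
 (fun i k => umax_ge u i) uV hb.
rewrite subnKC// in hF; have {}hF := (hF (meas_psum u N)).2.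
have -> : (fun k => bmp k0 (t / lam ^+ n) k * dens u N k) = (fun k => bmp k0 (t / lam ^+ n) k *
  (lam ^- (2 * N) * normc (psum (fun i _ => u i) N o3 k) ^+ 2)) by apply/funext => k; rewrite dens_psum.
apply: (le_trans hF).
have -> : C * (9 * t + 9 * (t * (24 * pi * umax u + 2 * 0))) ^+ 2 = C * D ^+ 2 * t * t by rewrite /D; ring.
apply: le_trans t2; rewrite mulrDl mul1r -[leLHS]addr0; apply: lerD; last exact: ltW.
by rewrite ler_piMr// mulr_ge0 ?(ltW t0)// mulr_ge0// sqr_ge0.
Qed.

(** * The intensity of the central peak *)

Lemma poisson_near (e s t : R) : 0 < e -> `|t - s| <= 3 -> poisson e t <= (1 + 24 / e) ^+ 2 * poisson e s.
Proof.
move=> e0 ts; have pi4 : (pi : R) <= 4 by have := pihalf_lt2 R; lra.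
rewrite /poisson; set a := 2 * pi * t; set b := 2 * pi * s.
have p (y : R) : 0 < e ^+ 2 + y ^+ 2 by rewrite ltr_pwDl ?sqr_ge0// exprn_gt0.
rewrite mulrCA ler_pM2l ?mulr_gt0// -[leRHS]mulrC ler_pdivlMl// -[leLHS]/(_ / _) ler_pdivrMr//.
have ab : `|a - b| <= 24.
 rewrite -mulrBr normrM ger0_norm ?mulr_ge0 ?pi_ge0//.
 by apply: (le_via (2 * 4 * 3)); [apply: ler_pM => //; rewrite ?mulr_ge0 ?pi_ge0// ler_pM2l|lra].
have b2 : b ^+ 2 <= a ^+ 2 + 48 * `|a| + 576.
 have h : `|b| <= `|a| + 24 by have := ler_distD a b 0; rewrite !subr0 distrC; move: ab; lra.
 rewrite -(real_normK (num_real b)) -(real_normK (num_real a)).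
 have -> : `|a| ^+ 2 + 48 * `|a| + 576 = (`|a| + 24) ^+ 2 by ring. by rewrite lerXn2r// nnegrE addr_ge0.
pose d := 24 / e; have d0 : 0 < d by rewrite divr_gt0.
have de : d * e = 24 by rewrite /d divfK// gt_eqF.
have h1 : 48 * `|a| <= d * (e ^+ 2 + a ^+ 2).
 have : 0 <= d * (e - `|a|) ^+ 2 by rewrite mulr_ge0 ?sqr_ge0// ltW.
 have -> : d * (e - `|a|) ^+ 2 = d * (e ^+ 2 + `|a| ^+ 2) - 2 * (d * e) * `|a| by ring. by rewrite de real_normK ?num_real//; lra.
have h2 : 576 <= d ^+ 2 * (e ^+ 2 + a ^+ 2).
 have -> : 576 = (d * e) ^+ 2 by rewrite de; ring. by rewrite exprMn ler_wpM2l ?sqr_ge0// lerDl sqr_ge0.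
have h3 : 0 <= d * (e ^+ 2 + a ^+ 2) by rewrite mulr_ge0 ?ltW.
have -> : (1 + d) ^+ 2 * (e ^+ 2 + a ^+ 2) = e ^+ 2 + a ^+ 2 + 2 * (d * (e ^+ 2 + a ^+ 2)) + d ^+ 2 * (e ^+ 2 + a ^+ 2) by ring.
by move: b2 h1 h2 h3; lra.
Qed.

Definition qq (e : R) : R := ((1 + 24 / e) ^+ 2) ^+ 2.

Lemma qq_ge1 e : 0 < e -> 1 <= qq e.
Proof. by move=> e0; rewrite !exprn_ege1// lerDl divr_ge0// ltW. Qed.

Lemma K2_ge0 (e : R) x : 0 < e -> 0 <= K2 e x.
Proof. by move=> e0; rewrite mulr_ge0 ?(ltW (poisson_gt0 _ e0)). Qed.

Lemma K2_near (e : R) x y : 0 < e -> `|y.1 - x.1| <= 3 -> `|y.2 - x.2| <= 3 -> K2 e y <= qq e * K2 e x.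
Proof.
move=> e0 h1 h2; have p z := ltW (poisson_gt0 z e0).
have -> : qq e * K2 e x = ((1 + 24 / e) ^+ 2 * poisson e x.1) * ((1 + 24 / e) ^+ 2 * poisson e x.2) by rewrite /qq /K2; ring.
by rewrite /K2 ler_pM ?p// poisson_near.
Qed.

Lemma K2_Int (e : R) : 0 < e -> rint2 (K2 e) /\ Int2 (K2 e) = 1.
Proof.
move=> e0; have [r1 i1] := K2_integral; have ei : 0 < e^-1 by rewrite invr_gt0.
have p y : poisson e y = e^-1 * poisson 1 (e^-1 * y) by rewrite -(poisson_scale _ e0) mulVKf ?gt_eqF// mulKf ?gt_eqF.
have -> : K2 e = (fun x => e ^- 2 * K2 1 (affine2 e^-1 P0 x))
 by apply/funext => x; rewrite /K2 !p /affine2 /= !addr0 mulrACA -invfM -expr2.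
have r2 := integrable_affine2 P0 ei r1.
split; first exact: rintZ.
rewrite IntZ// /Int (Rintegral_affine2 P0 ei r1) [X in _ * (_ * X)]i1 mulr1 exprVn mulfV// gt_eqF//.
by rewrite invr_gt0 exprn_gt0.
Qed.

Lemma inner_sc (c : R) k x : inner (sc c k) x = inner k (sc c x).
Proof. by rewrite /inner /sc /=; ring. Qed.

Lemma normc2_sum (T : Type) (l : seq T) (c : T -> R) (f : T -> P) k :
 normc (\sum_(x <- l) (c x)%:C%C * ek k (- f x)) ^+ 2 =
 \sum_(x <- l) \sum_(x' <- l) c x * c x' * cos (2 * pi * inner k (f x' - f x)).
Proof.
rewrite sqr_normcE Re_sum Im_sum !expr2 !big_distrlr /= -big_split; apply: eq_bigr => x _ /=.
rewrite -big_split; apply: eq_bigr => x' _ /=.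
by rewrite !innerN !mulrN cosN cosN !sinN innerB [_ * (inner _ _ - _)]mulrBr cosD cosN sinN; ring.
Qed.

(** Reference weights: the corners of a supertile weighted by area imitate Lebesgue measure, so
    their spectral mass near 0 can be computed directly. *)
Definition aw (i : 'I_4) : R[i] := (ar i)%:C%C.
Definition hsum N (z : P) : R := \sum_(y <- rsup N o3) \1_(hbox 1 y) z.

Lemma hbox1_near (y : tl) z : hbox 1 y z -> `|y.2.1 - z.1| <= 3 /\ `|y.2.2 - z.2| <= 3.
Proof.
have [w1 w3 h1 h3] := wh_bounds y.1.
rewrite /hbox /= !in_itv /= !mul1r => -[/andP[a1 a2] /andP[a3 a4]].
by rewrite !ler_norml; split; apply/andP; split; lra.
Qed.

Definition hK (e : R) N x : R := Int2 (fun z => hsum N z * K2 e (z - x)).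

Lemma rint_hbK (e : R) x (y : tl) : 0 < e -> rint2 (fun z => \1_(hbox 1 y) z * K2 e (z - x)).
Proof.
move=> e0; have [rk _] := Int_shift (- x) (K2_Int e0).1; have mk := rint_meas rk.
apply: rint_le rk => [|z].
 by apply: mfunM; [exact: rint_meas (hbox_int y ltr01).1|exact: mk].
by rewrite normrM (ger0_norm (K2_ge0 _ e0)) ler_piMl ?K2_ge0// indicE; case: (_ \in _); rewrite ?normr1 ?normr0.
Qed.

Lemma hKE (e : R) N x : 0 < e -> rint2 (fun z => hsum N z * K2 e (z - x)) /\
 hK e N x = \sum_(y <- rsup N o3) Int2 (fun z => \1_(hbox 1 y) z * K2 e (z - x)).
Proof.
move=> e0; have h y := rint_hbK x y e0.
have E : (fun z => hsum N z * K2 e (z - x)) = (fun z => \sum_(y <- rsup N o3) \1_(hbox 1 y) z * K2 e (z - x))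
 by apply/funext => z; rewrite /hsum mulr_suml.
by rewrite /hK E; split; [exact: rint_sum|rewrite Int_sum].
Qed.

Definition Ksum (e : R) N x : R := \sum_(y <- rsup N o3) ar y.1 * K2 e (y.2 - x).

(** Spreading the mass of a corner over its tile moves the argument by at most 3 in each coordinate,
    which changes the kernel by at most the factor [qq e]. *)
Lemma Ksum_hK (e : R) N x : 0 < e -> Ksum e N x <= qq e * hK e N x /\ hK e N x <= qq e * Ksum e N x.
Proof.
move=> e0; rewrite (hKE N x e0).2 /Ksum !mulr_sumr.
have q0 : 0 <= qq e := le_trans ler01 (qq_ge1 e0).
have E (y : tl) : ar y.1 * K2 e (y.2 - x) = Int2 (fun z => K2 e (y.2 - x) * \1_(hbox 1 y) z)
 by have [r1 e1] := hbox_int y (ltr01 : 0 < (1 : R)); rewrite IntZ// e1 expr1n mul1r mulrC.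
have near (y : tl) z : hbox 1 y z -> `|(y.2 - x).1 - (z - x).1| <= 3 /\ `|(y.2 - x).2 - (z - x).2| <= 3
 by move=> /hbox1_near[h1 h2]; rewrite /= !opprB !addrA !subrK.
split; apply: ler_sum => y _; rewrite ?E.
 rewrite -IntZ; last exact: rint_hbK.
 apply: le_Int => [||z]; [by apply: rintZ; exact: (hbox_int y ltr01).1|by apply: rintZ; exact: rint_hbK|].
 rewrite indicE; have [/set_mem yz|_] := boolP (z \in _); last by rewrite !(mul0r, mulr0).
 by have [h1 h2] := near y z yz; rewrite mulr1 mul1r; exact: K2_near.
rewrite -IntZ; last by apply: rintZ; exact: (hbox_int y ltr01).1.
apply: le_Int => [||z]; [exact: rint_hbK|by apply: rintZ; apply: rintZ; exact: (hbox_int y ltr01).1|].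
rewrite indicE; have [/set_mem yz|_] := boolP (z \in _); last by rewrite !(mul0r, mulr0).
by have [h1 h2] := near y z yz; rewrite mulr1 mul1r; apply: K2_near => //; rewrite distrC.
Qed.

Lemma hsum_le1 N z : 0 <= hsum N z /\ hsum N z <= \1_(hbox (lam ^+ N) ((o3, 0) : tl)) z.
Proof.
split; first by apply: sumr_ge0 => y _; rewrite indicE ler0n.
rewrite [leRHS]indicE; have [zb|zb] := boolP (z \in _).
 by apply: hbox_sum_le1 (rsup_dj N o3).
rewrite /hsum big1_seq// => y /andP[_ ys]; rewrite indicE memNset// => yz; move/negP: zb; apply; apply/mem_set.
have /and4P[a1 a2 a3 a4] := allP (rsup_in N o3) y ys.
move: yz; rewrite /hbox /= !in_itv /= !mul1r !add0r => -[/andP[b1 b2] /andP[b3 b4]].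
by split; apply/andP; split; [exact: le_trans a1 b1|exact: lt_le_trans b2 a2|exact: le_trans a3 b3|exact: lt_le_trans b4 a4].
Qed.

Lemma hK_le1 (e : R) N x : 0 < e -> hK e N x <= 1.
Proof.
move=> e0; have [rk ik] := K2_Int e0; have [rs is1] := Int_shift (- x) rk.
rewrite -ik -is1; apply: le_Int => //; first exact: (hKE N x e0).1.
move=> z; have [h0 h1] := hsum_le1 N z; rewrite ler_piMl ?K2_ge0// (le_trans h1)// indicE.
Qed.

Lemma hK_ge (e L : R) N x : 1 <= e -> ~~ bdry L N o3 x ->
 Int2 (fun z => \1_(cbx P0 L) z * K2 e z) <= hK e N x.
Proof.
move=> e1 nb; have e0 : 0 < e by lra.
have [rk ik] := K2_Int e0; have l0 := lamX_gt0 N.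
pose B := hbox (lam ^+ N) ((o3, 0) : tl); have [rB iB] : rint2 (ind B) /\ _ := hbox_int (o3, 0) l0.
have rH : rint2 (hsum N) by apply: rint_sum => y; exact: (hbox_int y ltr01).1.
have iH : Int2 (hsum N) = Int2 (ind B).
 rewrite iB Int_sum; last by move=> y; exact: (hbox_int y ltr01).1.
 rewrite /= -exprM mulnC -lsum_rsup; apply: eq_bigr => y _. by rewrite (hbox_int y ltr01).2 expr1n mul1r.
have mk := rint_meas rk; have rC : rint2 (fun z => \1_(cbx P0 L) z * K2 e z).
 apply: rint_le rk => [|z].
  by apply: mfunM; [apply: measurable_indic; exact: measurable_cbx|exact: mk].
 by rewrite normrM (ger0_norm (K2_ge0 _ e0)) ler_piMl ?K2_ge0// indicE; case: (_ \in _); rewrite ?normr1 ?normr0.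
have [rs <-] := Int_shift (- x) rC; have [rh _] := hKE N x e0.
rewrite -subr_ge0 /hK -IntB//.
(* [hsum N] lies below the indicator of the supertile and has the same integral. Adding this
   function of integral 0 permits a pointwise comparison in place of an argument with null sets; 4
   bounds [K2 e] for [e >= 1]. *)
have r2 : rint2 (fun z => 4 * (hsum N z - \1_B z)) by apply: rintZ; exact: rintB.
apply: (le_via (Int2 (fun z => 4 * (hsum N z - \1_B z)))).
 by rewrite IntZ ?IntB ?iH ?subrr ?mulr0//; exact: rintB.
apply: le_Int => //; first exact: rintB.
move=> z; have [h0 h1] := hsum_le1 N z.
have k4 : K2 e (z - x) <= 4.
 have p (t : R) : poisson e t <= 2.
  rewrite /poisson ler_pdivrMr ?ltr_pwDl ?sqr_ge0 ?exprn_gt0//.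
  rewrite ler_pM2l//; apply: (le_via (e ^+ 2)); last by rewrite lerDl sqr_ge0. by rewrite expr2 ler_peMr// ltW.
 have -> : 4 = 2 * 2 :> R by ring. by rewrite /K2 ler_pM ?(ltW (poisson_gt0 _ e0))// p.
have cB : \1_(cbx P0 L) (z - x) <= \1_B z :> R.
 rewrite !indicE; have [/set_mem/cbxP[]|_] := boolP (z - x \in _); last exact: ler0n.
 rewrite /= !subr0 !ler_norml => /andP[a1 a2] /andP[a3 a4]; move: nb; rewrite !negb_or -!ltNge => /and4P[b1 b2 b3 b4].
 have q (u v w : R) : - L <= u - v -> u - v <= L -> L < v -> v < w - L -> 0 <= u /\ u < w by move=> *; split; lra.
 have [c1 c2] := q _ _ _ a1 a2 b1 b2; have [c3 c4] := q _ _ _ a3 a4 b3 b4.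
 rewrite mem_set// /B /hbox /= !in_itv /= !add0r; split; apply/andP; split; assumption.
have kx := K2_ge0 (z - x) e0; have B0 : 0 <= \1_B z :> R by rewrite indicE ler0n.
have := ler_wpM2r kx cB; have := ler_wpM2l (_ : 0 <= \1_B z - hsum N z) k4; rewrite subr_ge0 => /(_ h1).
move: (\1_B z) (hsum N z) (K2 e (z - x)) (\1_(cbx 0 L) _) => p q r s; clear; lra.
Qed.

Lemma K2_core (e d : R) : 0 < e -> 0 < d -> exists L : R, 0 <= L /\ 1 - d <= Int2 (fun z => \1_(cbx P0 L) z * K2 e z).
Proof.
move=> e0 d0; have [rk ik] := K2_Int e0.
pose F (n : nat) z : R := \1_(cbx P0 n%:R) z * K2 e z.
have [|n z|z|_ c] := @Int_dominated _ _ _ (leb2 R) F (K2 e) (K2 e) _ rk.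
- by move=> n; apply: mfunM; [apply: measurable_indic; exact: measurable_cbx|exact: rint_meas rk].
- by rewrite normrM (ger0_norm (K2_ge0 _ e0)) ler_piMl ?K2_ge0// indicE; case: (_ \in _); rewrite ?normr1 ?normr0.
- apply: cvg_near_cst; exists (Num.truncn (`|z.1| + `|z.2|)).+1 => // n /= nz.
 rewrite /F indicE mem_set ?mul1r//; apply/cbxP; rewrite /= !subr0.
 have t : `|z.1| + `|z.2| <= n%:R by apply: ltW; apply: lt_le_trans (truncnS_gt _) _; rewrite ler_nat.
 by split; apply: le_trans t; rewrite ?lerDl ?lerDr.
move/cvgrPdist_le: c => /(_ d d0)[n _ /(_ n (leqnn n))]; rewrite ik => h.
exists n%:R; split => //; have := le_trans (ler_norm _) h; rewrite -/(F n); move: (Int _ _) => y; lra.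
Qed.

Definition Qm (e : R) N : R := Int2 (fun k => w2 e k * dens aw N k).

Lemma QmE (e : R) N : 0 < e -> rint2 (fun k => w2 e k * dens aw N k) /\
 Qm e N = lam ^- (2 * N) * \sum_(x <- rsup N o3) ar x.1 * Ksum e N x.2.
Proof.
move=> e0; pose G (x y : tl) k : R := w2 e k * cos (2 * pi * inner k (y.2 - x.2)).
have rG (x y : tl) : rint2 (G x y).
 apply: rint_le (rint_w2 e0) => [|k]; last by apply: normr_w2M_le; rewrite ler_norml cos_geN1 cos_le1.
 apply: mfunM; first exact: meas_w2.
 have -> : (fun k => cos (2 * pi * inner k (y.2 - x.2))) = (fun k => cos (2 * pi * inner (y.2 - x.2) k))
  by apply/funext => k; congr (cos (_ * _)); rewrite /inner; ring.
 exact: cont_mfun (@continuous_cos_inner (y.2 - x.2)).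
pose H k := lam ^- (2 * N) * \sum_(x <- rsup N o3) \sum_(y <- rsup N o3) (ar x.1 * ar y.1) * G x y k.
have E : (fun k => w2 e k * dens aw N k) = H.
 apply/funext => k; rewrite dens_psum /psum /aw normc2_sum mulrCA /H; congr (_ * _).
 rewrite mulr_sumr; apply: eq_bigr => x _; rewrite mulr_sumr; apply: eq_bigr => y _. by rewrite /G mulrCA.
have r1 (x : tl) : rint2 (fun k => \sum_(y <- rsup N o3) (ar x.1 * ar y.1) * G x y k) by apply: rint_sum => y; exact: rintZ.
rewrite /Qm E; split; first by apply: rintZ; exact: rint_sum.
rewrite IntZ; last exact: rint_sum.
congr (_ * _); rewrite Int_sum//; apply: eq_bigr => x _; rewrite Int_sum; last by move=> y; exact: rintZ.
rewrite /Ksum mulr_sumr; apply: eq_bigr => y _; rewrite IntZ// (Int_w2_cos _ e0).1.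
by rewrite mulrA.
Qed.

Lemma Qm_le (e : R) N : 0 < e -> Qm e N <= qq e.
Proof.
move=> e0; rewrite (QmE N e0).2 ler_pdivrMl ?lamX_gt0//.
have := lsum_rsup N o3; rewrite ar_o3 mulr1 => <-; rewrite /lsum mulr_suml; apply: ler_sum => x _.
apply: ler_wpM2l; first exact: le_trans ler01 (ar_ge1 x.1).
apply: le_trans (Ksum_hK N x.2 e0).1 _.
by rewrite ler_piMr ?hK_le1// (le_trans ler01 (qq_ge1 e0)).
Qed.

(** Corners outside the boundary layer see almost the whole kernel. The layer has of the order of
    [lambda^N] corners against an area of [lambda^(2 N)]; 180 is 9, the bound for [ar], times 20
    from [bdry_count]. *)
Lemma Qm_ge (e d : R) : 1 <= e -> 0 < d -> exists N1, forall N, (N1 <= N)%N -> 1 - d <= qq e * Qm e N.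
Proof.
move=> e1 d0; have e0 : 0 < e by lra.
have d2 : 0 < d / 2 by rewrite divr_gt0.
have [L [L0 hL]] := K2_core e0 d2; set m := Int _ _ in hL.
have c : 180 * (L + 2) * lam ^- n @[n --> \oo] --> (0 : R)
 by rewrite -[X in _ --> X](mulr0 (180 * (L + 2))); apply: cvgM_cst; exact: lamV_cvg.
have [N1 H] := cvg0_ev c d2; exists N1 => N /H hN.
have l0 := lamX_gt0 N; have l20 := lamX_gt0 (2 * N).
have m1 : m <= 1.
 have [rk ik] := K2_Int e0; rewrite -ik; apply: (le_Int0 _ _ rk _).2 => [|z|z].
 - by apply: mfunM; [apply: measurable_indic; exact: measurable_cbx|exact: rint_meas rk].
 - by rewrite mulr_ge0 ?K2_ge0// indicE ler0n.
 - by rewrite ler_piMl ?K2_ge0// indicE; case: (_ \in _).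
have m0 : 0 <= m by apply: Int_ge0 => z; rewrite mulr_ge0 ?K2_ge0// indicE ler0n.
rewrite (QmE N e0).2 mulrCA ler_pdivlMl// mulr_sumr.
have b := bdry_count N o3 L0.
apply: (le_via (\sum_(x <- rsup N o3) (ar x.1 * m - 9 * (bdry L N o3 x.2)%:R))).
 rewrite sumrB -mulr_suml -mulr_sumr -[\sum_(x <- _) ar x.1]/(lsum _) lsum_rsup ar_o3 mulr1.
 have : 9 * \sum_(x <- rsup N o3) (bdry L N o3 x.2)%:R <= lam ^+ (2 * N) * (d / 2).
  apply: (le_via (9 * (20 * (L + 2) * lam ^+ N))); first by rewrite ler_pM2l.
  have := ler_wpM2r (ltW l20) hN; rewrite [leRHS]mulrC; apply: le_trans. apply: eqW; rewrite mulnC exprM; field; exact: lt0r_neq0.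
 have := ler_wpM2l (ltW l20) hL; move: (\sum_(x <- _) _) => y; clear; lra.
apply: ler_sum => x _; have a1 := le_trans ler01 (ar_ge1 x.1).
rewrite mulrCA; have k1 := (Ksum_hK N x.2 e0).2.
have [bx|bx] := boolP (bdry L N o3 x.2).
 rewrite mulr1; apply: (le_via 0); last by rewrite mulr_ge0// (le_trans _ k1)//; apply: Int_ge0 => z; rewrite mulr_ge0 ?K2_ge0//; exact: (hsum_le1 N z).1.
 have := ler_pM a1 m0 (ar_le9 x.1) m1; lra.
rewrite mulr0 subr0; apply: ler_wpM2l => //; apply: le_trans k1.
exact: hK_ge.
Qed.

(** The choice [e = 24 / s] makes [qq e] equal to [(1 + s)^4], at most [1 + 15 s]. *)
Lemma Qm_bounds (s : R) : 0 < s -> s <= 1 -> (forall N, Qm (24 / s) N <= 1 + 15 * s) /\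
 exists N1, forall N, (N1 <= N)%N -> 1 - 16 * s <= Qm (24 / s) N.
Proof.
move=> s0 s1; have e1 : 1 <= 24 / s by rewrite ler_pdivlMr//; lra.
have e0 : 0 < 24 / s by lra.
have qE : qq (24 / s) <= 1 + 15 * s.
 have -> : qq (24 / s) = (1 + s) ^+ 4 by rewrite /qq; field; rewrite gt_eqF.
 have h n : s ^+ n.+1 <= s by rewrite exprS ler_piMr ?exprn_ile1// ltW.
 have -> : (1 + s) ^+ 4 = 1 + 4 * s + 6 * s ^+ 2 + 4 * s ^+ 3 + s ^+ 4 by ring.
 by have := h 1%N; have := h 2%N; have := h 3%N; clear; lra.
split => [N|]; first exact: le_trans (Qm_le N e0) qE.
have [N1 H] := Qm_ge e1 s0; exists N1 => N /H h.
have Q0 : 0 <= Qm (24 / s) N by apply: Int_ge0 => k; rewrite mulr_ge0 ?dens_ge0// ltW// w2_gt0.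
have := ler_wpM2r Q0 qE; have := ler_wpM2l (ltW s0) (le_trans (Qm_le N e0) qE).
nra.
Qed.

Lemma rint_bmp_dens u N (r : R) : 0 < r -> rint2 (fun k => bmp 0 r k * dens u N k).
Proof.
move=> r0; apply: (kc_rint leb2_lf); apply: kcM; first exact: kc_bmp.
by move=> k; apply: cvgM_cst; exact: continuous_tsum.
Qed.

Lemma wexp_bounds (e t : R) : 0 < e -> 1 - e * `|t| <= wexp e t /\ wexp e t * `|t| <= 2 / e * wexp (e / 2) t.
Proof.
move=> e0; split; first by rewrite /wexp expR_ge1Dx.
have -> : wexp e t = wexp (e / 2) t * wexp (e / 2) t by rewrite /wexp -expRD; congr expR; field.
have h : e / 2 * `|t| * wexp (e / 2) t <= 1.
 rewrite /wexp expRN ler_pdivrMr ?expR_gt0// mul1r. by apply: le_trans (expR_ge1Dx _); rewrite lerDr.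
have w0 := wexp_gt0 (e / 2) t.
have -> : wexp (e / 2) t * wexp (e / 2) t * `|t| = 2 / e * (e / 2 * `|t| * wexp (e / 2) t) * wexp (e / 2) t by field; rewrite gt_eqF.
by apply: ler_wpM2r; [exact: ltW|rewrite ler_piMr// divr_ge0// ltW].
Qed.

(** The bump is compared with two exponential weights of nearly unit mass. The weight [w2 e] is
    almost 1 on its support, which bounds the mass from above; the narrower [w2 f] exceeds the bump
    by at most a small multiple of [w2 (f / 2)], which bounds it from below. *)
Lemma ref_mass (t : R) : 0 < t -> t <= 1 -> exists2 r0 : R, 0 < r0 & forall r, 0 < r -> r <= r0 ->
 exists N1, forall N, (N1 <= N)%N -> `|Int2 (fun k => bmp 0 r k * dens aw N k) - 1| <= t.
Proof.
move=> t0 t1; pose s := t / 45; have [s0 s1] : 0 < s /\ s <= 1 by rewrite /s; split; lra.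
pose e := 24 / s; have e0 : 0 < e by rewrite divr_gt0.
exists (Num.min 1 (s / (2 * e))); first by rewrite lt_min ltr01 divr_gt0// mulr_gt0.
move=> r rp; rewrite le_min => /andP[r1 re].
pose f := 24 / (t * r / 45); have tr0 : 0 < t * r / 45 by rewrite divr_gt0// mulr_gt0.
have tr1 : t * r / 45 <= 1 by nra.
have f0 : 0 < f by rewrite divr_gt0.
have [_ [N1 HN]] := Qm_bounds tr0 tr1; have [HU _] := Qm_bounds s0 s1.
exists N1 => N nN; have rb := rint_bmp_dens aw N rp; set I := Int _ _.
have d0 k := dens_ge0 aw N k.
have le1 g (y : R) : 0 < g -> wexp g y <= 1 by move=> g0; rewrite /wexp -expR0 ler_expR oppr_le0 mulr_ge0// ltW.
have up : (1 - s) * I <= 1 + 15 * s.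
 apply: le_trans (HU N); rewrite -IntZ//; apply: le_Int => [||k]; [exact: rintZ|exact: (QmE N e0).1|].
 rewrite mulrA; apply: ler_wpM2r => //. have [b0 b1 bz _] := bmpP 0 k rp; have w0 := ltW (w2_gt0 e k).
 have [/cbxP[]|/bz ->] := pselect (cbx 0 r k); last by rewrite mulr0.
 rewrite /= !subr0 => k1 k2; apply: (le_via (1 - s)); first by rewrite ler_piMr//; lra.
 have [h1 _] := wexp_bounds k.1 e0; have [h2 _] := wexp_bounds k.2 e0. have es : 2 * e * r <= s by rewrite mulrC -ler_pdivlMr// mulr_gt0.
 have m1 := ler_wpM2l (ltW e0) k1; have m2 := ler_wpM2l (ltW e0) k2. have q1 := le1 _ k.1 e0; have q2 := le1 _ k.2 e0; rewrite /w2.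
 have : 0 <= (1 - wexp e k.1) * (1 - wexp e k.2) by rewrite mulr_ge0// subr_ge0.
 by move: h1 h2 es m1 m2; rewrite mulrBl mul1r mulrBr mulr1; lra.
have low : Qm f N <= I + 4 / (r * f) * Qm (f / 2) N.
 have f2 : 0 < f / 2 by rewrite divr_gt0. have [rq _] := QmE N f2; have [rqf _] := QmE N f0.
 rewrite -IntZ// -IntD//; last exact: rintZ. apply: le_Int => [||k]; [exact: rqf|by apply: rintD => //; exact: rintZ|].
 rewrite [_ * (w2 _ _ * _)]mulrA -mulrDl; apply: ler_wpM2r => //.
 have [b0 b1 _ _] := bmpP 0 k rp; have ri : 0 < r^-1 by rewrite invr_gt0. have bl : 1 - (`|k.1| + `|k.2|) / r <= bmp 0 r k.
  rewrite /bmp /plateau subr0. have c (y : R) : clamp (r^-1 * (r - `|y|)) <= 1 /\ 1 - `|y| / r <= clamp (r^-1 * (r - `|y|)).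
   have [c0 c1 c2 c3] := clampP (r^-1 * (r - `|y|)); split => //. have -> : 1 - `|y| / r = r^-1 * (r - `|y|) by field; rewrite gt_eqF.
   rewrite /clamp; case: ifP => // _; case: ifP => // /negbT; rewrite -ltNge => h.
   have : r^-1 * (r - `|y|) <= 1 by rewrite ler_pdivrMl// mulr1 lerBlDr lerDl. by [].
  have [a1 a2] := c k.1; have [a3 a4] := c k.2. move: (clamp _) (clamp _) a1 a2 a3 a4 => p q a1 a2 a3 a4.
  have : 0 <= (1 - p) * (1 - q) by rewrite mulr_ge0// subr_ge0. have -> : (1 - p) * (1 - q) = 1 - p - q + p * q by ring.
  by move: a2 a4; rewrite mulrDl; lra.
 have w1 : w2 f k <= 1 by rewrite /w2 mulr_ile1 ?(ltW (wexp_gt0 _ _))// le1.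
 have wk : w2 f k * (`|k.1| + `|k.2|) <= 4 / f * w2 (f / 2) k.
  have [_ h1] := wexp_bounds k.1 f0; have [_ h2] := wexp_bounds k.2 f0.
  have mono (y : R) : wexp f y <= wexp (f / 2) y by rewrite /wexp ler_expR lerN2 ler_wpM2r// ler_pdivrMr// ler_peMr ?(ltW f0)//; lra.
  have g1 := ler_pM (mulr_ge0 (ltW (wexp_gt0 f k.1)) (normr_ge0 k.1)) (ltW (wexp_gt0 f k.2)) h1 (mono k.2).
  have g2 := ler_pM (mulr_ge0 (ltW (wexp_gt0 f k.2)) (normr_ge0 k.2)) (ltW (wexp_gt0 f k.1)) h2 (mono k.1).
  have -> : w2 f k * (`|k.1| + `|k.2|) = wexp f k.1 * `|k.1| * wexp f k.2 + wexp f k.2 * `|k.2| * wexp f k.1 by rewrite /w2; ring.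
  have -> : 4 / f * w2 (f / 2) k = 2 / f * wexp (f / 2) k.1 * wexp (f / 2) k.2 + 2 / f * wexp (f / 2) k.2 * wexp (f / 2) k.1
   by rewrite /w2; field; rewrite gt_eqF.
  exact: lerD.
 have -> : 4 / (r * f) * w2 (f / 2) k = r^-1 * (4 / f * w2 (f / 2) k) by field; rewrite !gt_eqF.
 have h1 := ler_wpM2l (ltW ri) wk; have h2 := ler_wpM2l (ltW (w2_gt0 f k)) bl.
 have h3 : w2 f k * bmp 0 r k <= bmp 0 r k by rewrite ler_piMl.
 have e3 : w2 f k * (1 - (`|k.1| + `|k.2|) / r) = w2 f k - r^-1 * (w2 f k * (`|k.1| + `|k.2|)) by field; rewrite gt_eqF.
 by move: h1 h2 h3; rewrite e3; lra.
have fb : 4 / (r * f) * Qm (f / 2) N <= 4 * t / 45.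
 have f20 : 0 < f / 2 by rewrite divr_gt0. have q16 : qq (f / 2) <= 16.
  have -> : qq (f / 2) = (1 + 2 * (t * r / 45)) ^+ 4 by rewrite /qq /f; field; rewrite !gt_eqF.
  have h : 1 + 2 * (t * r / 45) <= 2 by move: t0 t1 rp r1; clear; nra.
  have -> : 16 = 2 ^+ 4 :> R by ring. by rewrite lerXn2r ?nnegrE//; move: h tr0; clear; lra.
 have c0 : 0 <= 4 / (r * f) by rewrite divr_ge0// mulr_ge0// ltW. apply: le_trans (ler_wpM2l c0 (le_trans (Qm_le N f20) q16)) _.
 have -> : 4 / (r * f) * 16 = 64 / 24 / 45 * t by rewrite /f; field; rewrite !gt_eqF. by move: t0; clear; lra.
have h := HN N nN; rewrite -/f in h; rewrite ler_norml; apply/andP; split.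
 have : t * r <= t by rewrite ler_piMr// ltW. by move: h low fb t0; clear; lra.
by rewrite lerBlDr; move: up t0 t1; rewrite /s; clear; nra.
Qed.

Lemma lam_ratio_cvg : (3 / lam ^+ 2) ^+ n @[n --> \oo] --> (0 : R).
Proof.
have [l1 l2] := lam_bounds; have l3 := lamE.
apply: cvg_expr; rewrite ger0_norm ?divr_ge0 ?sqr_ge0// ltr_pdivrMr ?exprn_gt0 ?lam_gt0// mul1r l3; lra.
Qed.

(** The mean amplitude per unit area; its squared modulus turns out to be the intensity at 0. *)
Definition itot u : R[i] := \sum_i (fd i)%:C%C * u i.

Lemma csum_rate (c : 'I_4 -> R[i]) n j : itot c = 0 ->
 normc (\sum_(p <- rsup n j) c p.1) <= 200 * umax c * 3 ^+ n.
Proof.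
move=> c0.
have r0 : \sum_i fd i * cRe (c i) = 0.
 apply: (etrans (_ : _ = cRe (itot c))); last by rewrite c0. rewrite /itot Re_sum; apply: eq_bigr => i _. by rewrite cReM /= mul0r subr0.
have i0 : \sum_i fd i * cIm (c i) = 0.
 apply: (etrans (_ : _ = cIm (itot c))); last by rewrite c0. rewrite /itot Im_sum; apply: eq_bigr => i _. by rewrite cImM /= mul0r addr0.
have h1 := @gsum_rate (fun i => cRe (c i)) (umax c) n j (fun i => le_trans (normr_Re_le _) (umax_ge c i)).
have h2 := @gsum_rate (fun i => cIm (c i)) (umax c) n j (fun i => le_trans (normr_Im_le _) (umax_ge c i)).
rewrite r0 mulr0 subr0 in h1; rewrite i0 mulr0 subr0 in h2.
apply: le_trans (normc_le_ReIm _) _; rewrite Re_sum Im_sum; apply: le_trans (lerD h1 h2) _.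
by apply: eqW; ring.
Qed.

Lemma normc_sqD (z w : R[i]) (t : R) : 0 < t -> normc (z + w) ^+ 2 <= (1 + t) * normc z ^+ 2 + (1 + t^-1) * normc w ^+ 2.
Proof.
move=> t0; have h := normcD z w; have n1 := normc_ge0 z; have n2 := normc_ge0 w.
apply: (le_via ((normc z + normc w) ^+ 2)).
 by rewrite lerXn2r ?nnegrE ?normc_ge0 ?addr_ge0.
have : 0 <= t^-1 * (t * normc z - normc w) ^+ 2 by rewrite mulr_ge0 ?sqr_ge0// invr_ge0 ltW.
have -> : t^-1 * (t * normc z - normc w) ^+ 2 = t * normc z ^+ 2 - 2 * normc z * normc w + t^-1 * normc w ^+ 2 by field; exact: lt0r_neq0.
move: (normc z) (normc w) (t^-1) => x y s; clear; rewrite sqrrD; nra.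
Qed.

Lemma squeeze_calc (X Y Z J e t : R) : 0 <= J -> 0 < e -> 0 < t -> t <= 1 / 8 -> 8 * t * (J + 1) <= e -> 0 <= X -> 0 <= Y ->
 0 <= Z -> Z <= t * e / 8 -> `|Y - J| <= t * J -> X <= (1 + t) * Y + (1 + t^-1) * Z -> Y <= (1 + t) * X + (1 + t^-1) * Z ->
 `|X - J| <= e.
Proof.
move=> J0 e0 t0 t8 tJ X0 Y0 Z0 Zt; rewrite ler_norml => /andP[y1 y2] h1 h2.
have z1 : (1 + t^-1) * Z <= e / 4.
 have ti : 0 < t^-1 by rewrite invr_gt0. have a : 1 + t^-1 <= 2 * t^-1.
  have : 1 <= t^-1 by rewrite invf_ge1// (le_trans t8)//; lra. by lra.
 have : (1 + t^-1) * Z <= 2 * t^-1 * (t * e / 8) by apply: ler_pM => //; lra.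
 have -> : 2 * t^-1 * (t * e / 8) = e / 4 by field; exact: lt0r_neq0. by [].
have up : X <= J + e.
 have : t * J <= e / 8 by nra. have : t * Y <= t * (2 * J) by rewrite ler_pM2l//; nra. move=> ? ?; lra.
rewrite ler_norml; apply/andP; split; last by lra.
have q1 : t * J <= e / 8 by nra.
have q2 : t * X <= t * (J + e) by rewrite ler_pM2l.
have q3 : t * e <= e / 8 by nra.
lra.
Qed.

(** Subtracting the multiple of the area weights with the same mean amplitude leaves weights [v]
    whose supertile sums at frequency 0 grow only like [3^n]. Their mass near 0 is negligible, and
    the reference part contributes the squared mean. *)
Lemma near_zero u (e d : R) : 0 < e -> 0 < d -> exists r : R, [/\ 0 < r, r <= d & exists N1 : nat, forall N, (N1 <= N)%N ->
 `|Int2 (fun k => bmp 0 r k * dens u N k) - normc (itot u) ^+ 2| <= e].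
Proof.
move=> e0 d0; pose I := itot u; pose J := normc I ^+ 2; have J0 : 0 <= J by exact: sqr_ge0.
pose v i := u i - I * aw i; have U0 := umax_ge0 v.
have c0 : itot v = 0.
 rewrite /itot /v; under eq_bigr do rewrite mulrBr. rewrite sumrB -/(itot u) -/I.
 have -> : \sum_i (fd i)%:C%C * (I * aw i) = I * (\sum_i fd i * ar i)%:C%C.
  rewrite rmorph_sum mulr_sumr; apply: eq_bigr => i _. by rewrite [LHS]mulrCA; congr (_ * _); rewrite -rmorphM.
 by rewrite fd_ar mulr1 subrr.
have pv N k : psum (fun i _ => u i) N o3 k = I * psum (fun i _ => aw i) N o3 k + psum (fun i _ => v i) N o3 k
 by rewrite /psum mulr_sumr -big_split; apply: eq_bigr => p _; rewrite /v /=; ring.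
have [C C0 HC] := near_conc.
pose t := Num.min (1 / 8) (e / (8 * (J + 1))).
have J10 : 0 < 8 * (J + 1) by rewrite mulr_gt0// ltr_wpDl.
have t0 : 0 < t by rewrite lt_min !divr_gt0.
have t8 : t <= 1 / 8 by rewrite ge_min lexx.
have tJ : 8 * t * (J + 1) <= e.
 have : t <= e / (8 * (J + 1)) by rewrite ge_min lexx orbT. by rewrite ler_pdivlMr// (_ : 8 * t * (J + 1) = t * (8 * (J + 1)))//; ring.
have [r1 r10 hr1] : exists2 r0 : R, 0 < r0 & _ := ref_mass t0 (le_trans t8 (ltac:(lra) : (1 / 8 : R) <= 1)).
pose D := 1 + 9 * (24 * pi * umax v + 2 * 0).
have D1 : 1 <= D by rewrite lerDl mulr0 addr0 mulr_ge0// mulr_ge0// mulr_ge0// pi_ge0.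
pose rho := Num.min 1 (t * e / (8 * (C * D ^+ 2 + 1))).
have CD : 0 < C * D ^+ 2 + 1 by rewrite ltr_wpDl// mulr_ge0// sqr_ge0.
have rho0 : 0 < rho by rewrite lt_min ltr01 divr_gt0 ?mulr_gt0.
have rho1 : rho <= 1 by rewrite ge_min lexx.
have Zb : C * (D * rho) ^+ 2 <= t * e / 8.
 have : rho <= t * e / (8 * (C * D ^+ 2 + 1)) by rewrite ge_min lexx orbT. rewrite ler_pdivlMr ?mulr_gt0// => h.
 have h1 : C * (D * rho) ^+ 2 <= rho * (C * D ^+ 2 + 1).
  have -> : C * (D * rho) ^+ 2 = rho * (C * D ^+ 2 * rho) by ring.
  rewrite ler_pM2l//; have q : 0 <= C * D ^+ 2 by rewrite mulr_ge0// sqr_ge0. by apply: le_trans (ler_piMr q rho1) _; rewrite lerDl.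
 by move: h1 h; clear; lra.
have d1 : 0 < Num.min d r1 by rewrite lt_min d0.
have [n [hn nd]] : exists n, 200 * umax v * (3 / lam ^+ 2) ^+ n <= rho /\ rho / lam ^+ n <= Num.min d r1.
 have l1 : 200 * umax v * (3 / lam ^+ 2) ^+ n @[n --> \oo] --> (0 : R)
  by rewrite -[X in _ --> X](mulr0 (200 * umax v)); apply: cvgM_cst; exact: lam_ratio_cvg.
 have [n1 H1] := cvg0_ev l1 rho0; have [n2 H2] := cvg0_ev lamV_cvg d1. exists (maxn n1 n2); split; first exact: H1 (leq_maxl _ _).
 apply: le_trans (H2 _ (leq_maxr n1 n2)). by rewrite ler_piMl// invr_ge0 ltW// lamX_gt0.
have r0 : 0 < rho / lam ^+ n by rewrite divr_gt0// lamX_gt0.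
have hb i : normc (psum (fun i _ => v i) n i 0) <= rho * lam ^+ (2 * n).
 have -> : psum (fun i _ => v i) n i 0 = \sum_(p <- rsup n i) v p.1
  by apply: eq_bigr => p _; rewrite /ek (_ : inner 0 _ = 0) ?mulr0 ?expi0 ?mulr1// /inner /= !mul0r addr0.
 apply: le_trans (csum_rate n i c0) _. apply: le_trans (ler_wpM2r (ltW (lamX_gt0 (2 * n))) hn); rewrite expr_div_n -exprM; apply: eqW.
 by field; exact: lt0r_neq0 (lamX_gt0 _).
move: nd; rewrite le_min => /andP[nd nr1].
exists (rho / lam ^+ n); split => //.
pose rr := rho / lam ^+ n.
have [N0 HN] := hr1 _ r0 nr1.
exists (maxn n N0) => N; rewrite geq_max => /andP[nN N0N].
have ife := HN N N0N.
have vV (i : 'I_4) (k : P) : normc (v i - v i) <= 0 * (`|k.1 - P0.1| + `|k.2 - P0.2|)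
 by rewrite subrr (normc_real 0) normr0 mul0r.
have hQ := HC (fun i _ => v i) (umax v) 0 n (N - n)%N 0 rho rho U0 (lexx 0) (ltW rho0) rho0 rho1 (fun i k => umax_ge v i) vV hb.
rewrite subnKC// in hQ; have [_ iQ] := hQ (meas_psum v N).
have rD w := rint_bmp_dens w N r0.
have f0 k : 0 <= bmp 0 rr k by have [] := bmpP 0 k r0.
have l0 : 0 <= lam ^- (2 * N) by rewrite invr_ge0 ltW// lamX_gt0.
have p1 k : dens u N k <= (1 + t) * (J * dens aw N k) + (1 + t^-1) * dens v N k.
 rewrite !dens_psum /J pv. have h := ler_wpM2l l0 (normc_sqD (I * psum (fun i _ => aw i) N o3 k) (psum (fun i _ => v i) N o3 k) t0).
 apply: (le_trans h); rewrite normcM (exprMn _ (normc I)); apply: eqW.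
 by move: (normc I ^+ 2) (normc _ ^+ 2) (normc _ ^+ 2) (t^-1) => a b b' s; ring.
have p2 k : J * dens aw N k <= (1 + t) * dens u N k + (1 + t^-1) * dens v N k.
 rewrite !dens_psum /J.
 have e1 : I * psum (fun i _ => aw i) N o3 k = psum (fun i _ => u i) N o3 k + - psum (fun i _ => v i) N o3 k by rewrite pv; ring.
 have h := ler_wpM2l l0 (normc_sqD (psum (fun i _ => u i) N o3 k) (- psum (fun i _ => v i) N o3 k) t0).
 have nN2 z : normc (- z) = normc z :> R by case: z => a b; rewrite /= !sqrrN.
 rewrite -e1 nN2 normcM (exprMn _ (normc I)) in h. rewrite mulrCA; apply: (le_trans h); apply: eqW.
 by move: (normc _ ^+ 2) (normc _ ^+ 2) (t^-1) => b b' s; ring.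
have int1 (w w' : 'I_4 -> R[i]) (a b c : R) : (forall k, a * dens w N k <= b * dens w' N k + c * dens v N k) ->
  a * Int2 (fun k => bmp 0 rr k * dens w N k) <= b * Int2 (fun k => bmp 0 rr k * dens w' N k) +
  c * Int2 (fun k => bmp 0 rr k * dens v N k).
 move=> h; rewrite -!IntZ// -IntD; [|exact: rintZ..]. apply: le_Int => [||k]; [exact: rintZ|by apply: rintD; exact: rintZ|].
 by have := ler_wpM2l (f0 k) (h k); rewrite mulrDr !(mulrCA (bmp _ _ _)).
have := @squeeze_calc (Int2 (fun k => bmp 0 rr k * dens u N k)) (J * Int2 (fun k => bmp 0 rr k * dens aw N k))
 (Int2 (fun k => bmp 0 rr k * dens v N k)) J e t J0 e0 t0 t8 tJ; apply.
- by apply: Int_ge0 => k; rewrite mulr_ge0// dens_ge0.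
- by rewrite mulr_ge0//; apply: Int_ge0 => k; rewrite mulr_ge0// dens_ge0.
- by apply: Int_ge0 => k; rewrite mulr_ge0// dens_ge0.
- apply: le_trans Zb; under eq_Int => k do rewrite dens_psum.
 apply: (le_trans iQ); rewrite (_ : rho + 9 * (rho * (24 * pi * umax v + 2 * 0)) = D * rho)//. by rewrite /D; ring.
- by rewrite -[X in _ - X]mulr1 -mulrBr normrM (ger0_norm J0) mulrC; apply: ler_wpM2r.
- have := @int1 u aw 1 ((1 + t) * J) (1 + t^-1); rewrite mul1r -[_ * J * _]mulrA; apply => k.
 by rewrite mul1r -mulrA.
- exact: int1.
Qed.

(** A bump dominates the indicator of 0, which bounds the atom from above; bumps inside boxes
    shrinking to 0 bound it from below. *)
Lemma atom_mass u mu : vague_cluster (dens u) mu -> mu [set P0] = (normc (itot u) ^+ 2)%:E.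
Proof.
move=> [lfm H]; set J := normc _ ^+ 2.
have int_bmp (r e : R) : 0 < r -> 0 < e -> (exists N1 : nat, forall N, (N1 <= N)%N ->
  `|Int2 (fun k => bmp 0 r k * dens u N k) - J| <= e) ->
  ((\int[mu]_x (bmp 0 r x)%:E <= (J + e)%:E) /\ ((J - e)%:E <= \int[mu]_x (bmp 0 r x)%:E))%E.
 move=> r0 e0 [N1 HN]; have f0 k : 0 <= bmp 0 r k by have [] := bmpP 0 k r0. split.
  apply: (H _ (kc_bmp 0 r0) f0 (J + e) N1).1 => N /HN; rewrite ler_norml => /andP[_]; move: (Int _ _) => x; clear; lra.
 apply: (H _ (kc_bmp 0 r0) f0 (J - e) N1).2 => N /HN; rewrite ler_norml => /andP[+ _]; move: (Int _ _) => x; clear; lra.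
apply/eqP; rewrite eq_le; apply/andP; split.
 apply/lee_addgt0Pr => e e0; rewrite -EFinD. have [r [r0 _ hN]] := near_zero u e0 (ltr01 : 0 < (1 : R)).
 have [h _] := int_bmp r e r0 e0 hN; apply: le_trans h. apply: set_le_int.
 - exact: measurable_pt.
 - exact: kc_meas (kc_bmp 0 r0).
 - by move=> k; have [] := bmpP 0 k r0.
 - by move=> k ->; have [_ _ _ ->] := bmpP 0 0 r0.
pose F n := cbx P0 n.+1%:R^-1.
have Fint : \bigcap_n F n = [set P0].
 apply/seteqP; split => x /=; last first.
  by move=> -> n _; apply/cbxP; rewrite !subrr normr0 invr_ge0 ler0n.
 move=> h; have z (y : R) : (forall n : nat, `|y| <= n.+1%:R^-1) -> y = 0.
  move=> hy; apply/normr0_eq0/le_anti; rewrite normr_ge0 andbT; apply/ler_addgt0Pr => e e0; rewrite add0r.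
  apply: le_trans (hy (Num.bound e^-1)) _; rewrite -[leRHS]invrK lef_pV2 ?posrE ?invr_gt0//.
  by rewrite -natr1; have := archi_boundP (_ : 0 <= e^-1); rewrite invr_ge0 (ltW e0) => /(_ isT); lra.
 rewrite [x]pairE; congr pair; apply: z => n; have /cbxP[] := h n I; rewrite /= !subr0//.
have mF n : measurable (F n : set BP) by exact: measurable_cbx.
have cv : mu (F n) @[n --> \oo] --> mu (\bigcap_n F n).
 apply: nonincreasing_cvg_mu => //.
 - by apply: lfm; exact: compact_box.
 - by rewrite Fint; exact: measurable_pt. move=> m n mn; apply/subsetPset => x /cbxP[h1 h2]; apply/cbxP.
 have h : n.+1%:R^-1 <= m.+1%:R^-1 :> R by rewrite lef_pV2 ?posrE// ler_nat. by split; apply: le_trans h.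
rewrite Fint in cv; apply/lee_addgt0Pr => e e0; rewrite -leeBlDr// -EFinB.
rewrite -(cvg_lim _ cv)//; apply: lime_ge; first by apply/cvg_ex; eexists; exact: cv.
apply: nearW => n.
have n0 : 0 < n.+1%:R^-1 :> R by rewrite invr_gt0.
have [r [r0 rn hN]] := near_zero u e0 n0.
have [_ h] := int_bmp r e r0 e0 hN; apply: (le_trans h).
rewrite -[mu (F n)]mul1e -integral_cst// integral_mkcond /=; apply: ge0_le_integral => //.
- by move=> x _; rewrite lee_fin; have [] := bmpP 0 x r0.
- by apply/measurable_EFinP; exact: kc_meas (kc_bmp 0 r0).
- by apply/measurable_restrict => //; rewrite ?setIT.
move=> x _; rewrite patchE; have [f0 f1 fz _] := bmpP 0 x r0.
case: ifPn => [_|nx]; first by rewrite lee_fin.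
rewrite fz// => /cbxP[h1 h2]; move: nx; rewrite mem_set//; apply/cbxP; split; exact: le_trans rn.
Qed.

Lemma itotE u : normc (itot u) ^+ 2 = fr_density R ^+ 2 * normc (\sum_(i < 4) (fr_frequency R i)%:C%C * u i) ^+ 2.
Proof.
have -> : itot u = (fr_density R)%:C%C * \sum_(i < 4) (fr_frequency R i)%:C%C * u i
 by rewrite /itot mulr_sumr; apply: eq_bigr => i _; rewrite fd_frequency rmorphM /= mulrA.
by rewrite normcM exprMn normc_real real_normK// num_real.
Qed.

Lemma freq_sum1 : \sum_(i < 4) (fr_frequency R i)%:C%C * (1 : R[i]) = 1.
Proof.
have : \sum_(i < 4) fr_frequency R i = 1 by rewrite big_ord4 /fr_frequency /=; field.
by move=> h; under eq_bigr do rewrite mulr1; rewrite -rmorph_sum h.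
Qed.

End CoefSum.

(* A state records the types of two tiles and the difference of their corners. *)
Definition state : Type := ('I_4 * 'I_4 * pt)%type.
HB.instance Definition _ := Choice.on state.

Definition dgs (s : state) : bool := (s.1.1 == s.1.2) && (s.2 == 0).
(** Division by [lambda] when it is exact: inverting [zlam] needs the constant term to be a multiple
    of 3. *)
Definition zdiv (a : zl) : option zl := let q := (a.1 %/ 3)%Z in if 3 * q == a.1 then Some (a.2 - q, q) else None.
Definition pdiv (p : pt) : option pt :=
 if zdiv p.1 is Some a then if zdiv p.2 is Some b then Some (a, b) else None else None.
(** Both tiles of [p] are inflated, and [x], [x'] pick one subtile of each. *)
Definition kid (p : state) (x x' : 'I_4 * pt) : state := (x.1, x'.1, plam p.2 + x'.2 - x.2).
Definition decs : seq ('I_4 * ('I_4 * pt)) := [seq (b, x) | b <- ord4, x <- idec b].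
Definition dad (s : state) (y : 'I_4 * ('I_4 * pt) * ('I_4 * ('I_4 * pt))) : option state :=
 if (y.1.2.1 == s.1.1) && (y.2.2.1 == s.1.2) then omap (fun q => (y.1.1, y.2.1, q)) (pdiv (s.2 + y.1.2.2 - y.2.2.2)) else None.
(** The search over all pairs of subtiles is finite, and each pair has at most one parent because
    [lambda] divides exactly or not at all. Repetitions are kept: they are the multiplicities in
    [count_par]. *)
Definition par (s : state) : seq state := pmap (dad s) [seq (y, y') | y <- decs, y' <- decs].
Definition ndp s := [seq p <- par s | ~~ dgs p].
Definition zx : pt := (zc 1 0, zc 0 0).
Definition sh (y : pt) (s : state) : state := (s.1, s.2 + y).
Definition dstates : seq state := [seq (j, j, 0) | j <- ord4].

(** Whether the fuel suffices is not proved here; the closure checks below would fail on an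
    incomplete list. *)
Fixpoint explore (fuel : nat) (todo seen : seq state) : seq state :=
 if fuel is f.+1 then
  if todo is s :: todo' then
   let new := undup [seq p <- ndp s | p \notin seen] in explore f (new ++ todo') (new ++ seen)
  else seen
 else seen.
Definition grow (l : seq state) : seq state := let l' := undup l in explore 400 l' l'.
(** The non-diagonal ancestors of diagonal states carry the off-diagonal part of every [phin n]. *)
Definition ancestors : seq state := Eval vm_compute in grow (flatten [seq ndp p | p <- dstates]).
(** Unit horizontal shifts of the ancestors and of the diagonal are added before closing under
    parents, to accommodate [sg zx (phin n)]. *)
Definition states : seq state := Eval vm_compute in
 grow ([seq s <- flatten [seq [:: sh zx s; sh (- zx) s] | s <- ancestors ++ dstates] | ~~ dgs s] ++ ancestors).
(** With [n1] parents and [n2] grandparents, [25 + 5 n1 + n2] is 25 times the truncated Neumann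
    series of the parent graph at 1/5. The parents of a state then weigh [25 n1 + 5 n2 + n3], at
    most 5 times its own weight as soon as there are at most 125 great-grandparents. *)
Definition weights : seq nat := Eval vm_compute in
 let g := [seq [seq index p states | p <- ndp s] | s <- states] in
 let n1 := [seq size l | l <- g] in
 let n2 := [seq sumn [seq nth 0%N n1 i | i <- l] | l <- g] in
 [seq (25 + 5 * p.1 + p.2)%N | p <- zip n1 n2].
Definition wgt (s : state) : nat := nth 0%N weights (index s states).

(* Five is less than lambda^2, the growth rate along the diagonal. *)
Lemma states_check : all (fun s => let ps := ndp s in
 [&& ~~ dgs s, all (fun p => p \in states) ps & (sumn (map wgt ps) <= 5 * wgt s)%N]) states.
Proof. by vm_compute. Qed.

Lemma weights_check : all (fun n => 1 <= n)%N weights && (size weights == size states).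
Proof. by vm_compute. Qed.

Lemma uniq_check : uniq states.
Proof. by vm_compute. Qed.

Lemma ancestors_check : all (fun s => all (fun p => p \in ancestors) (ndp s)) (dstates ++ ancestors).
Proof. by vm_compute. Qed.

Lemma shift_check : all (fun s => [&& (sh zx s \in states) || dgs (sh zx s), (sh (- zx) s \in states) || dgs (sh (- zx) s) &
 (s \in states) || dgs s]) (ancestors ++ dstates).
Proof. by vm_compute. Qed.

#[global] Opaque states ancestors weights.

Lemma zdivP (a q : zl) : zdiv a = Some q <-> zlam q = a.
Proof.
rewrite /zdiv /zlam; case: a q => [a1 a2] [q1 q2] /=; split.
 by case: eqP => // h [<- <-]; congr pair => //; rewrite subrK.
move=> [<- <-]; rewrite [3 * q2]mulrC mulzK// mulrC eqxx; congr (Some (_, _)); rewrite addrK//.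
Qed.

Lemma pdivP (p q : pt) : pdiv p = Some q <-> plam q = p.
Proof.
rewrite /pdiv /plam; case: p q => [a b] [x y] /=; split.
 case E: (zdiv a) => [a'|//]; case E': (zdiv b) => [b'|//] [<- <-]. by move/zdivP: E => ->; move/zdivP: E' => ->.
by move=> [/zdivP -> /zdivP ->].
Qed.

Lemma dadP s y p : (dad s y == Some p) = [&& y.1.1 == p.1.1, y.2.1 == p.1.2 & kid p y.1.2 y.2.2 == s].
Proof.
case: s p y => [[i i'] d] [[b b'] q] [[k x] [k' x']]; rewrite /dad /kid !xpair_eqE /=.
rewrite -andbA; case: (x.1 == i) => //=; last by rewrite !andbF.
case: (x'.1 == i') => //=; last by rewrite !andbF.
have -> : (plam q + x'.2 - x.2 == d) = (pdiv (d + x.2 - x'.2) == Some q)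
 by apply/eqP/eqP => [<-|/pdivP ->]; [apply/pdivP; rewrite subrK addrK|rewrite subrK addrK].
case: (pdiv _) => [q'|] /=; last by rewrite !andbF.
by rewrite -[Some _ == Some _]/((k, k', q') == (b, b', q)) !xpair_eqE andbA.
Qed.

Lemma count_par p s : (\sum_(x <- idec p.1.1) \sum_(x' <- idec p.1.2) (kid p x x' == s))%N = count_mem p (par s).
Proof.
have cp (T : Type) (f : T -> option state) (l : seq T) : count_mem p (pmap f l) = (\sum_(y <- l) (f y == Some p))%N.
 elim: l => [|y l IH]; first by rewrite big_nil. by rewrite big_cons -IH /=; case: (f y) => [z|].
have step (f : 'I_4 -> nat) (k : 'I_4) : (\sum_(x <- ord4) (x == k) * f x)%N = f k
 by elim/ord4_ind: k; rewrite /ord4 !big_cons big_nil /= ?mul0n ?mul1n ?addn0 ?add0n.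
have sd (f : 'I_4 * ('I_4 * pt) -> nat) : (\sum_(y <- decs) f y = \sum_(k <- ord4) \sum_(x <- idec k) f (k, x))%N
 by rewrite /decs big_allpairs_dep.
rewrite /par cp big_allpairs sd.
rewrite -(step (fun k => \sum_(x <- idec k) \sum_(x' <- idec p.1.2) (kid p x x' == s))%N).
apply: eq_bigr => k _; rewrite big_distrr; apply: eq_bigr => x _ /=.
rewrite sd -(step (fun k' => \sum_(x' <- idec k') (kid p x x' == s))%N) big_distrr.
apply: eq_bigr => k' _ /=; rewrite !big_distrr; apply: eq_bigr => x' _ /=.
by rewrite dadP /= -!mulnb.
Qed.

(** * The transfer operator on pair functions *)

Section States.
Implicit Types (phi psi chi : state -> R) (s p : state) (j b : 'I_4) (q w : pt).

(** Iterated [n] times, it sums [phi] over all pairs of tiles from two level-[n] supertiles in state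
    [p] ([iterU]). *)
Definition U phi p : R := \sum_(x <- idec p.1.1) \sum_(x' <- idec p.1.2) phi (kid p x x').

Fixpoint isup n j : seq ('I_4 * pt) :=
 if n is n'.+1 then flatten [seq [seq (y.1, iter n' plam x.2 + y.2) | y <- isup n' x.1] | x <- idec j] else [:: (j, 0)].

Lemma pv_iter n q : pv (iter n plam q) = sc (lam ^+ n) (pv q).
Proof.
elim: n => [|n IH]; first by rewrite expr0 sc1.
by rewrite iterS /pv /sc /= !zv_lam; move: IH => [-> ->]; rewrite exprS !mulrA.
Qed.

Lemma pvD (p q : pt) : pv (p + q) = pv p + pv q.
Proof. by rewrite /pv /= !zvD. Qed.

Lemma rsup_isup n j : rsup n j = [seq (y.1, pv y.2) | y <- isup n j].
Proof.
elim: n j => [|n IH] j.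
 by rewrite /= /pv /= /zv /= mul0r addr0.
rewrite /= map_flatten /rdec -!map_comp; congr flatten; apply: eq_map => x /=.
by rewrite IH -!map_comp; apply: eq_map => y /=; rewrite pvD pv_iter.
Qed.

Lemma plam_iterD n (p q : pt) : iter n plam (p + q) = iter n plam p + iter n plam q.
Proof.
elim: n => // n IH; rewrite !iterS IH /plam /zlam /=.
by congr (_, _); congr (_, _); rewrite /= ?mulrDr// addrACA.
Qed.

Lemma plam_iterN n (p : pt) : iter n plam (- p) = - iter n plam p.
Proof.
elim: n => // n IH; rewrite !iterS IH /plam /zlam /=.
by congr (_, _); congr (_, _); rewrite /= ?mulrN// opprD.
Qed.

Lemma iterU n phi p : iter n U phi p =
 \sum_(x <- isup n p.1.1) \sum_(x' <- isup n p.1.2) phi (x.1, x'.1, iter n plam p.2 + x'.2 - x.2).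
Proof.
elim: n p => [|n IH] p; first by rewrite /= !big_seq1 subr0 addr0; case: p => [[]].
have e j (f : 'I_4 * pt -> R) : \sum_(x <- isup n.+1 j) f x =
  \sum_(x <- idec j) \sum_(y <- isup n x.1) f (y.1, iter n plam x.2 + y.2).
 by rewrite /= big_flatten big_map; apply: eq_bigr => x _; rewrite big_map.
rewrite iterS /U e; apply: eq_bigr => x _.
under [RHS]eq_bigr do rewrite e.
rewrite exchange_big /=.
transitivity (\sum_(x' <- idec p.1.2) \sum_(y <- isup n x.1) \sum_(y' <- isup n x'.1)
 phi (y.1, y'.1, iter n plam (plam p.2 + x'.2 - x.2) + y'.2 - y.2)). by apply: eq_bigr => x' _; rewrite IH.
apply: eq_bigr => x' _; apply: eq_bigr => y _; apply: eq_bigr => y' _.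
congr (phi (_, _, _)); rewrite plam_iterD plam_iterD plam_iterN -iterSr iterS.
by rewrite opprD !addrA; congr (_ - _); rewrite -!addrA; congr (_ + (_ + _)); rewrite addrC.
Qed.

(** Diagonal states are always allowed; [L] lists the others. *)
Definition supp (L : seq state) phi := forall s, s \notin L -> ~~ dgs s -> phi s = 0.
Definition full : seq state := states ++ dstates.

Lemma dgsP s : dgs s -> s \in dstates.
Proof.
case: s => [[i i'] d]; rewrite /dgs /= => /andP[/eqP <- /eqP ->].
by apply/mapP; exists i => //; exact: mem_ord4.
Qed.

Lemma supp_full phi s : supp states phi -> s \notin full -> phi s = 0.
Proof.
by move=> sp; rewrite mem_cat negb_or => /andP[ns nd]; apply: sp => //; apply: contra nd; exact: dgsP.
Qed.

Lemma full_uniq : uniq full.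
Proof.
rewrite /full cat_uniq uniq_check andTb; apply/andP; split; last by vm_compute.
apply/hasPn => s; apply: contraL => /(allP states_check) /and3P[nd _ _].
by apply: contra nd => /mapP[j _ ->]; rewrite /dgs /= !eqxx.
Qed.

Lemma kid_par p x x' : x \in idec p.1.1 -> x' \in idec p.1.2 -> p \in par (kid p x x').
Proof.
move=> xi xi'; rewrite -has_pred1 has_count -count_par.
by rewrite (big_rem x)//= (big_rem x')//= eqxx.
Qed.

Lemma U_supp phi (L : seq state) : all (fun s => all (fun p => p \in L) (ndp s)) (dstates ++ L) -> supp L phi -> supp L (U phi).
Proof.
move=> /allP cl sp p pL pd; rewrite /U big1_seq// => x /andP[_ xi]; rewrite big1_seq// => x' /andP[_ xi'].
have [s0|s0] := eqVneq (phi (kid p x x')) 0 => //.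
have : kid p x x' \in dstates ++ L.
 rewrite mem_cat; apply: contraNT s0; rewrite negb_or => /andP[nd nL]; apply/eqP; apply: sp => //. by apply: contra nd; exact: dgsP.
move=> /cl /allP/(_ p); rewrite mem_filter pd kid_par// => /(_ isT) pL'; by rewrite pL' in pL.
Qed.

Lemma states_closed : all (fun s => all (fun p => p \in states) (ndp s)) (dstates ++ states).
Proof.
rewrite all_cat; apply/andP; split; last by apply/allP => s /(allP states_check) /and3P[].
apply/allP => s sd; apply/allP => p ps.
have := ancestors_check; rewrite all_cat => /andP[/allP/(_ s sd)/allP/(_ p ps) pa _].
have := shift_check; rewrite all_cat => /andP[/allP/(_ p pa)/and3P[_ _ /orP[//|pd]] _].
by move: ps; rewrite mem_filter pd.
Qed.

Definition dgn phi : R := \sum_(s <- dstates) `|phi s|.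
Definition ndn phi : R := \sum_(s <- states) (wgt s)%:R * `|phi s|.
Definition dout : R := \sum_(s <- dstates) \sum_(p <- par s) (p \in states)%:R * (wgt p)%:R.

Lemma sum_count (X l : seq state) (V : state -> R) : uniq X ->
 \sum_(p <- X) V p * (count_mem p l)%:R = \sum_(p <- l) (p \in X)%:R * V p.
Proof.
move=> uX; elim: l => [|y l IH]; first by rewrite big_nil big1// => p _; rewrite mulr0.
rewrite big_cons -IH /=; under eq_bigr do rewrite natrD mulrDr.
rewrite big_split /=; congr (_ + _); have [yX|nyX] := boolP (y \in X).
 rewrite mul1r (bigD1_seq y)//= eqxx mulr1 big1 ?addr0// => p /negbTE py. by rewrite eq_sym py mulr0.
rewrite mul0r big1_seq// => p /andP[_ pX]; case: eqP => [e|]; last by rewrite mulr0.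
by move: nyX; rewrite e pX.
Qed.

Lemma abs_full phi c : supp states phi -> `|phi c| = \sum_(s <- full) `|phi s| * (c == s)%:R.
Proof.
move=> sp; have [cf|cf] := boolP (c \in full).
 rewrite (bigD1_seq c) ?full_uniq//= eqxx mulr1 big1 ?addr0// => s /negbTE sc. by rewrite eq_sym sc mulr0.
rewrite (supp_full sp cf) normr0 big1_seq// => s /andP[_ sf]; case: eqP => [e|]; last by rewrite mulr0.
by move: cf; rewrite e sf.
Qed.

(** Transposed, [U] hands the value at a state to its parents. An off-diagonal state feeds parents
    of total weight at most 5 times its own, and the diagonal feeds in through [dout]. *)
Lemma ndn_U phi : supp states phi -> ndn (U phi) <= 5 * ndn phi + dout * dgn phi.
Proof.
move=> sp.
have e1 c := abs_full c sp.
have b p : `|U phi p| <= \sum_(s <- full) `|phi s| * (count_mem p (par s))%:R.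
 apply: (le_via (\sum_(x <- idec p.1.1) \sum_(x' <- idec p.1.2) `|phi (kid p x x')|)).
  rewrite (le_trans (ler_norm_sum _ _ _))//; apply: ler_sum => x _; exact: ler_norm_sum.
 apply: eqW. under eq_bigr => x _ do under eq_bigr => x' _ do rewrite e1. under eq_bigr => x _ do rewrite exchange_big /=.
 rewrite exchange_big /=; apply: eq_bigr => s _; rewrite -count_par natr_sum mulr_sumr; apply: eq_bigr => x _.
 by rewrite natr_sum mulr_sumr.
apply: (le_via (\sum_(p <- states) (wgt p)%:R * \sum_(s <- full) `|phi s| * (count_mem p (par s))%:R)).
 by apply: ler_sum => p _; rewrite ler_wpM2l// ler0n.
under eq_bigr do rewrite mulr_sumr.
rewrite exchange_big /=.
have -> : \sum_(s <- full) \sum_(p <- states) (wgt p)%:R * (`|phi s| * (count_mem p (par s))%:R) =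
  \sum_(s <- full) `|phi s| * \sum_(p <- par s) (p \in states)%:R * (wgt p)%:R.
 apply: eq_bigr => s _; rewrite -(sum_count _ _ uniq_check) mulr_sumr; apply: eq_bigr => p _; by rewrite mulrCA.
rewrite /full big_cat /=; apply: lerD.
 rewrite /ndn mulr_sumr big_seq [leRHS]big_seq; apply: ler_sum => s ss. have /and3P[_ _ w5] := allP states_check s ss.
 rewrite mulrA [leRHS]mulrC; apply: ler_wpM2l => //. apply: (le_via (\sum_(p <- ndp s) (wgt p)%:R)); last first.
  by move: w5; rewrite sumnE big_map -(ler_nat R) natr_sum natrM.
 rewrite /ndp big_filter [leRHS]big_mkcond /=; apply: ler_sum => p _.
 have [pX|_] := boolP (p \in states); last by rewrite mul0r; case: ifP. by have /and3P[-> _ _] := allP states_check p pX; rewrite mul1r.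
rewrite /dgn mulr_sumr big_seq [leRHS]big_seq; apply: ler_sum => s sd; rewrite mulrC; apply: ler_wpM2r => //.
rewrite /dout; apply: (@mem_sum_le _ dstates (fun s => \sum_(p <- par s) (p \in states)%:R * (wgt p)%:R)) => // s'.
by apply: sumr_ge0 => p _; rewrite mulr_ge0.
Qed.

Lemma pv_inj : injective (pv).
Proof.
have zi (a b : zl) : zv a = zv b -> a = b.
 case: a b => [a1 a2] [b1 b2]; rewrite /zv /= => e.
 have e2 : (a1 - b1)%:~R = lam * (b2 - a2)%:~R :> R by rewrite !intrD !intrN; move: e; clear; lra.
 move: (lam_irrational e2) => /eqP; rewrite subr_eq0 => /eqP e3; move: e; rewrite e3 => /addIr/eqP. by rewrite eqr_int => /eqP ->.
by move=> [a b] [c d] [/zi -> /zi ->].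
Qed.

Lemma plam_iter0 n : iter n plam 0 = 0.
Proof. by elim: n => // n IH; rewrite iterS IH. Qed.

Definition dsp : seq pt := undup [seq s.2 | s <- full].
(** A sum of point indicators: discontinuous, but bounded and of bounded support, so the uniform
    limit of pair sums over exact supertiles applies. *)
Definition FF phi (i i' : 'I_4) (x : P) : R := \sum_(q <- dsp) phi (i, i', q) * (x == pv q)%:R.
Definition LF : R := \sum_(q <- dsp) (`|(pv q).1| + `|(pv q).2|).

Lemma LF_ge0 : 0 <= LF. Proof. by apply: sumr_ge0 => q _; rewrite addr_ge0. Qed.

Lemma FF_pv phi i i' q : supp states phi -> FF phi i i' (pv q) = phi (i, i', q).
Proof.
move=> sp; rewrite /FF; have [qd|qd] := boolP (q \in dsp).
 rewrite (bigD1_seq q) ?undup_uniq//= eqxx mulr1 big1 ?addr0// => q' /negbTE qq. by rewrite (inj_eq pv_inj) eq_sym qq mulr0.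
rewrite big1_seq => [|q' /andP[_ q'd]].
 rewrite (supp_full sp)//; apply: contra qd => qf; rewrite mem_undup; apply/mapP. by exists (i, i', q).
by case: eqP => [/pv_inj e|]; [move: qd; rewrite e q'd|rewrite mulr0].
Qed.

Lemma FF_bnd phi B : (forall s, `|phi s| <= B) -> bnd (FF phi) B LF.
Proof.
move=> pB; split => [i i' x|i i' x].
 have [[q [qd ->]]|nq] := pselect (exists q, q \in dsp /\ x = pv q); last first.
  rewrite /FF big1_seq ?normr0 ?(le_trans _ (pB (i, i', 0)))// => q /andP[_ qd].
  by case: eqP => [e|]; [case: nq; exists q|rewrite mulr0].
 rewrite /FF (bigD1_seq q) ?undup_uniq//= eqxx mulr1 big1 ?addr0// => q' /negbTE qq. by rewrite (inj_eq pv_inj) eq_sym qq mulr0.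
move=> nx; rewrite /FF big1_seq// => q /andP[_ qd]; case: eqP => [e|]; last by rewrite mulr0.
move: nx; rewrite /near0 e.
have h : `|(pv q).1| + `|(pv q).2| <= LF by apply: (@mem_sum_le _ dsp (fun q => `|(pv q).1| + `|(pv q).2|)) => // q'; rewrite addr_ge0.
have n1 := normr_ge0 (pv q).1; have n2 := normr_ge0 (pv q).2.
have -> : `|(pv q).1| <= LF by move: h n1 n2; clear; lra.
by have -> : `|(pv q).2| <= LF by move: h n1 n2; clear; lra.
Qed.

Lemma Apair_U phi r j : supp states phi -> Apair (FF phi) r j = iter r (@U) phi (j, j, 0).
Proof.
move=> sp; rewrite iterU /Apair /pairsum rsup_isup big_map; apply: eq_bigr => x _.
rewrite big_map; apply: eq_bigr => x' _ /=.
rewrite plam_iter0 add0r -(FF_pv _ _ _ sp); congr FF.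
by rewrite /pv /= !zvB.
Qed.

Definition W phi s : R := lam ^- 2 * U phi s.

Lemma UZ (c : R) phi p : U (fun s => c * phi s) p = c * U phi p.
Proof. by rewrite /U mulr_sumr; apply: eq_bigr => x _; rewrite mulr_sumr. Qed.

Lemma UD phi psi p : U (fun s => phi s + psi s) p = U phi p + U psi p.
Proof. by rewrite /U -big_split; apply: eq_bigr => x _; rewrite -big_split. Qed.

Lemma UM phi psi p : (forall s, phi s <= psi s) -> U phi p <= U psi p.
Proof. by move=> pp; apply: ler_sum => x _; apply: ler_sum => x' _. Qed.

Lemma WZ (c : R) phi : W (fun s => c * phi s) = (fun s => c * W phi s).
Proof. by apply/funext => s; rewrite /W UZ mulrCA. Qed.

Lemma WD phi psi : W (fun s => phi s + psi s) = (fun s => W phi s + W psi s).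
Proof. by apply/funext => s; rewrite /W UD mulrDr. Qed.

Lemma WM phi psi p : (forall s, phi s <= psi s) -> W phi p <= W psi p.
Proof. by move=> pp; rewrite ler_wpM2l ?invr_ge0 ?exprn_ge0 ?(ltW (lam_gt0))//; exact: UM. Qed.

Lemma iterWZ n (c : R) phi : iter n W (fun s => c * phi s) = (fun s => c * iter n W phi s).
Proof. by elim: n => // n IH; rewrite !iterS IH WZ. Qed.

Lemma iterWD n phi psi : iter n W (fun s => phi s + psi s) = (fun s => iter n W phi s + iter n W psi s).
Proof. by elim: n => // n IH; rewrite !iterS IH WD. Qed.

Lemma iterWM n phi psi p : (forall s, phi s <= psi s) -> iter n W phi p <= iter n W psi p.
Proof. by move=> pp; elim: n p => // n IH p; rewrite !iterS; exact: WM. Qed.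

Lemma iterW n phi s : iter n W phi s = lam ^- (2 * n) * iter n (@U) phi s.
Proof.
elim: n s => [|n IH] s; first by rewrite muln0 expr0 invr1 mul1r.
rewrite iterS /W (_ : iter n W phi = (fun s => lam ^- (2 * n) * iter n (@U) phi s)); last exact/funext.
have -> : lam ^+ (2 * n.+1) = lam ^+ 2 * lam ^+ (2 * n) by rewrite mulnS exprD.
by rewrite UZ mulrA (invfM (lam ^+ 2)) iterS.
Qed.

Lemma W_supp phi (L : seq state) : all (fun s => all (fun p => p \in L) (ndp s)) (dstates ++ L) -> supp L phi -> supp L (W phi).
Proof. by move=> cl sp p pL pd; rewrite /W (U_supp cl sp)// mulr0. Qed.

Lemma iterW_supp n phi (L : seq state) : all (fun s => all (fun p => p \in L) (ndp s)) (dstates ++ L) ->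
 supp L phi -> supp L (iter n W phi).
Proof. by move=> cl sp; elim: n => // n IH; exact: W_supp. Qed.

Definition gm phi : R := gam (FF phi).

Lemma gm_unif (eps : R) : 0 < eps -> exists N, forall phi B, supp states phi -> (forall s, `|phi s| <= B) ->
 forall n j, (N <= n)%N -> `|iter n W phi (j, j, 0) - ar j * gm phi| <= B * eps.
Proof.
move=> e0; have [N HN] := Apair_unif LF_ge0 e0; exists N => phi B sp pB n j Nn.
have l0 := lamX_gt0 (2 * n).
have /= := HN _ _ (FF_bnd pB) n j Nn; rewrite Apair_U// => H.
rewrite -(ler_pM2l l0) -[X in X * `|_|]gtr0_norm// -normrM; apply: le_trans H.
rewrite iterW mulrBr !mulrA mulfV ?mul1r// gt_eqF//.
Qed.

Definition l1 phi : R := \sum_(s <- full) `|phi s|.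

Lemma l1_ge0 phi : 0 <= l1 phi. Proof. by apply: sumr_ge0. Qed.

Lemma le_l1 phi s : supp states phi -> `|phi s| <= l1 phi.
Proof.
move=> sp; have [sf|sf] := boolP (s \in full); last by rewrite (supp_full sp)// normr0 l1_ge0.
exact: (@mem_sum_le _ full (fun s => `|phi s|)).
Qed.

Lemma gm_cvg phi j : supp states phi -> iter n W phi (j, j, 0) @[n --> \oo] --> ar j * gm phi.
Proof.
move=> sp; apply/cvgrPdist_le => e e0.
have B0 : 0 < l1 phi + 1 by have := l1_ge0 phi; lra.
have [N HN] := @gm_unif (e / (l1 phi + 1)) (divr_gt0 e0 B0); exists N => // n /= Nn.
rewrite distrC (le_trans (HN phi (l1 phi + 1) sp _ n j Nn))//.
 by move=> s; rewrite (le_trans (le_l1 s sp))// lerDl.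
by rewrite mulrC divfK// gt_eqF.
Qed.

Lemma gm_eq phi (l : R) : supp states phi -> iter n W phi (o3, o3, 0) @[n --> \oo] --> l -> gm phi = l.
Proof. by move=> /(@gm_cvg _ o3); rewrite ar_o3 mul1r => c1 c2; exact: (cvg_unique _ c1 c2). Qed.

Lemma gm_c3 phi : supp states phi -> iter n W phi (o3, o3, 0) @[n --> \oo] --> gm phi.
Proof. by move=> /(@gm_cvg _ o3); rewrite ar_o3 mul1r. Qed.

Lemma supp_lin L (c : R) phi psi : supp L phi -> supp L psi -> supp L (fun s => phi s + c * psi s).
Proof. by move=> s1 s2 s sL sd; rewrite s1// s2// mulr0 addr0. Qed.

Lemma gm_lin (c : R) phi psi : supp states phi -> supp states psi ->
 gm (fun s => phi s + c * psi s) = gm phi + c * gm psi.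
Proof.
move=> s1 s2; apply: gm_eq; first exact: supp_lin.
under eq_cvg do rewrite iterWD iterWZ.
by apply: cvgD; [exact: gm_c3|apply: cvgM_cst; exact: gm_c3].
Qed.

Lemma gm_W phi n : supp states phi -> gm (iter n W phi) = gm phi.
Proof.
move=> sp; apply: gm_eq; first exact: (iterW_supp _ states_closed sp).
under eq_cvg do rewrite -iterD.
by have := gm_c3 sp; rewrite -(cvg_shiftn n (fun m => iter m W phi (o3, o3, 0))).
Qed.

Lemma gm_le phi psi : supp states phi -> supp states psi -> (forall s, phi s <= psi s) -> gm phi <= gm psi.
Proof.
move=> s1 s2 pp; apply: ler_cvg_to (gm_c3 s1) (gm_c3 s2) _.
by apply: nearW => n; exact: iterWM.
Qed.

Lemma isup_uniq n j : uniq (isup n j).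
Proof.
have := rsup_sepr n j; rewrite rsup_isup /unzip2 -map_comp => ps.
apply: (@map_uniq _ _ (snd \o (fun y : 'I_4 * pt => (y.1, pv y.2)))).
apply: (@pairwise_uniq _ (@sepr)) => //= x.
by rewrite /sepr !subrr normr0 ler10.
Qed.

Lemma isup_le1 n j (z : 'I_4 * pt) (f : 'I_4 * pt -> bool) : (forall x, f x -> x = z) ->
 \sum_(x <- isup n j) (f x)%:R <= 1 :> R.
Proof.
move=> fz; apply: (le_via (\sum_(x <- isup n j) (x == z)%:R)).
 apply: ler_sum => x _; case E: (f x); last by rewrite ler0n. by rewrite (fz _ E) eqxx.
rewrite -natr_sum -[1]/(1%:R) ler_nat.
have -> : (\sum_(x <- isup n j) (x == z) = count_mem z (isup n j))%N by elim: (isup n j) => [|y l IH]; [rewrite big_nil|rewrite big_cons /= IH].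
by rewrite count_uniq_mem ?isup_uniq// leq_b1.
Qed.

Lemma size_isup n j : (size (isup n j))%:R <= 9 * lam ^+ (2 * n).
Proof. by have := size_rsup n j; rewrite rsup_isup size_map. Qed.

Definition shft w phi s : R := phi (sh w s).

(** For a given tile, each state determines at most one partner, so the sum is at most the number of
    tiles times [l1 chi]. The shift [w] is arbitrary although it may lead out of the finite
    support. *)
Lemma eval_bound m j w chi : supp states chi -> `|iter m W (shft w chi) (j, j, 0)| <= 9 * l1 chi.
Proof.
move=> sp; rewrite iterW iterU plam_iter0.
have l0 := lamX_gt0 (2 * m); rewrite normrM gtr0_norm ?invr_gt0// ler_pdivrMl//.
rewrite (le_trans (ler_norm_sum _ _ _))//.
apply: (le_via (\sum_(x <- isup m j) l1 chi)); last first.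
 have -> : \sum_(x <- isup m j) l1 chi = (size (isup m j))%:R * l1 chi by rewrite sum_cst mulr_natl.
 rewrite [leRHS]mulrA; apply: ler_wpM2r; first exact: l1_ge0. by rewrite [leRHS]mulrC size_isup.
apply: ler_sum => x _; rewrite (le_trans (ler_norm_sum _ _ _))// /shft /sh /=.
under eq_bigr do rewrite (abs_full _ sp).
rewrite exchange_big /=; apply: ler_sum => s _; rewrite -mulr_sumr -[leRHS]mulr1; apply: ler_wpM2l => //.
apply: (@isup_le1 _ _ (s.1.2, s.2 - w + x.2)) => -[a y] /eqP <- /=.
 by congr (_, _); rewrite add0r addrK subrK.
Qed.

Definition phi0 s : R := (dgs s)%:R.
(** The normalised number of coincidences, in type and position, between two level-[n] supertiles in
    the given state. *)
Definition phin n : state -> R := iter n W phi0.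
(** The symmetric shift corresponds to multiplying a density by the cosine [coe w], see [mean_G]. *)
Definition sg w phi s : R := (phi (sh (- w) s) + phi (sh w s)) / 2.

Lemma phi0_supp L : supp L phi0.
Proof. by move=> s _ /negbTE sd; rewrite /phi0 sd. Qed.

Lemma ancestors_closed : all (fun s => all (fun p => p \in ancestors) (ndp s)) (dstates ++ ancestors).
Proof. exact: ancestors_check. Qed.

Lemma phin_anc n : supp ancestors (phin n).
Proof. exact: (iterW_supp _ ancestors_closed (@phi0_supp _)). Qed.

Lemma phin_supp n : supp states (phin n).
Proof. exact: (iterW_supp _ states_closed (@phi0_supp _)). Qed.

Lemma shK w s : sh (- w) (sh w s) = s.
Proof. by case: s => [i y]; rewrite /sh /= addrK. Qed.

Lemma sg_supp n : supp states (sg zx (phin n)).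
Proof.
have h s : phin n s != 0 -> s \in ancestors ++ dstates.
 move=> s0; rewrite mem_cat; apply: contraNT s0; rewrite negb_or => /andP[sa sd].
 by apply/eqP; apply: phin_anc => //; apply: contra sd; exact: dgsP.
move=> s ss sd; rewrite /sg.
have -> : phin n (sh (- zx) s) = 0.
 apply/eqP; apply: contraT => /h /(allP shift_check) /and3P[+ _ _]. by rewrite -{1 2}[zx]opprK shK (negbTE ss) (negbTE sd).
have -> : phin n (sh zx s) = 0.
 apply/eqP; apply: contraT => /h /(allP shift_check) /and3P[_ + _]. by rewrite shK (negbTE ss) (negbTE sd).
by rewrite addr0 mul0r.
Qed.

Lemma phin_ge0 n s : 0 <= phin n s.
Proof.
rewrite /phin iterW iterU mulr_ge0 ?invr_ge0 ?(ltW (lamX_gt0 _))//.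
by apply: sumr_ge0 => x _; apply: sumr_ge0 => x' _; exact: ler0n.
Qed.

Lemma phin_le9 n s : phin n s <= 9.
Proof.
rewrite /phin iterW iterU mulrC ler_pdivrMr ?lamX_gt0//.
apply: le_trans (size_isup n s.1.1).
rewrite -sum1_size natr_sum; apply: ler_sum => x _.
apply: (@isup_le1 _ _ (x.1, x.2 - iter n plam s.2)) => -[a y]; rewrite /dgs /= => /andP[/eqP <-].
by rewrite subr_eq0 => /eqP <-; rewrite [iter _ _ _ + y]addrC addrK.
Qed.

Lemma phin_o3 n : 9^-1 <= phin n (o3, o3, 0).
Proof.
have l0 := lamX_gt0 (2 * n).
rewrite /phin iterW iterU mulrC ler_pdivlMr// plam_iter0.
have h : lam ^+ (2 * n) <= 9 * (size (isup n o3))%:R.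
 have := lsum_rsup n o3; rewrite ar_o3 mulr1 => <-.
 rewrite -(size_map (fun y : 'I_4 * pt => (y.1, pv y.2))) -rsup_isup -sum1_size natr_sum mulr_sumr.
 by apply: ler_sum => x _; rewrite mulr1 ar_le9.
rewrite mulrC ler_pdivrMr// mulrC (le_trans h)//; apply: ler_wpM2l => //.
rewrite -sum1_size natr_sum big_seq [leRHS]big_seq; apply: ler_sum => x xi.
rewrite (big_rem x)//= /phi0 /dgs /= eqxx add0r subrr eqxx lerDl.
by apply: sumr_ge0 => y _; exact: ler0n.
Qed.

Lemma gm_phin n : gm (phin n) = gm phi0.
Proof. exact/gm_W/phi0_supp. Qed.

Lemma gm_phi0_gt0 : 0 < gm phi0.
Proof.
rewrite (@lt_le_trans _ _ 9^-1)// ?invr_gt0//.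
apply: ler_cvg_to (cvg_cst (9^-1 : R)) (gm_c3 (@phi0_supp _)) _.
by apply: nearW => n; exact: phin_o3.
Qed.

Definition one_at s0 s : R := (s == s0)%:R.

Lemma U_ge phi p x x' : (forall s, 0 <= phi s) -> x \in idec p.1.1 -> x' \in idec p.1.2 -> phi (kid p x x') <= U phi p.
Proof.
move=> p0 xi xi'; rewrite /U (big_rem x)//= (big_rem x')//=.
rewrite -addrA lerDl addr_ge0 ?sumr_ge0// => y _; rewrite ?sumr_ge0//.
Qed.

Lemma one_U s0 p x x' : x \in idec p.1.1 -> x' \in idec p.1.2 -> kid p x x' = s0 ->
 1 <= U (one_at s0) p.
Proof.
move=> xi xi' <-; have {1}<- : one_at (kid p x x') (kid p x x') = 1 by rewrite /one_at eqxx.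
by apply: U_ge => // s; exact: ler0n.
Qed.

(** Two inflations of any tile contain two unit tiles side by side: the first yields a tile of type
    1, whose inflation has unit tiles at its corner. The factor [lambda^4] undoes the
    normalisation. *)
Lemma phi0_le : forall s, phi0 s <= lam ^+ 4 * iter 2 W (one_at (o3, o3, zx)) s.
Proof.
have l4 : 0 < lam ^+ 4 := lamX_gt0 4.
have u0 phi p : (forall s, 0 <= phi s) -> 0 <= U phi p by move=> h; rewrite /U sumr_ge0// => x _; rewrite sumr_ge0.
move=> s; rewrite iterW mulrA mulfV ?gt_eqF// mul1r !iterS /=.
rewrite /phi0; have [sd|_] := boolP (dgs s); last first.
 by apply: (u0 _ _) => p; apply: (u0 _ _) => q; exact: ler0n.
apply: (le_via (U (one_at (o0, o0, 0)) s)).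
 have /mapP[j _ ->] := dgsP sd. have [x xi x1] : exists2 x, x \in idec j & x.1 = o0
  by elim/ord4_ind: j {sd s}; [exists (o0, (zc 2 0, zc 2 0))|exists (o0, 0)|exists (o0, 0)|exists (o0, 0)].
 apply: (@one_U _ _ x x) => //; rewrite /kid /= x1. by rewrite -[plam 0]/(iter 1 plam 0) plam_iter0 add0r subrr.
apply: UM => p; rewrite {1}/one_at; case: eqP => [->|_]; last by apply: (u0 _ _) => q; exact: ler0n.
by apply: (@one_U _ _ (o3, 0) (o3, zx)).
Qed.

(** The normalised correlation at the translation by [lambda^n] in the horizontal direction, which
    is the limit mean of the cosine under the densities. *)
Definition cn n : R := gm (sg zx (phin n)) / gm phi0.
Definition cmin : R := (18 * lam ^+ 4)^-1.

Lemma cmin_gt0 : 0 < cmin. Proof. by rewrite invr_gt0 mulr_gt0// lamX_gt0. Qed.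

Lemma one_at_supp : supp states (one_at (o3, o3, zx)).
Proof.
move=> s sL sd; rewrite /one_at; case: eqP => // e; exfalso; move: sL sd; rewrite e.
have := allP shift_check (o3, o3, 0); rewrite mem_cat => /(_ _)/and3P[//|/orP[->//|->]//].
Qed.

(** Adjacent unit tiles have mean at least [lambda^-4 * gm phi0], and after [n] inflations their
    supertiles coincide under the translation by [lambda^n]. In [cmin], 18 is the 9 of [phin_o3]
    times 2 from the symmetrisation. *)
Lemma cn_ge n : cmin <= cn n.
Proof.
have g0 := gm_phi0_gt0; rewrite /cn ler_pdivlMr//.
have h1 : gm phi0 <= lam ^+ 4 * gm (one_at (o3, o3, zx)).
 have so := one_at_supp; have s2 := iterW_supp 2 states_closed so. have sz : supp states (fun _ => 0 : R) by [].
 have z0 : gm (fun _ => 0 : R) = 0.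
  have -> : (fun=> 0 : R) = (fun s => phi0 s + -1 * phi0 s) by apply/funext => s; rewrite mulN1r subrr.
  by rewrite gm_lin; [rewrite mulN1r subrr|exact: phi0_supp|exact: phi0_supp].
 rewrite -(gm_W 2 so) -[leRHS]add0r -{1}z0 -gm_lin//; apply: gm_le => //.
 - exact: phi0_supp.
 - exact: supp_lin.
 - by move=> s; rewrite add0r; exact: phi0_le.
have h2 : gm (one_at (o3, o3, zx)) <= 18 * gm (sg zx (phin n)).
 have z0 : supp states (fun s => one_at (o3, o3, zx) s + (-18) * sg zx (phin n) s)
  by apply: supp_lin; [exact: one_at_supp|exact: sg_supp].
 rewrite -subr_le0 -mulNr -gm_lin; [|exact: one_at_supp|exact: sg_supp].
 have <- : gm (fun s => phi0 s + (-1) * phi0 s) = 0 by rewrite gm_lin; [rewrite mulN1r subrr|exact: phi0_supp|exact: phi0_supp].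
 apply: gm_le => // [|s].
  by apply: supp_lin; exact: phi0_supp.
 have -> : phi0 s + -1 * phi0 s = 0 by rewrite mulN1r subrr. rewrite mulNr subr_le0 /sg.
 have n1 := phin_ge0 n (sh (- zx) s); have n2 := phin_ge0 n (sh zx s).
 rewrite /one_at; case: eqP => [e|_]; last by rewrite mulr_ge0// divr_ge0// addr_ge0.
 have := phin_o3 n; have -> : (o3, o3, 0) = sh (- zx) s by rewrite e /sh /= subrr. by rewrite mulr1n; move: n1 n2; clear; lra.
rewrite /cmin ler_pdivrMl; last by rewrite mulr_gt0// lamX_gt0.
have l4 : 0 < lam ^+ 4 := lamX_gt0 4.
have h3 := ler_wpM2l (ltW l4) h2.
by apply: le_trans h1 (le_trans h3 _); rewrite mulrA [18 * _]mulrC.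
Qed.

(** Centred by [cn n] so that its mean [gm] vanishes, as [W_decay] requires. *)
Definition psi n s : R := sg zx (phin n) s + (- cn n) * phin n s.

Lemma psi_supp n : supp states (psi n).
Proof. by apply: supp_lin; [exact: sg_supp|exact: phin_supp]. Qed.

Lemma gm_psi n : gm (psi n) = 0.
Proof.
rewrite gm_lin; [|exact: sg_supp|exact: phin_supp].
by rewrite gm_phin /cn mulNr divfK ?subrr// gt_eqF// gm_phi0_gt0.
Qed.

Definition wsum : R := \sum_(s <- states) (wgt s)%:R.

Lemma wgt_ge1 s : s \in states -> (1 <= wgt s)%N.
Proof.
have /andP[/allP wg /eqP sw] := weights_check; move=> ss; apply: wg.
by rewrite /wgt mem_nth// sw index_mem.
Qed.

Lemma l1_le phi : l1 phi <= ndn phi + dgn phi.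
Proof.
rewrite /l1 /full big_cat /= lerD2r /ndn big_seq [leRHS]big_seq; apply: ler_sum => s ss.
by rewrite ler_peMl// ler1n wgt_ge1.
Qed.

Lemma ndn_ge0 phi : 0 <= ndn phi. Proof. by apply: sumr_ge0 => s _; rewrite mulr_ge0. Qed.
Lemma dgn_ge0 phi : 0 <= dgn phi. Proof. by apply: sumr_ge0. Qed.
Lemma dout_ge0 : 0 <= dout.
Proof. by apply: sumr_ge0 => s _; apply: sumr_ge0 => p _; rewrite mulr_ge0. Qed.

(** The factor is [5 / lambda^2], below 24/25 because [lambda^2] exceeds 5.21. *)
Lemma ndn_W phi : supp states phi -> ndn (W phi) <= (24 / 25) * ndn phi + dout * dgn phi.
Proof.
move=> sp; have l2 : 521 / 100 <= lam ^+ 2.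
 by rewrite lamE; have [? _] := lam_bounds; lra.
have l0 : 0 < lam ^+ 2 by rewrite exprn_gt0// lam_gt0.
have -> : ndn (W phi) = lam ^- 2 * ndn (U phi).
 rewrite /ndn mulr_sumr; apply: eq_bigr => s _; rewrite /W normrM gtr0_norm ?invr_gt0//. by rewrite mulrCA.
rewrite ler_pdivrMl//; apply: le_trans (ndn_U sp) _.
have n0 := ndn_ge0 phi; have d0 := mulr_ge0 dout_ge0 (dgn_ge0 phi).
rewrite mulrDr; apply: lerD; last by rewrite ler_peMl//; lra.
by rewrite mulrA; apply: ler_wpM2r => //; lra.
Qed.

Lemma rec_bound (u : nat -> R) (a e : R) : 0 <= a < 1 -> 0 <= e -> (forall n, u n.+1 <= a * u n + e) ->
 forall n, u n <= a ^+ n * u 0%N + e / (1 - a).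
Proof.
move=> /andP[a0 a1] e0 h.
have fx : a * (e / (1 - a)) + e = e / (1 - a) by field; rewrite subr_eq0 gt_eqF.
elim=> [|n IH]; first by rewrite expr0 mul1r lerDl divr_ge0// subr_ge0 ltW.
have := ler_wpM2l a0 IH; rewrite mulrDr mulrA -exprS; have := h n; move: fx; clear; lra.
Qed.

(** The diagonal values tend to [ar j * gm phi = 0] at a rate uniform in [phi]. Once they are below
    [e1], the off-diagonal norm contracts with ratio 24/25 up to a forcing of size [dout * e1]. *)
Lemma W_decay (B eps : R) : 0 < eps -> exists N, forall phi, supp states phi -> (forall s, `|phi s| <= B) -> gm phi = 0 ->
 forall n, (N <= n)%N -> l1 (iter n W phi) <= eps.
Proof.
move=> e0; pose B1 := `|B| + 1.
have B0 : 0 < B1 by rewrite ltr_wpDl.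
pose D := 36 * (B1 * (size full)%:R).
have D0 : 0 <= D by rewrite !mulr_ge0// ltW.
have do0 := dout_ge0.
pose M := B1 * wsum + (dout * D) / (1 - 24 / 25).
have M0 : 0 <= M.
 apply: addr_ge0; first by apply: mulr_ge0; [exact: ltW|apply: sumr_ge0 => s _; exact: ler0n]. by apply: divr_ge0; [exact: mulr_ge0|lra].
have aa : 0 <= (24 / 25 : R) < 1 by apply/andP; split; lra.
(* Here 25 is the sum of the geometric series of ratio 24/25. *)
pose e1 := eps / (4 * (25 * dout + 1)).
have e10 : 0 < e1 by rewrite divr_gt0// mulr_gt0//; move: do0; clear; lra.
have [N1 HN1] := @gm_unif (e1 / (4 * B1)) (divr_gt0 e10 (mulr_gt0 (ltr0Sn _ 3) B0)).
have [N2 HN2] : exists N2 : nat, forall n, (N2 <= n)%N -> (24 / 25) ^+ n * M <= eps / 4.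
 have c : (24 / 25 : R) ^+ n * M @[n --> \oo] --> (0 : R).
  rewrite -[X in _ --> X](mul0r M); apply: cvgM; last exact: cvg_cst. by apply: cvg_expr; rewrite ger0_norm; lra.
 have e4 : 0 < eps / 4 by rewrite divr_gt0. exact: cvg0_ev c e4.
exists (N1 + N2)%N => phi sp pB g0 n nN.
have pB1 s : `|phi s| <= B1 by apply: le_trans (pB s) _; rewrite (le_trans (ler_norm B))// lerDl.
have sn k := iterW_supp k states_closed sp.
have dk k : dgn (iter k W phi) <= D.
 rewrite /dgn /D /dstates big_map -[36]/(36%:R) (_ : 36%N = 4 * 9)%N// natrM -mulrA.
 have -> (X : R) : 4%:R * X = \sum_(j <- ord4) X by rewrite sum_cst mulr_natl. apply: ler_sum => j _; have := eval_bound k j 0 sp.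
 have -> : shft 0 phi = phi by apply/funext => -[i y]; rewrite /shft /sh addr0. move/le_trans; apply; apply: ler_wpM2l => //.
 rewrite /l1 mulr_natr -iter_addr_0 -(count_predT full) -big_const_seq; exact: ler_sum.
have nk k : ndn (iter k W phi) <= M.
 have r1 m : ndn (iter m.+1 W phi) <= 24 / 25 * ndn (iter m W phi) + dout * D
  by apply: le_trans (ndn_W (sn m)) _; rewrite lerD2l ler_wpM2l.
 have := rec_bound aa (mulr_ge0 do0 D0) r1 k; move/le_trans; apply; rewrite lerD2r. apply: (le_via (ndn phi)).
  by rewrite ler_piMl ?ndn_ge0// exprn_ile1//; lra.
 rewrite /ndn /wsum mulr_sumr; apply: ler_sum => s _; rewrite mulrC ler_wpM2r//.
have dk1 k : (N1 <= k)%N -> dgn (iter k W phi) <= e1.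
 move=> Nk; rewrite /dgn /dstates big_map. have -> : e1 = \sum_(j <- ord4) B1 * (e1 / (4 * B1)).
  rewrite sum_cst /= -mulr_natr; field. by rewrite gt_eqF.
 apply: ler_sum => j _; have := HN1 _ _ sp pB1 k j Nk. by rewrite g0 mulr0 subr0.
pose k := (n - N1)%N.
have nE : n = (k + N1)%N by rewrite /k subnK// (leq_trans _ nN)// leq_addr.
have r2 m : ndn (iter m.+1 W (iter N1 W phi)) <= 24 / 25 * ndn (iter m W (iter N1 W phi)) + dout * e1.
 rewrite iterS; apply: le_trans (ndn_W _) _; first by rewrite -iterD; exact: sn. by rewrite lerD2l ler_wpM2l// -iterD dk1// leq_addl.
have := rec_bound aa (mulr_ge0 do0 (ltW e10)) r2 k; rewrite -iterD -nE => h1.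
have h2 : (24 / 25) ^+ k * ndn (iter N1 W phi) <= eps / 4.
 apply: le_trans (HN2 k _); first by rewrite ler_wpM2l ?nk// exprn_ge0//; lra. by rewrite /k leq_subRL// (leq_trans _ nN)// leq_addr.
apply: le_trans (l1_le _) _.
have h3 := dk1 n (leq_trans (leq_addr _ _) nN).
have h4 : dout * e1 / (1 - 24 / 25) + e1 = eps / 4 + 24 * (dout * e1) * 0.
 have -> : dout * e1 / (1 - 24 / 25) + e1 = (25 * dout + 1) * e1 by field. rewrite /e1 mulr0 addr0; field.
 by rewrite gt_eqF//; move: do0; clear; lra.
move: h1 h2 h3 h4 e0; rewrite mulr0 addr0; clear; lra.
Qed.
End States.

(** * Means of characters at dilated frequencies *)

Section TrigMean.
Implicit Types (phi : state -> R) (q w : pt) (F G : P -> R) (k x : P) (u : 'I_4 -> R[i]).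

(** The mean of an almost periodic function, taken along the dilations by [lambda^n] that occur when
    sums factor. The weight [w2 1] has total mass 4, so the constant 1 has mean 4. *)
Definition tmean F (c : R) : Prop :=
 (forall n, rint2 (fun k => w2 1 k * F (sc (lam ^+ n) k))) /\
 Int2 (fun k => w2 1 k * F (sc (lam ^+ n) k)) @[n --> \oo] --> c.

Lemma tmean_ext F G c d : F =1 G -> c = d -> tmean F c -> tmean G d.
Proof. by move=> /funext -> ->. Qed.

Lemma tmeanD F G c d : tmean F c -> tmean G d -> tmean (fun k => F k + G k) (c + d).
Proof.
move=> [r1 c1] [r2 c2]; split => [n|].
 by under eq_fun do rewrite mulrDr; exact: rintD.
have e n : Int2 (fun k => w2 1 k * (F (sc (lam ^+ n) k) + G (sc (lam ^+ n) k))) =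
  Int2 (fun k => w2 1 k * F (sc (lam ^+ n) k)) + Int2 (fun k => w2 1 k * G (sc (lam ^+ n) k)).
 by rewrite -IntD//; apply: eq_Int => k; rewrite mulrDr.
by under eq_cvg do rewrite e; exact: cvgD.
Qed.

Lemma tmeanZ a F c : tmean F c -> tmean (fun k => a * F k) (a * c).
Proof.
move=> [r1 c1]; split => [n|].
 by under eq_fun do rewrite mulrCA; exact: rintZ.
have e n : Int2 (fun k => w2 1 k * (a * F (sc (lam ^+ n) k))) = a * Int2 (fun k => w2 1 k * F (sc (lam ^+ n) k))
 by rewrite -IntZ//; apply: eq_Int => k; rewrite mulrCA.
by under eq_cvg do rewrite e; apply: cvgM => //; exact: cvg_cst.
Qed.

Lemma tmean0 : tmean (fun=> 0) 0.
Proof.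
split => [n|].
 by under eq_fun do rewrite mulr0; exact: rint0.
have e : (fun k : P => w2 1 k * 0) = (fun=> 0 : R) by apply/funext => k; rewrite mulr0.
by rewrite e; under eq_cvg do rewrite Int0; exact: cvg_cst.
Qed.

Lemma tmean_sum (I : Type) (s : seq I) (F : I -> P -> R) (c : I -> R) :
 (forall i, tmean (F i) (c i)) -> tmean (fun k => \sum_(i <- s) F i k) (\sum_(i <- s) c i).
Proof.
move=> H; elim: s => [|i s IH].
 by apply: (tmean_ext _ _ tmean0) => [k|]; rewrite big_nil.
by apply: (tmean_ext _ _ (tmeanD (H i) IH)) => [k|]; rewrite big_cons.
Qed.

Definition coe q k : R := cos (2 * pi * inner k (pv q)).

Lemma poisson1_le (t : R) : poisson 1 t <= 2 /\ (t != 0 -> poisson 1 t <= `|t|^-1).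
Proof.
rewrite /poisson mulr1 expr1n; set y := 2 * pi * t.
have s0 : 0 <= y ^+ 2 := sqr_ge0 y.
have p0 : 0 < 1 + y ^+ 2 by move: s0; clear; lra.
split; first by rewrite ler_pdivrMr//; move: s0; clear; lra.
move=> t0; have a0 : 0 < `|t| by rewrite normr_gt0.
have yt : `|t| <= `|y|.
 rewrite /y normrM ler_peMl// ger0_norm ?mulr_ge0 ?pi_ge0//. by have := pi_ge2 R; clear; lra.
rewrite ler_pdivrMr// ler_pdivlMl//.
have := sqr_ge0 (`|y| - 1); rewrite sqrrB1 real_normK ?num_real// -mulr_natr.
by move: yt; clear; lra.
Qed.

Lemma sc_lam_cvg (t : R) : t != 0 -> poisson 1 (lam ^+ n * t) @[n --> \oo] --> (0 : R).
Proof.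
move=> t0; have c : lam ^- n * `|t|^-1 @[n --> \oo] --> (0 : R).
 by rewrite -[X in _ --> X](mul0r `|t|^-1); apply: cvgM; [exact: lamV_cvg|exact: cvg_cst].
apply: cvg0_le c; apply: nearW => n.
rewrite ger0_norm ?(ltW (poisson_gt0 _ ltr01))//.
have l0 := lamX_gt0 n; have n0 : lam ^+ n * t != 0 by rewrite mulf_neq0// gt_eqF.
by have [_ /(_ n0)] := poisson1_le (lam ^+ n * t); rewrite normrM gtr0_norm// invfM.
Qed.

Lemma tmean_coe q : tmean (coe q) (4 * (q == 0)%:R).
Proof.
have e n k : w2 1 k * coe q (sc (lam ^+ n) k) = w2 1 k * cos (2 * pi * inner k (sc (lam ^+ n) (pv q))) by rewrite /coe inner_sc.
split => [n|].
 apply: rint_le (rint_w2 ltr01) => [|k]; last by apply: normr_w2M_le; rewrite ler_norml cos_geN1 cos_le1.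
 under eq_fun do rewrite e. set v := sc _ _. have mc : mfun (fun k => cos (2 * pi * inner k v)).
  have -> : (fun k => cos (2 * pi * inner k v)) = (fun k => cos (2 * pi * inner v k))
   by apply/funext => k; congr (cos (_ * _)); rewrite /inner; ring.
  exact: cont_mfun (@continuous_cos_inner v).
 by apply: mfunM => //; exact: meas_w2.
have E n : Int2 (fun k => w2 1 k * coe q (sc (lam ^+ n) k)) = K2 1 (sc (lam ^+ n) (pv q))
 by rewrite -(Int_w2_cos _ ltr01).1; apply: eq_Int; exact: e.
have -> : (fun n => Int2 (fun k => w2 1 k * coe q (sc (lam ^+ n) k))) =
  (fun n => poisson 1 (lam ^+ n * (pv q).1) * poisson 1 (lam ^+ n * (pv q).2)).
 by apply/funext => n; exact: E.
have p0 (x : R) := ltW (poisson_gt0 x (ltr01 : 0 < (1 : R))).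
have [->|q0] := eqVneq q 0.
 have -> : pv 0 = 0 by rewrite /pv /zv /= mul0r addr0. under eq_cvg do rewrite !mulr0.
 have -> : poisson 1 (0 : R) = 2 by rewrite /poisson !mulr0 expr0n addr0 expr1n divr1 mulr1.
 by rewrite (_ : 4 * _ = 2 * 2 :> R); [exact: cvg_cst|rewrite mulr1; ring].
have [z1|z1] := eqVneq (pv q).1 0; last first.
 have c : poisson 1 (lam ^+ n * (pv q).1) * 2 @[n --> \oo] --> (4 * 0 : R)
  by rewrite mulr0 -[X in _ --> X](mul0r (2 : R)); apply: cvgM; [exact: sc_lam_cvg|exact: cvg_cst].
 rewrite mulr0 in c *; apply: cvg0_le c; apply: nearW => n.
 rewrite (ger0_norm (mulr_ge0 (p0 _) (p0 _))); apply: (ler_wpM2l (p0 _)); exact: (poisson1_le _).1.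
have z2 : (pv q).2 != 0.
 apply: contra q0 => /eqP z2; apply/eqP; apply: (@pv_inj). have -> : pv 0 = 0 by rewrite /pv /zv /= mul0r addr0.
 by rewrite [LHS]pairE z1 z2.
have c : 2 * poisson 1 (lam ^+ n * (pv q).2) @[n --> \oo] --> (4 * 0 : R)
 by rewrite mulr0 -[X in _ --> X](mulr0 (2 : R)); apply: cvgM_cst; exact: sc_lam_cvg.
rewrite mulr0 in c *; apply: cvg0_le c; apply: nearW => n.
rewrite (ger0_norm (mulr_ge0 (p0 _) (p0 _))); apply: (ler_wpM2r (p0 _)); exact: (poisson1_le _).1.
Qed.

Lemma cos_prod (a b : R) : cos a * cos b = (cos (a - b) + cos (a + b)) / 2.
Proof. by rewrite !cosD cosN sinN; field. Qed.

Lemma coeM q w k : coe q k * coe w k = (coe (q - w) k + coe (q + w) k) / 2.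
Proof.
have zb : pv (q - w) = pv q - pv w by rewrite /pv /= !zvB.
by rewrite /coe cos_prod -mulrBr -mulrDr -innerB -innerD -pvD zb.
Qed.

Definition tau1 (i i' : 'I_4) (_ : P) : R[i] := delta4 i i'.
(** Summing over the marked type leaves only pairs of equal types, so the means of [Gm] involve
    nothing but iterates of shifts of [phi0]; it also dominates each type-wise factor of a supertile
    sum. *)
Definition Gm m j k : R := lam ^- (2 * m) * \sum_(i < 4) normc (psum (tau1 i) m j k) ^+ 2.

Lemma GmE m j k : Gm m j k = lam ^- (2 * m) *
 \sum_(x <- isup m j) \sum_(x' <- isup m j) (x.1 == x'.1)%:R * coe (x'.2 - x.2) k.
Proof.
rewrite /Gm; congr (_ * _).
transitivity (\sum_(i < 4) \sum_(x <- isup m j) \sum_(x' <- isup m j)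
  (i == x.1)%:R * (i == x'.1)%:R * coe (x'.2 - x.2) k).
 apply: eq_bigr => i _; rewrite /psum rsup_isup big_map. have -> : \sum_(x <- isup m j) tau1 i x.1 k * ek k (- pv x.2) =
   \sum_(x <- isup m j) (((i == x.1)%:R : R)%:C)%C * ek k (- pv x.2).
  by apply: eq_bigr => x _; rewrite /tau1 /delta4; case: (_ == _).
 rewrite normc2_sum; apply: eq_bigr => x _; apply: eq_bigr => x' _. by rewrite /coe /pv /= !zvB.
rewrite exchange_big /=; apply: eq_bigr => x _; rewrite exchange_big /=; apply: eq_bigr => x' _.
rewrite (bigD1 x.1)//= eqxx mul1r big1 ?addr0// => i /negbTE ->.
by rewrite !mul0r.
Qed.

(** Only pairs of total displacement 0 have a nonzero mean, so each cosine factor acts as a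
    symmetric shift on the coincidence function. *)
Lemma mean_G m j w w' : tmean (fun k => Gm m j k * (coe w k * coe w' k))
 (4 * iter m (@W) (sg w (sg w' (@phi0))) (j, j, 0)).
Proof.
pose T (x x' : 'I_4 * pt) q : P -> R := fun k => (x.1 == x'.1)%:R * coe q k.
pose c (x x' : 'I_4 * pt) q : R := (x.1 == x'.1)%:R * (4 * (q == 0)%:R).
have t a b q : tmean (T a b q) (c a b q) by apply: tmeanZ; exact: tmean_coe.
pose S (x x' : 'I_4 * pt) k := let q := x'.2 - x.2 in
 4^-1 * ((T x x' (q - w - w') k + T x x' (q - w + w') k) + (T x x' (q + w - w') k + T x x' (q + w + w') k)).
pose s (x x' : 'I_4 * pt) := let q := x'.2 - x.2 in
 4^-1 * ((c x x' (q - w - w') + c x x' (q - w + w')) + (c x x' (q + w - w') + c x x' (q + w + w'))).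
have h : tmean (fun k => lam ^- (2 * m) * \sum_(x <- isup m j) \sum_(x' <- isup m j) S x x' k)
 (lam ^- (2 * m) * \sum_(x <- isup m j) \sum_(x' <- isup m j) s x x').
 apply: tmeanZ; apply: tmean_sum => x; apply: tmean_sum => x'; apply: tmeanZ. by apply: tmeanD; apply: tmeanD; exact: t.
apply: tmean_ext h => [k|].
 rewrite GmE -[RHS]mulrA; congr (_ * _); rewrite mulr_suml; apply: eq_bigr => x _.
 rewrite mulr_suml; apply: eq_bigr => x' _; rewrite /S /T -mulrA.
 have := coeM (x'.2 - x.2) w k; have := coeM (x'.2 - x.2 - w) w' k; have := coeM (x'.2 - x.2 + w) w' k.
 rewrite [coe _ k * (coe w k * _)]mulrA => h1 h2 ->.
 rewrite [X in _ = _ * X](_ : _ = (coe (x'.2 - x.2 - w) k * coe w' k + coe (x'.2 - x.2 + w) k * coe w' k) / 2).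
  by rewrite h1 h2; field.
 by field.
rewrite iterW iterU plam_iter0 mulrCA; congr (_ * _); rewrite mulr_sumr; apply: eq_bigr => x _.
rewrite mulr_sumr; apply: eq_bigr => x' _; rewrite /s /c /sg /phi0 /dgs /sh /= !add0r.
case: (x.1 == x'.1) => /=; last by rewrite !(mul0r, addr0, mulr0, mulr0n).
by rewrite !mul1r; field.
Qed.

Definition Dg w (c : R) phi s : R := sg w phi s + (- c) * phi s.
Definition dc w (c : R) k : R := coe w k - c.

Lemma sg0 phi : sg 0 phi = phi.
Proof.
apply/funext => -[i y]; rewrite /sg /sh oppr0 addr0 /=.
by field.
Qed.

Lemma sg_lin w (c : R) phi psi : sg w (fun s => phi s + c * psi s) = (fun s => sg w phi s + c * sg w psi s).
Proof. by apply/funext => s; rewrite /sg; ring. Qed.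

Lemma coe0 k : coe 0 k = 1.
Proof. by rewrite /coe /pv /zv /inner /= mul0r addr0 !mulr0 addr0 mulr0 cos0. Qed.

Lemma mean_GD m j w c w' c' : tmean (fun k => Gm m j k * (dc w c k * dc w' c' k))
 (4 * iter m (@W) (Dg w c (Dg w' c' (@phi0))) (j, j, 0)).
Proof.
have h := tmeanD (tmeanD (mean_G m j w w') (tmeanZ (- c') (mean_G m j w 0)))
 (tmeanD (tmeanZ (- c) (mean_G m j 0 w')) (tmeanZ (c * c') (mean_G m j 0 0))).
apply: tmean_ext h => [k|]; first by rewrite /dc coe0; ring.
rewrite /Dg sg_lin !sg0.
have -> : (fun s => sg w (sg w' (@phi0)) s + - c' * sg w (@phi0) s + - c * (sg w' (@phi0) s + - c' * phi0 s)) =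
 (fun s => (fun s => sg w (sg w' (@phi0)) s + - c' * sg w (@phi0) s) s + - c * (fun s => sg w' (@phi0) s + - c' * phi0 s) s) by [].
rewrite !(iterWD, iterWZ); ring.
Qed.

(** A displacement by [w] becomes one by [lambda w] after inflation. *)
Lemma W_sg w phi : W (sg (plam w) phi) = sg w (W phi).
Proof.
apply/funext => s; rewrite /W /sg /U -mulrDr -mulrA; congr (_ * _).
rewrite -big_split mulr_suml; apply: eq_bigr => x _; rewrite -big_split mulr_suml; apply: eq_bigr => x' _.
have pD (a b : pt) : plam (a + b) = plam a + plam b := plam_iterD 1 a b.
have pN (a : pt) : plam (- a) = - plam a := plam_iterN 1 a.
have k a : kid (sh a s) x x' = sh (plam a) (kid s x x').
 rewrite /sh /kid; congr (_, _). change (plam (s.2 + a) + x'.2 - x.2 = plam s.2 + x'.2 - x.2 + plam a).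
 by rewrite pD [RHS]addrAC [plam s.2 + x'.2 + _]addrAC.
by rewrite !k pN.
Qed.

Lemma iterW_Dg n w (c : R) phi : iter n (@W) (Dg (iter n plam w) c phi) = Dg w c (iter n (@W) phi).
Proof.
elim: n phi => // n IH phi; rewrite !iterSr -IH; congr (iter n _ _).
by rewrite /Dg -iterSr iterS WD W_sg WZ.
Qed.

(** The first [a] inflations turn the inner factor into [psi a], which then decays during [b - a]
    inflations before the outer factor acts. Distant exponents are thus nearly uncorrelated. *)
Lemma iter_Dg a b m : (a <= b)%N -> (b <= m)%N ->
 iter m (@W) (Dg (iter b plam zx) (cn b) (Dg (iter a plam zx) (cn a) (@phi0))) =
 iter (m - b) (@W) (Dg zx (cn b) (iter (b - a) (@W) (psi a))).
Proof.
move=> ab bm; rewrite -{1}(subnK bm) iterD iterW_Dg; congr (iter _ _ (Dg _ _ _)).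
by rewrite -{1}(subnK ab) iterD iterW_Dg.
Qed.

Lemma iter_Dg_bound m j (c : R) chi : supp states chi ->
 `|iter m (@W) (Dg zx c chi) (j, j, 0)| <= 9 * (1 + `|c|) * l1 chi.
Proof.
move=> sp; have -> : Dg zx c chi = (fun s => (2^-1 * shft (- zx) chi s + 2^-1 * shft zx chi s) + (- c) * chi s).
 by apply/funext => s; rewrite /Dg /sg /shft; field.
rewrite iterWD (iterWD _ (fun s => 2^-1 * _)) !iterWZ.
have h1 := eval_bound m j (- zx) sp; have h2 := eval_bound m j zx sp; have h3 := eval_bound m j 0 sp.
have e0 : shft 0 chi = chi by apply/funext => -[i y]; rewrite /shft /sh addr0.
rewrite e0 in h3.
apply: le_trans (ler_normD _ _) _; rewrite normrM normrN.
apply: (le_via (2^-1 * `|iter m (@W) (shft (- zx) chi) (j, j, 0)| + 2^-1 * `|iter m (@W) (shft zx chi) (j, j, 0)| +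
 `|c| * (9 * l1 chi))). apply: lerD; last exact: ler_wpM2l. by apply: le_trans (ler_normD _ _) _; rewrite !normrM ger0_norm// invr_ge0.
have -> : 9 * (1 + `|c|) * l1 chi = 2^-1 * (9 * l1 chi) + 2^-1 * (9 * l1 chi) + `|c| * (9 * l1 chi) by field.
by rewrite lerD2r; apply: lerD; apply: ler_wpM2l; rewrite ?invr_ge0.
Qed.

Lemma cn_bound : exists2 K : R, 0 <= K & forall n, `|cn n| <= K.
Proof.
have g0 := gm_phi0_gt0; exists (9 * (9 * (size full)%:R) / gm (@phi0)).
 by rewrite divr_ge0 ?(ltW g0)// !mulr_ge0.
move=> n; have c0 := le_trans (ltW (cmin_gt0)) (cn_ge n); rewrite ger0_norm// /cn ler_pM2r ?invr_gt0//.
have lim := gm_c3 (@sg_supp n); apply: ler_cvg_to lim (cvg_cst _) _; apply: nearW => m.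
apply: (le_trans (ler_norm _)); have h w := eval_bound m o3 w (@phin_supp n).
have e : sg zx (phin n) = (fun s => 2^-1 * shft (- zx) (phin n) s + 2^-1 * shft zx (phin n) s)
 by apply/funext => s; rewrite /sg /shft; field.
rewrite e iterWD !iterWZ; apply: le_trans (ler_normD _ _) _; rewrite !normrM ger0_norm ?invr_ge0//.
have h1 := h (- zx); have h2 := h zx.
have b : l1 (phin n) <= 9 * (size full)%:R.
 rewrite mulr_natr -iter_addr_0 -(count_predT full) -big_const_seq; apply: ler_sum => s _. by rewrite ger0_norm ?phin_ge0 ?phin_le9.
by move: h1 h2 b; clear; lra.
Qed.

Lemma psi_bound : exists2 B : R, 0 <= B & forall n s, `|psi n s| <= B.
Proof.
have [K K0 cK] := cn_bound; exists (9 + K * 9); first by rewrite addr_ge0// mulr_ge0.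
move=> n s; rewrite /psi; apply: le_trans (ler_normD _ _) _; rewrite (normrM (- cn n)) normrN.
have p (x : state) : `|phin n x| <= 9 by rewrite ger0_norm ?phin_ge0 ?phin_le9.
apply: lerD; last by apply: ler_pM.
rewrite /sg normrM [X in _ * X]ger0_norm ?invr_ge0// ler_pdivrMr//.
apply: le_trans (ler_normD _ _) _; have := p (sh (- zx) s); have := p (sh zx s); clear; lra.
Qed.

(* The [r] characters sampled in [Sm] become nearly uncorrelated under [Gm] when [D] is large. *)
Definition ex D t : pt := iter (D * t) plam zx.
Definition Sm D r k : R := (r%:R)^-1 * \sum_(t < r) coe (ex D t) k.
Definition cm D r : R := (r%:R)^-1 * \sum_(t < r) cn (D * t).

Lemma cm_ge D r : (0 < r)%N -> cmin <= cm D r.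
Proof.
move=> r0; rewrite /cm ler_pdivlMl ?ltr0n//.
apply: (le_via (\sum_(t < r) cmin)); first by rewrite sumr_const card_ord mulr_natl.
by apply: ler_sum => t _; exact: cn_ge.
Qed.

(** Distinct powers of [lambda] neither coincide nor cancel, so the cosines are orthogonal in mean
    and the average has variance of order [1 / r]. *)
Lemma mean_S D r : (0 < r)%N -> (0 < D)%N -> exists2 c : R, c <= 4 / r%:R & tmean (fun k => Sm D r k ^+ 2) c.
Proof.
move=> r0 D0; pose c (t t' : 'I_r) : R := 2^-1 * (4 * (ex D t - ex D t' == 0)%:R + 4 * (ex D t + ex D t' == 0)%:R).
exists ((r%:R)^-1 * ((r%:R)^-1 * \sum_(t < r) \sum_(t' < r) c t t')); last first.
 have h : tmean (fun k => (r%:R)^-1 * ((r%:R)^-1 * \sum_(t < r) \sum_(t' < r) 2^-1 * (coe (ex D t - ex D t') k + coe (ex D t + ex D t') k)))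
  ((r%:R)^-1 * ((r%:R)^-1 * \sum_(t < r) \sum_(t' < r) c t t')).
  apply: tmeanZ; apply: tmeanZ; apply: tmean_sum => t; apply: tmean_sum => t'; apply: tmeanZ. by apply: tmeanD; exact: tmean_coe.
 apply: tmean_ext h => // k; rewrite /Sm expr2 mulrACA -mulrA; congr (_ * (_ * _)).
 rewrite big_distrlr /=; apply: eq_bigr => t _; apply: eq_bigr => t' _. by rewrite coeM mulrC.
have px n : (pv (iter n plam zx)).1 = lam ^+ n by rewrite pv_iter /sc /pv /zv /= mul0r addr0 mulr1.
have c0 (t t' : 'I_r) : t != t' -> c t t' = 0.
 move=> tt; rewrite /c; case: eqP => [e|_]; last first.
  case: eqP => [e|_]; last by rewrite !mulr0 addr0 mulr0.
  exfalso; have := congr1 (fun q => (pv q).1) e; rewrite -[LHS]/((pv (ex D t + ex D t')).1) pvD -[LHS]/((pv (ex D t)).1 + (pv (ex D t')).1) /ex !px /pv /zv /= mul0r addr0 => /eqP.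
  by rewrite gt_eqF// addr_gt0// lamX_gt0.
 exfalso; move: e => /eqP; rewrite subr_eq0 => /eqP e.
 have := congr1 (fun q => (pv q).1) e; rewrite -[LHS]/((pv (ex D t)).1) -[RHS]/((pv (ex D t')).1) /ex !px => /ieexprIn e'.
 have l1' : lam != 1 by have [? _] := lam_bounds; rewrite gt_eqF//; lra.
 move: (e' (lam_gt0) l1') => /eqP; rewrite eqn_pmul2l// => /eqP/val_inj e2; by rewrite e2 eqxx in tt.
have r1 : 0 < (r%:R : R) by rewrite ltr0n.
rewrite mulrC; apply: ler_wpM2r; first by rewrite invr_ge0 ltW.
rewrite ler_pdivrMl//.
apply: (le_via (\sum_(t < r) (4 : R))); last by rewrite sumr_const card_ord mulr_natl.
apply: ler_sum => t _; rewrite (bigD1 t)//= big1 ?addr0 => [|t' tt]; last by apply: c0; rewrite eq_sym.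
rewrite /c subrr eqxx; case: (_ == _) => /=; lra.
Qed.

(** The gap [D] exceeds the decay time, so off-diagonal covariances are at most [eta / 2]; then [r]
    is taken so large that the diagonal ones contribute at most [eta / 2]. *)
Lemma mean_GS (eta : R) : 0 < eta -> exists r D m, [/\ (0 < r)%N, (0 < D)%N & forall j,
 exists2 c : R, c <= eta & tmean (fun k => Gm m j k * (Sm D r k - cm D r) ^+ 2) c /\
 exists2 c' : R, c' <= eta & tmean (fun k => Sm D r k ^+ 2) c'].
Proof.
move=> e0; have [K K0 cK] := cn_bound; have [B B0 pB] := psi_bound.
pose A := 36 * (1 + K); have A0 : 0 < A by rewrite mulr_gt0// ltr_wpDr.
have [N HN] := @W_decay B (eta / (2 * A)) (divr_gt0 e0 (mulr_gt0 (ltr0Sn _ 1) A0)).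
pose D := N.+1; pose Z := A * (B * (size full)%:R) + 4.
have Z0 : 0 < Z by rewrite ltr_wpDl// mulr_ge0 ?(ltW A0)// mulr_ge0.
pose r := (Num.truncn (2 * Z / eta)).+1.
have r1 : 0 < (r%:R : R) by rewrite ltr0n.
have rZ : Z / r%:R <= eta / 2.
 rewrite ler_pdivrMr// mulrC -ler_pdivrMr; last by rewrite divr_gt0.
 have -> : Z / (eta / 2) = 2 * Z / eta by field; rewrite gt_eqF. exact/ltW/truncnS_gt.
(* All sampled exponents are at most [m], as [iter_Dg] requires. *)
pose m := (D * r)%N; exists r, D, m; split => // j.
have [c' c'4 mc'] := @mean_S D r isT isT.
pose I a b := 4 * iter m (@W) (Dg (iter b plam zx) (cn b) (Dg (iter a plam zx) (cn a) (@phi0))) (j, j, 0).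
pose M a b := if (a <= b)%N then I a b else I b a.
have mM a b : tmean (fun k => Gm m j k * (dc (iter a plam zx) (cn a) k * dc (iter b plam zx) (cn b) k)) (M a b).
 rewrite /M /I; case: leqP => _; [|exact: mean_GD].
 by apply: tmean_ext (mean_GD m j (iter b plam zx) (cn b) (iter a plam zx) (cn a)) => // k; rewrite [dc _ _ k * _]mulrC.
pose c := (r%:R)^-1 * ((r%:R)^-1 * \sum_(t < r) \sum_(t' < r) M (D * t)%N (D * t')%N).
exists c; last first.
 split; last by exists c' => //; apply: le_trans c'4 _; apply: le_trans (le_trans rZ _); [rewrite ler_pM2r ?invr_gt0// /Z lerDr mulr_ge0 ?(ltW A0)// mulr_ge0|lra].
 have h : tmean (fun k => (r%:R)^-1 * ((r%:R)^-1 * \sum_(t < r) \sum_(t' < r) Gm m j k * (dc (ex D t) (cn (D * t)) k * dc (ex D t') (cn (D * t')) k))) c.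
  apply: tmeanZ; apply: tmeanZ; apply: tmean_sum => t; apply: tmean_sum => t'; exact: mM.
 apply: tmean_ext h => // k.
 have -> : Sm D r k - cm D r = (r%:R)^-1 * \sum_(t < r) dc (ex D t) (cn (D * t)) k by rewrite /Sm /cm -mulrBr -sumrB.
 under eq_bigr => t _ do rewrite -mulr_sumr -mulr_sumr. rewrite -mulr_sumr -mulr_suml; ring.
have bI a b : (a <= b)%N -> (b <= m)%N -> `|I a b| <= A * l1 (iter (b - a) (@W) (psi a)).
 move=> ab bm; rewrite /I iter_Dg// normrM ger0_norm//.
 have := iter_Dg_bound (m - b) j (cn b) (iterW_supp (b - a) states_closed (@psi_supp a)).
 have l0 := l1_ge0 (iter (b - a) (@W) (psi a)). have q : 9 * (1 + `|cn b|) <= 9 * (1 + K) by rewrite ler_wpM2l// lerD2l.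
 have := ler_wpM2r l0 q; rewrite /A; clear; lra.
have l1B a : l1 (psi a) <= B * (size full)%:R by rewrite mulr_natr -iter_addr_0 -(count_predT full) -big_const_seq; apply: ler_sum => s _.
have bM (t t' : 'I_r) : M (D * t)%N (D * t')%N <= (t == t')%:R * (A * (B * (size full)%:R)) + eta / 2.
 have off a b : (a < b)%N -> (b < r)%N -> I (D * a)%N (D * b)%N <= eta / 2.
  move=> ab br; apply: (le_trans (ler_norm _)); have bm : (D * b <= m)%N by rewrite leq_mul2l ltnW ?orbT.
  apply: le_trans (bI _ _ _ bm) _; first by rewrite leq_mul2l ltnW ?orbT.
  have := HN _ (@psi_supp (D * a)) (pB _) (@gm_psi _) (D * b - D * a)%N.
  rewrite -mulnBr => /(_ _)/(ler_wpM2l (ltW A0)) h; apply: (le_trans (h _)).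
   by rewrite (leq_trans (leqnSn N))// leq_pmulr// subn_gt0.
  by apply: eqW; field; rewrite gt_eqF.
 have e2 : 0 <= eta / 2 by rewrite divr_ge0// ltW. rewrite /M leq_pmul2l//; case: ltngtP => [tt|tt|tt].
 - have -> : (t == t') = false by apply/eqP => e; rewrite e ltnn in tt.
  by rewrite mul0r add0r; exact: off.
 - have -> : (t == t') = false by apply/eqP => e; rewrite e ltnn in tt.
  by rewrite mul0r add0r; exact: off.
 - rewrite (val_inj tt) eqxx mul1r; apply: ler_wpDr => //.
  apply: (le_trans (ler_norm _)); apply: le_trans (bI _ _ (leqnn _) _) _.
   by rewrite leq_mul2l ltnW ?orbT.
  by rewrite subnn; apply: ler_wpM2l; [exact: ltW|exact: l1B].
rewrite /c ler_pdivrMl// ler_pdivrMl//.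
apply: (le_via (\sum_(t < r) (A * (B * (size full)%:R) + r%:R * (eta / 2)))).
 apply: ler_sum => t _; apply: (le_via (\sum_(t' < r) ((t == t')%:R * (A * (B * (size full)%:R)) + eta / 2))).
  by apply: ler_sum => t' _; exact: bM.
 rewrite big_split /= sumr_const card_ord mulr_natl lerD2r (bigD1 t)//= eqxx mul1r big1 ?addr0// => t' tt.
 by rewrite eq_sym (negbTE tt) mul0r.
rewrite sumr_const card_ord -[leLHS]mulr_natl ler_pM2l//.
have : Z <= r%:R * (eta / 2) by rewrite mulrC -ler_pdivrMr.
by rewrite /Z; clear; lra.
Qed.

(** * Small affinity with Lebesgue measure and singularity *)

Lemma wt_le (s : seq (R[i] * P)) (B : R) n j : unzip2 s = unzip2 (rsup n j) ->
 (forall p, p \in s -> normc p.1 <= B) -> wt s <= 9 * B ^+ 2 * lam ^+ (2 * n).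
Proof.
move=> e sB; have ss : size s = size (rsup n j) by rewrite -(size_map snd) -/(unzip2 _) e size_map.
apply: (le_via (\sum_(p <- s) B ^+ 2)).
 rewrite /wt big_seq [leRHS]big_seq; apply: ler_sum => p ps. have h := sB _ ps; have h0 := normc_ge0 p.1.
 by rewrite lerXn2r// nnegrE// (le_trans h0).
rewrite sum_cst ss -[leLHS]mulr_natr.
have -> : 9 * B ^+ 2 * lam ^+ (2 * n) = B ^+ 2 * (9 * lam ^+ (2 * n)) by ring.
by rewrite ler_wpM2l ?sqr_ge0// size_rsup.
Qed.

Lemma box_L2 (L : R) : 0 <= L -> exists2 C : R, 0 <= C & forall s B n j, unzip2 s = unzip2 (rsup n j) ->
 (forall p, p \in s -> normc p.1 <= B) ->
 let F k := \1_(cbx P0 L) k * (lam ^- (2 * n) * normc (tsum s k) ^+ 2) in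
 rint2 F /\ Int2 F <= C * B ^+ 2.
Proof.
move=> L0; have [C C0 H] := scaled_box_bound; exists (C * (1 * L + 2) ^+ 2 * 9).
 exact: mulr_ge0 (mulr_ge0 C0 (sqr_ge0 _)) (ler0n _ _).
move=> s B n j e sB F; have l0 := lamX_gt0 (2 * n).
have ss : pairwise (@sepr) (unzip2 s) by rewrite e; exact: rsup_sepr.
have [r1 b1] := H s P0 1 L ss ltr01 L0.
have FE : F = (fun k => lam ^- (2 * n) * (\1_(cbx P0 L) k * normc (tsum s (sc 1 k)) ^+ 2))
 by apply/funext => k; rewrite /F sc1 mulrCA.
rewrite FE; split; first exact: rintZ.
rewrite IntZ// ler_pdivrMl//; apply: (le_trans b1).
have w := wt_le e sB; rewrite expr1n invr1 mulr1.
have c0 : 0 <= C * (1 * L + 2) ^+ 2 by rewrite mulr_ge0// sqr_ge0.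
apply: le_trans (ler_wpM2l c0 w) _.
by apply: eqW; ring.
Qed.

Definition cu u (i : 'I_4) (_ : P) : R[i] := u i.
Definition ulist u n j : seq (R[i] * P) := [seq (u y.1, y.2) | y <- rsup n j].
(** The product of a level-[n] sum of type [i] and a dilated level-[m] sum, written as one sum over
    the level-[n + m] supertile with coefficients set to 0 outside the supertiles of type [i]. The
    large sieve thus applies to the product. *)
Definition plist u i n m j : seq (R[i] * P) :=
 [seq (if p.1 == i then u y.1 else 0, sc (lam ^+ n) p.2 + y.2) | p <- rsup m j, y <- rsup n p.1].

Lemma ulistE u n j k : tsum (ulist u n j) k = psum (cu u) n j k.
Proof. by rewrite /tsum /ulist big_map. Qed.

Lemma plistE u i n m j k : tsum (plist u i n m j) k = psum (cu u) n i k * psum (@tau1 i) m j (sc (lam ^+ n) k).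
Proof.
rewrite /tsum /plist big_allpairs_dep /= /psum mulr_sumr; apply: eq_bigr => p _.
have e x : - (sc (lam ^+ n) p.2 + x) = sc (lam ^+ n) (- p.2) - x by rewrite opprD; congr (_ - _); rewrite /sc /= !mulrN.
rewrite /tau1 /delta4; case: eqVneq => [pi|_]; last by rewrite big1 ?mul0r ?mulr0// => x _; rewrite mul0r.
rewrite mul1r mulr_suml pi; apply: eq_bigr => x _.
by rewrite e ekD ek_sc /cu [ek (sc _ _) _ * _]mulrC mulrA.
Qed.

Lemma ulist_unzip u n j : unzip2 (ulist u n j) = unzip2 (rsup n j).
Proof. by rewrite /unzip2 -map_comp. Qed.

Lemma plist_unzip u i n m j : unzip2 (plist u i n m j) = unzip2 (rsup (n + m) j).
Proof.
rewrite rsup_add /asm /scl /plist /unzip2 !map_flatten -!map_comp; congr flatten; apply: eq_map => p /=.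
by rewrite /blk -!map_comp; apply: eq_map.
Qed.

Lemma psum_facj u n m j k : normc (psum (cu u) (n + m) j k) <=
 \sum_(i < 4) normc (psum (cu u) n i k) * normc (psum (@tau1 i) m j (sc (lam ^+ n) k)).
Proof.
have -> : psum (cu u) (n + m) j k = \sum_(i < 4) psum (cu u) n i k * psum (@tau1 i) m j (sc (lam ^+ n) k).
 rewrite psum_add. transitivity (\sum_(p <- rsup m j) \sum_(i < 4) psum (cu u) n i k * (delta4 i p.1 * ek (sc (lam ^+ n) k) (- p.2))).
  apply: eq_bigr => p _; rewrite (bigD1 p.1)//= /delta4 eqxx mul1r big1 ?addr0 1?mulrC// => i /negbTE ->. by rewrite mul0r mulr0.
 by rewrite exchange_big /=; apply: eq_bigr => i _; rewrite -mulr_sumr.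
by apply: (le_trans (normc_sum _ _ _)); apply: ler_sum => i _; rewrite normcM.
Qed.

Lemma meas_psum_cu u n j : mfun (fun k => normc (psum (cu u) n j k)).
Proof.
have -> : (fun k => normc (psum (cu u) n j k)) = (fun k => Num.sqrt (normc (tsum (ulist u n j) k) ^+ 2))
 by apply/funext => k; rewrite ulistE sqrtr_sqr ger0_norm ?normc_ge0.
apply: (@mcomp _ _ _ _ _ _ (Num.sqrt : mR -> mR)); last exact: meas_tsum.
by apply: continuous_measurable_fun; exact: sqrt_continuous.
Qed.

(** Write [c = (c - s) + s] and apply Young's inequality to each part. The product [a x] is small in
    mean if [s] is near [c] with respect to [x^2] and near 0 with respect to Lebesgue measure. *)
Lemma two_point (eps a x s c : R) : 0 < eps -> 0 <= a -> 0 <= x -> 0 < c ->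
 c * (a * x) <= eps * a ^+ 2 + x ^+ 2 * (s - c) ^+ 2 / eps + (eps * (a * x) ^+ 2 + s ^+ 2 / eps).
Proof.
move=> e0 a0 x0 c0.
have h (p q : R) : p * q <= eps * p ^+ 2 + q ^+ 2 / eps.
 rewrite -subr_ge0.
 have -> : eps * p ^+ 2 + q ^+ 2 / eps - p * q = eps * (p - q / eps / 2) ^+ 2 + 3 / 4 * (q ^+ 2 / eps) by field; rewrite gt_eqF.
 apply: addr_ge0; first exact: mulr_ge0 (ltW e0) (sqr_ge0 _).
 by apply: mulr_ge0; [rewrite divr_ge0|exact: divr_ge0 (sqr_ge0 _) (ltW e0)].
have h1 := h a (x * (c - s)); have h2 := h (a * x) s.
apply: (le_via (a * (x * (c - s)) + a * x * s)); first by apply: eqW; ring.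
apply: lerD => //; apply: (le_trans h1); rewrite lerD2l; apply: eqW; ring.
Qed.

Lemma Gm_ge0 m j k : 0 <= Gm m j k.
Proof.
by apply: mulr_ge0; [rewrite invr_ge0 (ltW (lamX_gt0 _))|apply: sumr_ge0 => i _; exact: sqr_ge0].
Qed.

Lemma small_L1 u (L del : R) : 0 < L -> 0 < del -> exists N, forall j,
 let F k := \1_(cbx P0 L) k * (lam ^- N * normc (psum (cu u) N j k)) in
 rint2 F /\ Int2 F <= del.
Proof.
move=> L0 d0; have [C C0 HC] := box_L2 (ltW L0).
have cm0 := cmin_gt0; have u0 := umax_ge0 u.
pose V := 8 * (C * (umax u) ^+ 2) + 1; have V0 : 0 < V by rewrite ltr_wpDl// !mulr_ge0// sqr_ge0.
(* [V] bounds the eight mean squares, four of level-[n] sums and four of products; [eps] is fixed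
   against them before [eta] controls the characters. *)
pose eps := del * cmin / (2 * V); have e0 : 0 < eps by rewrite divr_gt0// mulr_gt0.
pose w0 : R := wexp 1 L * wexp 1 L; have w00 : 0 < w0 by rewrite mulr_gt0 ?wexp_gt0.
pose Y := 5 / (eps * w0); have Y0 : 0 < Y by rewrite divr_gt0// mulr_gt0.
pose eta := del * cmin / (4 * Y); have eta0 : 0 < eta by rewrite divr_gt0// mulr_gt0.
have [r [D [m [r0 D0 H]]]] := mean_GS eta0.
have c0 : cmin <= cm D r := cm_ge D r0.
pose G1 j n k : R := w2 1 k * (Gm m j (sc (lam ^+ n) k) * (Sm D r (sc (lam ^+ n) k) - cm D r) ^+ 2).
pose G2 n k : R := w2 1 k * Sm D r (sc (lam ^+ n) k) ^+ 2.
have ev j : exists n0, forall n, (n0 <= n)%N ->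
  [/\ rint2 (G1 j n), rint2 (G2 n) & Int2 (G1 j n) + 4 * Int2 (G2 n) <= 5 * (2 * eta)].
 have [c ce [[r1 m1] [c' ce' [r2 m2]]]] := H j. have m3 : Int2 (G1 j n) + 4 * Int2 (G2 n) @[n --> \oo] --> c + 4 * c'
  by apply: cvgD => //; apply: cvgM => //; exact: cvg_cst.
 have e4 : 0 < 5 * eta by rewrite mulr_gt0. have /cvgrPdist_le/(_ _ e4)[n0 _ Hn] := m3; exists n0 => n nn; split; [exact: r1|exact: r2|].
 have := Hn n nn; rewrite distrC => /(le_trans (ler_norm _)); move: ce ce'; clear; lra.
have [n Hn] : exists n, forall j, [/\ rint2 (G1 j n), rint2 (G2 n) &
  Int2 (G1 j n) + 4 * Int2 (G2 n) <= 5 * (2 * eta)].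
 have [n0 h0] := ev o0; have [n1 h1] := ev o1; have [n2 h2] := ev o2; have [n3 h3] := ev o3.
 exists (n0 + (n1 + (n2 + n3)))%N; elim/ord4_ind; [apply: h0|apply: h1|apply: h2|apply: h3].
 - exact: leq_addr.
 - exact: leq_trans (leq_addr _ _) (leq_addl _ _).
 - exact: leq_trans (leq_trans (leq_addr _ _) (leq_addl _ _)) (leq_addl _ _).
 - exact: leq_trans (leq_trans (leq_addl _ _) (leq_addl _ _)) (leq_addl _ _).
exists (n + m)%N => j; have [r1 r2 b12] := Hn j; move=> F.
pose B k : R := \1_(cbx P0 L) k.
pose A1 i k : R := B k * (lam ^- (2 * n) * normc (tsum (ulist u n i) k) ^+ 2).
pose A2 i k : R := B k * ((lam ^+ (2 * (n + m)))^-1 * normc (tsum (plist u i n m j) k) ^+ 2).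
have a1 i : rint2 (A1 i) /\ Int2 (A1 i) <= C * umax u ^+ 2.
 apply: HC (ulist_unzip u n i) _ => p /mapP[x _ ->]; exact: umax_ge.
have a2 i : rint2 (A2 i) /\ Int2 (A2 i) <= C * umax u ^+ 2.
 apply: HC (plist_unzip u i n m j) _ => p /allpairsPdep[y [x [_ _ ->]]] /=.
 by case: ifP => _; [exact: umax_ge|rewrite (normc_real 0) normr0].
pose T k : R := (cmin)^-1 * ((\sum_(i < 4) eps * A1 i k + \sum_(i < 4) eps * A2 i k) + (eps * w0)^-1 * (G1 j n k + 4 * G2 n k)).
have rA1 : rint2 (fun k => \sum_(i < 4) eps * A1 i k) by apply: rint_sum => i; apply: rintZ; exact: (a1 i).1.
have rA2 : rint2 (fun k => \sum_(i < 4) eps * A2 i k) by apply: rint_sum => i; apply: rintZ; exact: (a2 i).1.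
have rG : rint2 (fun k => (eps * w0)^-1 * (G1 j n k + 4 * G2 n k)) by apply: rintZ; apply: rintD => //; exact: rintZ.
have rT : rint2 T by apply: rintZ; apply: rintD => //; exact: rintD.
have F0 k : 0 <= F k by rewrite !mulr_ge0 ?invr_ge0 ?normc_ge0 ?(ltW (lamX_gt0 _))// indicE ler0n.
have mF : mfun F.
 apply: mfunM; first by apply: measurable_indic; exact: measurable_cbx. by apply: mfunM; [exact: measurable_cst|exact: meas_psum_cu].
have FT k : F k <= T k.
 rewrite /T ler_pdivlMl//. have G10 : 0 <= G1 j n k.
  exact: mulr_ge0 (ltW (w2_gt0 _ _)) (mulr_ge0 (Gm_ge0 _ _ _) (sqr_ge0 _)).
 have G20 : 0 <= G2 n k := mulr_ge0 (ltW (w2_gt0 _ _)) (sqr_ge0 _). have ew : 0 <= (eps * w0)^-1 by rewrite invr_ge0 mulr_ge0// ltW.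
 rewrite /F /A1 /A2 /B; have [kb|kb] := pselect (cbx P0 L k); last first.
  rewrite indicE memNset// !mul0r mulr0 !big1 ?add0r; last by move=> i _; rewrite mul0r mulr0.
   by rewrite mulr_ge0// addr_ge0// mulr_ge0.
  by move=> i _; rewrite mul0r mulr0.
 rewrite indicE mem_set// !mul1r. have wk : w0 <= w2 1 k.
  have /cbxP[/= k1 k2] := kb; rewrite !subr0 in k1 k2.
  by rewrite /w0 /w2 ler_pM ?(ltW (wexp_gt0 _ _))// /wexp ler_expR !mul1r lerN2 (ger0_norm (ltW L0)).
 pose a i : R := lam ^- n * normc (psum (cu u) n i k).
 pose x i : R := lam ^- m * normc (psum (@tau1 i) m j (sc (lam ^+ n) k)). pose S := Sm D r (sc (lam ^+ n) k).
 have cp : 0 < cm D r := lt_le_trans cm0 c0. have li N : 0 <= lam ^- N :> R by rewrite invr_ge0 (ltW (lamX_gt0 N)).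
 have a0 i : 0 <= a i by rewrite mulr_ge0// normc_ge0. have x0 i : 0 <= x i by rewrite mulr_ge0// normc_ge0.
 have h1 : lam ^- (n + m) * normc (psum (cu u) (n + m) j k) <= \sum_(i < 4) a i * x i.
  apply: le_trans (ler_wpM2l (li _) (psum_facj u n m j k)) _; rewrite mulr_sumr; apply: ler_sum => i _.
  by rewrite /a /x (exprD lam n m) invfM mulrACA.
 have h2 i := two_point S e0 (a0 i) (x0 i) cp.
 have sq N (z : R) : (lam ^- N * z) ^+ 2 = lam ^- (2 * N) * z ^+ 2 by rewrite [in RHS]mulnC exprM -[in RHS]exprVn; ring.
 have e1 i : lam ^- (2 * n) * normc (tsum (ulist u n i) k) ^+ 2 = a i ^+ 2 by rewrite ulistE /a sq.
 have e2 i : (lam ^+ (2 * (n + m)))^-1 * normc (tsum (plist u i n m j) k) ^+ 2 = (a i * x i) ^+ 2.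
  rewrite plistE normcM /a /x mulrACA -invfM -exprD. by rewrite sq.
 have e3 : \sum_(i < 4) x i ^+ 2 = Gm m j (sc (lam ^+ n) k).
  rewrite /Gm mulr_sumr; apply: eq_bigr => i _. by rewrite /x sq.
 under eq_bigr do rewrite mul1r e1. under [X in _ + X + _]eq_bigr do rewrite mul1r e2.
 have s0 : 0 <= \sum_(i < 4) a i * x i by apply: sumr_ge0 => i _; exact: mulr_ge0. apply: (le_via (cm D r * \sum_(i < 4) a i * x i)).
  by apply: (le_trans (ler_wpM2l (ltW cm0) h1)); exact: ler_wpM2r.
 rewrite mulr_sumr.
 apply: (le_via (\sum_(i < 4) (eps * a i ^+ 2 + x i ^+ 2 * (S - cm D r) ^+ 2 / eps + (eps * (a i * x i) ^+ 2 + S ^+ 2 / eps)))).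
  by apply: ler_sum => i _; exact: h2.
 rewrite !big_split /= sumr_const card_ord -mulr_suml -mulr_suml e3.
 set s1 := \sum_(i < 4) _; set s2 := \sum_(i < 4) _; set g := Gm _ _ _. have g0 : 0 <= g * (S - cm D r) ^+ 2.
  exact: mulr_ge0 (Gm_ge0 _ _ _) (sqr_ge0 _).
 have k3 : g * (S - cm D r) ^+ 2 / eps <= (eps * w0)^-1 * G1 j n k.
  rewrite /G1 -/g -/S ler_pdivlMl; last exact: mulr_gt0.
  have -> : eps * w0 * (g * (S - cm D r) ^+ 2 / eps) = w0 * (g * (S - cm D r) ^+ 2) by field; rewrite gt_eqF. exact: ler_wpM2r.
 have k4 : S ^+ 2 / eps <= (eps * w0)^-1 * G2 n k.
  rewrite /G2 -/S ler_pdivlMl; last exact: mulr_gt0.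
  have -> : eps * w0 * (S ^+ 2 / eps) = w0 * S ^+ 2 by field; rewrite gt_eqF. by apply: ler_wpM2r => //; exact: sqr_ge0.
 rewrite -[_ *+ 4]mulr_natl mulrDr; move: k3 k4; clear; lra.
have [rF iF] := le_Int0 mF F0 rT FT; split => //; apply: (le_trans iF).
rewrite IntZ; last by apply: rintD => //; exact: rintD.
rewrite IntD//; last exact: rintD.
rewrite IntD// IntZ; last by apply: rintD => //; exact: rintZ.
rewrite IntD//; last exact: rintZ.
rewrite IntZ// ler_pdivrMl// !Int_sum; first last.
- by move=> i; apply: rintZ; exact: (a1 i).1.
- by move=> i; apply: rintZ; exact: (a2 i).1.
have sA1 : \sum_(i < 4) Int2 (fun k => eps * A1 i k) <= 4 * (eps * (C * umax u ^+ 2)).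
 rewrite mulr_natl -[X in _ *+ X](card_ord 4) -sumr_const; apply: ler_sum => i _.
 by rewrite IntZ; [apply: ler_wpM2l; [exact: ltW|exact: (a1 i).2]|exact: (a1 i).1].
have sA2 : \sum_(i < 4) Int2 (fun k => eps * A2 i k) <= 4 * (eps * (C * umax u ^+ 2)).
 rewrite mulr_natl -[X in _ *+ X](card_ord 4) -sumr_const; apply: ler_sum => i _.
 by rewrite IntZ; [apply: ler_wpM2l; [exact: ltW|exact: (a2 i).2]|exact: (a2 i).1].
have sG : (eps * w0)^-1 * (Int2 (G1 j n) + 4 * Int2 (G2 n)) <= (eps * w0)^-1 * (5 * (2 * eta))
 by apply: ler_wpM2l => //; rewrite invr_ge0 mulr_ge0// ltW.
have q1 : (eps * w0)^-1 * (5 * (2 * eta)) = del * cmin / 2.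
 have -> : (eps * w0)^-1 * (5 * (2 * eta)) = Y * (2 * eta) by rewrite /Y; field; rewrite !gt_eqF. by rewrite /eta; field; rewrite gt_eqF.
have q2 : eps * V = del * cmin / 2 by rewrite /eps; field; rewrite gt_eqF.
move: sA1 sA2 sG q1 q2 e0; rewrite /V; clear; lra.
Qed.

Lemma continuous_psum_cu u n j : continuous (fun k => normc (psum (cu u) n j k) ^+ 2).
Proof.
have -> : (fun k => normc (psum (cu u) n j k) ^+ 2) = (fun k => normc (tsum (ulist u n j) k) ^+ 2) by apply/funext => k; rewrite ulistE.
exact: continuous_tsum.
Qed.

(** Equal to 1 up to [b] and to 0 from [2 b] on; a continuous substitute for the condition that a
    sum is small, so that vague convergence applies. *)
Definition cut (t b : R) : R := clamp (2 - t / b).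

Lemma cutP (t b : R) : 0 < b -> 0 <= t -> [/\ 0 <= cut t b, cut t b <= 1, cut t b * t <= 2 * b & t <= b -> cut t b = 1].
Proof.
move=> b0 t0; have [c0 c1 c2 c3] := clampP (2 - t / b); rewrite /cut; split => //.
 have [h|h] := leP t (2 * b); first by apply: le_trans h; rewrite ler_piMl.
 by rewrite c2 ?mul0r ?mulr_ge0// ?(ltW b0)// subr_le0 ler_pdivlMr// ltW.
move=> h; apply: c3; have : t / b <= 1 by rewrite ler_pdivrMr// mul1r.
lra.
Qed.

Lemma continuous_cut (f : P -> R) b : continuous f -> continuous (fun k => cut (f k) b).
Proof.
move=> cf; have cc : continuous (@clamp).
 move=> t; apply/cvgrPdist_lt => e e0; near=> s. by rewrite (le_lt_trans (clamp_lip _ _))//; near: s; apply: cvgr_dist_lt.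
move=> k; apply: (@continuous_comp _ _ _ (fun k => 2 - f k / b) (@clamp)); last exact: cc.
apply: cvgB; first exact: cvg_cst.
by apply: cvgM; [exact: cf|exact: cvg_cst].
Unshelve. all: by end_near. Qed.

(** [A] collects the points of the box where some level-[n] sum is large: few in Lebesgue measure by
    [small_L1] and Markov. On [B] all level-[n] sums are small, and [conc_bound] keeps every later
    density small there, hence also [mu]. *)
Lemma singular_step u mu : vague_cluster (dens u) mu -> exists2 C : R, 0 <= C & forall s : nat, exists A B : set P,
 [/\ measurable (A : set BP), measurable (B : set BP), cbx P0 s.+1%:R `<=` A `|` B,
   (leb2 R A <= (2^-1 ^+ s)%:E)%E & (mu B <= (C * 2^-1 ^+ s)%:E)%E].
Proof.
move=> [_ H]; have [C C0 HC] := conc_bound; exists (2 * C); first exact: mulr_ge0.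
move=> s; pose L : R := s.+1%:R; have L0 : 0 < L by rewrite ltr0n.
(* The divisor [L + 3] cancels the growth with the box of the bound in [conc_bound]. *)
pose h : R := 2^-1 ^+ s / (L + 3); have L3 : 0 < L + 3 by rewrite addr_gt0.
have d0 : 0 < (2^-1 ^+ s : R) by rewrite exprn_gt0// invr_gt0.
have h0 : 0 < h by rewrite divr_gt0.
pose del : R := h * 2^-1 ^+ s / 4; have del0 : 0 < del by rewrite divr_gt0// mulr_gt0.
have [n Hn] := small_L1 u L0 del0.
have l1 := lamX_gt0 n; have l2 := lamX_gt0 (2 * n).
pose S : set P := [set k | forall i, normc (psum (cu u) n i k) <= h * lam ^+ n].
have mS : measurable (S : set BP).
 have -> : S = \bigcap_(i in [set: 'I_4]) [set k | normc (psum (cu u) n i k) <= h * lam ^+ n]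
  by apply/seteqP; split => [k hk i _|k hk i]; [exact: hk|exact: hk i I].
 apply: fin_bigcap_measurable => // i _. have mm := meas_psum_cu u n i; rewrite -[X in measurable X]setTI.
 have -> : [set k | normc (psum (cu u) n i k) <= h * lam ^+ n] =
   (fun k => normc (psum (cu u) n i k)) @^-1` [set` `]-oo, (h * lam ^+ n)]].
  by apply/seteqP; split => k /=; rewrite in_itv.
 by apply: mm => //; exact: measurable_itv.
pose K := cbx P0 L; have mK : measurable (K : set BP) by exact: measurable_cbx.
exists (K `\` S), (K `&` S); split.
- exact: measurableD.
- exact: measurableI.
- by move=> k Kk; have [Sk|Sk] := pselect (S k); [right|left].
- pose F i k : R := \1_K k * (lam ^- n * normc (psum (cu u) n i k)).
 have rF i : rint2 (F i) := (Hn i).1.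
 have F0 i k : 0 <= F i k by apply: mulr_ge0; [rewrite indicE ler0n|apply: mulr_ge0; [rewrite invr_ge0 ltW|exact: normc_ge0]].
 pose G k : R := h^-1 * \sum_(i < 4) F i k. have rG : rint2 G by apply: rintZ; exact: rint_sum.
 apply: (le_via (\int[leb2 R]_x (G x)%:E)%E).
  apply: set_le_int => [||k|k].
  + exact: measurableD.
  + exact: rint_meas rG.
  + by rewrite mulr_ge0 ?invr_ge0 ?(ltW h0)// sumr_ge0.
  + move=> [Kk /existsNP[i /negP]]; rewrite -ltNge => hi.
   rewrite /G ler_pdivlMl// mulr1 (bigD1 i)//= -[leLHS]addr0; apply: lerD; last exact: sumr_ge0.
   by rewrite /F indicE mem_set// mul1r ler_pdivlMl// mulrC ltW.
 rewrite -Int_EFin// lee_fin IntZ; last exact: rint_sum. rewrite Int_sum// ler_pdivrMl//.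
 apply: (le_via (\sum_(i < 4) del)); first by apply: ler_sum => i _; exact: (Hn i).2.
 by rewrite sumr_const card_ord /del -[leLHS]mulr_natr divfK.
pose b : R := h ^+ 2 * lam ^+ (2 * n); have b0 : 0 < b by rewrite mulr_gt0// exprn_gt0.
pose f k : R := plateau 1 (L + 1) k * \prod_(i < 4) cut (normc (psum (cu u) n i k) ^+ 2) b.
have p1 k := plateauP (L + 1) k (ltr01 : 0 < (1 : R)).
have cP i k := cutP b0 (sqr_ge0 (normc (psum (cu u) n i k))).
have pr0 k : 0 <= \prod_(i < 4) cut (normc (psum (cu u) n i k) ^+ 2) b by apply: prodr_ge0 => i _; have [] := cP i k.
have f0 k : 0 <= f k by apply: mulr_ge0 => //; have [] := p1 k.
have kf : kc f.
 apply: kcM; first exact: kc_plateau. elim: (index_enum _) => [|i l IH].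
  by under eq_fun do rewrite big_nil; exact: cst_continuous.
 under eq_fun do rewrite big_cons. move=> k; apply: cvgM; last exact: IH. by apply: continuous_cut; exact: continuous_psum_cu.
have fz k : ~ cbx P0 (L + 1) k -> f k = 0.
 move=> nk; have [_ _ _ pz] := p1 k; rewrite /f pz ?mul0r//.
 apply/negPn/negP; rewrite negb_or -!ltNge => /andP[/ltW h1 /ltW h2]. by apply: nk; apply/cbxP; rewrite /= !subr0.
have fA i k : f k * normc (psum (cu u) n i k) ^+ 2 <= 2 * b.
 have [_ _ ct _] := cP i k; apply: le_trans ct; apply: ler_wpM2r; first exact: sqr_ge0.
 rewrite /f (bigD1 i)//= mulrCA ler_piMr//; first by have [] := cP i k. have [q0 q1 _ _] := p1 k; rewrite -[leRHS]mulr1 ler_pM//.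
  by apply: prodr_ge0 => i' _; have [] := cP i' k.
 by apply: prodr_ile1 => i' _; have [-> -> _ _] := cP i' k.
have iN N : (n <= N)%N -> Int2 (fun k => f k * dens u N k) <= 2 * C * 2^-1 ^+ s.
 move=> nN; have b20 : 0 <= 2 * b by rewrite mulr_ge0// ltW. have L10 : 0 <= L + 1 by rewrite addr_ge0// ltW.
 have := HC (cu u) n (N - n)%N P0 (L + 1) f (2 * b) L10 b20 (kc_meas kf) f0 fz. rewrite subnKC// => /(_ (meas_psum u N) fA) /= [_].
 have -> : (fun k => f k * dens u N k) = (fun k => f k * (lam ^- (2 * N) * normc (psum (cu u) N o3 k) ^+ 2))
  by apply/funext => k; rewrite dens_psum.
 move/le_trans; apply. have q : (lam ^+ n * (L + 1) + 2) ^+ 2 <= lam ^+ (2 * n) * (L + 3) ^+ 2.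
  have -> : lam ^+ (2 * n) * (L + 3) ^+ 2 = (lam ^+ n * (L + 3)) ^+ 2 by rewrite mulnC exprM; ring.
  have h1 : 0 <= lam ^+ n * (L + 1) by rewrite mulr_ge0// ltW.
  have h2 : lam ^+ n * (L + 1) + 2 <= lam ^+ n * (L + 3) by have := lamX_ge1 n; rewrite !mulrDr mulr1; clear; lra.
  by rewrite lerXn2r// nnegrE; move: h1 h2; clear; lra.
 have c0 : 0 <= 2 * b * C by rewrite mulr_ge0. have i0 : 0 <= lam ^- (2 * n) ^+ 2 by exact: sqr_ge0.
 apply: le_trans (ler_wpM2r i0 (ler_wpM2l c0 q)) _.
 have -> : 2 * b * C * (lam ^+ (2 * n) * (L + 3) ^+ 2) * lam ^- (2 * n) ^+ 2 = 2 * C * (2^-1 ^+ s * 2^-1 ^+ s).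
  rewrite /b /h; move: (2^-1 ^+ s : R) (lam ^+ (2 * n)) l2 => d l l0. by field; rewrite !gt_eqF.
 rewrite ler_wpM2l ?mulr_ge0// ler_piMl ?(ltW d0)// exprn_ile1 ?invr_ge0// invf_le1//; lra.
apply: (le_via (\int[mu]_x (f x)%:E)%E); last exact: (H f kf f0 _ n).1 iN.
apply: set_le_int => //; [exact: measurableI|exact: kc_meas|move=> k [/cbxP[/= k1 k2] Sk]].
rewrite !subr0 in k1 k2; have [_ _ pe _] := p1 k.
rewrite /f pe ?invr1 ?addrK// mul1r big1// => i _.
have [_ _ _ ->] := cP i k => //.
have -> : b = (h * lam ^+ n) ^+ 2 by rewrite /b mulnC exprM; ring.
have hi := Sk i; rewrite lerXn2r// nnegrE ?normc_ge0//; exact: le_trans (normc_ge0 _) hi.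
Qed.

Lemma half_cvg (C : R) : C * 2^-1 ^+ n @[n --> \oo] --> (0 : R).
Proof.
rewrite -[X in _ --> X](mulr0 C); apply: cvgM; first exact: cvg_cst.
by apply: cvg_expr; rewrite ger0_norm ?invr_ge0// invf_lt1//; lra.
Qed.

(** Borel-Cantelli: the upper limit of the sets [A s] is Lebesgue null, and a point outside it lies
    in all [B s] from some index on. *)
Theorem cluster_singular u mu : vague_cluster (dens u) mu -> singular mu.
Proof.
move=> /singular_step[C C0 /choice[A /choice[B H]]].
have mA s : measurable (A s : set BP) by have [] := H s.
have mB s : measurable (B s : set BP) by have [] := H s.
exists (lim_sup_set A : set BP); split.
- by apply: bigcap_measurable => // m _; apply: bigcup_measurable => s _.
- apply: lim_sup_set_cvg0 => //.
 apply: (@le_lt_trans _ _ (\sum_(n <oo) (2^-1 ^+ n)%:E)%E).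
  by apply: lee_nneseries => // s _; have [_ _ _ ? _] := H s.
 have -> : (\sum_(n <oo) (2^-1 ^+ n)%:E)%E = (2 / 2 ^+ 0 : R)%:E.
  transitivity (limn (eseries (fun k : nat => (2 / (2 ^ (k + 1))%:R : R)%:E))); last by apply/cvg_lim => //; exact: cvg_geometric_eseries_half.
  congr (limn _); apply/funext => n; rewrite /eseries /=; apply: eq_bigr => i _; congr EFin.
  by rewrite addn1 natrX exprS invfM mulVKf// exprVn.
 exact: ltry.
have sub : ~` lim_sup_set A `<=` \bigcup_m \bigcap_(s in [set s | (m <= s)%N]) B s.
 move=> k; rewrite /lim_sup_set => /existsNP[m /not_implyP[_ nk]].
 pose m' := maxn m (Num.truncn (`|k.1| + `|k.2|)).+1; exists m' => // s /= ms. have [_ _ cov _ _] := H s; have [] // := cov k.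
  have t1 : `|k.1| + `|k.2| <= s.+1%:R.
   apply: ltW; apply: lt_le_trans (truncnS_gt _) _; rewrite ler_nat.
   by apply: leq_trans (leqnSn _); apply: leq_trans ms; exact: leq_maxr.
  by apply/cbxP; rewrite /= !subr0; split; apply: le_trans t1; rewrite ?lerDl ?lerDr.
 by move=> As; exfalso; apply: nk; exists s => //=; apply: leq_trans ms; exact: leq_maxl.
have mE m : measurable (\bigcap_(s in [set s | (m <= s)%N]) B s : set BP) by apply: bigcap_measurable => //; exists m => /=.
have E0 m : mu (\bigcap_(s in [set s | (m <= s)%N]) B s) = 0%E.
 apply/eqP; rewrite eq_le measure_ge0 andbT; apply/lee_addgt0Pr => e e0; rewrite add0e.
 have /cvgrPdist_le/(_ _ e0)[n0 _ h] := half_cvg C. pose s := maxn m n0; have [_ _ _ _ bs] := H s. apply: (le_via (mu (B s))).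
  by apply: le_measure; rewrite ?inE// => k; apply => /=; exact: leq_maxl.
 apply: (le_trans bs); rewrite lee_fin; have := h s (leq_maxr _ _). by rewrite sub0r normrN; apply: le_trans; exact: ler_norm.
have mN : measurable (~` lim_sup_set A : set BP)
 by apply: measurableC; apply: bigcap_measurable => // m _; apply: bigcup_measurable => s _.
have [D [mD D0 sD]] : mu.-negligible (\bigcup_m \bigcap_(s in [set s | (m <= s)%N]) B s)
 by apply: negligible_bigcup => m; exists (\bigcap_(s in [set s | (m <= s)%N]) B s); split; [exact: mE|exact: E0|].
apply/eqP; rewrite eq_le measure_ge0 andbT -D0; apply: le_measure; rewrite ?inE//.
exact: subset_trans sub sD.
Qed.
End TrigMean.

(** * Telescoping Riesz products *)

Section Riesz.
Implicit Types (f g : P -> R) (k x : P) (mu : PM).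

Definition nbmp (k0 : P) (r : R) k : R := (Int2 (bmp P0 r))^-1 * bmp k0 r k.

Lemma Int_bmp_gt0 (r : R) : 0 < r -> 0 < Int2 (bmp P0 r).
Proof.
move=> r0; have rb := kc_rint leb2_lf (kc_bmp P0 r0).
have a0 : - (r / 2) <= r / 2 by lra.
have := Int_box a0 a0; have rB := indic_box_rint leb2_lf (- (r / 2)) (r / 2) (- (r / 2)) (r / 2).
set B := box _ _ _ _ => iB.
have h : Int2 (fun k => 4^-1 * \1_B k) <= Int2 (bmp P0 r).
 apply: le_Int => // [|k]; first exact: rintZ.
 rewrite indicE; have [/set_mem kB|_] := boolP (k \in B); last by rewrite mulr0; have [] := bmpP 0 k r0.
 rewrite mulr1 /bmp /plateau subr0. have [k1 k2] : `|k.1| <= r / 2 /\ `|k.2| <= r / 2 by apply/sub_box.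
 have c (t : R) : 0 <= t -> t <= r / 2 -> 2^-1 <= clamp (r^-1 * (r - t)).
  move=> t0 t1; have h1 : 2^-1 <= r^-1 * (r - t) by rewrite ler_pdivlMl//; lra.
  have h2 : r^-1 * (r - t) <= 1 by rewrite ler_pdivrMl//; lra.
  have n0 : (r^-1 * (r - t) <= 0) = false by apply/negbTE; rewrite -ltNge (lt_le_trans _ h1)// invr_gt0. by rewrite /clamp n0 h2.
 have -> : 4^-1 = 2^-1 * 2^-1 :> R by field. by rewrite ler_pM ?invr_ge0//; exact: c.
apply: lt_le_trans h; rewrite IntZ// iB mulr_gt0// mulr_gt0//; lra.
Qed.

Lemma nbmpP k0 r : 0 < r -> [/\ kc (nbmp k0 r), forall k, 0 <= nbmp k0 r k, Int2 (nbmp k0 r) = 1 &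
 forall k, ~ cbx k0 r k -> nbmp k0 r k = 0].
Proof.
move=> r0; have I0 := Int_bmp_gt0 r0; have rb := kc_rint leb2_lf (kc_bmp P0 r0).
split => [|k||k nk].
- by apply: kcZ; exact: kc_bmp.
- by rewrite mulr_ge0 ?invr_ge0 ?(ltW I0)//; have [] := bmpP k0 k r0.
- have [r1 e1] := Int_shift (- k0) rb.
 have e : (fun x : P => bmp 0 r (x - k0)) = bmp k0 r by apply/funext => x; rewrite /bmp subr0.
 by rewrite e in r1 e1; rewrite IntZ// e1 mulVf// gt_eqF.
- by have [_ _ z _] := bmpP k0 k r0; rewrite /nbmp z ?mulr0.
Qed.

Definition corner n (p : int * int) : P := (p.1%:~R / 2 ^+ n, p.2%:~R / 2 ^+ n).
(** Level-[n] cells of the box of half-side [n], so mesh and range improve together. *)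
Definition cgrid n : seq (int * int) :=
 let l := [seq i%:Z - (n * 2 ^ n)%N%:Z | i <- iota 0 (2 * (n * 2 ^ n)).+1] in [seq (i, j) | i <- l, j <- l].
Definition cbmp n p : P -> R := nbmp (corner n p) (2 ^- n).

Lemma cgrid_uniq n : uniq (cgrid n).
Proof.
have ul : uniq [seq i%:Z - (n * 2 ^ n)%N%:Z | i <- iota 0 (2 * (n * 2 ^ n)).+1] by rewrite map_inj_uniq ?iota_uniq// => i j /addIr [].
by rewrite allpairs_uniq// => -[a b] [c d].
Qed.

Lemma cgrid_cell n x : `|x.1| < n%:R -> `|x.2| < n%:R -> cell_of n x \in cgrid n.
Proof.
have e2 : 0 < (2 ^+ n : R) by rewrite exprn_gt0.
have one (t : R) : `|t| < n%:R -> Num.floor (t * 2 ^+ n) \in [seq i%:Z - (n * 2 ^ n)%N%:Z | i <- iota 0 (2 * (n * 2 ^ n)).+1].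
 rewrite ltr_norml => /andP[t1 t2]; set N := (n * 2 ^ n)%N.
 have NE : (N%:Z)%:~R = n%:R * 2 ^+ n :> R by rewrite -pmulrn natrM natrX. have f1 : - (N%:Z) <= Num.floor (t * 2 ^+ n).
  rewrite floor_ge_int intrN NE -mulNr ler_pM2r//; exact: ltW.
 have f2 : Num.floor (t * 2 ^+ n) < N%:Z by rewrite floor_lt_int NE ltr_pM2r. apply/mapP; exists (absz (Num.floor (t * 2 ^+ n) + N%:Z)).
  rewrite mem_iota /= add0n; move: f1 f2; clear; lia.
 by move: f1; clear; lia.
by move=> h1 h2; apply/allpairsP; exists (cell_of n x); split; [exact: one|exact: one|].
Qed.

Lemma corner_near n x y : cbx (corner n (cell_of n x)) (2 ^- n) y ->
 `|x.1 - y.1| <= 2 * 2 ^- n /\ `|x.2 - y.2| <= 2 * 2 ^- n.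
Proof.
have e2 : 0 < (2 ^+ n : R) by rewrite exprn_gt0.
have cc : cell n (cell_of n x) (corner n (cell_of n x)).
 rewrite /cell /corner /= !in_itv /= !lexx /= !ltr_pM2r ?invr_gt0// !ltr_int !ltzD1 !lexx//.
have cx : cell n (cell_of n x) x by apply/cell_ofP.
have [d1 d2] := cell_diam cx cc; move=> /cbxP[].
rewrite [ `|y.1 - _| ]distrC [ `|y.2 - _| ]distrC => h1 h2.
by split; [apply: le_trans (ler_distD (corner n (cell_of n x)).1 _ _) _|
  apply: le_trans (ler_distD (corner n (cell_of n x)).2 _ _) _]; move: d1 d2 h1 h2; clear; lra.
Qed.

Lemma exp2V_gt0 n : 0 < (2 ^- n : R).
Proof. by rewrite invr_gt0 exprn_gt0. Qed.

(** The mass of each cell is smeared by a bump of unit integral at its corner. The vanishing term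
    [1 / (n + 1)] makes the density strictly positive, so that quotients are continuous. *)
Definition riesz_p mu n k : R := (n.+1%:R)^-1 + \sum_(p <- cgrid n) fine (mu (cell n p)) * cbmp n p k.

Lemma cell_fin mu n p : locally_finite mu -> mu (cell n p) \is a fin_num /\ rint mu (ind (cell n p)).
Proof.
move=> lf; have rB := indic_box_rint lf (p.1%:~R / 2 ^+ n) ((p.1 + 1)%:~R / 2 ^+ n) (p.2%:~R / 2 ^+ n) ((p.2 + 1)%:~R / 2 ^+ n).
have sB : (cell n p : set P) `<=` box (p.1%:~R / 2 ^+ n) ((p.1 + 1)%:~R / 2 ^+ n) (p.2%:~R / 2 ^+ n) ((p.2 + 1)%:~R / 2 ^+ n).
 move=> k; rewrite /cell /box /= !in_itv /= => -[/andP[-> /ltW ->] /andP[-> /ltW ->]] //.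
split.
 rewrite ge0_fin_numE// (le_lt_trans _ (lf _ (@compact_box R (p.1%:~R / 2 ^+ n) ((p.1 + 1)%:~R / 2 ^+ n) (p.2%:~R / 2 ^+ n) ((p.2 + 1)%:~R / 2 ^+ n))))//.
 by apply: le_measure; rewrite ?inE//; [exact: measurable_cell|exact: measurable_box].
apply: rint_le rB; first by apply: measurable_indic; exact: measurable_cell.
move=> k; rewrite !indicE ger0_norm//.
by have [/set_mem kc|_] := boolP (k \in cell n p); [rewrite mem_set//; exact: sB|rewrite ler0n].
Qed.

Lemma riesz_p_cont mu n : continuous (riesz_p mu n).
Proof.
rewrite /riesz_p; have h : continuous (fun k => \sum_(p <- cgrid n) fine (mu (cell n p)) * cbmp n p k).
 elim: (cgrid n) => [|p l IH].
  by under eq_fun do rewrite big_nil; exact: cst_continuous.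
 under eq_fun do rewrite big_cons. move=> k; apply: cvgD; last exact: IH. apply: cvgM; first exact: cvg_cst.
 by have [[+ _] _ _ _] := @nbmpP (corner n p) (2 ^- n) (exp2V_gt0 n); exact.
by move=> k; apply: cvgD; [exact: cvg_cst|exact: h].
Qed.

Lemma riesz_p_gt0 mu n k : 0 < riesz_p mu n k.
Proof.
rewrite /riesz_p ltr_pwDl ?invr_gt0//; apply: sumr_ge0 => p _; rewrite mulr_ge0 ?fine_ge0//.
by have [_ + _ _] := @nbmpP (corner n p) (2 ^- n) (exp2V_gt0 n); exact.
Qed.

(** Up to the vanishing constant, the integral against the approximant is the [mu]-integral of a
    step function on cells, which is uniformly close to [f] by uniform continuity and vanishes off a
    fixed box. *)
Lemma riesz_p_cvg mu f : locally_finite mu -> kc f -> Int2 (fun k => f k * riesz_p mu n k) @[n --> \oo] --> Int mu f.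
Proof.
move=> lf kf; have [cf [L L0 fL]] := kf; pose lm := leb2 R.
have lfl : locally_finite lm := @leb2_locally_finite R.
have rf : rint lm f := kc_rint lfl kf.
pose K := box (- (L + 2)) (L + 2) (- (L + 2)) (L + 2); have rK : rint mu (ind K) := indic_box_rint lf _ _ _ _.
pose M := Int mu \1_K; have M0 : 0 <= M by apply: Int_ge0 => k; rewrite indicE ler0n.
have r2 := exp2V_gt0.
pose a n p : R := Int lm (fun k => f k * cbmp n p k).
have rfc n p : rint lm (fun k => f k * cbmp n p k) by apply: kc_rint => //; apply: kcM => //; have [[]] := nbmpP (corner n p) (r2 n).
have E n : Int lm (fun k => f k * riesz_p mu n k) = (n.+1%:R)^-1 * Int lm f + \sum_(p <- cgrid n) fine (mu (cell n p)) * a n p.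
 have -> : (fun k => f k * riesz_p mu n k) = (fun k => (n.+1%:R)^-1 * f k + \sum_(p <- cgrid n) fine (mu (cell n p)) * (f k * cbmp n p k)).
  apply/funext => k; rewrite /riesz_p mulrDr mulrC mulr_sumr; congr (_ + _); apply: eq_bigr => p _. by rewrite mulrCA.
 have rs : rint lm (fun k => \sum_(p <- cgrid n) fine (mu (cell n p)) * (f k * cbmp n p k)) by apply: rint_sum => p; exact: rintZ.
 rewrite IntD//; last exact: rintZ. rewrite IntZ// Int_sum; last by move=> p; exact: rintZ.
 by congr (_ + _); apply: eq_bigr => p _; rewrite IntZ.
have S n : \sum_(p <- cgrid n) fine (mu (cell n p)) * a n p = Int mu (fun x => \sum_(p <- cgrid n) a n p * \1_(cell n p) x).
 rewrite Int_sum; last by move=> p; apply: rintZ; exact: (cell_fin n p lf).2.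
 apply: eq_bigr => p _; rewrite IntZ; last exact: (cell_fin n p lf).2. rewrite mulrC; congr (_ * _); rewrite /Int /Rintegral; congr fine.
 by rewrite integral_indic ?setIT//; exact: measurable_cell.
have stepE n x : \sum_(p <- cgrid n) a n p * \1_(cell n p) x = if cell_of n x \in cgrid n then a n (cell_of n x) else 0.
 have i1 p : \1_(cell n p) x = (p == cell_of n x)%:R :> R.
  rewrite indicE; have -> // : (x \in cell n p) = (p == cell_of n x).
  by apply/idP/eqP => [/set_mem/cell_ofP//|h]; apply/mem_set/cell_ofP.
 under eq_bigr do rewrite i1. case: ifPn => xg.
  rewrite (bigD1_seq (cell_of n x)) ?cgrid_uniq//= eqxx mulr1 big1 ?addr0// => p /negbTE ->. by rewrite mulr0.
 rewrite big1_seq// => p /andP[_ pg]; case: eqP => [e|]; last by rewrite mulr0. by rewrite -e pg in xg.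
apply/cvgrPdist_le => e e0.
pose e1 := e / (2 * (M + 1)); have e10 : 0 < e1 by rewrite divr_gt0// mulr_gt0// ltr_wpDl.
have [d d0 hd] := kc_unif kf e10.
have [n0 hn0] : exists n0, 2 ^- n0 < Num.min (d / 2) 1 by apply: exp2N_lt; rewrite lt_min ltr01 divr_gt0.
have c1 : (n.+1%:R)^-1 * Int lm f @[n --> \oo] --> (0 : R).
 rewrite -[X in _ --> X](mul0r (Int lm f)); apply: cvgM; last exact: cvg_cst. exact: cvg_harmonic.
have e20 : 0 < e / 2 by rewrite divr_gt0.
have /cvgrPdist_le/(_ _ e20)[n1 _ hn1] := c1.
pose n2 := (Num.truncn (L + 2)).+1.
exists (n0 + (n1 + n2))%N => // n /= nn.
have nn0 : (n0 <= n)%N := leq_trans (leq_addr _ _) nn.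
have nn1 : (n1 <= n)%N := leq_trans (leq_trans (leq_addr _ _) (leq_addl _ _)) nn.
have nn2 : (n2 <= n)%N := leq_trans (leq_trans (leq_addl _ _) (leq_addl _ _)) nn.
have nL : L + 2 < n%:R by apply: lt_le_trans (truncnS_gt _) _; rewrite ler_nat.
have small : 2 ^- n < Num.min (d / 2) 1 by apply: le_lt_trans hn0; rewrite lef_pV2 ?posrE ?exprn_gt0// ler_weXn2l// ler1n.
have [sd s1] : 2 * 2 ^- n < d /\ 2 * 2 ^- n <= 2 :> R by move: small; rewrite lt_min => /andP[]; clear; split; lra.
have nearE x : `|f x - a n (cell_of n x)| <= e1.
 have [kb b0 b1 bz] := nbmpP (corner n (cell_of n x)) (r2 n). have rb := kc_rint lfl kb.
 have -> : f x - a n (cell_of n x) = Int lm (fun y => f x * cbmp n (cell_of n x) y - f y * cbmp n (cell_of n x) y).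
  have e2 : Int lm (fun y => f x * cbmp n (cell_of n x) y) = f x
   by rewrite (IntZ (f x) rb) -[Int _ _]/(Int2 (nbmp (corner n (cell_of n x)) (2 ^- n))) b1 mulr1.
  by rewrite (IntB (rintZ (f x) rb) (rfc n (cell_of n x))) e2.
 apply: le_trans (Int_norm _) _; first by apply: rintB => //; exact: rintZ.
 apply: (le_via (Int lm (fun y => e1 * cbmp n (cell_of n x) y))); last first.
  by rewrite (IntZ e1 rb) -[Int _ _]/(Int2 (nbmp (corner n (cell_of n x)) (2 ^- n))) b1 mulr1.
 apply: le_Int => [||y]; [by apply: rint_norm; apply: rintB => //; exact: rintZ|exact: rintZ|].
 rewrite -mulrBl normrM (ger0_norm (b0 y)).
 have [yc|/bz z] := pselect (cbx (corner n (cell_of n x)) (2 ^- n) y); last by rewrite /cbmp z !mulr0.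
 apply: ler_wpM2r => //; have [d1 d2] := corner_near yc. by apply/ltW/hd; [apply: le_lt_trans d1 sd|apply: le_lt_trans d2 sd].
have outE x : ~ K x -> f x = 0 /\ a n (cell_of n x) = 0.
 move=> nK; have nx : ~ (`|x.1| <= L + 2 /\ `|x.2| <= L + 2) by move=> /sub_box.
 split; first by apply: fL => -[h1 h2]; apply: nx; split; lra. rewrite -(Int0 lm); apply: eq_Int => y.
 have [_ _ _ bz] := nbmpP (corner n (cell_of n x)) (r2 n).
 have [yc|/bz z] := pselect (cbx (corner n (cell_of n x)) (2 ^- n) y); last by rewrite /cbmp z mulr0.
 have [d1 d2] := corner_near yc; rewrite fL ?mul0r// => -[y1 y2]; apply: nx; split.
  by have := ler_distD y.1 x.1 0; rewrite !subr0; move: d1 y1 s1; clear; lra.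
 by have := ler_distD y.2 x.2 0; rewrite !subr0; move: d2 y2 s1; clear; lra.
have rstep : rint mu (fun x => \sum_(p <- cgrid n) a n p * \1_(cell n p) x)
 by apply: rint_sum => p; apply: rintZ; exact: (cell_fin n p lf).2.
have rfm := kc_rint lf kf.
rewrite E S.
have main : `|Int mu f - Int mu (fun x => \sum_(p <- cgrid n) a n p * \1_(cell n p) x)| <= e1 * M.
 rewrite -IntB//; apply: le_trans (Int_norm _) _; first exact: rintB.
 rewrite -IntZ//; apply: le_Int => [||x]; [by apply: rint_norm; exact: rintB|exact: rintZ|].
 rewrite stepE indicE; have [/set_mem xK|xK] := boolP (x \in K).
  have [x1 x2] : `|x.1| <= L + 2 /\ `|x.2| <= L + 2 by apply/sub_box. by rewrite cgrid_cell ?(le_lt_trans _ nL)// mulr1.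
 have [|-> ->] := outE x; first by move=> h; move: xK; rewrite mem_set. by rewrite if_same subr0 normr0 mulr0.
have h1 := hn1 n nn1; rewrite sub0r normrN in h1.
apply: (le_via (e1 * M + e / 2)).
 have tri (x y z A B : R) : `|x - z| <= A -> `|y| <= B -> `|x - (y + z)| <= A + B.
  move=> hA hB; have -> : x - (y + z) = (x - z) - y by ring. by apply: le_trans (ler_normB _ _) _; exact: lerD.
 exact: tri main h1.
have : e1 * M <= e / 2; last by clear; lra.
have -> : e / 2 = e1 * (M + 1) by rewrite /e1; field; rewrite gt_eqF// ltr_wpDl.
by apply: ler_wpM2l; [exact: ltW|rewrite lerDl].
Qed.

Definition riesz_f mu m k : R := if m is m'.+1 then riesz_p mu m k / riesz_p mu m' k else riesz_p mu 0 k.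

Lemma riesz_prod mu n k : \prod_(m < n.+1) riesz_f mu m k = riesz_p mu n k.
Proof.
elim: n => [|n IH]; first by rewrite big_ord1.
by rewrite big_ord_recr /= IH mulrC divfK// gt_eqF// riesz_p_gt0.
Qed.

(** The factors are quotients of consecutive approximants, so the partial products are the
    approximants themselves. *)
Theorem riesz_ex mu : locally_finite mu -> exists f : nat -> P -> R, is_riesz_product f mu.
Proof.
move=> lf; exists (riesz_f mu); split => //.
- move=> [|m]; first exact: riesz_p_cont.
 move=> k; apply: cvgM; first exact: riesz_p_cont. by apply: cvgV; [rewrite gt_eqF// riesz_p_gt0|exact: riesz_p_cont].
- by move=> [|m] k; [exact: ltW (riesz_p_gt0 _ _ _)|rewrite divr_ge0 ?(ltW (riesz_p_gt0 _ _ _))].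
- move=> g /Cc_kc[kr ki]; apply: cvg_complex; rewrite /cintegral /=.
  have := riesz_p_cvg lf kr; apply: cvg_trans; apply: near_eq_cvg; near=> n.
  by apply: eq_Int => k; rewrite riesz_prod cReM /= mulr0 subr0.
 have := riesz_p_cvg lf ki; apply: cvg_trans; apply: near_eq_cvg; near=> n.
 by apply: eq_Int => k; rewrite riesz_prod cImM /= mulr0 add0r.
Unshelve. all: by end_near. Qed.
End Riesz.

(** * Separation of the central peak *)

Section Peak.

Lemma locally_finite_sub (mu nu : PM) : (forall A, measurable A -> (nu A <= mu A)%E) ->
 locally_finite mu -> locally_finite nu.
Proof.
move=> h lf K cK; have [L L0 KL] := compact_sub_box cK.
apply: (@le_lt_trans _ _ (nu (box (- L) L (- L) L))).
 apply: le_measure; rewrite ?inE//; last exact: measurable_box.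
 by rewrite -[K]setCK; apply: measurableC; apply: open_plane_measurable; apply: closed_openC; apply: compact_closed => //; exact: norm_hausdorff.
by apply: le_lt_trans (h _ (measurable_box _ _ _ _)) _; apply: lf; exact: compact_box.
Qed.

Definition nopeak (mu : PM) : PM := mrestr mu (measurableC (measurable_pt P0)).

Lemma nopeak_le mu A : measurable A -> (nopeak mu A <= mu A)%E.
Proof. by move=> mA; apply: le_measure; rewrite ?inE//; apply: measurableI => //; apply: measurableC; exact: measurable_pt. Qed.

Lemma peak_split (mu : PM) (c : R) (A : set BP) : mu [set P0] = c%:E -> measurable A ->
 mu A = (c%:E * \d_((0%R : P) : BP) A + nopeak mu A)%E.
Proof.
move=> m0 mA; have mp := measurable_pt P0.
have -> : mu A = (mu (A `&` [set (0%R : P)]) + mu (A `&` ~` [set (0%R : P)]))%E.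
 rewrite -measureU//; [by rewrite -setIUr setUv setIT|exact: measurableI| |].
  by apply: measurableI => //; exact: measurableC.
 by rewrite setIACA setICr setI0.
congr (_ + _)%E; rewrite diracE; have [/set_mem A0|A0] := boolP (P0 \in A).
 by rewrite mule1 -m0; congr (mu _); apply/seteqP; split => [k []//|k ->].
rewrite mule0 (_ : A `&` _ = set0) ?measure0//.
by apply/seteqP; split => // k [Ak k0]; move: A0; rewrite -k0 mem_set.
Qed.

Lemma nopeak_singular mu : singular mu -> singular (nopeak mu).
Proof.
move=> [N [mN N0 muN]]; exists N; split => //; apply/eqP; rewrite eq_le measure_ge0 andbT -muN.
by apply: nopeak_le; exact: measurableC.
Qed.

Lemma nopeak_atoms (mu : PM) : (forall x : P, x != 0 -> mu [set x] = 0%E) -> forall x : P, nopeak mu [set x] = 0%E.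
Proof.
move=> h x; have [->|x0] := eqVneq x 0.
 by rewrite -[LHS]/(mu ([set P0] `&` ~` [set P0])) setICr measure0.
apply/eqP; rewrite eq_le measure_ge0 andbT -(h x x0).
by apply: nopeak_le; exact: measurable_pt.
Qed.

Lemma all_control_wcomb (T : tileset R) : usep T -> (\1_(all_control_points T) : P -> R[i]) = wcomb (fun=> 1) T.
Proof.
move=> uT; apply/funext => x; rewrite indicE; have [/set_mem[i _ Tix]|nx] := boolP (x \in _).
 by rewrite (wcomb_in (fun=> 1) uT (Tix : T (i, x))).
rewrite /wcomb big1// => i _; rewrite indicE memNset ?mulr0// => Tix.
by move/negP: nx; apply; apply/mem_set; exists i.
Qed.
End Peak.

End FrankRobinson.

Theorem theorem9p1 (R : realType) (T0 T : tileset R)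
    (hT0 : is_tiling T0) (hfix : inflate (inflate T0) = T0)
    (hT : hull T0 T) :
  [/\ has_density (all_control_points T) (fr_density R),
      forall i : 'I_4, has_rel_frequency (control_points T i)
        (all_control_points T) (fr_frequency R i),
      exists mu musc : plane_measure R,
        [/\ is_diffraction (\1_(all_control_points T)) mu,
            forall A : set (borel_plane R), measurable A ->
              mu A = ((fr_density R ^+ 2)%:E * \d_((0%R : plane R) : borel_plane R) A + musc A)%E,
            singular_continuous musc &
            exists f : nat -> plane R -> R, is_riesz_product f musc] &
      forall u : 'I_4 -> R[i], (exists i, u i != 0) ->
        exists mu : plane_measure R,
          [/\ is_diffraction
                (fun x => \sum_(i < 4) u i * \1_(control_points T i) x) mu,
              singular mu &
              forall x : plane R, mu [set x] =
                (if x == 0 then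
                   fr_density R ^+ 2 *
                   ComplexField.Normc.normc
                     (\sum_(i < 4) (fr_frequency R i)%:C%C * u i) ^+ 2
                 else 0)%:E]].
Proof.
split.
- exact: hull_density hT0 hfix hT.
- exact: hull_frequency hT0 hfix hT.
(* With unit weights the intensity at 0 reduces to the squared density, since the relative
   frequencies sum to 1. *)
- have [mu dmu vmu] := diffraction_ex (fun=> 1) hT0 hfix hT.
  have m0 : mu [set (0 : plane R)] = (fr_density R ^+ 2)%:E by rewrite (atom_mass vmu) itotE freq_sum1 (normc_real 1) normr1 expr1n mulr1.
  exists mu, (nopeak mu); split.
  + have uT0 : usep T0 by move=> p q Tp Tq pq; exact: rdj_sepr (tiling_rdj hT0 Tp Tq pq).
    by rewrite all_control_wcomb//; exact: usep_hull uT0 hT.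
  + by move=> A mA; exact: peak_split.
  + split; first exact/nopeak_singular/(cluster_singular vmu).
    by apply: nopeak_atoms => x x0; exact: atom_zero vmu x0.
  + by apply: riesz_ex; apply: locally_finite_sub (nopeak_le mu) vmu.1.
- move=> u _; have [mu dmu vmu] := diffraction_ex u hT0 hfix hT.
  exists mu; split => //; first exact: cluster_singular vmu.
  move=> x; have [->|x0] := eqVneq x 0; last exact: atom_zero vmu x0. by rewrite (atom_mass vmu) itotE.
Qed.
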